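(* Let $T>1$, $y\in[1,2]$ and write $y=\frac aq+O\big(\frac1{qQ}\big)$ (with an absolute implied constant) for positive coprime integers $a,q$ with $q\leq Q:=T^{0.99}$. Let $I\subseteq\mathbb{R}$ be a fixed bounded interval of positive length. Then $$\Big\{\Big(\frac{x+i}{T},\frac{xy+i}{T}\Big)\ \Big|\ x\in T\cdot I\Big\}=\Big\{\Big(x+\frac{i}{T},xy+\frac{i}{T}\Big)\ \Big|\ x\in I\Big\}\subseteq X\times X$$ equidistributes with respect to $\mu_X\otimes\mu_X$ as $T\to\infty$ for pairs $(y,T)$ with $q\to\infty$. That is, along any sequence of such data $(T,y,a,q)$ with $T\to\infty$ and $q\to\infty$, for every continuous compactly supported $\varphi:X\times X\to\mathbb{C}$, $$\frac1{|I|}\int_I\varphi\Big(x+\frac iT,\;xy+\frac iT\Big)\,dx\longrightarrow\int_{X\times X}\varphi\,d(\mu_X\otimes\mu_X).$$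
   Context: $\mathbb{H}$ is the upper half plane and $X=\mathrm{SL}_2(\mathbb{Z})\backslash\mathbb{H}$ is the modular curve with the hyperbolic probability measure $d\mu_X(z)=\frac{3}{\pi}\frac{dx\,dy}{y^2}$. Points of $\mathbb{H}$ are identified with their images in $X$. $|I|$ denotes the length of $I$. *)

(* Defs.v *)
From HB Require Import structures.
From mathcomp Require Import all_boot all_order all_algebra.
From mathcomp Require Import all_classical all_reals all_analysis.
From mathcomp Require Import measurable_realfun.
From mathcomp Require Import complex ring lra.
Set Implicit Arguments. Unset Strict Implicit. Unset Printing Implicit Defensive.
Import Order.TTheory GRing.Theory Num.Theory numFieldNormedType.Exports.
Local Open Scope classical_set_scope.
Local Open Scope ring_scope.
Local Open Scope complex_scope.

Local Open Scope quotient_scope.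

(* R[i] comes without a topology; R[i]^o has the one of the complex modulus. *)
HB.instance Definition _ (R : realType) := PseudoPointedMetric.copy R[i] R[i]^o.
HB.instance Definition _ (R : realType) := NormedModule.copy R[i] R[i]^o.

Definition upper_half_plane (R : realType) : Type :=
  set_type [set z : R[i] | 0 < complex.Im z].

Section upper_half_plane.
Context {R : realType}.
Local Notation H := (upper_half_plane R).
Local Notation Hset := [set z : R[i] | 0 < complex.Im z].

HB.instance Definition _ := Topological.copy H (set_type Hset).
HB.instance Definition _ := SubChoice.copy H (set_type Hset).

Lemma i_in_Hset : 'i \in Hset.
Proof. by rewrite inE /= ltr01. Qed.

Definition uhp_i : H := exist _ 'i i_in_Hset.

HB.instance Definition _ := isPointed.Build H uhp_i.

Lemma Im_uhp_gt0 (z : H) : 0 < complex.Im (val z).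
Proof. by case: z => z /= /set_mem. Qed.

Definition mobius (g : 'M[int]_2) (z : R[i]) : R[i] :=
  ((g 0 0)%:~R * z + (g 0 1)%:~R) / ((g 1 0)%:~R * z + (g 1 1)%:~R).

(* Being in the same orbit of SL_2(Z). *)
Definition modular_equiv (z w : H) : bool :=
  `[< exists g : 'M[int]_2, \det g = 1 /\ val w = mobius g (val z) >].

Lemma det22 (A : comPzRingType) (g : 'M[A]_2) :
  \det g = g 0 0 * g 1 1 - g 0 1 * g 1 0.
Proof.
rewrite (expand_det_row _ ord0) !big_ord_recl big_ord0 addr0 /cofactor.
rewrite !det_mx11 !mxE /= expr0 expr1 mul1r mulN1r mulrN.
congr (_ * g _ _ - g _ _ * g _ _); exact/val_inj.
Qed.

Lemma mobius_denom_neq0 (c d : int) (z : H) :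
  (c != 0) || (d != 0) -> (c%:~R * val z + d%:~R : R[i]) != 0.
Proof.
move=> cd; apply/eqP; move: (Im_uhp_gt0 z); case: (val z) => x y /= y0.
rewrite -(rmorph_int (real_complex R)) -(rmorph_int (real_complex R) d).
move=> [] /=; rewrite !mul0r subr0 !addr0 => /eqP.
move=> cx /eqP; rewrite mulf_eq0 (gt_eqF y0) orbF intr_eq0 => /eqP c0.
by move: cd cx; rewrite c0 eqxx mul0r add0r intr_eq0 => /negPf ->.
Qed.

Lemma modular_equiv_refl : reflexive modular_equiv.
Proof.
move=> z; apply/asboolP; exists 1%:M; split; first exact: det1.
by rewrite /mobius !mxE /= mul1r addr0 mul0r add0r divr1.
Qed.

Lemma det1_row1 (g : 'M[int]_2) : \det g = 1 -> (g 1 0 != 0) || (g 1 1 != 0).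
Proof.
rewrite det22; case: eqP => //= ->; case: eqP => //= ->.
by rewrite !mulr0 subr0.
Qed.

Lemma modular_equiv_sym : symmetric modular_equiv.
Proof.
suff S z w : modular_equiv z w -> modular_equiv w z.
  by move=> z w; apply/idP/idP; exact: S.
move=> /asboolP[g [dg wE]]; apply/asboolP.
pose h : 'M[int]_2 := \matrix_(i, j)
  if i == 0 then (if j == 0 then g 1 1 else - g 0 1)
  else (if j == 0 then - g 1 0 else g 0 0).
have dh : \det h = 1 by rewrite det22 !mxE /= -dg det22; ring.
exists h; split => //.
have := mobius_denom_neq0 w (det1_row1 dh).
have := mobius_denom_neq0 z (det1_row1 dg).
rewrite wE /mobius !mxE /=.
have := congr1 (fun n : int => n%:~R : R[i]) (etrans (esym (det22 g)) dg).
rewrite !rmorphB /= !rmorphM /= !rmorphN /=.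
move: ((g 0 0)%:~R : R[i]) ((g 0 1)%:~R : R[i]) ((g 1 0)%:~R : R[i]) ((g 1 1)%:~R : R[i]).
move=> a b c d.
move: (val z) => {wE} {}z; move=> detE dn0.
have -> : - c * ((a * z + b) / (c * z + d)) + a = (c * z + d)^-1 * (a * d - b * c).
  by field.
have -> : d * ((a * z + b) / (c * z + d)) + - b =
  (c * z + d)^-1 * (a * d - b * c) * z by field.
rewrite detE mulr1 => _; by field.
Qed.

Lemma modular_equiv_trans : transitive modular_equiv.
Proof.
move=> w z u /asboolP[g [dg wE]] /asboolP[h [dh uE]]; apply/asboolP.
exists (h *m g); split; first by rewrite det_mulmx dg dh mul1r.
have dhg : \det (h *m g) = 1 by rewrite det_mulmx dg dh mul1r.
have := mobius_denom_neq0 z (det1_row1 dhg).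
have := mobius_denom_neq0 z (det1_row1 dg).
rewrite uE wE /mobius !mxE /= !big_ord_recl !big_ord0 /= !addr0.
have -> : lift ord0 ord0 = 1 :> 'I_2 by exact/val_inj.
rewrite !rmorphD /= !rmorphM /=.
move=> d2 d3; field; apply/andP; split; [exact: d3|exact: d2].
Qed.

Canonical modular_equiv_rel := EquivRel modular_equiv
  modular_equiv_refl modular_equiv_sym modular_equiv_trans.

End upper_half_plane.

Definition modular_curve (R : realType) : Type :=
  quotient_topology {eq_quot @modular_equiv R}.

Section modular_curve.
Context {R : realType}.
Local Notation H := (upper_half_plane R).
Local Notation X := (modular_curve R).

HB.instance Definition _ :=
  PointedTopological.copy X (quotient_topology {eq_quot @modular_equiv R}).
HB.instance Definition _ := Quotient.copy X {eq_quot @modular_equiv R}.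
HB.instance Definition _ := Measurable.copy X (g_sigma_algebraType (@open X)).

(* Junk value (the class of 'i) when z is not in the upper half plane. *)
Definition to_curve (z : R[i]) : X := \pi_X (insubd uhp_i z : H).
End modular_curve.

Section plane.
Context {R : realType}.

Lemma open_plane_measurable (A : set (R * R)) :
  open A -> measurable (A : set (measurableTypeR R * measurableTypeR R)).
Proof.
move=> oA.
pose B (u : rat * rat * (rat * rat)) : set (R * R) :=
  `]ratr u.1.1, ratr u.1.2[ `*` `]ratr u.2.1, ratr u.2.2[.
have -> : A = \bigcup_u (if `[< B u `<=` A >] then B u else set0).
  apply/seteqP; split => [p Ap|p [u _]]; last first.
    by case: asboolP => // BA /BA.
  have /= [[P Q] [/= /nbhs_ballP[e /= e0 eP] /nbhs_ballP[f /= f0 fQ]] PQA] :=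
    open_nbhs_nbhs (conj oA Ap).
  have lb (x d : R) : 0 < d -> exists u : rat * rat,
      (x \in `]ratr u.1, ratr u.2[) /\
      [set` `](ratr u.1 : R), ratr u.2[ ] `<=` ball x d.
    move=> d0.
    have /rat_in_itvoo[r] : x - d < x by rewrite ltrBlDr ltrDl.
    have /rat_in_itvoo[s] : x < x + d by rewrite ltrDl.
    rewrite !in_itv /= => /andP[xs sd] /andP[dr rx].
    exists (r, s); split; first by rewrite in_itv /= rx xs.
    move=> z /=; rewrite in_itv /= => /andP[rz zs].
    rewrite /ball /= ltr_distlC (lt_trans dr rz) (lt_trans zs sd) //.
  have [u [u1 ue]] := lb p.1 e e0; have [v [v1 vf]] := lb p.2 f f0.
  exists (u, v) => //; case: asboolP => [_|]; first by split.
  by case => -[x y] [/= /ue/eP Px /vf/fQ Qy]; apply: PQA.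
apply: countable_bigcupT_measurable => [|u]; first exact: countableP.
case: ifP => // _; apply: measurableX; exact: measurable_itv.
Qed.

Lemma continuous_mkcomplex :
  continuous (fun p : R * R => (p.1 +i* p.2 : R[i])).
Proof.
move=> [x y]; apply/cvgrPdist_lt => eps.
case: eps => e e'; rewrite ltcE /= => /andP[/eqP -> e0].
exists (ball x (e / 2), ball y (e / 2)) => /=.
  by split; apply: nbhsx_ballx; rewrite divr_gt0.
move=> [u v] [/= xu yv].
have -> : (x +i* y) - (u +i* v) = (x - u)%:C + 'i * (y - v)%:C :> R[i].
  by apply/eqP; rewrite eq_complex /=; apply/andP; split; apply/eqP; ring.
apply: (le_lt_trans (ler_normD _ _)); rewrite normrM.
have -> : `|'i : R[i]| = 1.
  by rewrite normc_def /= expr0n /= expr1n add0r sqrtr1.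
have normC (t : R) : `|t%:C| = `|t|%:C :> R[i].
  by rewrite normc_def /= expr0n /= addr0 sqrtr_sqr.
rewrite mul1r !normC -rmorphD /= ltcR.
by move: xu yv; rewrite /ball /=; lra.
Qed.

End plane.

Section modular_measure.
Context {R : realType}.
Local Notation H := (upper_half_plane R).
Local Notation X := (modular_curve R).
Local Notation leb := (@lebesgue_measure R).

Definition uhp_coord (z : H) : measurableTypeR R * measurableTypeR R :=
  (complex.Re (val z), complex.Im (val z)).

(* The measure dx dy / y^2, computed in the coordinates (x, y). *)
Definition hyperbolic_area (A : set H) : \bar R :=
  (\int[leb \x leb]_(p in uhp_coord @` A) (p.2 ^- 2)%:E)%E.

Definition fundamental_domain : set H :=
  [set z | `|complex.Re (val z)| <= 1 / 2 /\ 1 <= `|val z|].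

(* The pushforward to X of 3/pi times the area of the standard fundamental
   domain, whose boundary identifications only concern null sets. *)
Definition modular_measure (A : set X) : \bar R :=
  ((3 / pi)%:E * hyperbolic_area (fundamental_domain `&` \pi_X @^-1` A))%E.

Lemma val_insubd_uhp (z : R[i]) :
  0 < complex.Im z -> val (insubd uhp_i z : H) = z.
Proof. by move=> z0; apply: insubdK; exact: mem_set. Qed.

Let R2 : Type := (measurableTypeR R * measurableTypeR R)%type.
Let halfplane : set R2 := [set p | 0 < p.2].
Let mkX (p : R2) : X := to_curve (p.1 +i* p.2).
Let fund : set R2 :=
  [set p | [/\ p.1 \in `[- (1 / 2), 1 / 2], p.1 ^+ 2 + p.2 ^+ 2 \in `[1, +oo[ & p.2 \in `]0, +oo[]].

Let fund_half : fund `<=` halfplane.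
Proof. by move=> p [_ _] /=; rewrite in_itv /= andbT. Qed.

Let measurable_halfplane : measurable halfplane.
Proof.
have -> : halfplane = setT `*` `]0, +oo[%classic.
  by apply/seteqP; split => -[x y]; rewrite /halfplane /= in_itv /= andbT //; case.
by apply: measurableX => //; exact: measurable_itv.
Qed.

Let measurable_fund : measurable fund.
Proof.
have -> : fund = ((@fst (measurableTypeR R) (measurableTypeR R)) @^-1` `[- (1/2), 1/2])
    `&` ((fun p : R2 => p.1 ^+ 2 + p.2 ^+ 2) @^-1` `[1, +oo[)
    `&` ((@snd (measurableTypeR R) (measurableTypeR R)) @^-1` `]0, +oo[).
  by apply/seteqP; split => p; [case|case; case].
apply: measurableI; first apply: measurableI.
- by rewrite -[X in measurable X]setTI; apply: measurable_fst => //; exact: measurable_itv.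
- rewrite -[X in measurable X]setTI.
  have mf : measurable_fun setT (fun p : R2 => p.1 ^+ 2 + p.2 ^+ 2).
    by apply: measurable_funD; apply: measurable_funX;
      [exact: measurable_fst|exact: measurable_snd].
  by apply: mf => //; exact: measurable_itv.
- by rewrite -[X in measurable X]setTI; apply: measurable_snd => //; exact: measurable_itv.
Qed.

Let measurable_mkX : measurable_fun halfplane mkX.
Proof.
apply: (@measurability _ _ _ _ _ _ (@open X)) => // _ [U oU <-].
have [V oV VU] : exists2 V : set R[i], open V & val @^-1` V = \pi_X @^-1` U :> set H.
  by move: oU; rewrite /open /=.
have -> : halfplane `&` mkX @^-1` U =
    halfplane `&` (fun p : R2 => (p.1 +i* p.2 : R[i])) @^-1` V.
  apply/seteqP; split => -[x y] [/= y0]; rewrite /mkX /to_curve /= => h; split => //=.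
    have : (\pi_X @^-1` U) (insubd uhp_i (x +i* y) : H) by [].
    by rewrite -VU /= val_insubd_uhp.
  have : (val @^-1` V) (insubd uhp_i (x +i* y) : H).
    by rewrite /= val_insubd_uhp.
  by rewrite VU.
apply: measurableI => //; apply: open_plane_measurable.
by apply: open_comp => // p _; exact: continuous_mkcomplex.
Qed.

Let measurable_density : measurable_fun halfplane (fun p : R2 => (p.2 ^- 2)%:E).
Proof.
apply/measurable_EFinP.
have m : measurable_fun (`]0, +oo[%classic : set R) (fun y : R => y ^- 2).
  apply: open_continuous_measurable_fun; first exact: interval_open.
  move=> y; rewrite inE /= in_itv /= andbT => y0.
  apply: cvgV; first by rewrite expf_neq0 // gt_eqF.
  exact: exprn_continuous.
apply: (measurable_comp _ _ m) => //.
  by move=> _ [p p0 <-]; rewrite /= in_itv /= andbT.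
apply: measurable_funTS; exact: measurable_snd.
Qed.

Let coord_fund (A : set X) :
  uhp_coord @` (fundamental_domain `&` \pi_X @^-1` A) = fund `&` mkX @^-1` A.
Proof.
apply/seteqP; split => [_ [z [[zx z1] zA] <-]|[x y] [[/= x2 xy y0] pA]].
  have zE : insubd uhp_i (complex.Re (val z) +i* complex.Im (val z)) = z.
    by rewrite -[RHS](valKd uhp_i); congr insubd; case: (val z).
  split; last by rewrite /mkX /= /to_curve zE.
  split => /=; rewrite in_itv /= ?andbT.
  - by rewrite -ler_norml.
  - move: z1; rewrite normc_def lecR => z1.
    rewrite -(@ler_sqrt _ 1); last by rewrite addr_ge0 ?sqr_ge0.
    by rewrite sqrtr1.
  - exact: Im_uhp_gt0.
move: x2 xy y0; rewrite !in_itv /= !andbT => x2 xy y0.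
have vE : val (insubd uhp_i (x +i* y) : H) = x +i* y.
  by rewrite val_insubd_uhp.
exists (insubd uhp_i (x +i* y)); last by rewrite /uhp_coord vE.
split => //; rewrite /fundamental_domain /= vE /= ler_norml; split => //.
by rewrite normc_def lecR /= -sqrtr1 ler_sqrt // addr_ge0 ?sqr_ge0.
Qed.

Let modular_measureE (A : set X) : modular_measure A =
  ((3 / pi)%:E * \int[leb \x leb]_(p in fund `&` mkX @^-1` A) (p.2 ^- 2)%:E)%E.
Proof. by rewrite /modular_measure /hyperbolic_area coord_fund. Qed.

Let c_ge0 : (0 <= (3 / pi : R)%:E)%E.
Proof. by rewrite lee_fin divr_ge0 // pi_ge0. Qed.

Let modular_measure0 : modular_measure set0 = 0%E.
Proof. by rewrite modular_measureE preimage_set0 setI0 integral_set0 mule0. Qed.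

Let modular_measure_ge0 A : (0 <= modular_measure A)%E.
Proof.
rewrite mule_ge0 // integral_ge0 // => p _.
by rewrite lee_fin invr_ge0 sqr_ge0.
Qed.

Let measurable_fundX (A : set X) : measurable A -> measurable (fund `&` mkX @^-1` A).
Proof.
move=> mA; have -> : fund `&` mkX @^-1` A = fund `&` (halfplane `&` mkX @^-1` A).
  by rewrite setIA (setIidl fund_half).
by apply: measurableI => //; exact: measurable_mkX.
Qed.

Let modular_measure_sigma_additive : semi_sigma_additive modular_measure.
Proof.
move=> A mA tA mUA; rewrite modular_measureE preimage_bigcup setI_bigcupr.
rewrite ge0_integral_bigcup //=; last 4 first.
- by move=> k; exact: measurable_fundX.
- apply: measurable_funS measurable_density => //.
  by move=> p [k _ [/fund_half]].
- by move=> p _; rewrite lee_fin invr_ge0 sqr_ge0.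
- apply/trivIsetP => i j _ _ ij; rewrite setIACA -preimage_setI.
  by move/trivIsetP : tA => -> //; rewrite preimage_set0 setI0.
have i_ge0 k : (0 <= \int[leb \x leb]_(p in fund `&` mkX @^-1` A k) (p.2 ^- 2)%:E)%E.
  by apply: integral_ge0 => p _; rewrite lee_fin invr_ge0 sqr_ge0.
rewrite -nneseriesZl //.
rewrite (_ : (fun n => _) = (fun n => \sum_(0 <= i < n) (3 / pi)%:E *
    \int[leb \x leb]_(p in fund `&` mkX @^-1` A i) (p.2 ^- 2)%:E)%E); last first.
  by apply/funext => n; apply: eq_bigr => i _; exact: modular_measureE.
by apply: is_cvg_ereal_nneg_natsum_cond => n _ _; rewrite mule_ge0.
Qed.

HB.instance Definition _ := isMeasure.Build _ _ _ modular_measure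
  modular_measure0 modular_measure_ge0 modular_measure_sigma_additive.

Let sqrt_gt0 (x : R) : x \in `[- (1 / 2), 1 / 2] -> 0 < 1 - x ^+ 2.
Proof. by rewrite in_itv /= => /andP[? ?]; nra. Qed.

Let inner_integral (x : R) : x \in `[- (1 / 2), 1 / 2] ->
  (\int[leb]_(y in `[Num.sqrt (1 - x ^+ 2), +oo[) (y ^- 2)%:E =
    ((Num.sqrt (1 - x ^+ 2))^-1)%:E)%E.
Proof.
move=> xI; have := sqrt_gt0 xI; rewrite -sqrtr_gt0.
move: (Num.sqrt _) => a a0.
have dF (y : R) : a <= y -> is_derive y 1 (fun y : R => - y^-1) (y ^- 2).
  move=> ay; have y0 : y != 0 by rewrite gt_eqF // (lt_le_trans a0).
  have dI : is_derive y 1 (fun y : R => y^-1) (- y ^- 2 *: (1 : R)).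
    exact: (@is_deriveV _ id).
  by have := is_deriveN dI; rewrite /= scaleNr opprK scaler1.
rewrite (@ge0_continuous_FTC2y _ _ (fun y => - y^-1) _ 0) //.
- by rewrite sub0e EFinN oppeK.
- by move=> y _; rewrite invr_ge0 sqr_ge0.
- apply: continuous_in_subspaceT => y; rewrite inE /= in_itv /= andbT => ay.
  apply: cvgV; first by rewrite expf_neq0 // gt_eqF // (lt_le_trans a0).
  exact: exprn_continuous.
- by rewrite -[X in _ --> X]oppr0; apply: cvgN; apply/(gtr0_cvgV0 (f := id)) => //;
    exact: nbhs_pinfty_gt.
- by move=> y ay; apply: (@ex_derive _ _ _ _ _ _ _ (dF y (ltW ay))).
- apply: cvg_at_right_filter; apply: cvgN; apply: cvgV => //; first by rewrite gt_eqF.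
- move=> y; rewrite in_itv /= andbT => ay.
  by rewrite derive1E; exact: (@derive_val _ _ _ _ _ _ _ (dF y (ltW ay))).
Qed.

Let sin_pi6 : sin (pi / 6) = 1 / 2 :> R.
Proof.
have p0 : 0 < pi :> R := pi_gt0 R.
have c0 : 0 < cos (pi / 6) :> R by apply: cos_gt0_pihalf; apply/andP; split; lra.
have : sin ((pi / 6) *+ 2) = cos (pi / 6) :> R.
  by rewrite -(cosBpihalf (_ *+ 2)) -cosN; congr cos; rewrite mulr2n; field.
rewrite sin_mulr2n => h.
have : cos (pi / 6) * (sin (pi / 6) *+ 2 - 1) = 0 :> R.
  by rewrite mulrBr mulr1 -{2}h -mulrnAr subrr.
move/eqP; rewrite mulf_eq0 gt_eqF //= => /eqP; rewrite mulr2n; lra.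
Qed.

Let outer_integral :
  (\int[leb]_(x in `[(- (1 / 2))%R, (1 / 2)%R]) ((Num.sqrt (1 - x ^+ 2))^-1)%:E =
    (pi / 3)%:E)%E.
Proof.
have dom (x : R) : x \in `[- (1 / 2), 1 / 2] -> -1 < x < 1.
  by rewrite in_itv /= => /andP[? ?]; apply/andP; split; lra.
have h2 : - (1 / 2) < 1 / 2 :> R by lra.
rewrite (@continuous_FTC2 _ _ (@asin R)) //.
- have p0 : 0 < pi :> R := pi_gt0 R.
  have -> : asin (1 / 2) = pi / 6 :> R.
    by rewrite -sin_pi6 sinK // in_itv /=; apply/andP; split; lra.
  have -> : asin (- (1 / 2)) = - (pi / 6) :> R.
    by rewrite -sin_pi6 -sinN sinK // in_itv /=; apply/andP; split; lra.
  by rewrite -EFinB; congr EFin; field.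
- apply: continuous_in_subspaceT => x; rewrite inE /= => xI.
  apply: cvgV; first by rewrite gt_eqF // sqrtr_gt0 sqrt_gt0.
  apply: (@continuous_comp _ _ _ (fun x : R => 1 - x ^+ 2) Num.sqrt); last exact: sqrt_continuous.
  by apply: cvgB; [exact: cvg_cst|exact: exprn_continuous].
- split.
  + move=> x xI; have /dom /is_derive1_asin dx : x \in `[- (1 / 2), 1 / 2].
      by move: xI; rewrite !in_itv /= => /andP[/ltW -> /ltW ->].
    exact: (@ex_derive _ _ _ _ _ _ _ dx).
  + by apply: cvg_at_right_filter; apply: continuous_asin; apply: dom;
      rewrite in_itv /= lexx ltW.
  + by apply: cvg_at_left_filter; apply: continuous_asin; apply: dom;
      rewrite in_itv /= lexx ltW.
- move=> x xI; have /dom /is_derive1_asin dx : x \in `[- (1 / 2), 1 / 2].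
    by move: xI; rewrite !in_itv /= => /andP[/ltW -> /ltW ->].
  by rewrite derive1E; exact: (@derive_val _ _ _ _ _ _ _ dx).
Qed.

Let modular_measure_setT : modular_measure setT = 1%E.
Proof.
rewrite modular_measureE preimage_setT setIT integral_mkcond fubini_tonelli1.
- transitivity ((3 / pi)%:E * \int[leb]_(x in `[(- (1 / 2))%R, (1 / 2)%R])
      ((Num.sqrt (1 - x ^+ 2))^-1)%:E)%E; last first.
    rewrite outer_integral -EFinM; congr EFin.
    have := pi_gt0 R; move: (pi : R) => p p0; field; apply: lt0r_neq0; exact: p0.
  congr (_ * _)%E; rewrite [RHS]integral_mkcond; apply: eq_integral => x _.
  rewrite /fubini_F [RHS]patchE; case: ifPn => [|xI].
    rewrite inE /= => xI; rewrite -inner_integral // [RHS]integral_mkcond.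
    apply: eq_integral => y _; rewrite !patchE.
    congr (if _ then _ else _); apply/idP/idP; rewrite !inE /= in_itv /= andbT.
    - case=> _; rewrite !in_itv /= !andbT => xy y0.
      by rewrite -[leRHS]gtr0_norm // -sqrtr_sqr ler_sqrt ?sqr_ge0 // lerBlDl.
    - move=> sy; have y0 : 0 < y.
        by apply: lt_le_trans sy; rewrite sqrtr_gt0 sqrt_gt0.
      split => //=; rewrite in_itv /= andbT //.
      move: sy; rewrite -[leRHS]gtr0_norm // -sqrtr_sqr ler_sqrt ?sqr_ge0 //.
      by rewrite lerBlDl.
  rewrite integral0_eq // => y _; rewrite patchE ifF //.
  by apply/negP; rewrite inE => -[/= xI' _ _]; move/negP: xI; apply; rewrite inE.
- apply/(measurable_restrictT _ measurable_fund).
  exact: (measurable_funS measurable_halfplane fund_half measurable_density).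
- by move=> p; rewrite patchE; case: ifP => // _; rewrite lee_fin invr_ge0 sqr_ge0.
Qed.

HB.instance Definition _ :=
  Measure_isProbability.Build _ _ _ modular_measure modular_measure_setT.

End modular_measure.

Definition cintegral d (T : measurableType d) (R : realType)
    (mu : {measure set T -> \bar R}) (D : set T) (f : T -> R[i]) : R[i] :=
  (\int[mu]_(x in D) complex.Re (f x)) +i* (\int[mu]_(x in D) complex.Im (f x)).

Definition compactly_supported (T : topologicalType) (R : realType)
    (f : T -> R[i]) : Prop := compact (closure [set x | f x != 0]).

(* Main.v *)
(** Lift functions on X to SL_2(R) by g |-> g i, so that x + i/T becomes the horocycle point n(x) a_T, with n(x)
    upper unipotent. Moving the second variable by one unit u_1 of the horocycle flow is shown not to change
    the limit of the integrals over I. Granted this, the second variable may be replaced by its average along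
    u_0, ..., u_(N-1), which by the mean ergodic theorem (the horocycle flow being ergodic by Mautner's
    phenomenon) and the equidistribution of long horocycles is close in L^1 to a constant for each fixed first
    variable; the equidistribution of long horocycles for the first variable then concludes.

    For the invariance, I is exhausted by blocks: images under matrices k of SL_2(Z) of intervals [w, w + L].
    On a block the first variable is periodic up to a small error, while the second one follows a horocycle
    orbit for a long time. By pigeonhole two points of this orbit, taken at the same time modulo the period, are
    close in SL_2(Z)\SL_2(R). Their relative position then drifts polynomially, mostly along the flow, as in
    Ratner's shearing argument, and at suitable times it is close to a shift by one, respectively two, units.
    So averages over stretches of time of the function and of its shift agree, provided that the averages at two
    consecutive scales are close, and such scales exist by an energy decrement argument. Pairs of points that
    never separate are rare, because j y stays away from the integers at scale 1/T for bounded j <> 0: this is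
    where q -> oo enters. Finally the blocks fill a fixed proportion of every Farey arc, and iterating on the
    remaining arcs exhausts the interval. *)

Require Import Defs.
From HB Require Import structures.
From mathcomp Require Import all_boot all_order all_algebra.
From mathcomp Require Import all_classical all_reals all_analysis.
From mathcomp Require Import measurable_realfun complex ring lra zify.
Set Implicit Arguments. Unset Strict Implicit. Unset Printing Implicit Defensive.
Import Order.TTheory GRing.Theory Num.Theory numFieldNormedType.Exports.
Local Open Scope classical_set_scope.
Local Open Scope ring_scope.

(** The difficulty is to move the second variable while holding the first one still. With
    [Z = dil y * hor T x] both variables are read off a single horocycle orbit, and on a block a
    full period multiplies the first variable by an element of SL_2(Z). Times that differ by a
    multiple of the period thus carry literally the same first variable, and the drift of two such
    times acts on the second variable alone. Only averages over short stretches can be compared in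
    this way, and the shear relates stretches that lie a bounded but long time apart; a second, much
    longer scale ties them back to the starting times. Since the long scale depends on the short one
    through the time of the shear, and the scale at which the energy is stable is unknown in
    advance, a finite tower of scales is fixed before [y] and [T]. The sign of the drift is not
    controlled, which is harmless: a unit shift in either direction exchanges the observables with
    shifts 0 and 1. All statements are finite with explicit errors, and no limit measure is
    formed. *)

(** * Measurability of functions built from coordinates *)

Section measurability.
Context {d : measure_display} {T : measurableType d} {R : realType}.
Local Notation mR := (measurableTypeR R).
Implicit Types f g : T -> R.

Lemma mcst d' (T' : measurableType d') (c : T') :
  measurable_fun setT (fun _ : T => c).
Proof. exact: measurable_cst. Qed.

Lemma mid : measurable_fun setT (fun x : T => x).
Proof. exact: measurable_id. Qed.

Lemma mD f g : measurable_fun setT f -> measurable_fun setT g ->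
  measurable_fun setT (fun x => f x + g x).
Proof. exact: measurable_funD. Qed.

Lemma mN f : measurable_fun setT f -> measurable_fun setT (fun x => - f x).
Proof. exact: measurable_funN. Qed.

Lemma mM f g : measurable_fun setT f -> measurable_fun setT g ->
  measurable_fun setT (fun x => f x * g x).
Proof. exact: measurable_funM. Qed.

Lemma mX f n : measurable_fun setT f -> measurable_fun setT (fun x => f x ^+ n).
Proof. exact: measurable_funX. Qed.

Lemma mnorm f : measurable_fun setT f -> measurable_fun setT (fun x => `|f x|).
Proof. by move=> mf; exact: measurableT_comp. Qed.

Lemma measurable_inv : measurable_fun setT (fun x : mR => x^-1 : mR).
Proof.
rewrite (_ : (fun x : mR => _) = fun x : mR => if x == 0 then 0 else x^-1); last first.
  by apply/funext => x; case: eqP => // ->; rewrite invr0.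
apply: measurable_fun_if => //.
- exact: measurable_fun_eqr.
- rewrite setTI (_ : _ @^-1` _ = [set~ (0 : R)]); last first.
    by apply/seteqP; split => x /=; [move/negbT/eqP | move/eqP/negbTE].
  apply: open_continuous_measurable_fun.
    by rewrite openC; exact: closed_eq.
  by move=> x; rewrite inE /= => /eqP x0; exact: inv_continuous.
Qed.

Lemma mV f : measurable_fun setT f -> measurable_fun setT (fun x => (f x)^-1).
Proof. move=> mf; exact: (measurableT_comp measurable_inv mf). Qed.

Lemma mE f : measurable_fun setT f -> measurable_fun setT (fun x => (f x)%:E).
Proof. by move=> mf; exact/measurable_EFinP. Qed.

Lemma mMe (f g : T -> \bar R) : measurable_fun setT f -> measurable_fun setT g ->
  measurable_fun setT (fun x => f x * g x)%E.
Proof. exact: emeasurable_funM. Qed.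

Section pairs.
Context {d1 d2 : measure_display} {T1 : measurableType d1} {T2 : measurableType d2}.

Lemma mpair (f : T -> T1) (g : T -> T2) :
  measurable_fun setT f -> measurable_fun setT g ->
  measurable_fun setT (fun x => (f x, g x)).
Proof. exact: measurable_fun_pair. Qed.

Lemma mfst (f : T -> T1 * T2) :
  measurable_fun setT f -> measurable_fun setT (fun x => (f x).1).
Proof. move=> mf; exact: (measurableT_comp measurable_fst mf). Qed.

Lemma msnd (f : T -> T1 * T2) :
  measurable_fun setT f -> measurable_fun setT (fun x => (f x).2).
Proof. move=> mf; exact: (measurableT_comp measurable_snd mf). Qed.

Lemma mcomp (f : T -> T1) (g : T1 -> T2) : measurable_fun setT g ->
  measurable_fun setT f -> measurable_fun setT (fun x => g (f x)).
Proof. move=> mg mf; exact: (measurableT_comp mg mf). Qed.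

End pairs.
End measurability.

(** The constant pattern precedes the algebraic ones, so a subterm free of the variable is closed at
    once and [mfun] handles rational expressions in the coordinates. *)
Ltac mstep := lazymatch goal with
  | |- measurable_fun _ (fun x => x) => exact: mid
  | |- measurable_fun _ (fun _ => ?c) => exact: mcst
  | |- measurable_fun _ (fun x => (@?f x, @?g x)) => apply: (mpair (f := f) (g := g))
  | |- measurable_fun _ (fun x => @?f x + @?g x) => apply: (mD (f := f) (g := g))
  | |- measurable_fun _ (fun x => @?f x * @?g x) => apply: (mM (f := f) (g := g))
  | |- measurable_fun _ (fun x => - @?f x) => apply: (mN (f := f))
  | |- measurable_fun _ (fun x => (@?f x)^-1) => apply: (mV (f := f))
  | |- measurable_fun _ (fun x => @?f x ^+ _) => apply: (mX _ (f := f))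
  | |- measurable_fun _ (fun x => `|@?f x|) => apply: (mnorm (f := f))
  | |- measurable_fun _ (fun x => (@?f x)%:E) => apply: (mE (f := f))
  | |- measurable_fun _ (fun x => (@?f x * @?g x)%E) => apply: (mMe (f := f) (g := g))
  | |- measurable_fun _ (fun x => (@?f x).1) => apply: (mfst (f := f))
  | |- measurable_fun _ (fun x => (@?f x).2) => apply: (msnd (f := f))
  end.
Ltac mfun := repeat mstep.

Definition pushforward_measure d1 d2 (T1 : measurableType d1) (T2 : measurableType d2)
    (R : realType) (m : {measure set T1 -> \bar R}) (f : T1 -> T2)
    (mf : measurable_fun setT f) : {measure set T2 -> \bar R} :=
  ltac:(refine (@Measure.clone _ _ _ (pushforward m f) _); exact: mf).

(** * Lebesgue integrals under affine maps *)

Section affine_change.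
Context {R : realType}.
Local Notation mR := (measurableTypeR R).
Local Notation leb := (@lebesgue_measure R).
Local Open Scope ereal_scope.

Let pre_itv (a b u v : R) : (0 < a)%R ->
  (fun x : R => a * x + b)%R @^-1` `]u, v]%classic = `]((u - b) / a)%R, ((v - b) / a)%R]%classic.
Proof.
move=> a0; apply/seteqP; split => x /=; rewrite !in_itv /= => /andP[h1 h2].
  by rewrite ltr_pdivrMr // ler_pdivlMr // mulrC; apply/andP; split; lra.
move: h1 h2; rewrite ltr_pdivrMr // ler_pdivlMr // mulrC => h1 h2.
by apply/andP; split; lra.
Qed.

Let affine_pos (a b : R) (f : R -> \bar R) : (0 < a)%R -> measurable_fun setT f ->
  (forall x, 0 <= f x) ->
  \int[leb]_x f (a * x + b)%R = (a^-1)%:E * \int[leb]_x f x.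
Proof.
move=> a0 mf f0.
have mphi : measurable_fun setT (fun x : mR => a * x + b : mR)%R by mfun.
have k0 : (0 <= a)%R by exact: ltW.
(* Lebesgue measure is recognised in the rescaled image measure by comparing the two on half-open
   intervals. *)
pose mu := mscale (NngNum k0)
  (@pushforward_measure _ _ _ _ R leb (fun x : mR => a * x + b : mR)%R mphi).
have E A : measurable A -> leb A = mu A.
  apply: lebesgue_measure_unique => _ [[u v]] _ <-.
  transitivity (a%:E * leb ((fun x : R => a * x + b)%R @^-1` `]u, v]%classic)); last by [].
  rewrite pre_itv // !lebesgue_measure_itv /= !lte_fin ltr_pM2r ?invr_gt0 // ltrD2r.
  case: ifP => _; last by rewrite mule0.
  rewrite -!EFinB -EFinM; congr EFin; field; exact: lt0r_neq0.
have -> : \int[leb]_x f x = \int[mu]_x f x.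
  by apply: eq_measure_integral => A mA _; exact: E.
rewrite ge0_integral_mscale //= ge0_integral_pushforward //=.
rewrite preimage_setT muleA -EFinM mulVf ?mul1e // gt_eqF //.
Qed.

Lemma integral_affine (a b : R) (f : R -> \bar R) : a != 0%R -> measurable_fun setT f ->
  (forall x, 0 <= f x) ->
  \int[leb]_x f (a * x + b)%R = (`|a|^-1)%:E * \int[leb]_x f x.
Proof.
move=> a0 mf f0; case: (ltgtP a 0%R) a0 => // a0 _; last first.
  by rewrite gtr0_norm // affine_pos.
rewrite ltr0_norm //.
have -> : \int[leb]_x f x = \int[leb]_x f (- x)%R.
  have mopp : measurable_fun setT (fun x : mR => - x : mR)%R by mfun.
  transitivity (\int[pushforward_measure leb mopp]_x f x).
    by apply: eq_measure_integral => A mA _; exact/esym/(lebesgue_measureN mA).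
  by rewrite ge0_integral_pushforward.
have mfN : measurable_fun setT (fun x : R => f (- x)%R).
  by apply: (mcomp mf); mfun.
rewrite -(affine_pos (- b) _ mfN) ?oppr_gt0 //.
by apply: eq_integral => x _; congr f; ring.
Qed.

Lemma integral_translate (b : R) (f : R -> \bar R) : measurable_fun setT f ->
  (forall x, 0 <= f x) -> \int[leb]_x f (x + b)%R = \int[leb]_x f x.
Proof.
move=> mf f0; have := integral_affine b (@oner_neq0 R) mf f0.
by rewrite normr1 invr1 mul1e => <-; apply: eq_integral => x _; rewrite mul1r.
Qed.

(** Serves to discard the sets [c = 0] and [d = 0], where the coordinates on SL_2(R) degenerate. *)
Lemma eq_integral_neq (r : R) (f g : R -> \bar R) : measurable_fun setT f ->
  (forall x, x != r -> f x = g x) -> \int[leb]_x f x = \int[leb]_x g x.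
Proof.
move=> mf fg.
have mD : measurable (setT `\ r : set mR) by exact: measurableD.
have mfD : measurable_fun (setT `\ r : set mR) f by exact: measurable_funS mf.
have E x : x \in (setT `\ r : set mR) -> f x = g x.
  by rewrite inE => -[_ /= /eqP xr]; rewrite fg.
have mgD : measurable_fun (setT `\ r : set mR) g by apply: (eq_measurable_fun f) mfD => x /E.
rewrite -(integral_setD1 mD mfD) -(integral_setD1 mD mgD).
by apply: eq_integral => x /E.
Qed.
Lemma ge0_integral_scale (k : R) (f : R -> \bar R) : measurable_fun setT f ->
  (forall x, 0 <= f x) -> (0 <= k)%R ->
  \int[leb]_x (k%:E * f x) = k%:E * \int[leb]_x f x.
Proof. by move=> mf f0 k0; rewrite ge0_integralZl // => [x _|]; rewrite ?lee_fin. Qed.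
End affine_change.

(* The library's sigma-finite structure on [m1 \x m2] is shadowed by the one for
   finite measures. *)
Definition prod_measure d1 d2 (T1 : measurableType d1) (T2 : measurableType d2)
    (R : realType) (m1 : {sigma_finite_measure set T1 -> \bar R})
    (m2 : {sigma_finite_measure set T2 -> \bar R}) : set (T1 * T2) -> \bar R :=
  (m1 \x m2)%E.

Section prod_measure.
Context d1 d2 (T1 : measurableType d1) (T2 : measurableType d2) (R : realType).
Variables (m1 : {sigma_finite_measure set T1 -> \bar R})
  (m2 : {sigma_finite_measure set T2 -> \bar R}).

HB.instance Definition _ := Measure.copy (prod_measure m1 m2) (m1 \x m2)%E.

Let prod_measure_sigma_finite : sigma_finite setT (prod_measure m1 m2).
Proof.
have /sigma_finiteP[F [TF ndF Foo]] := sigma_finiteT m1.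
have /sigma_finiteP[G [TG ndG Goo]] := sigma_finiteT m2.
exists (fun n => F n `*` G n) => [|k].
  rewrite -setXTT TF TG predeqE => -[x y]; split => [[/= [n _ Fnx] [k _ Gky]]|].
    exists (maxn n k) => //; split.
    - by move: x Fnx; exact/subsetPset/ndF/leq_maxl.
    - by move: y Gky; exact/subsetPset/ndG/leq_maxr.
  by move=> [n _ []/= ? ?]; split; exists n.
have [? ?] := Foo k; have [? ?] := Goo k.
by split; [exact: measurableX|rewrite /prod_measure product_measure1E// lte_mul_pinfty// ge0_fin_numE].
Qed.

HB.instance Definition _ := Measure_isSigmaFinite.Build _ _ _ (prod_measure m1 m2)
  prod_measure_sigma_finite.

End prod_measure.

(** * Haar measure of SL_2(R) *)

Notation mat2 R := ((R * R) * (R * R))%type.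

(* SL_2(R) as 2x2 arrays ((a, b), (c, d)), and the Haar measure dx dc dd in the
   coordinates [ (1, x; 0, 1) * (1/d, 0; c, d) ], defined off the null set d = 0. *)
Section Haar.
Context {R : realType}.
Local Notation mR := (measurableTypeR R).
Local Notation leb := (@lebesgue_measure R).
Local Notation M := ((mR * mR) * (mR * mR))%type.

Definition mulm (g h : mat2 R) : mat2 R :=
  ((g.1.1 * h.1.1 + g.1.2 * h.2.1, g.1.1 * h.1.2 + g.1.2 * h.2.2),
   (g.2.1 * h.1.1 + g.2.2 * h.2.1, g.2.1 * h.1.2 + g.2.2 * h.2.2)).
Definition detm (g : mat2 R) : R := g.1.1 * g.2.2 - g.1.2 * g.2.1.
Definition invm (g : mat2 R) : mat2 R := ((g.2.2, - g.1.2), (- g.2.1, g.1.1)).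
Definition idm : mat2 R := ((1, 0), (0, 1)).
Definition upm (t : R) : mat2 R := ((1, t), (0, 1)).
Definition lowm (z : R) : mat2 R := ((1, 0), (z, 1)).
Definition diagm (l : R) : mat2 R := ((l, 0), (0, l^-1)).
Definition oppm (g : mat2 R) : mat2 R := ((- g.1.1, - g.1.2), (- g.2.1, - g.2.2)).

Definition haar_coord (p : R * (R * R)) : mat2 R :=
  ((p.2.2^-1 + p.1 * p.2.1, p.1 * p.2.2), (p.2.1, p.2.2)).

Local Open Scope ereal_scope.

Let leb2 : {sigma_finite_measure set (mR * mR)%type -> \bar R} := prod_measure leb leb.

Definition haar (f : M -> \bar R) : \bar R :=
  \int[prod_measure leb (prod_measure leb leb)]_p f (haar_coord p).

Lemma measurable_haar_coord : measurable_fun setT (haar_coord : mR * (mR * mR) -> M).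
Proof. rewrite /haar_coord; mfun. Qed.

Lemma measurable_mulml (g : mat2 R) : measurable_fun setT (mulm g : M -> M).
Proof. rewrite /mulm; mfun. Qed.

Lemma measurable_mulmr (g : mat2 R) : measurable_fun setT ((mulm^~ g) : M -> M).
Proof. rewrite /mulm; mfun. Qed.

Section integral_forms.
Variable f : M -> \bar R.
Hypotheses (mf : measurable_fun setT f) (f0 : forall g, 0 <= f g).

Let mfh : measurable_fun setT (fun p : mR * (mR * mR) => f (haar_coord p)).
Proof. by apply: (mcomp mf); exact: measurable_haar_coord. Qed.

Lemma haar_cdx : haar f = \int[leb]_c \int[leb]_d \int[leb]_x f (haar_coord (x, (c, d))).
Proof.
rewrite /haar /prod_measure (@fubini_tonelli2 _ _ _ _ R leb leb2 _ mfh (fun p => f0 _)).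
rewrite /leb2 /= /prod_measure fubini_tonelli1 //.
- exact: measurable_fun_fubini_tonelli_G.
- by move=> p; exact: integral_ge0.
Qed.

Lemma haar_dcx : haar f = \int[leb]_d \int[leb]_c \int[leb]_x f (haar_coord (x, (c, d))).
Proof.
rewrite /haar /prod_measure (@fubini_tonelli2 _ _ _ _ R leb leb2 _ mfh (fun p => f0 _)).
rewrite /leb2 /= /prod_measure fubini_tonelli2 //.
- exact: measurable_fun_fubini_tonelli_G.
- by move=> p; exact: integral_ge0.
Qed.

(** At fixed [c] and [d] the entry [a = 1/d + x c] replaces [x], with [da = |c| dx]. In this form
    the measure is symmetric in [a] and [d], which [haar_flip] uses. *)
Lemma haar_cda : haar f = \int[leb]_c ((`|c|^-1)%:E *
  \int[leb]_d \int[leb]_a f ((a, (a * d - 1) / c)%R, (c, d))).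
Proof.
rewrite haar_cdx; apply: (@eq_integral_neq _ 0%R) => [|c c0].
  have mF3 : measurable_fun setT (fun p : mR * mR * mR => f (haar_coord (p.2, (p.1.1, p.1.2)))).
    by apply: (mcomp mf); rewrite /haar_coord; mfun.
  have mF2 := measurable_fun_fubini_tonelli_F (m2 := leb) _ mF3 (fun p => f0 _).
  exact: (measurable_fun_fubini_tonelli_F (m2 := leb) _ mF2 (fun p => integral_ge0 _ (fun x _ => f0 _))).
have mF : measurable_fun setT (fun p : mR * mR => f ((p.1, (p.1 * p.2 - 1) / c), (c, p.2))%R).
  by apply: (mcomp mf); mfun.
rewrite -(ge0_integral_scale (measurable_fun_fubini_tonelli_G (m1 := leb) _ mF (fun p => f0 _))
   (fun d => integral_ge0 _ (fun x _ => f0 _))) ?invr_ge0 //.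
apply: (@eq_integral_neq _ 0%R) => [|d d0].
  have mF3 : measurable_fun setT (fun p : mR * mR => f (haar_coord (p.2, (c, p.1)))).
    by apply: (mcomp mf); rewrite /haar_coord; mfun.
  exact: (measurable_fun_fubini_tonelli_F (m2 := leb) _ mF3 (fun p => f0 _)).
have mFd : measurable_fun setT (fun a : mR => f ((a, (a * d - 1) / c), (c, d))%R).
  by apply: (mcomp mf); mfun.
rewrite -(@integral_affine _ c d^-1 _ c0 mFd (fun x => f0 _)).
apply: eq_integral => x _; congr f; rewrite /haar_coord /=; congr ((_, _), _); first by ring.
by field; rewrite c0 d0.
Qed.
End integral_forms.

Lemma haar_upl (t : R) (f : M -> \bar R) : measurable_fun setT f -> (forall g, 0 <= f g) ->
  haar (fun g => f (mulm (upm t) g)) = haar f.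
Proof.
move=> mf f0; rewrite (haar_cdx mf f0).
rewrite (haar_cdx (mcomp mf (measurable_mulml (upm t))) (fun g => f0 _)).
apply: eq_integral => c _; apply: eq_integral => d _.
have mF : measurable_fun setT (fun x : mR => f (haar_coord (x, (c, d)))).
  by apply: (mcomp mf); rewrite /haar_coord; mfun.
rewrite -(integral_translate t mF (fun x => f0 _)).
apply: eq_integral => x _; congr f.
by rewrite /mulm /haar_coord /=; congr ((_, _), (_, _)); ring.
Qed.

(** In the coordinates, right multiplication by [lowm z] is the translation of [c] by [d z], as left
    multiplication by [upm t] is the translation of [x] by [t]. The other translations are deduced
    from these two with [flipm]. *)
Lemma haar_lowr (z : R) (f : M -> \bar R) : measurable_fun setT f -> (forall g, 0 <= f g) ->
  haar (fun g => f (mulm g (lowm z))) = haar f.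
Proof.
move=> mf f0; rewrite (haar_dcx mf f0).
rewrite (haar_dcx (mcomp mf (measurable_mulmr (lowm z))) (fun g => f0 _)).
apply: eq_integral => d _.
have mF : measurable_fun setT (fun p : mR * mR => f (haar_coord (p.1, (p.2, d)))).
  by apply: (mcomp mf); rewrite /haar_coord; mfun.
have mFc := measurable_fun_fubini_tonelli_G (m1 := leb) _ mF (fun p => f0 _).
rewrite -(integral_translate (d * z) mFc (fun c => integral_ge0 _ (fun x _ => f0 _))).
apply: eq_integral => c _; apply: eq_integral => x _; congr f.
by rewrite /mulm /haar_coord /=; congr ((_, _), (_, _)); ring.
Qed.

(* [flipm] is an antiautomorphism exchanging left and right translations and
   fixing unipotent matrices. *)
Definition flipm (g : mat2 R) : mat2 R := ((g.2.2, g.1.2), (g.2.1, g.1.1)).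

Lemma flipm_mul (g h : mat2 R) : flipm (mulm g h) = mulm (flipm h) (flipm g).
Proof. by rewrite /flipm /mulm /=; congr ((_, _), (_, _)); ring. Qed.

Lemma flipmK (g : mat2 R) : flipm (flipm g) = g.
Proof. by case: g => -[? ?] [? ?]. Qed.

Lemma measurable_flipm : measurable_fun setT (flipm : M -> M).
Proof. rewrite /flipm; mfun. Qed.

Lemma haar_flip (f : M -> \bar R) : measurable_fun setT f -> (forall g, 0 <= f g) ->
  haar (fun g => f (flipm g)) = haar f.
Proof.
move=> mf f0; rewrite (haar_cda mf f0).
rewrite (haar_cda (mcomp mf measurable_flipm) (fun g => f0 _)).
apply: eq_integral => c _; congr (_ * _).
have mF : measurable_fun setT (fun p : mR * mR => f ((p.1, (p.1 * p.2 - 1) / c), (c, p.2))%R).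
  by apply: (mcomp mf); mfun.
rewrite -(fubini_tonelli (m1 := leb) (m2 := leb) _ mF (fun p => f0 _)).
by apply: eq_integral => d _; apply: eq_integral => a _; congr f; rewrite /flipm /= [(a * d)%R]mulrC.
Qed.

Lemma haar_lowl (z : R) (f : M -> \bar R) : measurable_fun setT f -> (forall g, 0 <= f g) ->
  haar (fun g => f (mulm (lowm z) g)) = haar f.
Proof.
move=> mf f0.
rewrite -(haar_flip (mcomp mf (measurable_mulml (lowm z))) (fun g => f0 _)) -(haar_flip mf f0).
rewrite -(haar_lowr z (mcomp mf measurable_flipm) (fun g => f0 _)).
by congr haar; apply/funext => g; rewrite flipm_mul.
Qed.

Lemma mulmA (g h k : mat2 R) : mulm g (mulm h k) = mulm (mulm g h) k.
Proof. by rewrite /mulm /=; congr ((_, _), (_, _)); ring. Qed.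

Lemma detm_mul (g h : mat2 R) : detm (mulm g h) = (detm g * detm h)%R.
Proof. by rewrite /detm /mulm /=; ring. Qed.

Lemma detm_inv (g : mat2 R) : detm (invm g) = detm g.
Proof. by rewrite /detm /invm /=; ring. Qed.

Lemma mulVm (g : mat2 R) : detm g = 1%R -> mulm (invm g) g = idm.
Proof. by rewrite /detm /mulm /invm /idm /= => <-; congr ((_, _), (_, _)); ring. Qed.

Lemma mulmV (g : mat2 R) : detm g = 1%R -> mulm g (invm g) = idm.
Proof. by rewrite /detm /mulm /invm /idm /= => <-; congr ((_, _), (_, _)); ring. Qed.

Lemma mul1m (g : mat2 R) : mulm idm g = g.
Proof. by case: g => -[? ?] [? ?]; rewrite /mulm /idm /=; congr ((_, _), (_, _)); ring. Qed.

Lemma mulm1 (g : mat2 R) : mulm g idm = g.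
Proof. by case: g => -[? ?] [? ?]; rewrite /mulm /idm /=; congr ((_, _), (_, _)); ring. Qed.

Let gauss3 (g : mat2 R) : detm g = 1%R -> g.2.1 != 0%R ->
  g = mulm (upm ((g.1.1 - 1) / g.2.1)) (mulm (lowm g.2.1) (upm ((g.2.2 - 1) / g.2.1))).
Proof.
case: g => -[a b] [c d]; rewrite /detm /mulm /upm /lowm /= => D c0.
have -> : b = ((a * d - 1) / c)%R by rewrite -D; field.
by congr ((_, _), (_, _)); field.
Qed.

(** A matrix with nonzero lower left entry is a product of three unipotent ones, upper, lower and
    upper. If the entry vanishes, a factor [lowm 1] makes it nonzero without changing the
    integral. *)
Lemma haar_mull (h : mat2 R) (f : M -> \bar R) : detm h = 1%R ->
  measurable_fun setT f -> (forall g, 0 <= f g) ->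
  haar (fun g => f (mulm h g)) = haar f.
Proof.
move=> D mf f0.
suff S (k : mat2 R) : detm k = 1%R -> k.2.1 != 0%R -> haar (fun g => f (mulm k g)) = haar f.
  have [c0|] := eqVneq h.2.1 0%R; last by move=> c0; exact: S.
  rewrite -(haar_lowl 1 (mcomp mf (measurable_mulml h)) (fun g => f0 _)).
  transitivity (haar (fun g => f (mulm (mulm h (lowm 1)) g))).
    by congr haar; apply/funext => g; rewrite mulmA.
  apply: S; first by rewrite detm_mul D /detm /=; ring.
  rewrite /mulm /= c0 mul0r mulr1 add0r; apply/eqP => d0.
  by move: D; rewrite /detm c0 d0 !mulr0 subr0 => /eqP; rewrite eq_sym oner_eq0.
move=> {}D c0; rewrite (gauss3 D c0).
set t := ((k.1.1 - 1) / k.2.1)%R; set s := ((k.2.2 - 1) / k.2.1)%R; set z := k.2.1.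
have m1 := mcomp mf (measurable_mulml (upm t)).
have m2 := mcomp m1 (measurable_mulml (lowm z)).
transitivity (haar (fun g => f (mulm (upm t) (mulm (lowm z) (mulm (upm s) g))))).
  by congr haar; apply/funext => g; rewrite -!mulmA.
rewrite (haar_upl s m2 (fun g => f0 _)) (haar_lowl z m1 (fun g => f0 _)).
exact: haar_upl.
Qed.

Lemma haar_mulr (h : mat2 R) (f : M -> \bar R) : detm h = 1%R ->
  measurable_fun setT f -> (forall g, 0 <= f g) ->
  haar (fun g => f (mulm g h)) = haar f.
Proof.
move=> D mf f0.
have D' : detm (flipm h) = 1%R by rewrite -D /detm /flipm /=; ring.
rewrite -(haar_flip (mcomp mf (measurable_mulmr h)) (fun g => f0 _)) -(haar_flip mf f0).
rewrite -(haar_mull D' (mcomp mf measurable_flipm) (fun g => f0 _)).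
by congr haar; apply/funext => g; rewrite flipm_mul flipmK.
Qed.

(** [haar_coord] has determinant one off the null set [d = 0], where the value 0 for the inverse of
    0 makes it singular. *)
Lemma eq_haar (f g : M -> \bar R) : measurable_fun setT f -> measurable_fun setT g ->
  (forall h, 0 <= f h) -> (forall h, 0 <= g h) ->
  (forall h, detm h = 1%R -> f h = g h) -> haar f = haar g.
Proof.
move=> mf mg f0 g0 fg; rewrite (haar_dcx mf f0) (haar_dcx mg g0).
apply: (@eq_integral_neq _ 0%R) => [|d d0].
  have mF3 : measurable_fun setT (fun p : mR * mR * mR => f (haar_coord (p.2, (p.1.2, p.1.1)))).
    by apply: (mcomp mf); rewrite /haar_coord; mfun.
  have mF2 := measurable_fun_fubini_tonelli_F (m2 := leb) _ mF3 (fun p => f0 _).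
  exact: (measurable_fun_fubini_tonelli_F (m2 := leb) _ mF2 (fun p => integral_ge0 _ (fun x _ => f0 _))).
apply: eq_integral => c _; apply: eq_integral => x _; apply: fg.
by rewrite /detm /haar_coord /=; field.
Qed.
End Haar.

(** * Integer matrices and finite boxes of them *)

Notation zmat := ((int * int) * (int * int))%type.

Definition zdet (g : zmat) : int := g.1.1 * g.2.2 - g.1.2 * g.2.1.
Definition sl2z : set zmat := [set g | zdet g = 1].
Definition zmul (g h : zmat) : zmat :=
  ((g.1.1 * h.1.1 + g.1.2 * h.2.1, g.1.1 * h.1.2 + g.1.2 * h.2.2),
   (g.2.1 * h.1.1 + g.2.2 * h.2.1, g.2.1 * h.1.2 + g.2.2 * h.2.2)).
Definition zinv (g : zmat) : zmat := ((g.2.2, - g.1.2), (- g.2.1, g.1.1)).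
Definition zopp (g : zmat) : zmat := ((- g.1.1, - g.1.2), (- g.2.1, - g.2.2)).

Lemma sl2z_mul g h : sl2z g -> sl2z h -> sl2z (zmul g h).
Proof. rewrite /sl2z /zdet /zmul /= => dg dh. by rewrite -[RHS](mulr1 1) -[X in _ = X * _]dg -dh; ring. Qed.

Lemma sl2z_inv g : sl2z g -> sl2z (zinv g).
Proof. by rewrite /sl2z /zdet /zinv /= => <-; ring. Qed.

Lemma sl2z_opp g : sl2z g -> sl2z (zopp g).
Proof. by rewrite /sl2z /zdet /zopp /= => <-; ring. Qed.

Lemma zinvK : involutive zinv.
Proof. by move=> [[a b] [c d]]; rewrite /zinv /= !opprK. Qed.

Lemma zmulKV g h : sl2z g -> zmul (zmul h (zinv g)) g = h.
Proof.
case: g h => -[a b] [c d] [[a' b'] [c' d']]; rewrite /sl2z /zdet /zmul /zinv /= => D.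
by congr ((_, _), (_, _)); rewrite -[RHS]mulr1 -D; ring.
Qed.

Section cast.
Context {R : realType}.
Definition zr (g : zmat) : mat2 R :=
  ((g.1.1%:~R, g.1.2%:~R), (g.2.1%:~R, g.2.2%:~R)).

Lemma zr_mul g h : zr (zmul g h) = mulm (zr g) (zr h).
Proof. by rewrite /zr /zmul /mulm /= !rmorphD /= !rmorphM. Qed.

Lemma zr_inv g : zr (zinv g) = invm (zr g).
Proof. by rewrite /zr /zinv /invm /= !rmorphN. Qed.

Lemma zr_opp g : zr (zopp g) = oppm (zr g).
Proof. by rewrite /zr /zopp /oppm /= !rmorphN. Qed.

Lemma detm_zr g : sl2z g -> detm (zr g) = 1.
Proof.
rewrite /sl2z /zdet /detm /zr /= => D.
by rewrite -!rmorphM /= -rmorphB /= D.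
Qed.
End cast.

Definition ibox (B : nat) : seq int := [seq i%:Z - B%:Z | i <- iota 0 (2 * B).+1].

Lemma mem_ibox (B : nat) (x : int) : `|x| <= B%:Z -> x \in ibox B.
Proof.
move=> xB; apply/mapP; exists (absz (x + B%:Z)); last by lia.
by rewrite mem_iota; lia.
Qed.

Definition ipairs (B : nat) : seq (int * int) := [seq (a, b) | a <- ibox B, b <- ibox B].

Lemma mem_ipairs (B : nat) (v : int * int) : `|v.1| <= B%:Z -> `|v.2| <= B%:Z -> v \in ipairs B.
Proof.
by case: v => a b /= ha hb; apply: (allpairs_f (fun a b => (a, b))); exact: mem_ibox.
Qed.

Definition zbox (B : nat) : seq zmat := [seq (p, q) | p <- ipairs B, q <- ipairs B].

Lemma mem_zbox (B : nat) (g : zmat) : `|g.1.1| <= B%:Z -> `|g.1.2| <= B%:Z ->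
  `|g.2.1| <= B%:Z -> `|g.2.2| <= B%:Z -> g \in zbox B.
Proof.
by case: g => p q /= *; apply: (allpairs_f (fun p q => (p, q))); exact: mem_ipairs.
Qed.

Lemma seq_argmin (R : realType) (T : eqType) (s : seq T) (F : T -> R) (x0 : T) :
  x0 \in s -> exists2 x, x \in s & forall y, y \in s -> F x <= F y.
Proof.
elim: s x0 => // z s IH x0 _.
case: s IH => [|z' s] IH.
  by exists z; rewrite ?mem_head // => y; rewrite inE => /eqP ->.
have [x xs xm] := IH z' (mem_head _ _).
have [le|lt] := leP (F x) (F z).
  by exists x => [|y]; rewrite inE ?xs ?orbT // => /orP[/eqP ->|/xm].
exists z; rewrite ?mem_head // => y; rewrite inE => /orP[/eqP ->//|/xm].
exact/le_trans/ltW.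
Qed.

(** * Reduction theory of SL_2(Z) *)

Section reduction.
Context {R : realType}.
Implicit Types g : mat2 R.

Definition row1sq g : R := g.1.1 ^+ 2 + g.1.2 ^+ 2.
Definition row2sq g : R := g.2.1 ^+ 2 + g.2.2 ^+ 2.
Definition rowdot g : R := g.1.1 * g.2.1 + g.1.2 * g.2.2.

(* z = g i satisfies |Re z| <= 1/2 and |z| >= 1. *)
Definition reduced g : bool := (2 * `|rowdot g| <= row2sq g) && (row2sq g <= row1sq g).
Definition sreduced g : bool := (2 * `|rowdot g| < row2sq g) && (row2sq g < row1sq g).

Lemma row2sq_gt0 g : detm g = 1 -> 0 < row2sq g.
Proof.
move=> D; rewrite lt_neqAle addr_ge0 ?sqr_ge0 // andbT eq_sym; apply/eqP => /eqP.
rewrite paddr_eq0 ?sqr_ge0 // !sqrf_eq0 => /andP[/eqP c0 /eqP d0].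
by move: D; rewrite /detm c0 d0 !mulr0 subr0 => /eqP; rewrite eq_sym oner_eq0.
Qed.

Lemma row_identity g : detm g = 1 -> row1sq g * row2sq g = 1 + rowdot g ^+ 2.
Proof.
move=> D; transitivity (detm g ^+ 2 + rowdot g ^+ 2); last by rewrite D expr1n.
by rewrite /row1sq /row2sq /rowdot /detm; ring.
Qed.

(** Cramer's rule recovers the coefficients from the combination of the two rows, and Cauchy-Schwarz
    bounds them; so an orbit has only finitely many short lower rows. *)
Let lower_bound g (r s : int) : detm g = 1 ->
  (r%:~R ^+ 2 + s%:~R ^+ 2 : R) <=
  ((r%:~R * g.1.1 + s%:~R * g.2.1) ^+ 2 + (r%:~R * g.1.2 + s%:~R * g.2.2) ^+ 2) * (row1sq g + row2sq g).
Proof.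
move: (r%:~R) (s%:~R) => x y D.
set u := x * g.1.1 + _; set v := x * g.1.2 + _.
have -> : x = u * g.2.2 - v * g.2.1.
  by rewrite -[LHS]mulr1 -D /u /v /detm; ring.
have -> : y = v * g.1.1 - u * g.1.2.
  by rewrite -[LHS]mulr1 -D /u /v /detm; ring.
rewrite /row1sq /row2sq -subr_ge0.
rewrite (_ : _ - _ = (u * g.2.1 + v * g.2.2) ^+ 2 + (u * g.1.1 + v * g.1.2) ^+ 2).
  by rewrite addr_ge0 ?sqr_ge0.
move: u v => u v; ring.
Qed.

(** The lower row of [k g] has squared length [1 / Im (k g i)]. A translation brings the real part
    of a minimiser to at most 1/2 in absolute value without changing that length, and minimality
    against the inversion then gives [|k g i| >= 1]. *)
Lemma reduction g : detm g = 1 -> exists2 k : zmat, sl2z k & reduced (mulm (zr k) g).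
Proof.
move=> D.
have K0 := row2sq_gt0 D.
pose K := row2sq g * (row1sq g + row2sq g).
have [B KB] : exists B : nat, K < B%:R.
  by have := archi_boundP (x := `|K|) (normr_ge0 _); exists (Num.bound `|K|); rewrite (le_lt_trans (ler_norm _)).
pose N (v : int * int) : R := (v.1%:~R * g.1.1 + v.2%:~R * g.2.1) ^+ 2 + (v.1%:~R * g.1.2 + v.2%:~R * g.2.2) ^+ 2.
have rowN k : row2sq (mulm (zr k) g) = N k.2 by [].
pose s := [seq v <- ipairs B | `[< exists2 k, sl2z k & k.2 = v >]].
have ins k : sl2z k -> N k.2 <= row2sq g -> k.2 \in s.
  move=> sk le; rewrite mem_filter; apply/andP; split; first by apply/asboolP; exists k.
  have S2 : (k.2.1%:~R ^+ 2 + k.2.2%:~R ^+ 2 : R) <= K.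
    apply: (le_trans (lower_bound _ _ D)); rewrite /K ler_pM2r //.
    by rewrite ltr_wpDl // addr_ge0 ?sqr_ge0.
  have bnd (x : int) : (x%:~R ^+ 2 : R) <= K -> `|x| <= B%:Z.
    move=> xK; have : (x ^+ 2)%:~R < (B%:Z)%:~R :> R by rewrite rmorphXn /= (le_lt_trans xK).
    by rewrite ltr_int; nia.
  by apply: mem_ipairs; apply: bnd; apply: le_trans S2; rewrite ?lerDl ?lerDr sqr_ge0.
have id1 : sl2z ((1, 0), (0, 1)) by rewrite /sl2z /zdet.
have x0s : (0, 1) \in s.
  by apply: (ins _ id1); rewrite /N /row2sq /= !mul0r !add0r !mul1r.
have [v vs vmin] := seq_argmin N x0s.
have [k sk kv] : exists2 k, sl2z k & k.2 = v.
  by move: vs; rewrite mem_filter => /andP[/asboolP].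
have kmin k' : sl2z k' -> N k.2 <= N k'.2.
  move=> sk'; rewrite kv; have [le|lt] := leP (N k'.2) (row2sq g); first by apply/vmin/ins.
  apply: le_trans (ltW lt); rewrite (_ : row2sq g = N (0, 1)); first exact: vmin.
  by rewrite /N /row2sq /= !mul0r !add0r !mul1r.
pose h := mulm (zr k) g.
have Dh : detm h = 1 by rewrite detm_mul detm_zr // D mulr1.
have h0 := row2sq_gt0 Dh.
pose m := Num.floor (rowdot h / row2sq h + 1 / 2).
pose k' := zmul ((1, - m), (0, 1)) k.
have sk' : sl2z k' by apply: sl2z_mul => //; rewrite /sl2z /zdet /=; ring.
exists k' => //.
have h'E : mulm (zr k') g = mulm (upm (- m%:~R)) h.
  by rewrite zr_mul -mulmA /zr /upm /= rmorphN.
have E2 : row2sq (mulm (zr k') g) = row2sq h.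
  by rewrite h'E /row2sq /mulm /upm /= !mul0r !add0r !mul1r.
have Ed : rowdot (mulm (zr k') g) = rowdot h - m%:~R * row2sq h.
  by rewrite h'E /row2sq /rowdot /mulm /upm /=; ring.
apply/andP; split.
  rewrite E2 Ed.
  have /andP[] := floor_itv (rowdot h / row2sq h + 1 / 2); rewrite -/m rmorphD /=.
  set q := rowdot h / row2sq h.
  have -> : rowdot h = q * row2sq h by rewrite divfK // gt_eqF.
  move=> m1 m2; rewrite -mulrBl normrM (gtr0_norm h0) mulrA -[leRHS]mul1r ler_pM2r //.
  by rewrite -(ger0_norm (ler0n R 2)) -normrM ler_norml; apply/andP; split; lra.
rewrite E2; pose k2 := zmul ((0, 1), (-1, 0)) k'.
have sk2 : sl2z k2 by apply: sl2z_mul => //; rewrite /sl2z /zdet /=.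
have := kmin _ sk2; rewrite -!rowN -/h; congr (_ <= _).
rewrite zr_mul -mulmA /row2sq /row1sq /mulm /zr /=; ring.
Qed.

(** By [key], an element with nonzero lower left entry strictly lengthens the lower row of a
    strictly reduced matrix, because the integer [r^2 - |r s| + s^2] is at least 1. Applied to [k]
    and to its inverse this is contradictory, so [k] is a translation up to sign. *)
Lemma sreduced_unique g (k : zmat) : detm g = 1 -> sl2z k -> sreduced g ->
  sreduced (mulm (zr k) g) -> k = ((1, 0), (0, 1)) \/ k = ((-1, 0), (0, -1)).
Proof.
move=> D sk /andP[d1 d2] /andP[d3 d4].
have key (h : mat2 R) (l : zmat) : sl2z l -> detm h = 1 -> 2 * `|rowdot h| < row2sq h ->
    row2sq h < row1sq h -> l.2.1 != 0 -> row2sq h < row2sq (mulm (zr l) h).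
  move=> sl Dh e1 e2 l0.
  have -> : row2sq (mulm (zr l) h) = (l.2.1 ^+ 2)%:~R * row1sq h + (2 * l.2.1 * l.2.2)%:~R * rowdot h + (l.2.2 ^+ 2)%:~R * row2sq h.
    by rewrite !rmorphM /row2sq /row1sq /rowdot /mulm /zr /=; ring.
  move: (l.2.1) (l.2.2) l0 => r s r0.
  have i1 : (1 <= r ^+ 2 - `|r| * `|s| + s ^+ 2 :> int) by nia.
  have i1' : (1 <= (r ^+ 2)%:~R - (`|r| * `|s|)%:~R + (s ^+ 2)%:~R :> R).
    by rewrite -rmorphB -rmorphD /= -[leLHS]/(1%:~R) ler_int.
  have i2 : - ((`|r| * `|s|)%:~R * row2sq h) <= (2 * r * s)%:~R * rowdot h.
    rewrite lerNl (le_trans (ler_norm _)) // normrN normrM -intr_norm !normrM.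
    rewrite (_ : `|2| = 2 :> int) // !rmorphM /=.
    have := ltW e1; have : 0 <= (`|r| * `|s|)%:~R :> R by rewrite ler0z mulr_ge0.
    rewrite rmorphM /= => z0 e1'.
    rewrite [leLHS](_ : _ = (`|r|%:~R * `|s|%:~R) * (2 * `|rowdot h|)); last first.
      by rewrite -[2%Z%:~R]/(2 : R); ring.
    exact: ler_wpM2l.
  have h0 := row2sq_gt0 Dh.
  have r2 : 0 < (r ^+ 2)%:~R :> R by rewrite ltr0z exprn_even_gt0.
  have i3 : (r ^+ 2)%:~R * row2sq h < (r ^+ 2)%:~R * row1sq h by rewrite ltr_pM2l.
  have i4 : row2sq h <= ((r ^+ 2)%:~R - (`|r| * `|s|)%:~R + (s ^+ 2)%:~R) * row2sq h.
    by rewrite -[leLHS]mul1r ler_pM2r.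
  move: i4; rewrite !mulrDl mulNr; lra.
have nb (x y : R) : 2 * `|x| < y -> - y < 2 * x /\ 2 * x < y.
  by have := ler_norm x; have := ler_norm (- x); rewrite normrN; split; lra.
have Dk : detm (mulm (zr k) g) = 1 by rewrite detm_mul detm_zr // D mulr1.
have [r0|r0] := eqVneq k.2.1 0; last first.
  have := key _ _ sk D d1 d2 r0.
  have := key _ (zinv k) (sl2z_inv sk) Dk d3 d4; rewrite /= oppr_eq0 => /(_ r0).
  rewrite zr_inv mulmA mulVm ?detm_zr // mul1m => h1 h2.
  by have := lt_trans h1 h2; rewrite ltxx.
have ks : k.1.1 * k.2.2 = 1 by move: sk; rewrite /sl2z /zdet /= r0 mulr0 subr0.
have C' : row2sq (mulm (zr k) g) = (k.2.2 ^+ 2)%:~R * row2sq g.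
  by rewrite rmorphXn /row2sq /mulm /zr /= r0; ring.
have B' : rowdot (mulm (zr k) g) = (k.1.1 * k.2.2)%:~R * rowdot g + (k.1.2 * k.2.2)%:~R * row2sq g.
  by rewrite !rmorphM /row2sq /rowdot /mulm /zr /= r0; ring.
have [s1|s1] : k.2.2 = 1 \/ k.2.2 = -1.
  by have := congr1 absz ks; rewrite abszM => /eqP; rewrite muln_eq1 => /andP[_ /eqP]; lia.
- have p1 : k.1.1 = 1 by lia.
  have q0 : k.1.2 = 0.
    move: d3; rewrite C' B' s1 p1 !mulr1 expr1n !mul1r => d3.
    have [e1 e2] := nb _ _ d1; have [e3 e4] := nb _ _ d3.
    have : `|k.1.2%:~R * row2sq g| < 1 * row2sq g by rewrite mul1r ltr_norml; apply/andP; split; lra.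
    rewrite normrM -intr_norm (gtr0_norm (row2sq_gt0 D)).
    rewrite ltr_pM2r ?row2sq_gt0 // -[ltRHS]/(1%:~R) ltr_int; lia.
  by left; case: k r0 p1 q0 s1 {sk ks C' B' Dk d3 d4} => -[? ?] [? ?] /= -> -> -> ->.
- have p1 : k.1.1 = -1 by lia.
  have q0 : k.1.2 = 0.
    move: d3; rewrite C' B'.
    have -> : ((k.1.1 * k.2.2)%:~R = 1 :> R) by rewrite ks.
    have -> : ((k.1.2 * k.2.2)%:~R = - k.1.2%:~R :> R) by rewrite s1 mulrN1 rmorphN.
    have -> : ((k.2.2 ^+ 2)%:~R = 1 :> R) by rewrite s1.
    rewrite !mul1r mulNr => d3.
    have [e1 e2] := nb _ _ d1; have [e3 e4] := nb _ _ d3.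
    have : `|k.1.2%:~R * row2sq g| < 1 * row2sq g by rewrite mul1r ltr_norml; apply/andP; split; lra.
    rewrite normrM -intr_norm (gtr0_norm (row2sq_gt0 D)).
    rewrite ltr_pM2r ?row2sq_gt0 // -[ltRHS]/(1%:~R) ltr_int; lia.
  by right; case: k r0 p1 q0 s1 {sk ks C' B' Dk d3 d4} => -[? ?] [? ?] /= -> -> -> ->.
Qed.
End reduction.

(** * Sums over SL_2(Z) and unfolding *)

Section orbit_sums.
Context {R : realType}.
Local Notation mR := (measurableTypeR R).
Local Notation leb := (@lebesgue_measure R).
Local Notation M := ((mR * mR) * (mR * mR))%type.
Local Open Scope ereal_scope.

Let pick (F : zmat -> \bar R) (n : nat) : \bar R :=
  if pickle_inv n is Some k then (if k \in sl2z then F k else 0) else 0.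

Let pick_ge0 F n : (forall k, 0 <= F k) -> 0 <= pick F n.
Proof. by move=> F0; rewrite /pick; case: pickle_inv => // k; case: ifP. Qed.

(** A series over an enumeration of all integer matrices, with zero terms off the group, gives
    access to measurability and to the exchange with integrals. *)
Lemma esum_sl2z (F : zmat -> \bar R) : (forall k, 0 <= F k) ->
  \esum_(k in sl2z) F k = \sum_(n <oo) pick F n.
Proof.
move=> F0; rewrite nneseries_esumT; last by move=> n; exact: pick_ge0.
transitivity (\esum_(k in sl2z) pick F (pickle k)).
  by apply: eq_esum => k sk; rewrite /pick pickleK_inv mem_set.
rewrite -(esum_image sl2z pickle (pick F)); last first.
  by move=> x y _ _; exact: (pcan_inj pickleK).
rewrite esum_mkcond; apply: eq_esum => n _; case: ifPn => // nP.
rewrite /pick; have := @pickle_invK zmat n; case E : (pickle_inv n) => [k|//] /= kn.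
case: ifP => // /set_mem sk; case/negP: nP; apply/mem_set.
by exists k.
Qed.

Let mpick (F : zmat -> M -> \bar R) n : (forall k, measurable_fun setT (F k)) ->
  measurable_fun setT (fun g => pick (F^~ g) n).
Proof.
move=> mF; rewrite /pick; case: pickle_inv => [k|]; last exact: mcst.
by case: (k \in sl2z); [exact: mF|exact: mcst].
Qed.

Lemma measurable_esum (F : zmat -> M -> \bar R) : (forall k, measurable_fun setT (F k)) ->
  (forall k g, 0 <= F k g) -> measurable_fun setT (fun g => \esum_(k in sl2z) F k g).
Proof.
move=> mF F0; under eq_fun do rewrite esum_sl2z //.
apply: (@ge0_emeasurable_sum _ M R setT (fun n g => pick (F^~ g) n) xpredT).
- by move=> n g _ _; exact: pick_ge0.
- by move=> n _; exact: (mpick n mF).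
Qed.

Lemma haar_esum (F : zmat -> M -> \bar R) : (forall k, measurable_fun setT (F k)) ->
  (forall k g, 0 <= F k g) ->
  haar (fun g => \esum_(k in sl2z) F k g) = \esum_(k in sl2z) haar (F k).
Proof.
move=> mF F0; rewrite esum_sl2z; last by move=> k; exact: integral_ge0.
under [in LHS]eq_fun do rewrite esum_sl2z //.
rewrite /haar.
have mF' n := mcomp (mpick n mF) measurable_haar_coord.
rewrite (integral_nneseries _ _ mF') //; last by move=> n g _; exact: pick_ge0.
apply: eq_eseriesr => n _; rewrite /pick; case: pickle_inv => [k|].
  by case: ifP => // _; rewrite integral0.
by rewrite integral0.
Qed.

Lemma esum_le_size (F : zmat -> \bar R) (s : seq zmat) :
  (forall k, 0 <= F k <= 1) -> (forall k, sl2z k -> F k != 0 -> k \in s) ->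
  \esum_(k in sl2z) F k <= (size s)%:R%:E.
Proof.
move=> F01 Fs; pose G k : \bar R := if k \in [set` s] then 1 else 0.
apply: (@le_trans _ _ (\esum_(k in setT) G k)).
  rewrite esum_mkcond; apply: le_esum => k _; rewrite /G.
  case: ifPn => [/set_mem sk|_]; last by case: ifP.
  case: ifPn => [_|ks]; first by case/andP: (F01 k).
  case: (eqVneq (F k) 0) => [->//|/(Fs _ sk) kk].
  by case/negP: ks; apply/mem_set.
elim: s @G {Fs} => [|x s IH] G.
  by rewrite (eq_esum (b := fun=> 0)) ?esum1 // => k _; rewrite /G; case: ifP => // /set_mem.
apply: (@le_trans _ _ (\esum_(k in setT) ((if k \in [set x] then 1 else 0) +
                                         (if k \in [set` s] then 1 else 0)))).
  apply: le_esum => k _; rewrite /G; case: ifPn => [/set_mem /=|_]; last first.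
    by apply: adde_ge0; case: ifP.
  rewrite inE => /orP[/eqP ->|ks].
    by rewrite mem_set // leeDl //; case: ifP.
  by rewrite (mem_set (A := [set` s]) ks) leeDr //; case: ifP.
rewrite esumD; [|by move=> k _; case: ifP..].
have -> : ((size (x :: s))%:R)%:E = 1 + ((size s)%:R)%:E :> \bar R by rewrite -EFinD /= -natr1 addrC.
by rewrite -[X in X + _]esum_mkcond esum_set1 //; apply: leeD2l; exact: IH.
Qed.

Lemma esum_ge2 (F : zmat -> \bar R) (k : zmat) :
  (forall l, 0 <= F l) -> sl2z k -> 1 <= F k -> 1 <= F (zopp k) ->
  2%:E <= \esum_(l in sl2z) F l.
Proof.
move=> F0 sk k1 k2; apply: esum_ge; exists ([set k] `|` [set zopp k]).
  split; first by rewrite finite_setU; split; exact: finite_set1.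
  by move=> l [->|->] //; exact: sl2z_opp.
have kk : k != zopp k.
  apply/eqP => -[] E; move: sk; rewrite /sl2z /zdet /= => sk.
  by case: k E sk {k1 k2} => -[a b] [c d] /= [] ? ? ? ?; nia.
rewrite fsbigU //=; last by move=> x [-> /= kE]; case/eqP: kk.
by rewrite !fsbig_set1 (_ : 2%:E = 1 + 1) ?leeD // -EFinD.
Qed.

Lemma esumZl_sl2z (c : R) (F : zmat -> \bar R) : (forall k, 0 <= F k) -> (0 <= c)%R ->
  \esum_(k in sl2z) (c%:E * F k) = c%:E * \esum_(k in sl2z) F k.
Proof.
move=> F0 c0; rewrite !esum_sl2z //; last by move=> k; exact: mule_ge0.
rewrite -nneseriesZl => [|n _]; last exact: pick_ge0.
apply: eq_eseriesr => n _; rewrite /pick; case: pickle_inv => [k|]; last by rewrite mule0.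
by case: ifP; rewrite ?mule0.
Qed.

Lemma haarZl (c : R) (f : M -> \bar R) : measurable_fun setT f -> (forall g, 0 <= f g) ->
  (0 <= c)%R -> haar (fun g => c%:E * f g) = c%:E * haar f.
Proof.
move=> mf f0 c0; rewrite /haar ge0_integralZl //; last exact: (mcomp mf measurable_haar_coord).
Qed.

Lemma le_haar (f g : M -> \bar R) : measurable_fun setT f -> measurable_fun setT g ->
  (forall h, 0 <= f h) -> (forall h, 0 <= g h) ->
  (forall h, detm h = 1%R -> f h <= g h) -> haar f <= haar g.
Proof.
move=> mf mg f0 g0 fg.
have mdet : measurable_fun setT (fun h : M => detm h == 1%R).
  by apply: measurable_fun_eqr; rewrite /detm; mfun.
pose cut (f : M -> \bar R) h := if detm h == 1%R then f h else 0.
have mcut f' : measurable_fun setT f' -> measurable_fun setT (cut f').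
  by move=> mf'; apply: measurable_fun_ifT => //; exact: mcst.
have cut0 f' : (forall h, 0 <= f' h) -> forall h, 0 <= cut f' h.
  by move=> f'0 h; rewrite /cut; case: ifP.
have cutE f' : measurable_fun setT f' -> (forall h, 0 <= f' h) -> haar f' = haar (cut f').
  move=> mf' f'0; apply: eq_haar => //; [exact: mcut|exact: cut0|].
  by move=> h Dh; rewrite /cut Dh eqxx.
have m1 := mcomp (mcut _ mf) measurable_haar_coord.
have m2 := mcomp (mcut _ mg) measurable_haar_coord.
rewrite (cutE f) // (cutE g) //; apply: ge0_le_integral => //.
- by move=> p _; exact: cut0.
- by move=> p _; rewrite /cut; case: eqP => // /fg.
Qed.

(* Unfolding: both sides equal the integral of h over a fundamental domain. *)
Lemma haar_compare (c1 c2 : R) (h u v : M -> R) :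
  measurable_fun setT h -> measurable_fun setT u -> measurable_fun setT v ->
  (forall g, 0 <= h g)%R -> (forall g, 0 <= u g)%R -> (forall g, 0 <= v g)%R ->
  (0 <= c1)%R -> (0 <= c2)%R ->
  (forall k g, sl2z k -> detm g = 1%R -> h (mulm (zr k) g) = h g) ->
  (forall g, detm g = 1%R -> c1%:E <= \esum_(k in sl2z) (v (mulm (zr k) g))%:E) ->
  (forall g, detm g = 1%R -> \esum_(k in sl2z) (u (mulm (zr k) g))%:E <= c2%:E) ->
  c1%:E * haar (fun g => (h g * u g)%:E) <= c2%:E * haar (fun g => (h g * v g)%:E).
Proof.
move=> mh mu mv h0 u0 v0 c10 c20 hG cv cu.
have mhu : measurable_fun setT (fun g : M => (h g * u g)%:E) by apply: mE; apply: mM.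
have mhv : measurable_fun setT (fun g : M => (h g * v g)%:E) by apply: mE; apply: mM.
have mk (f : M -> R) k : measurable_fun setT f -> measurable_fun setT (fun g => f (mulm (zr k) g)).
  by move=> mf; exact: (mcomp mf (measurable_mulml _)).
have hu0 g : (0 <= h g * u g)%R by exact: mulr_ge0.
have hv0 g : (0 <= h g * v g)%R by exact: mulr_ge0.
pose F k g := ((h g * u g) * v (mulm (zr k) g))%:E.
pose G k g := ((h g * v g) * u (mulm (zr k) g))%:E.
have mF k : measurable_fun setT (F k) by exact: (mE (mM (mM mh mu) (mk _ k mv))).
have mG k : measurable_fun setT (G k) by exact: (mE (mM (mM mh mv) (mk _ k mu))).
have F0 k g : 0 <= F k g by rewrite lee_fin mulr_ge0.
have G0 k g : 0 <= G k g by rewrite lee_fin mulr_ge0.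
rewrite -haarZl // -[leRHS]haarZl //.
have mc (c : R) (f : M -> \bar R) : measurable_fun setT f -> measurable_fun setT (fun g => c%:E * f g).
  by move=> mf; apply: mMe mf; exact: mcst.
apply: (@le_trans _ _ (haar (fun g => \esum_(k in sl2z) F k g))).
  have E0 g : 0 <= \esum_(k in sl2z) F k g by apply: esum_ge0 => k _; exact: F0.
  apply: (le_haar (mc c1 _ mhu) (measurable_esum mF F0) _ E0) => [g|g Dg].
    by rewrite mule_ge0 // lee_fin.
  rewrite /F; under eq_esum do rewrite EFinM.
  have v0' k : 0 <= (v (mulm (zr k) g))%:E by rewrite lee_fin.
  have u0' k : 0 <= (u (mulm (zr k) g))%:E by rewrite lee_fin.
  by rewrite esumZl_sl2z// muleC; apply: lee_wpmul2l; [rewrite lee_fin|exact: cv].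
rewrite haar_esum //.
have mg k := mcomp (mF k) (measurable_mulml (zr (zinv k))).
(* Replacing [g] by [k^-1 g] in each term moves the translate from [v] to [u], the function [h]
   being invariant. *)
have -> : \esum_(k in sl2z) haar (F k) = \esum_(k in sl2z) haar (G (zinv k)).
  apply: eq_esum => k sk.
  have Dk : detm (zr (zinv k) : mat2 R) = 1%R by rewrite detm_zr //; exact: sl2z_inv.
  rewrite -(haar_mull Dk (mF k) (F0 k)).
  apply: (eq_haar (mg k) (mG (zinv k)) (fun g => F0 _ _) (G0 _)).
  move=> g Dg; rewrite /F /G hG //; last exact: sl2z_inv.
  rewrite mulmA zr_inv mulmV ?detm_zr // mul1m; congr EFin; ring.
rewrite -(reindex_esum sl2z sl2z zinv (fun k => haar (G k))); last first.
  split; first by move=> k; exact: sl2z_inv.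
  - by move=> k l _ _ /(congr1 zinv); rewrite !zinvK.
  - by move=> k sk; exists (zinv k); [exact: sl2z_inv|rewrite zinvK].
have E0 g : 0 <= \esum_(k in sl2z) G k g by apply: esum_ge0 => k _; exact: G0.
rewrite -haar_esum //; apply: (le_haar (measurable_esum mG G0) (mc c2 _ mhv) E0) => [g|g Dg].
  by rewrite mule_ge0 // lee_fin.
rewrite /G; under eq_esum do rewrite EFinM.
have v0' k : 0 <= (v (mulm (zr k) g))%:E by rewrite lee_fin.
  have u0' k : 0 <= (u (mulm (zr k) g))%:E by rewrite lee_fin.
  by rewrite esumZl_sl2z// [leRHS]muleC; apply: lee_wpmul2l; [rewrite lee_fin|exact: cu].
Qed.
End orbit_sums.

(** * Integration over a fundamental domain *)

Section fundamental.
Context {R : realType}.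
Local Notation mR := (measurableTypeR R).
Local Notation leb := (@lebesgue_measure R).
Local Notation M := ((mR * mR) * (mR * mR))%type.
Implicit Types (g : mat2 R) (h : M -> R).
Local Open Scope ereal_scope.

Lemma measurable_row2sq : measurable_fun setT (row2sq : M -> R).
Proof. rewrite /row2sq; mfun. Qed.

Lemma measurable_row1sq : measurable_fun setT (row1sq : M -> R).
Proof. rewrite /row1sq; mfun. Qed.

Lemma measurable_rowdot : measurable_fun setT (rowdot : M -> R).
Proof. rewrite /rowdot; mfun. Qed.

Let m2dot : measurable_fun setT (fun g : M => 2 * `|rowdot g|)%R.
Proof. by apply: mM; [exact: mcst|apply: mnorm; exact: measurable_rowdot]. Qed.

Lemma measurable_reduced : measurable_fun setT (reduced : M -> bool).
Proof.
apply: measurable_and.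
- exact: measurable_fun_ler m2dot measurable_row2sq.
- exact: measurable_fun_ler measurable_row2sq measurable_row1sq.
Qed.

Lemma measurable_sreduced : measurable_fun setT (sreduced : M -> bool).
Proof.
apply: measurable_and.
- exact: measurable_fun_ltr m2dot measurable_row2sq.
- exact: measurable_fun_ltr measurable_row2sq measurable_row1sq.
Qed.

Lemma measurable_bool (b : M -> bool) : measurable_fun setT b ->
  measurable_fun setT (fun g => (b g)%:R : R).
Proof.
move=> mb; rewrite (_ : (fun g => _) = fun g => if b g then 1%R else 0%R : R).
  by apply: measurable_fun_ifT => //; exact: mcst.
by apply/funext => g; case: (b g).
Qed.

Lemma reduced_opp g : reduced (oppm g) = reduced g.
Proof. by rewrite /reduced /rowdot /row1sq /row2sq /oppm /= !mulrNN !sqrrN. Qed.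

Lemma mulm_oppl g k : mulm (oppm g) k = oppm (mulm g k).
Proof. by rewrite /mulm /oppm /=; congr ((_, _), (_, _)); ring. Qed.

Lemma esum_reduced g : detm g = 1%R ->
  2%:E <= \esum_(k in sl2z) ((reduced (mulm (zr k) g))%:R : R)%:E.
Proof.
move=> Dg; have [k sk rk] := reduction Dg.
have e0 l : 0 <= ((reduced (mulm (zr l) g))%:R : R)%:E by rewrite lee_fin.
apply: (esum_ge2 e0 sk).
  by rewrite /= rk.
by rewrite /= zr_opp mulm_oppl reduced_opp rk.
Qed.

Lemma esum_sreduced g : detm g = 1%R ->
  \esum_(k in sl2z) ((sreduced (mulm (zr k) g))%:R : R)%:E <= 2%:E.
Proof.
move=> Dg.
have [[k0 [sk0 rk0]]|no] := pselect (exists k, sl2z k /\ sreduced (mulm (zr k) g)); last first.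
  rewrite esum1 ?lee_fin // => k sk; case E : sreduced => //.
  by case: no; exists k.
apply: (@le_trans _ _ ((size [:: k0; zopp k0])%:R%:E)); last by rewrite lee_fin.
apply: esum_le_size => [k|k sk]; first by case: sreduced; rewrite !lee_fin ?lexx ler01.
case E : sreduced; last by rewrite eqxx.
move=> _.
have Dk0 : detm (mulm (zr k0) g) = 1%R by rewrite detm_mul detm_zr // Dg mulr1.
have sl : sl2z (zmul k (zinv k0)) by apply: sl2z_mul => //; exact: sl2z_inv.
have El : mulm (zr (zmul k (zinv k0))) (mulm (zr k0) g) = mulm (zr k) g.
  by rewrite mulmA -zr_mul zmulKV.
have := sreduced_unique Dk0 sl rk0; rewrite El => /(_ E) [] kE.
- have := zmulKV k sk0; rewrite kE => <-; rewrite inE; apply/orP; left; apply/eqP.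
  by case: (k0) => -[? ?] [? ?]; rewrite /zmul /= !mul1r !mul0r !addr0 !add0r.
- have := zmulKV k sk0; rewrite kE => <-; rewrite !inE; apply/orP; right; apply/eqP.
  by case: (k0) => -[? ?] [? ?]; rewrite /zmul /zopp /= !mulN1r !mul0r !addr0 !add0r.
Qed.

Definition ginv h := forall k g, sl2z k -> detm g = 1%R -> h (mulm (zr k) g) = h g.

(* Twice the integral over a fundamental domain of SL_2(Z). *)
Definition gint h : \bar R := haar (fun g => (h g * (reduced g)%:R)%:E).

(** The boundary of the domain is negligible: for fixed [c] and [d] it consists of at most four
    values of [x], because [rowdot] is affine in [x] and its square determines [row1sq]. *)
Lemma gint_sreduced h : measurable_fun setT h -> (forall g, 0 <= h g)%R ->
  gint h = haar (fun g => (h g * (sreduced g)%:R)%:E).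
Proof.
move=> mh h0; rewrite /gint.
have mr := mE (mM mh (measurable_bool measurable_reduced)).
have ms := mE (mM mh (measurable_bool measurable_sreduced)).
have p1 g : 0 <= (h g * (reduced g)%:R)%:E by rewrite lee_fin mulr_ge0.
have p2 g : 0 <= (h g * (sreduced g)%:R)%:E by rewrite lee_fin mulr_ge0.
rewrite (haar_dcx mr p1) (haar_dcx ms p2).
apply: (@eq_integral_neq _ 0%R) => [|d d0].
  have mF3 : measurable_fun setT (fun p : mR * mR * mR => ((h (haar_coord (p.2, (p.1.2, p.1.1))) * (reduced (haar_coord (p.2, (p.1.2, p.1.1))))%:R)%:E)).
    by apply: (mcomp mr); rewrite /haar_coord; mfun.
  have mF2 := measurable_fun_fubini_tonelli_F (m2 := leb) _ mF3 (fun p => p1 _).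
  exact: (measurable_fun_fubini_tonelli_F (m2 := leb) _ mF2 (fun p => integral_ge0 _ (fun x _ => p1 _))).
apply: eq_integral => c _.
have mc (b : M -> bool) : measurable_fun setT (fun g => (h g * (b g)%:R)%:E) ->
    measurable_fun setT (fun x : mR => (h (haar_coord (x, (c, d))) * (b (haar_coord (x, (c, d))))%:R)%:E).
  by move=> mb; apply: (mcomp mb); rewrite /haar_coord; mfun.
pose S := (c ^+ 2 + d ^+ 2)%R.
have S0 : S != 0%R by rewrite gt_eqF // ltr_wpDl ?sqr_ge0 // exprn_even_gt0.
pose pt (t : R) : R := ((t - c / d) / S)%R.
pose D := Num.sqrt ((c / d) ^+ 2 - S * (d ^- 2 - S)).
pose N : set mR := [set pt (S / 2)%R] `|` [set pt (- (S / 2))%R] `|` [set pt D] `|` [set pt (- D)%R].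
apply: ge0_ae_eq_integral => //; [exact: mc|exact: mc|].
exists N; split.
- by do 3 apply: measurableU => //.
- apply: countable_lebesgue_measure0; apply: finite_set_countable.
  by rewrite !finite_setU; do !split; exact: finite_set1.
move=> x /= /not_implyP[_ xN].
have E1 : rowdot (haar_coord (x, (c, d))) = (c / d + x * S)%R.
  by rewrite /rowdot /haar_coord /S /=; field.
have E2 : row2sq (haar_coord (x, (c, d))) = S by [].
have inv t : (c / d + x * S = t)%R -> x = pt t.
  by move=> <-; rewrite /pt addrAC subrr add0r mulfK.
have [e1|n1] := eqVneq (2 * `|c / d + x * S|)%R S.
  have : (c / d + x * S = S / 2 \/ c / d + x * S = - (S / 2))%R.
    by case: (ler0P (c / d + x * S)%R) e1 => _ e1; [right|left]; lra.
  by case=> /inv; [left; left; left|left; left; right].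
have [e2|n2] := eqVneq (row1sq (haar_coord (x, (c, d)))) S.
  have : ((c / d + x * S) ^+ 2 = D ^+ 2)%R.
    have e2' : (S * (d ^- 2 - row1sq (haar_coord (x, (c, d)))) = S * (d ^- 2 - S))%R by rewrite e2.
    have sq : ((c / d + x * S) ^+ 2 = (c / d) ^+ 2 - S * (d ^- 2 - S))%R.
      rewrite -[X in (_ - X)%R]e2' /row1sq /haar_coord /S /=; field.
      exact: d0.
    by rewrite sqr_sqrtr -?sq // sqr_ge0.
  by move/eqP; rewrite eqf_sqr => /orP[] /eqP /inv; [left; right|right].
case: xN; rewrite /reduced /sreduced E1 E2 !le_eqVlt (negbTE n1) eq_sym (negbTE n2) //.
Qed.

(** Unfolding compares the fundamental domain with a right translate of it. The bounds 2 of
    [esum_reduced] and [esum_sreduced], due to an element and its opposite, cancel; the reverse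
    inequality is the same one for the inverse of [k]. *)
Lemma gint_mulr (k : mat2 R) h : detm k = 1%R -> measurable_fun setT h ->
  (forall g, 0 <= h g)%R -> ginv h -> gint (fun g => h (mulm g k)) = gint h.
Proof.
have le (l : mat2 R) (f : M -> R) : detm l = 1%R -> measurable_fun setT f ->
    (forall g, 0 <= f g)%R -> ginv f -> gint (fun g => f (mulm g l)) <= gint f.
  move=> Dl mf f0 fG.
  have Dl' : detm (invm l) = 1%R by rewrite detm_inv.
  rewrite gint_sreduced //; last exact: (mcomp mf (measurable_mulmr l)).
  have mu : measurable_fun setT (fun g : M => (sreduced (mulm g (invm l)))%:R : R).
    exact: (mcomp (measurable_bool measurable_sreduced) (measurable_mulmr (invm l))).
  have mv := measurable_bool measurable_reduced.
  have mfs := mE (mM (mcomp mf (measurable_mulmr l)) (measurable_bool measurable_sreduced)).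
  rewrite -(haar_mulr Dl' mfs); last by move=> g; rewrite lee_fin mulr_ge0.
  have -> : haar (fun g : M => (f (mulm (mulm g (invm l)) l) * (sreduced (mulm g (invm l)))%:R)%:E) =
      haar (fun g : M => (f g * (sreduced (mulm g (invm l)))%:R)%:E).
    by congr haar; apply/funext => g; rewrite -mulmA mulVm // mulm1.
  have c2 : (0 <= 2 :> R)%R by [].
  have := @haar_compare _ 2 2 f _ _ mf mu mv f0 (fun g => ler0n _ _) (fun g => ler0n _ _) c2 c2 fG.
  have e1 g : detm g = 1%R -> 2%:E <= \esum_(j in sl2z) ((reduced (mulm (zr j) g))%:R : R)%:E.
    exact: esum_reduced.
  have e2 g : detm g = 1%R -> \esum_(j in sl2z) ((sreduced (mulm (mulm (zr j) g) (invm l)))%:R : R)%:E <= 2%:E.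
    move=> Dg; under eq_esum do rewrite -mulmA.
    by apply: esum_sreduced; rewrite detm_mul Dg Dl' mulr1.
  move=> /(_ e1 e2); rewrite lee_pmul2l //.
move=> Dk mh h0 hG; apply/eqP; rewrite eq_le le //=.
have Dk' : detm (invm k) = 1%R by rewrite detm_inv.
have := le (invm k) (fun g => h (mulm g k)) Dk' (mcomp mh (measurable_mulmr k)) (fun g => h0 _).
have -> : gint (fun g => h (mulm (mulm g (invm k)) k)) = gint h.
  by congr gint; apply/funext => g; rewrite -mulmA mulVm // mulm1.
apply=> l g sl Dg; rewrite -mulmA hG // detm_mul Dg Dk mulr1 //.
Qed.

Definition mbound (C : R) g : bool :=
  [&& `|g.1.1| <= C, `|g.1.2| <= C, `|g.2.1| <= C & `|g.2.2| <= C]%R.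

Lemma measurable_mbound C : measurable_fun setT (mbound C : M -> bool).
Proof.
have m (f : M -> R) : measurable_fun setT f -> measurable_fun setT (fun g => `|f g| <= C)%R.
  by move=> mf; apply: measurable_fun_ler; [exact: mnorm|exact: mcst].
rewrite /mbound; do ! apply: measurable_and; apply: m; mfun.
Qed.

Lemma mbound_mul (C1 C2 : R) g k : mbound C1 g -> mbound C2 k -> mbound (2 * C1 * C2) (mulm g k).
Proof.
move=> /and4P[a1 b1 c1 d1] /and4P[a2 b2 c2 d2].
have key (x y z t : R) : (`|x| <= C1 -> `|y| <= C1 -> `|z| <= C2 -> `|t| <= C2 ->
    `|x * z + y * t| <= 2 * C1 * C2)%R.
  move=> hx hy hz ht; apply: le_trans (ler_normD _ _) _; rewrite !normrM.
  have -> : (2 * C1 * C2 = C1 * C2 + C1 * C2)%R by ring.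
  by apply: lerD; apply: ler_pM.
by apply/and4P; split; exact: key.
Qed.

Lemma mbound_inv (C : R) g : mbound C g -> mbound C (invm g).
Proof. by move=> /and4P[a1 b1 c1 d1]; apply/and4P; split; rewrite /= ?normrN. Qed.

Lemma mbound_zr (C : R) (B : nat) (k : zmat) : (C < B%:R + 1)%R -> mbound C (zr k) -> k \in zbox B.
Proof.
have key (x : int) : (C < B%:R + 1 -> `|x%:~R| <= C -> `|x| <= B%:Z)%R.
  move=> CB xC; have : (`|x|%:~R < (B%:Z + 1)%:~R :> R)%R.
    by rewrite rmorphD /= intr_norm (le_lt_trans xC).
  by rewrite ltr_int ltzD1.
by move=> CB /and4P[a1 b1 c1 d1]; apply: mem_zbox; exact: key.
Qed.

(* A bounded part of SL_2(R) is covered finitely often. *)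
Lemma gint_cover (C : R) : exists2 K : R, (0 < K)%R & forall h, measurable_fun setT h ->
  (forall g, 0 <= h g)%R -> ginv h ->
  haar (fun g => (h g * (mbound C g)%:R)%:E) <= K%:E * gint h.
Proof.
have [B BC] : exists B : nat, (2 * C * C < B%:R + 1)%R.
  exists (Num.bound `|2 * C * C|%R); rewrite (le_lt_trans (ler_norm _)) //.
  by rewrite (lt_trans (archi_boundP (normr_ge0 _))) // ltrDl.
exists ((size (zbox B)).+1%:R / 2)%R => [|h mh h0 hG]; first by rewrite divr_gt0.
have mu := measurable_bool (measurable_mbound C).
have mv := measurable_bool measurable_reduced.
have c2 : (0 <= 2 :> R)%R by [].
have c3 : (0 <= (size (zbox B)).+1%:R :> R)%R by [].
have e1 g : detm g = 1%R -> 2%:E <= \esum_(j in sl2z) ((reduced (mulm (zr j) g))%:R : R)%:E.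
  exact: esum_reduced.
have e2 g : detm g = 1%R -> \esum_(j in sl2z) ((mbound C (mulm (zr j) g))%:R : R)%:E <= ((size (zbox B)).+1%:R)%:E.
  move=> Dg.
  have [[k0 [sk0 rk0]]|no] := pselect (exists k, sl2z k /\ mbound C (mulm (zr k) g)); last first.
    rewrite esum1 ?lee_fin // => k sk; case E : mbound => //.
    by case: no; exists k.
  (* If [k g] and [k0 g] both have entries at most [C], then [k k0^-1] has entries at most [2 C C],
     which leaves finitely many [k]. *)
  pose s := [seq zmul k k0 | k <- zbox B].
  apply: (@le_trans _ _ ((size s)%:R%:E)); last by rewrite size_map lee_fin ler_nat.
  apply: esum_le_size => [k|k sk]; first by case: mbound; rewrite !lee_fin ?lexx ler01.
  case E : mbound; last by rewrite eqxx.
  move=> _; apply/mapP; exists (zmul k (zinv k0)); last by rewrite zmulKV.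
  apply: (mbound_zr BC).
  have Dk0 : detm (mulm (zr k0) g) = 1%R by rewrite detm_mul detm_zr // Dg mulr1.
  have -> : zr (zmul k (zinv k0)) = mulm (mulm (zr k) g) (invm (mulm (zr k0) g)).
    have -> : invm (mulm (zr k0) g) = mulm (invm g) (invm (zr k0)).
      by rewrite /invm /mulm /=; congr ((_, _), (_, _)); ring.
    by rewrite mulmA -[mulm (mulm _ g) _]mulmA mulmV // mulm1 zr_mul zr_inv.
  by apply: mbound_mul => //; exact: mbound_inv.
have := @haar_compare _ 2 _ h _ _ mh mu mv h0 (fun g => ler0n _ _) (fun g => ler0n _ _) c2 c3 hG e1 e2.
rewrite -/(gint h) => le.
have := lee_wpmul2l (x := (2^-1)%:E) _ le; rewrite !muleA -!EFinM mulVf // mul1e.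
by rewrite [(2^-1 * _)%R]mulrC; apply; rewrite lee_fin.
Qed.
End fundamental.

Section integral_tools.
Context d (T : measurableType d) (R : realType) (mu : {measure set T -> \bar R}).
Local Open Scope ereal_scope.

Lemma le_int (f g : T -> \bar R) : (forall x, 0 <= f x) -> (forall x, f x <= g x) ->
  \int[mu]_x f x <= \int[mu]_x g x.
Proof.
move=> f0 fg; have g0 x : 0 <= g x by exact: le_trans (fg x).
rewrite !ge0_integralTE //; apply: le_ereal_sup => _ [h /= hf <-].
by exists h => // x; apply: le_trans (hf x) _.
Qed.

Lemma int_scale (k : R) (f : T -> \bar R) : measurable_fun setT f ->
  (forall x, 0 <= f x) -> (0 <= k)%R -> \int[mu]_x (k%:E * f x) = k%:E * \int[mu]_x f x.
Proof. by move=> mf f0 k0; rewrite ge0_integralZl // => [x _|]; rewrite ?lee_fin. Qed.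

Lemma int_add (f g : T -> \bar R) : measurable_fun setT f -> measurable_fun setT g ->
  (forall x, 0 <= f x) -> (forall x, 0 <= g x) ->
  \int[mu]_x (f x + g x) = \int[mu]_x f x + \int[mu]_x g x.
Proof. by move=> mf mg f0 g0; rewrite ge0_integralD. Qed.
End integral_tools.

(** * Volume of the cusp *)

Section volumes.
Context {R : realType}.
Local Notation mR := (measurableTypeR R).
Local Notation leb := (@lebesgue_measure R).
Local Notation M := ((mR * mR) * (mR * mR))%type.
Local Open Scope ereal_scope.

Lemma measurable_haar_c (f : M -> \bar R) : measurable_fun setT f -> (forall g, 0 <= f g) ->
  measurable_fun setT (fun c : mR => \int[leb]_d \int[leb]_x f (haar_coord (x, (c, d)))).
Proof.
move=> mf f0.
have mF3 : measurable_fun setT (fun p : mR * mR * mR => f (haar_coord (p.2, (p.1.1, p.1.2)))).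
  by apply: (mcomp mf); rewrite /haar_coord; mfun.
have mF2 := measurable_fun_fubini_tonelli_F (m2 := leb) _ mF3 (fun p => f0 _).
exact: (measurable_fun_fubini_tonelli_F (m2 := leb) _ mF2 (fun p => integral_ge0 _ (fun x _ => f0 _))).
Qed.

Definition box2 (s : R) (g : M) : bool := ((`|g.2.1| <= s) && (`|g.2.2| <= s))%R.

Lemma measurable_box2 s : measurable_fun setT (box2 s).
Proof.
have m (f : M -> R) : measurable_fun setT f -> measurable_fun setT (fun g => `|f g| <= s)%R.
  by move=> mf; apply: measurable_fun_ler; [exact: mnorm|exact: mcst].
by apply: measurable_and; apply: m; mfun.
Qed.

Let int_itv (a b : R) : (a <= b)%R ->
  \int[leb]_x ((\1_(`[a, b]%classic : set mR) x)%:E) = (b - a)%:E.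
Proof.
move=> ab; rewrite integral_indic // setIT.
rewrite [LHS](_ : _ = lebesgue_measure (`[a, b]%classic : set R)) // lebesgue_measure_itv /= lte_fin.
move: ab; rewrite le_eqVlt => /orP[/eqP ->|->]; last by rewrite EFinB.
by rewrite ltxx subrr.
Qed.

(** For fixed [c] and [d] the bound on [rowdot] confines [x] to an interval of length 1, so the
    volume is at most the area [(2 s)^2] of the box of lower rows. *)
Lemma cusp_volume (s : R) : (0 <= s)%R ->
  haar (fun g : M => ((reduced g && box2 s g)%:R : R)%:E) <= (4 * s ^+ 2)%:E.
Proof.
move=> s0.
have mb : measurable_fun setT (fun g : M => (reduced g && box2 s g)).
  by apply: measurable_and; [exact: measurable_reduced|exact: measurable_box2].
have mf := mE (measurable_bool mb).
have f0 (g : M) : 0 <= ((reduced g && box2 s g)%:R : R)%:E by rewrite lee_fin.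
pose A : set mR := `[(- s)%R, s]%classic.
pose J (c : mR) := \int[leb]_d ((\1_A c)%:E * (\1_A d)%:E).
have mA : measurable_fun setT (fun x : mR => (\1_A x : R)%:E).
  by apply: mE; apply: measurable_indic; exact: measurable_itv.
have A0 (x : mR) : 0 <= (\1_A x : R)%:E by rewrite lee_fin.
have JE c : J c = (2 * s)%:E * (\1_A c)%:E.
  rewrite /J int_scale // int_itv; last by rewrite ge0_cp.
  by rewrite muleC; congr (_%:E * _); ring.
apply: (@le_trans _ _ (\int[leb]_c J c)); last first.
  under eq_integral do rewrite JE.
  rewrite int_scale //; last by rewrite mulr_ge0.
  rewrite int_itv; last by rewrite ge0_cp.
  by rewrite -EFinM lee_fin le_eqVlt; apply/orP; left; apply/eqP; ring.
rewrite haar_cdx //.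
rewrite (@eq_integral_neq _ 0%R _ (fun c => if c == 0%R then 0 else
    \int[leb]_d \int[leb]_x ((reduced (haar_coord (x, (c, d))) && box2 s (haar_coord (x, (c, d))))%:R : R)%:E)).
- apply: le_int => c; first by case: ifP => // _; do 2 (apply: integral_ge0 => ? _).
  case: eqVneq => [->|c0]; first by apply: integral_ge0 => d _; rewrite mule_ge0.
  apply: le_int => d; first by apply: integral_ge0.
  have [bx|nb] := boolP (box2 s (haar_coord (0%R, (c, d)))); last first.
    have nb' x : box2 s (haar_coord (x, (c, d))) = false by exact/negbTE.
    under eq_integral do rewrite nb' andbF.
    by rewrite integral0 mule_ge0.
  have -> : (\1_A c)%:E * (\1_A d)%:E = 1 :> \bar R.
    move: bx => /andP[/= cs ds].
    have cA : c \in A by apply/mem_set; rewrite /A /= in_itv /= -ler_norml.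
    have dA : d \in A by apply/mem_set; rewrite /A /= in_itv /= -ler_norml.
    by rewrite !indicE cA dA mule1.
  pose S := (c ^+ 2 + d ^+ 2)%R.
  have S0 : (0 < S)%R by rewrite ltr_pwDl ?sqr_ge0 // exprn_even_gt0.
  pose lo := ((- (S / 2) - c / d) / S)%R; pose hi := ((S / 2 - c / d) / S)%R.
  have hl : (hi - lo = 1)%R.
    by rewrite /hi /lo; move: (c / d)%R S0 => u S0; field; rewrite gt_eqF.
  rewrite [leRHS](_ : _ = (hi - lo)%:E); last by rewrite hl.
  rewrite -int_itv; last by rewrite -subr_ge0 hl.
  apply: le_int => // x; rewrite lee_fin indicE ler_nat.
  case: (boolP (reduced _ && _)) => // /andP[/andP[r1 _] _].
  rewrite mem_set //= in_itv /=.
  have E1 : rowdot (haar_coord (x, (c, d))) = (c / d + x * S)%R.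
    rewrite /rowdot /haar_coord /S /=.
    by have [->|d0] := eqVneq d 0%R; [rewrite invr0; ring|field].
  move: r1; rewrite E1 /row2sq /= -/S => r1.
  have r2 : (`|c / d + x * S| <= S / 2)%R by rewrite ler_pdivlMr // mulrC.
  move: r2; rewrite ler_norml => /andP[u1 u2].
  by apply/andP; split; [rewrite ler_pdivrMr //|rewrite ler_pdivlMr //]; move: (c / d)%R u1 u2 => u u1 u2; lra.
- exact: (measurable_haar_c mf f0).
- by move=> c /negbTE ->.
Qed.

Lemma reduced_row2 (g : mat2 R) : detm g = 1%R -> reduced g -> (row2sq g ^+ 2 <= 4 / 3)%R.
Proof.
move=> D /andP[r1 r2]; have := row_identity D; have S0 := row2sq_gt0 D.
move=> E; have : (rowdot g ^+ 2 <= row2sq g ^+ 2 / 4)%R.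
  rewrite -real_normK ?num_real //; have := normr_ge0 (rowdot g); nra.
nra.
Qed.
End volumes.

(** * Bounded automorphic functions and their L^2 norm *)

Section test_functions.
Context {R : realType}.
Local Notation mR := (measurableTypeR R).
Local Notation leb := (@lebesgue_measure R).
Local Notation M := ((mR * mR) * (mR * mR))%type.
Implicit Types (f h : M -> R) (k g : mat2 R).
Local Open Scope ereal_scope.

(* Functions on SL_2(Z)\SL_2(R). *)
Definition autom h := [/\ measurable_fun setT h, exists B, forall g, (`|h g| <= B)%R & ginv h].

Lemma autom_cst (c : R) : autom (fun=> c).
Proof. by split; [exact: mcst|exists `|c|%R|]. Qed.

Lemma automD f h : autom f -> autom h -> autom (fun g => f g + h g)%R.
Proof.
move=> [mf [B fB] fG] [mh [C hC] hG]; split; first exact: mD.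
  exists (B + C)%R => g; apply: le_trans (ler_normD _ _) _; exact: lerD.
by move=> k g sk Dg; rewrite fG // hG.
Qed.

Lemma automM f h : autom f -> autom h -> autom (fun g => f g * h g)%R.
Proof.
move=> [mf [B fB] fG] [mh [C hC] hG]; split; first exact: mM.
  by exists (B * C)%R => g; rewrite normrM; apply: ler_pM.
by move=> k g sk Dg; rewrite fG // hG.
Qed.

Lemma automZ (c : R) h : autom h -> autom (fun g => c * h g)%R.
Proof. by move=> ah; apply: automM => //; exact: autom_cst. Qed.

Lemma automB f h : autom f -> autom h -> autom (fun g => f g - h g)%R.
Proof.
move=> af ah; have := automD af (automZ (-1) ah).
by congr autom; apply/funext => g; rewrite mulN1r.
Qed.

Lemma autom_norm h : autom h -> autom (fun g => `|h g|)%R.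
Proof.
move=> [mh [C hC] hG]; split; first exact: mnorm.
  by exists C => g; rewrite normr_id.
by move=> k g sk Dg; rewrite hG.
Qed.

Lemma autom_trans k h : detm k = 1%R -> autom h -> autom (fun g => h (mulm g k)).
Proof.
move=> Dk [mh [C hC] hG]; split; first exact: (mcomp mh (measurable_mulmr k)).
  by exists C.
by move=> l g sl Dg; rewrite -mulmA hG // detm_mul Dg Dk mulr1.
Qed.

Lemma autom_sum n (F : nat -> M -> R) : (forall i, autom (F i)) ->
  autom (fun g => \sum_(i < n) F i g)%R.
Proof.
move=> aF; elim: n => [|n IH].
  by have := autom_cst 0%R; congr autom; apply/funext => g; rewrite big_ord0.
have := automD IH (aF n); congr autom; apply/funext => g; by rewrite big_ord_recr.
Qed.

(** Its rules are stated for nonnegative functions, which avoids integrability conditions; signed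
    functions enter through squares and absolute values. *)
Definition aint h : R := fine (gint h).

Lemma le_gint f h : (forall g, 0 <= f g)%R -> measurable_fun setT f -> measurable_fun setT h ->
  (forall g, 0 <= h g)%R -> (forall g, detm g = 1 -> f g <= h g)%R -> gint f <= gint h.
Proof.
move=> f0 mf mh h0 fh; apply: le_haar.
- by apply: mE; apply: mM => //; exact: measurable_bool measurable_reduced.
- by apply: mE; apply: mM => //; exact: measurable_bool measurable_reduced.
- by move=> g; rewrite lee_fin mulr_ge0.
- by move=> g; rewrite lee_fin mulr_ge0.
- by move=> g Dg; rewrite lee_fin ler_wpM2r // fh.
Qed.

Lemma gintZ (c : R) h : (0 <= c)%R -> measurable_fun setT h -> (forall g, 0 <= h g)%R ->
  gint (fun g => c * h g)%R = c%:E * gint h.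
Proof.
move=> c0 mh h0; rewrite /gint -haarZl //.
- by congr haar; apply/funext => g; rewrite -EFinM mulrA.
- by apply: mE; apply: mM => //; exact: measurable_bool measurable_reduced.
- by move=> g; rewrite lee_fin mulr_ge0.
Qed.

Lemma gintD f h : measurable_fun setT f -> measurable_fun setT h -> (forall g, 0 <= f g)%R ->
  (forall g, 0 <= h g)%R -> gint (fun g => f g + h g)%R = gint f + gint h.
Proof.
move=> mf mh f0 h0; rewrite /gint /haar -int_add.
- by apply: eq_integral => p _; rewrite -EFinD mulrDl.
- exact: (mcomp (mE (mM mf (measurable_bool measurable_reduced))) measurable_haar_coord).
- exact: (mcomp (mE (mM mh (measurable_bool measurable_reduced))) measurable_haar_coord).
- by move=> p; rewrite lee_fin mulr_ge0.
- by move=> p; rewrite lee_fin mulr_ge0.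
Qed.

Lemma gint_ge0 h : (forall g, 0 <= h g)%R -> 0 <= gint h.
Proof. by move=> h0; apply: integral_ge0 => p _; rewrite lee_fin mulr_ge0. Qed.

Lemma gint1_le : gint (fun=> 1%R : R) <= 16%:E.
Proof.
rewrite (_ : gint _ = haar (fun g : M => ((reduced g)%:R : R)%:E)); last first.
  by congr haar; apply/funext => g; rewrite mul1r.
apply: (@le_trans _ _ (4 * 2 ^+ 2)%:E); last by rewrite lee_fin; lra.
apply: le_trans (cusp_volume _); last by [].
have mb := measurable_bool (@measurable_reduced R).
have mb2 : measurable_fun setT (fun g : M => (reduced g && box2 2 g)).
  by apply: measurable_and; [exact: measurable_reduced|exact: measurable_box2].
have p1 (g : M) : 0 <= ((reduced g)%:R : R)%:E by rewrite lee_fin.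
have p2 (g : M) : 0 <= ((reduced g && box2 2 g)%:R : R)%:E by rewrite lee_fin.
apply: (le_haar (mE mb) (mE (measurable_bool mb2)) p1 p2).
- move=> g Dg; rewrite lee_fin ler_nat.
  case: (boolP (reduced g)) => //= rg.
  have := reduced_row2 Dg rg; have := row2sq_gt0 Dg; rewrite /box2 /row2sq => S0 S2.
  have c2 := sqr_ge0 g.2.1; have d2 := sqr_ge0 g.2.2.
  have S3 : (g.2.1 ^+ 2 + g.2.2 ^+ 2 <= 4)%R by nra.
  have sq (x : R) : (x ^+ 2 <= 4 -> `|x| <= 2)%R.
    by move=> x4; rewrite -(@ler_pXn2r _ 2) ?nnegrE // real_normK ?num_real //; lra.
  by rewrite !sq //; lra.
Qed.

Lemma gint_fin h : autom h -> (forall g, 0 <= h g)%R -> gint h \is a fin_num.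
Proof.
move=> [mh [B hB] _] h0; rewrite ge0_fin_numE; last exact: gint_ge0.
have B0 : (0 <= B)%R := le_trans (normr_ge0 _) (hB idm).
apply: (@le_lt_trans _ _ (B%:E * 16%:E)); last by rewrite -EFinM ltry.
apply: le_trans (lee_wpmul2l _ gint1_le); last by rewrite lee_fin.
rewrite -(gintZ B0 (mcst _) (fun=> ler01)); apply: le_gint => //.
- by move=> g; rewrite mulr1.
- by move=> g _; rewrite mulr1 (le_trans (ler_norm _)).
Qed.

Lemma aint_ge0 h : (forall g, 0 <= h g)%R -> (0 <= aint h)%R.
Proof. by move=> h0; rewrite fine_ge0 // gint_ge0. Qed.

Lemma EFin_aint h : autom h -> (forall g, 0 <= h g)%R -> (aint h)%:E = gint h.
Proof. by move=> ah h0; rewrite fineK // gint_fin. Qed.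

Lemma le_aint f h : autom f -> autom h -> (forall g, 0 <= f g)%R -> (forall g, 0 <= h g)%R ->
  (forall g, detm g = 1 -> f g <= h g)%R -> (aint f <= aint h)%R.
Proof.
move=> af ah f0 h0 fh; rewrite -lee_fin !EFin_aint //.
by case: af ah => mf _ _ [mh _ _]; exact: le_gint.
Qed.

Lemma aintZ (c : R) h : (0 <= c)%R -> autom h -> (forall g, 0 <= h g)%R ->
  aint (fun g => c * h g)%R = (c * aint h)%R.
Proof.
move=> c0 ah h0; apply: EFin_inj; rewrite EFinM !EFin_aint //; last 2 first.
- exact: automZ.
- by move=> g; rewrite mulr_ge0.
by case: ah => mh _ _; exact: gintZ.
Qed.

Lemma aintD f h : autom f -> autom h -> (forall g, 0 <= f g)%R -> (forall g, 0 <= h g)%R ->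
  aint (fun g => f g + h g)%R = (aint f + aint h)%R.
Proof.
move=> af ah f0 h0; apply: EFin_inj; rewrite EFinD !EFin_aint //; last 2 first.
- exact: automD.
- by move=> g; rewrite addr_ge0.
by case: af ah => mf _ _ [mh _ _]; exact: gintD.
Qed.

Lemma aint_trans k h : detm k = 1%R -> autom h -> (forall g, 0 <= h g)%R ->
  aint (fun g => h (mulm g k)) = aint h.
Proof. by move=> Dk [mh _ hG] h0; rewrite /aint gint_mulr. Qed.

Definition nrm h : R := Num.sqrt (aint (fun g => h g ^+ 2)%R).
Definition vol : R := aint (fun=> 1%R).

Lemma autom_sq h : autom h -> autom (fun g => h g ^+ 2)%R.
Proof. by move=> ah; exact: automM. Qed.

Lemma aint_cst (c : R) : (0 <= c)%R -> aint (fun=> c) = (c * vol)%R.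
Proof.
move=> c0; rewrite -aintZ //; last exact: autom_cst.
by congr aint; apply/funext => g; rewrite mulr1.
Qed.

Lemma vol_ge0 : (0 <= vol)%R. Proof. by apply: aint_ge0. Qed.

Lemma nrm_ge0 h : (0 <= nrm h)%R. Proof. exact: sqrtr_ge0. Qed.

Lemma nrm_sq h : (nrm h ^+ 2 = aint (fun g => h g ^+ 2))%R.
Proof. by rewrite sqr_sqrtr // aint_ge0 // => g; exact: sqr_ge0. Qed.

Lemma nrm_le (B : R) h : (0 <= B)%R -> autom h -> (forall g, detm g = 1%R -> `|h g| <= B)%R ->
  (nrm h <= B * Num.sqrt vol)%R.
Proof.
move=> B0 ah hB; rewrite -(ger0_norm B0) -sqrtr_sqr -sqrtrM ?sqr_ge0 // ler_wsqrtr //.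
rewrite -aint_cst ?sqr_ge0 //; apply: le_aint.
- exact: autom_sq.
- exact: autom_cst.
- by move=> g; exact: sqr_ge0.
- by move=> g; exact: sqr_ge0.
- by move=> g Dg; rewrite -real_normK ?num_real // ler_pXn2r ?nnegrE ?hB.
Qed.

Lemma nrmZ (c : R) h : autom h -> nrm (fun g => c * h g)%R = (`|c| * nrm h)%R.
Proof.
move=> ah; rewrite /nrm -sqrtr_sqr -sqrtrM ?sqr_ge0 // -aintZ ?sqr_ge0 //.
- by congr (Num.sqrt (aint _)); apply/funext => g; rewrite exprMn.
- exact: autom_sq.
- by move=> g; exact: sqr_ge0.
Qed.

Lemma nrm_trans k h : detm k = 1%R -> autom h -> nrm (fun g => h (mulm g k)) = nrm h.
Proof.
move=> Dk ah; rewrite /nrm (aint_trans Dk (autom_sq ah)) // => g; exact: sqr_ge0.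
Qed.

Lemma nrm_parallelogram f h : autom f -> autom h ->
  (nrm (fun g => f g + h g) ^+ 2 + nrm (fun g => f g - h g) ^+ 2 =
   2 * nrm f ^+ 2 + 2 * nrm h ^+ 2)%R.
Proof.
move=> af ah; rewrite !nrm_sq -!aintZ //; try exact: autom_sq; try by move=> g; exact: sqr_ge0.
have s2 (u : M -> R) g : (0 <= u g ^+ 2)%R by exact: sqr_ge0.
have s3 (u : M -> R) g : (0 <= 2 * u g ^+ 2)%R by rewrite mulr_ge0 // sqr_ge0.
rewrite -!aintD //; first by congr aint; apply/funext => g; ring.
- by apply: automZ; exact: autom_sq.
- by apply: automZ; exact: autom_sq.
- by apply: autom_sq; exact: automD.
- by apply: autom_sq; exact: automB.
- by move=> g; exact: sqr_ge0.
- by move=> g; exact: sqr_ge0.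
Qed.

(** The weighted inequality [(f + h)^2 <= (1 + t/s) f^2 + (1 + s/t) h^2] takes the place of
    Cauchy-Schwarz. Here [s] and [t] exceed the two norms by [e / 2], which keeps the weights
    defined. *)
Lemma nrm_triangle f h : autom f -> autom h ->
  (nrm (fun g => f g + h g) <= nrm f + nrm h)%R.
Proof.
move=> af ah; apply/ler_addgt0Pr => e e0.
pose s := (nrm f + e / 2)%R; pose t := (nrm h + e / 2)%R.
have s0 : (0 < s)%R by rewrite ltr_wpDl ?nrm_ge0 // divr_gt0.
have t0 : (0 < t)%R by rewrite ltr_wpDl ?nrm_ge0 // divr_gt0.
rewrite (_ : _ + e = s + t)%R; last by rewrite /s /t; lra.
rewrite -(@ler_pXn2r _ 2) ?nnegrE ?nrm_ge0 //; last by rewrite addr_ge0 // ltW.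
rewrite nrm_sq.
have c1 : (0 <= 1 + t / s)%R by rewrite addr_ge0 // divr_ge0 // ltW.
have c2 : (0 <= 1 + s / t)%R by rewrite addr_ge0 // divr_ge0 // ltW.
have s2 (u : M -> R) g : (0 <= u g ^+ 2)%R by exact: sqr_ge0.
have a1 := automZ (1 + t / s) (autom_sq af).
have a2 := automZ (1 + s / t) (autom_sq ah).
have p1 g : (0 <= (1 + t / s) * f g ^+ 2)%R by rewrite mulr_ge0 // sqr_ge0.
have p2 g : (0 <= (1 + s / t) * h g ^+ 2)%R by rewrite mulr_ge0 // sqr_ge0.
apply: le_trans (le_aint (autom_sq (automD af ah)) (automD a1 a2) _ _ _) _.
- by move=> g; exact: sqr_ge0.
- by move=> g; rewrite addr_ge0.
- move=> g _; rewrite -subr_ge0.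
  rewrite (_ : _ - _ = (t * f g - s * h g) ^+ 2 / (s * t))%R; last first.
    by field; rewrite !gt_eqF.
  by rewrite divr_ge0 ?sqr_ge0 // mulr_ge0 // ltW.
rewrite aintD // !aintZ //; try exact: autom_sq.
rewrite -!nrm_sq (_ : (s + t) ^+ 2 = (1 + t / s) * s ^+ 2 + (1 + s / t) * t ^+ 2)%R; last first.
  by field; rewrite !gt_eqF.
by apply: lerD; rewrite ler_wpM2l // ler_pXn2r ?nnegrE ?nrm_ge0 ?ltW // /s /t; lra.
Qed.

Lemma nrm_sum n (F : nat -> M -> R) (c : R) : (forall i, autom (F i)) ->
  (forall i, nrm (F i) <= c)%R -> (nrm (fun g => \sum_(i < n) F i g) <= n%:R * c)%R.
Proof.
move=> aF Fc; elim: n => [|n IH].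
  rewrite mul0r (_ : (fun g => _) = fun g => 0 * F 0%N g)%R; last first.
    by apply/funext => g; rewrite big_ord0 mul0r.
  by rewrite nrmZ // normr0 mul0r.
rewrite (_ : (fun g => _) = fun g => \sum_(i < n) F i g + F n g)%R; last first.
  by apply/funext => g; rewrite big_ord_recr.
apply: le_trans (nrm_triangle _ (aF n)) _; first exact: autom_sum.
by rewrite -natr1 mulrDl mul1r lerD.
Qed.

Lemma nrmB f h : autom f -> autom h -> nrm (fun g => f g - h g)%R = nrm (fun g => h g - f g)%R.
Proof. by move=> af ah; congr (Num.sqrt (aint _)); apply/funext => g; rewrite -opprB sqrrN. Qed.
End test_functions.

(** * Ergodicity of the horocycle flow *)

Section mautner.
Context {R : realType}.
Local Notation mR := (measurableTypeR R).
Local Notation leb := (@lebesgue_measure R).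
Local Notation M := ((mR * mR) * (mR * mR))%type.
Implicit Types (f h : M -> R) (k g : mat2 R).

Definition nearm (d : R) k : bool :=
  [&& `|k.1.1 - 1| <= d, `|k.1.2| <= d, `|k.2.1| <= d & `|k.2.2 - 1| <= d].

(** Uniform continuity under right translations, which commute with the left action of SL_2(Z). *)
Definition ucont f := forall e : R, 0 < e -> exists2 d : R, 0 < d &
  forall g k, detm g = 1 -> detm k = 1 -> nearm d k -> `|f (mulm g k) - f g| <= e.

Lemma nearm_le (d e : R) k : d <= e -> nearm d k -> nearm e k.
Proof. by move=> de /and4P[h1 h2 h3 h4]; apply/and4P; split; exact: le_trans de. Qed.

Lemma detm_upm (t : R) : detm (upm t) = 1.
Proof. by rewrite /detm /upm /=; ring. Qed.

Lemma detm_lowm (t : R) : detm (lowm t) = 1.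
Proof. by rewrite /detm /lowm /=; ring. Qed.

Lemma detm_diagm (t : R) : t != 0 -> detm (diagm t) = 1.
Proof. by move=> t0; rewrite /detm /diagm /= mulr0 subr0 divff. Qed.

Lemma upm_mul (s t : R) : mulm (upm s) (upm t) = upm (s + t).
Proof. by rewrite /mulm /upm /=; congr ((_, _), (_, _)); ring. Qed.

Lemma nearm_conj_bound (S e : R) k l : detm k = 1 -> mbound S k -> 0 <= e -> nearm e l ->
  nearm (4 * S ^+ 2 * e) (mulm (invm k) (mulm l k)).
Proof.
case: k l => -[a b] [c d] [[p q] [r s]]; rewrite /detm /= => D.
move=> /and4P[/= ha hb hc hd] e0 /and4P[/= h1 h2 h3 h4].
have key (x1 y1 x2 y2 x3 y3 x4 y4 z1 z2 z3 z4 : R) : `|x1| <= S -> `|y1| <= S -> `|x2| <= S -> `|y2| <= S ->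
    `|x3| <= S -> `|y3| <= S -> `|x4| <= S -> `|y4| <= S -> `|z1| <= e -> `|z2| <= e -> `|z3| <= e -> `|z4| <= e ->
    `|x1 * z1 * y1 + x2 * z2 * y2 + x3 * z3 * y3 + x4 * z4 * y4| <= 4 * S ^+ 2 * e.
  move=> *.
  have one (x z y : R) : `|x| <= S -> `|z| <= e -> `|y| <= S -> `|x * z * y| <= S ^+ 2 * e.
    move=> hx hz hy; rewrite !normrM (_ : S ^+ 2 * e = S * e * S); last by ring.
    by apply: ler_pM => //; exact: ler_pM.
  have -> : 4 * S ^+ 2 * e = S ^+ 2 * e + S ^+ 2 * e + S ^+ 2 * e + S ^+ 2 * e by ring.
  by do 3 (apply: le_trans (ler_normD _ _) _; apply: lerD; last exact: one); exact: one.
have nN (x : R) : `|x| <= S -> `|- x| <= S by rewrite normrN.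
apply/and4P; split; rewrite /mulm /invm /=.
- rewrite (_ : _ - 1 = d * (p - 1) * a + d * q * c + (- b) * r * a + (- b) * (s - 1) * c); first by apply: key => //; exact: nN.
  rewrite -[X in _ - X]D; ring.
- rewrite (_ : _ + _ = d * (p - 1) * b + d * q * d + (- b) * r * b + (- b) * (s - 1) * d); first by apply: key => //; exact: nN.
  ring.
- rewrite (_ : _ + _ = (- c) * (p - 1) * a + (- c) * q * c + a * r * a + a * (s - 1) * c); first by apply: key => //; exact: nN.
  ring.
- rewrite (_ : _ - 1 = (- c) * (p - 1) * b + (- c) * q * d + a * r * b + a * (s - 1) * d); first by apply: key => //; exact: nN.
  rewrite -[X in _ - X]D; ring.
Qed.

Lemma mbound_ex k : exists2 S : R, 1 <= S & mbound S k.
Proof.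
case: k => -[a b] [c d]; exists (1 + `|a| + `|b| + `|c| + `|d|).
  by rewrite -!addrA lerDl !addr_ge0.
have na := normr_ge0 a; have nb := normr_ge0 b; have nc := normr_ge0 c; have nd := normr_ge0 d.
by apply/and4P; split => /=; lra.
Qed.

Lemma nearm_conj k : detm k = 1 -> exists2 C : R, 0 < C &
  forall d l, 0 <= d -> nearm d l -> nearm (C * d) (mulm (invm k) (mulm l k)).
Proof.
move=> Dk; have [S S1 kS] := mbound_ex k.
exists (4 * S ^+ 2) => [|d l d0 nl]; first by rewrite mulr_gt0 // exprn_gt0 // (lt_le_trans ltr01).
exact: nearm_conj_bound.
Qed.

Lemma ucont_trans k f : detm k = 1 -> ucont f -> ucont (fun g => f (mulm g k)).
Proof.
move=> Dk uf e e0; have [d d0 fd] := uf e e0; have [C C0 hC] := nearm_conj Dk.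
exists (d / C) => [|g l Dg Dl nl]; first by rewrite divr_gt0.
have -> : mulm (mulm g l) k = mulm (mulm g k) (mulm (invm k) (mulm l k)).
  by rewrite -!mulmA; congr mulm; rewrite mulmA mulmV // mul1m.
apply: fd; rewrite ?detm_mul ?Dg ?Dk ?detm_inv ?Dl ?Dk ?mulr1 //.
have -> : d = C * (d / C) by rewrite mulrC divfK // gt_eqF.
by apply: hC => //; rewrite divr_ge0 // ltW.
Qed.

Lemma ucont_cst (c : R) : ucont (fun=> c).
Proof. by move=> e e0; exists 1 => // g k _ _ _; rewrite subrr normr0 ltW. Qed.

Lemma ucontD f h : ucont f -> ucont h -> ucont (fun g => f g + h g).
Proof.
move=> uf uh e e0; have e2 : 0 < e / 2 by rewrite divr_gt0.
have [d1 d10 fd] := uf _ e2; have [d2 d20 hd] := uh _ e2.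
exists (Num.min d1 d2) => [|g k Dg Dk nk]; first by rewrite lt_min d10.
have n1 : nearm d1 k by apply: nearm_le nk; rewrite ge_min lexx.
have n2 : nearm d2 k by apply: nearm_le nk; rewrite ge_min lexx orbT.
rewrite opprD addrACA (splitr e); apply: le_trans (ler_normD _ _) _.
by apply: lerD; [exact: fd|exact: hd].
Qed.

Lemma ucontZ (c : R) f : ucont f -> ucont (fun g => c * f g).
Proof.
move=> uf e e0; have c1 : 0 < `|c| + 1 by rewrite ltr_wpDl.
have [d d0 fd] := uf (e / (`|c| + 1)) (divr_gt0 e0 c1).
exists d => // g k Dg Dk nk; rewrite -mulrBr normrM.
apply: le_trans (ler_wpM2l (normr_ge0 _) (fd _ _ Dg Dk nk)) _.
by rewrite mulrA ler_pdivrMr // [leRHS]mulrDr mulr1 mulrC lerDl ltW.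
Qed.

Lemma ucont_norm f : ucont f -> ucont (fun g => `|f g|).
Proof.
move=> uf e e0; have [d d0 fd] := uf e e0; exists d => // g k Dg Dk nk.
exact: le_trans (ler_dist_dist _ _) (fd _ _ Dg Dk nk).
Qed.

Lemma ucont_sum n (F : nat -> M -> R) : (forall i, ucont (F i)) ->
  ucont (fun g => \sum_(i < n) F i g).
Proof.
move=> uF; elim: n => [|n IH].
  by have := @ucont_cst 0; congr ucont; apply/funext => g; rewrite big_ord0.
by have := ucontD IH (uF n); congr ucont; apply/funext => g; rewrite big_ord_recr.
Qed.

Definition avg (f : M -> R) (N : nat) (g : M) : R :=
  N%:R^-1 * \sum_(i < N) f (mulm g (upm i%:R)).

Section properties.
Variables (f : M -> R) (B : R).
Hypotheses (af : autom f) (fB : forall g, `|f g| <= B).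

Let B0 : 0 <= B. Proof. exact: le_trans (normr_ge0 _) (fB idm). Qed.

Lemma autom_avg N : autom (avg f N).
Proof.
apply: automZ; apply: (@autom_sum _ N (fun i g => f (mulm g (upm i%:R)))) => i.
by apply: autom_trans => //; exact: detm_upm.
Qed.

Lemma avg_bound N g : `|avg f N g| <= B.
Proof.
rewrite /avg normrM ger0_norm ?invr_ge0 //.
case: N => [|N]; first by rewrite invr0 mul0r.
rewrite mulrC ler_pdivrMr // (le_trans (ler_norm_sum _ _ _)) //.
apply: le_trans (ler_sum _ (G := fun=> B) _) _ => [i _|]; first exact: fB.
by rewrite sumr_const card_ord mulr_natr.
Qed.

Lemma sum_translate N m g :
  `|\sum_(i < N) f (mulm g (upm (i + m)%:R)) - \sum_(i < N) f (mulm g (upm i%:R))| <= 2 * m%:R * B.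
Proof.
elim: m => [|m IH].
  under eq_bigr do rewrite addn0.
  by rewrite subrr normr0 mulr0 mul0r.
have -> : 2 * m.+1%:R * B = 2 * m%:R * B + (B + B) by rewrite -natr1; ring.
set s := \sum_(i < N) f (mulm g (upm (i + m)%:R)) in IH.
rewrite -(subrK s (\sum_(i < N) f (mulm g (upm (i + m.+1)%:R)))) -addrA addrC.
apply: le_trans (ler_normD _ _) _; apply: lerD => //.
have E : \sum_(i < N) f (mulm g (upm (i + m.+1)%:R)) + f (mulm g (upm m%:R)) =
    s + f (mulm g (upm (N + m)%:R)).
  rewrite /s -(big_mkord xpredT (fun i => f (mulm g (upm (i + m.+1)%:R)))).
  rewrite -(big_mkord xpredT (fun i => f (mulm g (upm (i + m)%:R)))).
  under eq_bigr do rewrite -addSnnS.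
  rewrite -(@big_nat_recr _ _ _ N 0 (fun i => f (mulm g (upm (i + m)%:R)))) //=.
  by rewrite big_nat_recl //= add0n addrC.
have -> : \sum_(i < N) f (mulm g (upm (i + m.+1)%:R)) - s = f (mulm g (upm (N + m)%:R)) - f (mulm g (upm m%:R)).
  by apply/eqP; rewrite subr_eq addrAC eq_sym subr_eq E addrC.
by apply: le_trans (ler_normB _ _) _; apply: lerD.
Qed.

Lemma avg_translate N m g : (0 < N)%N -> `|avg f N (mulm g (upm m%:R)) - avg f N g| <= 2 * m%:R * B / N%:R.
Proof.
move=> N0; rewrite /avg -mulrBr normrM ger0_norm ?invr_ge0 // mulrC ler_wpM2r ?invr_ge0 //.
under eq_bigr do rewrite -mulmA upm_mul -natrD addnC.
exact: sum_translate.
Qed.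

(** Averaging first over [m] steps only alters the ends of an average over [N] steps. *)
Lemma avg_avg N m g : (0 < N)%N -> (0 < m)%N -> `|avg (avg f m) N g - avg f N g| <= 2 * m%:R * B / N%:R.
Proof.
move=> N0 m0.
have -> : avg (avg f m) N g = m%:R^-1 * \sum_(j < m) avg f N (mulm g (upm j%:R)).
  rewrite /avg [in RHS]mulr_sumr [in LHS]mulr_sumr.
  under eq_bigr do rewrite mulrA mulr_sumr.
  under [in RHS]eq_bigr do rewrite mulrA mulr_sumr.
  rewrite exchange_big /=; apply: eq_bigr => j _; apply: eq_bigr => i _.
  by rewrite -!mulmA !upm_mul addrC [_ * N%:R^-1]mulrC.
have -> : avg f N g = m%:R^-1 * \sum_(j < m) avg f N g.
  by rewrite sumr_const card_ord -(mulr_natl (avg f N g) m) mulrA mulVf ?mul1r // pnatr_eq0 -lt0n.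
rewrite -mulrBr -sumrB normrM ger0_norm ?invr_ge0 // mulrC ler_pdivrMr ?ltr0n //.
apply: le_trans (ler_norm_sum _ _ _) _.
apply: le_trans (ler_sum _ (G := fun=> 2 * m%:R * B / N%:R) _) _ => [i _|]; last first.
  by rewrite sumr_const card_ord -[leLHS]mulr_natr.
apply: le_trans (avg_translate _ _ N0) _; rewrite ler_wpM2r ?invr_ge0 // ler_wpM2r //.
by rewrite ler_wpM2l // ler_nat ltnW.
Qed.
End properties.

Lemma ucont_avg f N : ucont f -> ucont (avg f N).
Proof.
move=> uf; apply: ucontZ; apply: (@ucont_sum N (fun i g => f (mulm g (upm i%:R)))) => i.
by apply: ucont_trans => //; exact: detm_upm.
Qed.

Lemma nrm_avg h N : autom h -> nrm (avg h N) <= nrm h.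
Proof.
move=> ah; case: N => [|N].
  by rewrite /avg nrmZ ?invr0 ?normr0 ?mul0r ?nrm_ge0 //; apply: (@autom_sum _ 0%N (fun i g => h (mulm g (upm i%:R)))) => i; apply: autom_trans => //; exact: detm_upm.
have aF i : autom (fun g => h (mulm g (upm i%:R))) by apply: autom_trans => //; exact: detm_upm.
rewrite /avg nrmZ; last exact: (@autom_sum _ N.+1 (fun i g => h (mulm g (upm i%:R)))).
rewrite ger0_norm ?invr_ge0 // mulrC ler_pdivrMr // mulrC.
apply: (@nrm_sum _ N.+1 (fun i g => h (mulm g (upm i%:R)))) => // i.
by rewrite nrm_trans //; exact: detm_upm.
Qed.

Lemma small_ratio (C e : R) : 0 <= C -> 0 < e -> exists2 N0 : nat, (0 < N0)%N & forall N, (N0 <= N)%N -> C / N%:R <= e.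
Proof.
move=> C0 e0; exists (Num.bound (C / e)).+1 => // N NN.
have lt := archi_boundP (divr_ge0 C0 (ltW e0)).
have N0 : 0 < N%:R :> R by rewrite ltr0n (leq_trans _ NN).
rewrite ler_pdivrMr // mulrC -ler_pdivrMr // (le_trans (ltW lt)) // ler_nat.
by rewrite (leq_trans _ NN).
Qed.

(* Mean ergodic theorem: the norms of the averages decrease to their infimum up to small errors, and the
   parallelogram law makes the averages a Cauchy sequence. *)
Lemma avg_cauchy f : autom f -> forall e : R, 0 < e -> exists2 N0 : nat, (0 < N0)%N &
  forall N m, (N0 <= N)%N -> (N0 <= m)%N -> nrm (fun g => avg f N g - avg f m g) <= e.
Proof.
move=> af e e0; have [_ [B fB] _] := af.
have B0 : 0 <= B := le_trans (normr_ge0 _) (fB idm).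
pose V := Num.sqrt (@vol R); have V0 : 0 <= V by exact: sqrtr_ge0.
pose S := [set nrm (avg f N.+1) | N in [set: nat]].
pose d := inf S.
have hS : has_inf S by split; [exists (nrm (avg f 1)), 0%N|exists 0 => _ [N _ <-]; exact: nrm_ge0].
have dS N : (0 < N)%N -> d <= nrm (avg f N).
  by case: N => // N _; apply: ge_inf; [case: hS|exists N].
have d0 : 0 <= d by apply: lb_le_inf => [|_ [N _ <-]]; [case: hS|exact: nrm_ge0].
(* The norms of all late averages lie between [d] and [d + t]; the parallelogram law then bounds a
   squared distance by [4 ((d + t)^2 - d^2) <= e^2 / 2]. *)
pose t := Num.min 1 (e ^+ 2 / (8 * (2 * d + 1))).
have t0 : 0 < t by rewrite lt_min ltr01 /= divr_gt0 ?exprn_gt0 // mulr_gt0 // ltr_wpDl // mulr_ge0.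
have td : (d + t) ^+ 2 - d ^+ 2 <= e ^+ 2 / 8.
  have t1 : t <= 1 by rewrite ge_min lexx.
  have d1 : 0 < 2 * d + 1 by rewrite ltr_wpDl // mulr_ge0.
  have : t * (2 * d + 1) <= e ^+ 2 / 8.
    rewrite -ler_pdivlMr // -mulrA -invfM; first by rewrite ge_min lexx orbT.
  nra.
have [_ [N1 _ <-] lt1] : exists2 x, S x & x < d + t / 2.
  by apply: inf_adherent => //; rewrite divr_gt0.
have t2 : 0 < t / 2 by rewrite divr_gt0.
have [N2 N20 hN2] := small_ratio (mulr_ge0 (mulr_ge0 (mulr_ge0 (ler0n R 2) (ler0n _ N1.+1)) B0) V0) t2.
exists N2 => // N m NN mm.
have big n : (N2 <= n)%N -> nrm (avg f n) <= d + t.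
  move=> n2; have n0 : (0 < n)%N by exact: leq_trans n2.
  rewrite (_ : avg f n = fun g => avg (avg f N1.+1) n g + (avg f n g - avg (avg f N1.+1) n g)); last first.
    by apply/funext => g; rewrite addrC subrK.
  have a1 := autom_avg af n; have a2 := autom_avg (autom_avg af N1.+1) n.
  apply: le_trans (nrm_triangle a2 (automB a1 a2)) _.
  have -> : d + t = (d + t / 2) + t / 2 by lra.
  apply: lerD; first exact: le_trans (nrm_avg _ (autom_avg af N1.+1)) (ltW lt1).
  apply: le_trans (hN2 n n2); rewrite mulrAC; apply: nrm_le => [||g _].
  - by rewrite divr_ge0 // mulr_ge0 // mulr_ge0.
  - exact: automB.
  - rewrite distrC; exact: avg_avg.
have N0 : (0 < N)%N by exact: leq_trans NN.
have m0 : (0 < m)%N by exact: leq_trans mm.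
have aN := autom_avg af N; have am := autom_avg af m.
(* A further average of the sum over many steps is close to twice a single average, of norm at least
   [2 d], and averaging does not increase the norm. *)
have low : 2 * d <= nrm (fun g => avg f N g + avg f m g).
  have aD := automD aN am.
  apply/ler_addgt0Pr => s s0.
  have [n n0 hn] := small_ratio (mulr_ge0 (mulr_ge0 (mulr_ge0 (ler0n R 2) (ler0n _ (N + m))) B0) V0) s0.
  have an := autom_avg af n.
  have aA := autom_avg aD n.
  have -> : 2 * d = `|2| * d by rewrite ger0_norm.
  apply: le_trans (ler_wpM2l (normr_ge0 _) (dS n n0)) _; rewrite -nrmZ //.
  rewrite (_ : (fun g => 2 * _) = fun g => avg (fun g => avg f N g + avg f m g) n g +
      (2 * avg f n g - avg (fun g => avg f N g + avg f m g) n g)); last first.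
    by apply/funext => g; rewrite addrC subrK.
  apply: le_trans (nrm_triangle aA (automB (automZ 2 an) aA)) _.
  apply: lerD; first exact: nrm_avg.
  apply: le_trans (hn n (leqnn n)); rewrite mulrAC; apply: nrm_le => [||g _].
  - by rewrite divr_ge0 // mulr_ge0 // mulr_ge0.
  - by apply: automB => //; exact: automZ.
  have -> : avg (fun g => avg f N g + avg f m g) n g = avg (avg f N) n g + avg (avg f m) n g.
    by rewrite {1}/avg big_split mulrDr.
  have -> : 2 * avg f n g - (avg (avg f N) n g + avg (avg f m) n g) =
      (avg f n g - avg (avg f N) n g) + (avg f n g - avg (avg f m) n g) by ring.
  apply: le_trans (ler_normD _ _) _.
  have -> : 2 * (N + m)%:R * B / n%:R = 2 * N%:R * B / n%:R + 2 * m%:R * B / n%:R by rewrite natrD; ring.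
  by apply: lerD; rewrite distrC; exact: avg_avg.
have := nrm_parallelogram aN am.
have := big N NN; have := big m mm; have nN := nrm_ge0 (avg f N); have nm := nrm_ge0 (avg f m).
move: low nN nm; have := nrm_ge0 (fun g => avg f N g - avg f m g).
move: (nrm _) (nrm _) (nrm _) (nrm _) => x y z u x0 le1 y0 z0 le2 le3 E.
rewrite -(@ler_pXn2r _ 2) ?nnegrE ?(ltW e0) //; nra.
Qed.

(** Mautner's argument is run with errors, which add up along products: instead of an invariant
    vector there is an average that all integer times of the flow move little. *)
Definition almost_inv (P : M -> R) (d : R) k :=
  detm k = 1 /\ nrm (fun g => P (mulm g k) - P g) <= d.

Section almost_invariance.
Variable P : M -> R.
Hypothesis aP : autom P.

Let aT k : detm k = 1 -> autom (fun g => P (mulm g k) - P g).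
Proof. by move=> Dk; apply: automB => //; exact: autom_trans. Qed.

Lemma almost_inv_mul (s t : R) k l : almost_inv P s k -> almost_inv P t l ->
  almost_inv P (s + t) (mulm k l).
Proof.
move=> [Dk nk] [Dl nl]; split; first by rewrite detm_mul Dk Dl mulr1.
rewrite (_ : (fun g => _) = fun g => (P (mulm g k) - P g) + (P (mulm (mulm g k) l) - P (mulm g k))); last first.
  by apply/funext => g; rewrite mulmA; ring.
apply: le_trans (nrm_triangle (aT Dk) _) _.
  exact: (autom_trans Dk (aT Dl)).
by apply: lerD => //; rewrite (nrm_trans Dk (aT Dl)).
Qed.

Lemma almost_inv_inv (s : R) k : almost_inv P s k -> almost_inv P s (invm k).
Proof.
move=> [Dk nk]; have Dk' : detm (invm k) = 1 by rewrite detm_inv.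
split=> //; rewrite -(nrm_trans Dk (aT Dk')).
rewrite (_ : (fun g => _) = fun g => P g - P (mulm g k)); last first.
  by apply/funext => g; rewrite -mulmA mulmV // mulm1.
by rewrite nrmB //; exact: autom_trans.
Qed.

Variables (e d : R).
Hypotheses (e0 : 0 < e) (d0 : 0 < d).
Hypothesis near_inv : forall k, detm k = 1 -> nearm d k -> almost_inv P e k.
Hypothesis upm_inv : forall m : nat, almost_inv P e (upm m%:R).

Let upN (m : nat) : almost_inv P e (upm (- m%:R)).
Proof.
have := almost_inv_inv (upm_inv m); congr almost_inv.
by rewrite /invm /upm /= oppr0.
Qed.

Let low_near (z : R) : `|z| <= d -> almost_inv P e (lowm z).
Proof.
move=> zd; apply: near_inv; first exact: detm_lowm.
by apply/and4P; split; rewrite /= ?subrr ?normr0 // ltW.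
Qed.

Let up_near (z : R) : `|z| <= d -> almost_inv P e (upm z).
Proof.
move=> zd; apply: near_inv; first exact: detm_upm.
by apply/and4P; split; rewrite /= ?subrr ?normr0 // ltW.
Qed.

(* (1 s; 0 1)(1 0; u 1)(1 s'; 0 1) = (x 0; u 1/x) when x = 1 + s u and s' = - s / x; large s makes u small. *)
Let diag_rat (p q : nat) : (0 < p)%N -> (0 < q)%N -> almost_inv P (4 * e) (diagm (p%:R / q%:R)).
Proof.
move=> p0 q0; set x := p%:R / q%:R.
have P0 : 0 < p%:R :> R by rewrite ltr0n.
have Q0 : 0 < q%:R :> R by rewrite ltr0n.
have x0 : 0 < x by rewrite divr_gt0.
have C0 : 0 <= `|x - 1| * (1 + x) / p%:R by apply: divr_ge0; [apply: mulr_ge0 => //; apply: addr_ge0 => //|]; exact: ltW.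
have [k k0 hk] := small_ratio C0 d0.
have K0 : 0 < k%:R :> R by rewrite ltr0n.
pose u := (x - 1) / (k * p)%:R.
have ub : `|u| * (1 + x) <= d.
  apply: le_trans (hk k (leqnn k)); rewrite /u normrM normfV natrM.
  rewrite (ger0_norm (_ : 0 <= k%:R * p%:R)); last by rewrite mulr_ge0 // ltW.
  by rewrite invfM le_eqVlt; apply/orP; left; apply/eqP; ring.
have u1 : `|u| <= d by apply: le_trans ub; rewrite ler_peMr // lerDl ltW.
have u2 : `|- (u * x)| <= d.
  by apply: le_trans ub; rewrite normrN normrM (gtr0_norm x0) ler_wpM2l // lerDr.
have := almost_inv_mul (almost_inv_mul (almost_inv_mul (upm_inv (k * p)) (low_near u1)) (upN (k * q))) (low_near u2).
congr almost_inv; first by ring.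
rewrite /mulm /upm /lowm /diagm /u !natrM /x /=.
by congr ((_, _), (_, _)); field; rewrite ?gt_eqF.
Qed.

(** A positive real is approximated from above by a fraction; their quotient gives a diagonal matrix
    close to the identity, which costs one more [e]. *)
Let diag_real (x : R) : 0 < x -> almost_inv P (5 * e) (diagm x).
Proof.
move=> x0; have [q q0 hq] := small_ratio (ltW (divr_gt0 ltr01 x0)) d0.
have Q0 : 0 < q%:R :> R by rewrite ltr0n.
pose p := (Num.truncn (x * q%:R)).+1.
have /andP[p1 p2] : p%:R - 1 <= x * q%:R < p%:R.
  have xq0 : 0 <= x * q%:R by rewrite mulr_ge0 // ltW.
  have /andP[t1 t2] := truncn_itv xq0; apply/andP; split; last exact: t2.
  by rewrite /p -natr1 addrK; exact: t1.
have P0 : 0 < p%:R :> R by rewrite ltr0n.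
pose r : R := p%:R / q%:R; have r0 : 0 < r by rewrite divr_gt0.
have rx : x < r by rewrite /r ltr_pdivlMr.
have rx2 : r - x <= d * x.
  have h := hq q (leqnn q).
  have : r - x <= q%:R^-1.
    by rewrite /r lerBlDr ler_pdivrMr // mulrDl mulVf ?gt_eqF // addrC -lerBlDr.
  move/le_trans; apply; rewrite (_ : q%:R^-1 = (1 / x / q%:R) * x); last by field; rewrite !gt_eqF.
  by rewrite ler_wpM2r // ltW.
have near1 : nearm d (diagm (x / r)).
  have xr : x != 0 by rewrite gt_eqF.
  have rr : r != 0 by rewrite gt_eqF.
  have u1 : x / r - 1 = - ((r - x) / r) by field.
  have u2 : (x / r)^-1 - 1 = (r - x) / x by rewrite invf_div; field.
  have rx0 : 0 <= r - x by rewrite subr_ge0 ltW.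
  apply/and4P; split; rewrite /= ?normr0 ?(ltW d0) // ?u1 ?u2 ?normrN ger0_norm ?divr_ge0 ?(ltW r0) ?(ltW x0) //.
  - rewrite ler_pdivrMr //; apply: le_trans rx2 _; rewrite ler_wpM2l // ltW //.
  - by rewrite ler_pdivrMr.
have := almost_inv_mul (diag_rat (p := p) (ltn0Sn _) q0) (near_inv (detm_diagm _) near1).
rewrite mulf_neq0 ?invr_eq0 ?gt_eqF // => /(_ isT).
congr almost_inv; first by ring.
rewrite -/r /mulm /diagm /= !mulr0 !mul0r !addr0 !add0r; congr ((_, _), (_, _)); field; rewrite ?gt_eqF //.
Qed.

(** Conjugation by a diagonal matrix brings any unipotent matrix close to the identity. Hence the
    cost [5 + 1 + 5 = 11] in [low_inv] and [up_inv], and [3 * 11 + 11 = 44] in [almost_inv_all]. *)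
Let stretch (z : R) : exists2 l : R, 0 < l & `|z / l ^+ 2| <= d.
Proof.
have l0 : 0 < 1 + `|z| / d by rewrite ltr_pwDl // divr_ge0 // ltW.
exists (1 + `|z| / d) => //.
rewrite normrM normfV (gtr0_norm (exprn_gt0 _ l0)) ler_pdivrMr ?exprn_gt0 //.
have E : `|z| = d * (`|z| / d) by rewrite mulrC divfK // gt_eqF.
rewrite {1}E ler_pM2l //; have : 0 <= `|z| / d by rewrite divr_ge0 // ltW.
move: (`|z| / d) => t t0; nra.
Qed.

Let low_inv (z : R) : almost_inv P (11 * e) (lowm z).
Proof.
have [l l0 hl] := stretch z.
have l0' : 0 < l^-1 by rewrite invr_gt0.
have := almost_inv_mul (almost_inv_mul (diag_real l0') (low_near hl)) (diag_real l0).
congr almost_inv; first by ring.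
rewrite /mulm /lowm /diagm /= invrK.
by congr ((_, _), (_, _)); field; rewrite gt_eqF.
Qed.

Let up_inv (z : R) : almost_inv P (11 * e) (upm z).
Proof.
have [l l0 hl] := stretch z.
have l0' : 0 < l^-1 by rewrite invr_gt0.
have := almost_inv_mul (almost_inv_mul (diag_real l0) (up_near hl)) (diag_real l0').
congr almost_inv; first by ring.
rewrite /mulm /upm /diagm /= invrK.
by congr ((_, _), (_, _)); field; rewrite gt_eqF.
Qed.

Lemma almost_inv_all k : detm k = 1 -> almost_inv P (44 * e) k.
Proof.
have nz l : detm l = 1 -> l.2.1 != 0 -> almost_inv P (33 * e) l.
  case: l => -[a b] [c c'] /= D c0.
  have := almost_inv_mul (almost_inv_mul (up_inv ((a - 1) / c)) (low_inv c)) (up_inv ((c' - 1) / c)).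
  congr almost_inv; first by ring.
  rewrite /mulm /upm /lowm /=; congr ((_, _), (_, _)); try by field.
  have -> : b = (a * c' - 1) / c by rewrite -D /detm /=; field.
  by field.
move=> Dk; have [c0|c0] := eqVneq k.2.1 0; last first.
  by case: (nz k Dk c0) => _ n33; split => //; apply: le_trans n33 _; rewrite ler_wpM2r ?(ltW e0)// ler_nat.
have d1 : k.2.2 != 0.
  by apply/eqP => d2; move: Dk; rewrite /detm c0 d2 !mulr0 subrr => /eqP; rewrite eq_sym oner_eq0.
have D1 : detm (mulm k (lowm 1)) = 1 by rewrite detm_mul Dk detm_lowm mulr1.
have c1 : (mulm k (lowm 1)).2.1 != 0 by rewrite /mulm /lowm /= c0 mul0r add0r mulr1.
have := almost_inv_mul (nz _ D1 c1) (low_inv (-1)).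
congr almost_inv; first by ring.
rewrite -mulmA (_ : mulm (lowm 1) (lowm (-1)) = idm) ?mulm1 //.
by rewrite /mulm /lowm /idm /=; congr ((_, _), (_, _)); ring.
Qed.
End almost_invariance.

Lemma avg_almost_inv f : autom f -> ucont f -> forall e : R, 0 < e -> exists2 N0 : nat, (0 < N0)%N &
  forall N k, (N0 <= N)%N -> detm k = 1 -> nrm (fun g => avg f N (mulm g k) - avg f N g) <= e.
Proof.
move=> af uf e e0; have [_ [B fB] _] := af.
have B0 : 0 <= B := le_trans (normr_ge0 _) (fB idm).
pose V := Num.sqrt (@vol R); have V0 : 0 <= V by exact: sqrtr_ge0.
(* With error [2 t], [almost_inv_all] costs [88 t]; the two comparisons of [avg f N] with [avg f N0]
   cost [t] each. *)
pose t := e / 100; have t0 : 0 < t by rewrite divr_gt0.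
have [N0 N00 cN] := avg_cauchy af t0.
pose P := avg f N0; have aP : autom P := autom_avg af N0.
have V1 : 0 < V + 1 by rewrite ltr_wpDl.
have [d d0 hd] := ucont_avg N0 uf (divr_gt0 t0 V1).
have nP k : detm k = 1 -> nearm d k -> almost_inv P (2 * t) k.
  move=> Dk nk; split=> //; apply: (@le_trans _ _ (t / (V + 1) * V)).
    apply: nrm_le => [||g Dg]; [by rewrite divr_ge0 // ltW|by apply: automB => //; exact: autom_trans|exact: hd].
  rewrite mulrAC ler_pdivrMr // mulrDr mulr1 (_ : 2 * t * V = t * V + t * V); last by ring.
  have : 0 <= t * V by rewrite mulr_ge0 // ltW.
  lra.
have close N k : (N0 <= N)%N -> detm k = 1 ->
    nrm (fun g => avg f N (mulm g k) - P (mulm g k)) <= t.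
  move=> NN Dk; rewrite (nrm_trans Dk (automB (autom_avg af N) aP)).
  exact: cN.
have uP m : almost_inv P (2 * t) (upm m%:R).
  split; first exact: detm_upm.
  apply/ler_addgt0Pr => s s0.
  have [n n0 hn] := small_ratio (mulr_ge0 (mulr_ge0 (mulr_ge0 (ler0n R 2) (ler0n _ m)) B0) V0) s0.
  pose N := maxn n N0; have NN : (N0 <= N)%N by exact: leq_maxr.
  have aN := autom_avg af N; have Du := detm_upm m%:R.
  have aN' := autom_trans Du aN; have aP' := autom_trans Du aP.
  rewrite (_ : (fun g => _) = fun g => (P (mulm g (upm m%:R)) - avg f N (mulm g (upm m%:R))) +
     ((avg f N g - P g) + (avg f N (mulm g (upm m%:R)) - avg f N g))); last by apply/funext => g; ring.
  apply: le_trans (nrm_triangle (automB aP' aN') (automD (automB aN aP) (automB aN' aN))) _.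
  have -> : 2 * t + s = t + (t + s) by ring.
  apply: lerD; first by rewrite nrmB //; exact: close.
  apply: le_trans (nrm_triangle (automB aN aP) (automB aN' aN)) _.
  apply: lerD; first exact: cN.
  apply: le_trans (hn N (leq_maxl _ _)); rewrite mulrAC; apply: nrm_le => [||g Dg].
  - by rewrite divr_ge0 // mulr_ge0 // mulr_ge0.
  - exact: automB.
  - by apply: avg_translate => //; apply: leq_trans NN.
exists N0 => // N k NN Dk.
have aN := autom_avg af N; have aN' := autom_trans Dk aN; have aP' := autom_trans Dk aP.
have [_ nk] := almost_inv_all aP (mulr_gt0 (ltr0n R 2) t0) d0 nP uP Dk.
rewrite (_ : (fun g => _) = fun g => (avg f N (mulm g k) - P (mulm g k)) +
     ((P g - avg f N g) + (P (mulm g k) - P g))); last by apply/funext => g; ring.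
apply: le_trans (nrm_triangle (automB aN' aP') (automD (automB aP aN) (automB aP' aP))) _.
have -> : e = t + (t + (98 * t)) by rewrite /t; field.
apply: lerD; first exact: close.
apply: le_trans (nrm_triangle (automB aP aN) (automB aP' aP)) _.
apply: lerD; first by rewrite nrmB //; exact: cN.
by apply: le_trans nk _; move: t0; rewrite mulrA; lra.
Qed.
End mautner.

(** * Long horocycles *)

Section interval_integrals.
Context {R : realType}.
Local Notation mR := (measurableTypeR R).
Local Notation leb := (@lebesgue_measure R).
Implicit Types (f g : mR -> R) (u v w s : R).

Definition itg u v f : R := (\int[leb]_(x in `[u, v]) f x)%R.

Definition bmeas f := measurable_fun setT f /\ exists B, forall x, `|f x| <= B.

Lemma bmeas_cst (c : R) : bmeas (fun=> c).
Proof. by split; [exact: mcst|exists `|c|]. Qed.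

Lemma bmeasD f g : bmeas f -> bmeas g -> bmeas (fun x => f x + g x).
Proof.
move=> [mf [B fB]] [mg [C gC]]; split; first exact: mD.
by exists (B + C) => x; apply: le_trans (ler_normD _ _) _; exact: lerD.
Qed.

Lemma bmeasM f g : bmeas f -> bmeas g -> bmeas (fun x => f x * g x).
Proof.
move=> [mf [B fB]] [mg [C gC]]; split; first exact: mM.
by exists (B * C) => x; rewrite normrM; apply: ler_pM.
Qed.

Lemma bmeasZ (c : R) f : bmeas f -> bmeas (fun x => c * f x).
Proof. by move=> bf; apply: bmeasM => //; exact: bmeas_cst. Qed.

Lemma bmeasB f g : bmeas f -> bmeas g -> bmeas (fun x => f x - g x).
Proof.
move=> bf bg; have := bmeasD bf (bmeasZ (-1) bg).
by congr bmeas; apply/funext => x; rewrite mulN1r.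
Qed.

Lemma bmeas_norm f : bmeas f -> bmeas (fun x => `|f x|).
Proof. by move=> [mf [B fB]]; split; [exact: mnorm|exists B => x; rewrite normr_id]. Qed.

Lemma bmeas_comp f h : bmeas f -> measurable_fun setT (h : mR -> mR) -> bmeas (fun x => f (h x)).
Proof. by move=> [mf [B fB]] mh; split; [exact: (mcomp mf mh)|exists B]. Qed.

Lemma bmeas_sum n (F : nat -> mR -> R) : (forall i, bmeas (F i)) ->
  bmeas (fun x => \sum_(i < n) F i x).
Proof.
move=> bF; elim: n => [|n IH].
  by have := bmeas_cst 0; congr bmeas; apply/funext => x; rewrite big_ord0.
by have := bmeasD IH (bF n); congr bmeas; apply/funext => x; rewrite big_ord_recr.
Qed.

Let integr u v f : bmeas f -> leb.-integrable `[u, v]%classic (EFin \o f).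
Proof.
move=> [mf [B fB]]; apply: measurable_bounded_integrable.
- exact: measurable_itv.
- by apply: le_lt_trans (ltry (`|v - u| : R)); rewrite [X in (X <= _)%E](_ : _ = lebesgue_measure (`[u, v]%classic : set R)) // lebesgue_measure_itv /=; case: ifP => _; rewrite -?EFinB lee_fin ?ler_norm.
- exact: measurable_funS mf.
- exists B; split; first exact: num_real.
  by move=> x Bx y _; apply: le_trans (fB y) (ltW Bx).
Qed.

Let mi u v : measurable (`[u, v]%classic : set mR).
Proof. exact: measurable_itv. Qed.

Lemma itgD u v f g : bmeas f -> bmeas g -> itg u v (fun x => f x + g x) = itg u v f + itg u v g.
Proof. by move=> bf bg; apply: RintegralD; [exact: mi|exact: integr|exact: integr]. Qed.

Lemma itgB u v f g : bmeas f -> bmeas g -> itg u v (fun x => f x - g x) = itg u v f - itg u v g.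
Proof. by move=> bf bg; apply: RintegralB; [exact: mi|exact: integr|exact: integr]. Qed.

Lemma itgZ u v (c : R) f : bmeas f -> itg u v (fun x => c * f x) = c * itg u v f.
Proof. by move=> bf; apply: RintegralZl; [exact: mi|exact: integr]. Qed.

Lemma itg_cst u v (c : R) : u <= v -> itg u v (fun=> c) = c * (v - u).
Proof.
move=> uv; rewrite /itg Rintegral_cst; last exact: mi.
congr (_ * _); rewrite [X in fine X](_ : _ = lebesgue_measure (`[u, v]%classic : set R)) // lebesgue_measure_itv /=.
by move: uv; rewrite lte_fin le_eqVlt => /predU1P[->|->//]; rewrite ltxx subrr.
Qed.

Lemma le_itg u v f g : bmeas f -> bmeas g -> (forall x, u <= x <= v -> f x <= g x) ->
  itg u v f <= itg u v g.
Proof.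
move=> bf bg fg; apply: le_Rintegral; [exact: mi|exact: integr|exact: integr|].
by move=> x /=; rewrite in_itv /=; exact: fg.
Qed.

Lemma itg_norm u v f : bmeas f -> `|itg u v f| <= itg u v (fun x => `|f x|).
Proof. by move=> bf; apply: le_normr_Rintegral; [exact: mi|exact: integr]. Qed.

Lemma itg_bound u v f (c : R) : u <= v -> bmeas f -> (forall x, u <= x <= v -> `|f x| <= c) ->
  `|itg u v f| <= c * (v - u).
Proof.
move=> uv bf fc; apply: le_trans (itg_norm _ _ bf) _; rewrite -itg_cst //.
by apply: le_itg => //; [exact: bmeas_norm|exact: bmeas_cst].
Qed.

Lemma itg_sum n u v (F : nat -> mR -> R) : (forall i, bmeas (F i)) ->
  itg u v (fun x => \sum_(i < n) F i x) = \sum_(i < n) itg u v (F i).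
Proof.
move=> bF; elim: n => [|n IH].
  rewrite big_ord0 (_ : (fun x => _) = fun x => 0 * F 0%N x); last by apply/funext => x; rewrite big_ord0 mul0r.
  by rewrite itgZ // mul0r.
rewrite big_ord_recr /= -IH -itgD //; last exact: bmeas_sum.
by congr itg; apply/funext => x; rewrite big_ord_recr.
Qed.

Lemma itg_cat u w v f : bmeas f -> u <= w -> w <= v -> itg u v f = itg u w f + itg w v f.
Proof.
move=> bf uw wv; apply/eqP; rewrite addrC -subr_eq; apply/eqP.
have i := integr u v bf.
rewrite /itg (@Rintegral_itvB R f (BLeft u) (BRight v) w i) ?bnd_simp //.
rewrite Rintegral_itv_obnd_cbnd //.
have i2 := integr w v bf; apply: integrableS i2 => //.
by move=> x /=; rewrite !in_itv /= => /andP[/ltW -> ->].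
Qed.

Lemma EFin_itg u v f : bmeas f ->
  ((itg u v f)%:E = \int[leb]_x ((\1_(`[u, v]%classic : set mR) x * f x)%:E))%E.
Proof.
move=> bf; have i := integr u v bf.
rewrite /itg /Rintegral fineK; last exact: (integrable_fin_num _ i).
rewrite integral_mkcond; apply: eq_integral => x _.
by rewrite patchE indicE; case: ifP => _; rewrite ?mul1r ?mul0r.
Qed.

Lemma itg_shift u v s f : bmeas f -> u <= v -> itg u v (fun x => f (x + s)) = itg (u + s) (v + s) f.
Proof.
have pos g : bmeas g -> (forall x, 0 <= g x) -> itg u v (fun x => g (x + s)) = itg (u + s) (v + s) g.
  move=> bg g0; apply: EFin_inj.
  have ms : measurable_fun setT (fun x : mR => x + s : mR) by mfun.
  rewrite EFin_itg; last exact: bmeas_comp.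
  rewrite EFin_itg // -[RHS](@integral_translate _ s).
  - apply: eq_integral => x _; congr (_%:E); rewrite !indicE; congr (_%:R * _).
    by congr nat_of_bool; apply/idP/idP; rewrite !inE /= !in_itv /= !lerD2r.
  - by apply: mE; apply: mM; [apply: measurable_indic; exact: mi|case: bg].
  - by move=> x; rewrite lee_fin mulr_ge0.
move=> bf uv; have [mf [B fB]] := bf.
have B0 : 0 <= B := le_trans (normr_ge0 _) (fB 0).
have ms : measurable_fun setT (fun x : mR => x + s : mR) by mfun.
have bfB := bmeasD bf (bmeas_cst B).
have p0 x : 0 <= f x + B by have := fB x; rewrite ler_norml => /andP[? ?]; lra.
have := pos _ bfB p0.
rewrite itgD //; last exact: bmeas_cst.
  rewrite itgD //; last exact: bmeas_cst.
  rewrite !itg_cst //; last by rewrite lerD2r.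
  by rewrite [v + s]addrC [u + s]addrC opprD addrACA subrr add0r => /addIr.
exact: (bmeas_comp bf ms).
Qed.

Lemma itg_move u v s f (B : R) : bmeas f -> u <= v -> 0 <= s -> (forall x, `|f x| <= B) ->
  `|itg u v (fun x => f (x + s)) - itg u v f| <= 2 * B * s.
Proof.
move=> bf uv s0 fB; rewrite itg_shift //.
have us : u <= u + s by rewrite lerDl.
have vs : v <= v + s by rewrite lerDl.
have us2 : u + s <= v + s by rewrite lerD2r.
have E1 := itg_cat bf us us2; have E2 := itg_cat bf uv vs.
have b1 : `|itg u (u + s) f| <= B * s by have := itg_bound us bf (fun x _ => fB x); rewrite {2}[u + s]addrC addrK.
have b2 : `|itg v (v + s) f| <= B * s by have := itg_bound vs bf (fun x _ => fB x); rewrite {2}[v + s]addrC addrK.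
have -> : itg (u + s) (v + s) f - itg u v f = itg v (v + s) f - itg u (u + s) f.
  by clear -E1 E2; lra.
by apply: le_trans (ler_normB _ _) _; rewrite -mulrA mulr_natl mulr2n lerD.
Qed.
End interval_integrals.

Lemma weighted_le (R : realDomainType) (w b c v : R) : 0 <= w -> 0 <= v -> w * (4 * b ^+ 2 + 1) <= c ->
  b ^+ 2 * v * w + b ^+ 2 * w * v <= c * v.
Proof.
move=> w0 v0 wc; have t1 : 0 <= w * b ^+ 2 * v by apply: mulr_ge0 => //; apply: mulr_ge0 => //; exact: sqr_ge0.
have t2 : 0 <= w * v by rewrite mulr_ge0.
by have := ler_wpM2r v0 wc; lra.
Qed.

(** * Convergence in mean of the ergodic averages *)

Section ergodic_mean.
Context {R : realType}.
Local Notation mR := (measurableTypeR R).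
Local Notation leb := (@lebesgue_measure R).
Local Notation M := ((mR * mR) * (mR * mR))%type.
Implicit Types (f h : M -> R) (k g : mat2 R).
Local Open Scope ereal_scope.

Let leb3 : {sigma_finite_measure set (mR * (mR * mR))%type -> \bar R} :=
  prod_measure leb (prod_measure leb leb).

Lemma measurable_haar (F : M * M -> \bar R) : measurable_fun setT F -> (forall p, 0 <= F p) ->
  measurable_fun setT (fun g => haar (fun k => F (g, k))).
Proof.
move=> mF F0.
have m1 : measurable_fun setT (fun p : M * (mR * (mR * mR)) => F (p.1, haar_coord p.2)).
  by apply: (mcomp mF); apply: mpair; [exact: mfst|apply: (mcomp measurable_haar_coord); exact: msnd].
exact: (measurable_fun_fubini_tonelli_F (m2 := leb3) _ m1 (fun p => F0 _)).
Qed.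

Lemma haar_swap (F : M * M -> \bar R) : measurable_fun setT F -> (forall p, 0 <= F p) ->
  haar (fun g => haar (fun k => F (g, k))) = haar (fun k => haar (fun g => F (g, k))).
Proof.
move=> mF F0.
have m1 : measurable_fun setT (fun p : (mR * (mR * mR)) * (mR * (mR * mR)) => F (haar_coord p.1, haar_coord p.2)).
  apply: (mcomp mF); apply: mpair; first by apply: (mcomp measurable_haar_coord); exact: mfst.
  by apply: (mcomp measurable_haar_coord); exact: msnd.
exact: (@fubini_tonelli _ _ _ _ R leb3 leb3 _ m1 (fun p => F0 _)).
Qed.

(** A box in the coordinates consists of matrices with entries at most [C], so that [gint_cover]
    bounds an integral over it by one over the fundamental domain. *)
Lemma haar_box (C s u v : R) (h : M -> R) : (0 < s <= 1)%R -> (2 + 2 * (`|u| + `|v|) <= C)%R ->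
  measurable_fun setT h -> (forall g, 0 <= h g)%R ->
  \int[leb]_c \int[leb]_d \int[leb]_x ((\1_(`[0%R, s]%classic : set mR) c *
     (\1_(`[1%R, (1 + s)%R]%classic : set mR) d * (\1_(`[u, v]%classic : set mR) x * h (haar_coord (x, (c, d))))))%:E)
  <= haar (fun g => (h g * (mbound C g)%:R)%:E).
Proof.
move=> /andP[s0 s1] uvC mh h0.
rewrite haar_cdx; last 2 first.
- by apply: mE; apply: mM => //; exact: measurable_bool (measurable_mbound C).
- by move=> g; rewrite lee_fin mulr_ge0.
apply: le_int => c; first by do 2 (apply: integral_ge0 => ? _); rewrite lee_fin !mulr_ge0.
apply: le_int => d; first by apply: integral_ge0 => ? _; rewrite lee_fin !mulr_ge0.
apply: le_int => x; first by rewrite lee_fin !mulr_ge0.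
rewrite lee_fin mulrA mulrA mulrC ler_wpM2l // !indicE.
have [cs|_] := boolP (c \in _); last by rewrite !mul0r.
have [ds|_] := boolP (d \in _); last by rewrite mulr0 mul0r.
have [xs|_] := boolP (x \in _); last by rewrite mulr0.
rewrite !mul1r (_ : mbound _ _) //.
move: cs ds xs; rewrite !inE /= !in_itv /= => /andP[c0 c1] /andP[d0 d1] /andP[x0 x1].
have xb : (`|x| <= `|u| + `|v|)%R.
  have := ler_norm v; have := ler_norm (- u)%R; rewrite normrN.
  have := normr_ge0 u; have := normr_ge0 v.
  by move=> *; rewrite ler_norml; apply/andP; split; lra.
have xb0 := normr_ge0 x.
have cn : (`|c| <= 1)%R by rewrite ger0_norm //; lra.
have dn : (`|d| <= 2)%R by rewrite ger0_norm //; lra.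
have d2 : (`|d^-1| <= 1)%R by rewrite normfV invf_le1 ger0_norm //; lra.
have pr (a b e1 e2 : R) : (`|a| <= e1 -> `|b| <= e2 -> `|a * b| <= e1 * e2)%R.
  by move=> h1 h2; rewrite normrM ler_pM.
have := pr _ _ _ _ xb cn; have := pr _ _ _ _ xb dn => p1 p2.
apply/and4P; split; rewrite /=.
- by apply: le_trans (ler_normD _ _) _; lra.
- by lra.
- by lra.
- by lra.
Qed.

Let int_ind (a b : R) : (a <= b)%R -> \int[leb]_x ((\1_(`[a, b]%classic : set mR) x)%:E) = (b - a)%:E.
Proof.
move=> ab; rewrite integral_indic // setIT.
rewrite [LHS](_ : _ = lebesgue_measure (`[a, b]%classic : set R)) // lebesgue_measure_itv /= lte_fin.
move: ab; rewrite le_eqVlt => /orP[/eqP ->|->]; last by rewrite EFinB.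
by rewrite ltxx subrr.
Qed.

Lemma box_lower (s a : R) (F : mR -> mR -> mR -> R) (u v : R) : (0 < s)%R -> (0 <= a)%R ->
  (forall c d x, 0 <= F c d x)%R ->
  (forall c d, (0 <= c <= s)%R -> (1 <= d <= 1 + s)%R ->
     a%:E <= \int[leb]_x ((\1_(`[u, v]%classic : set mR) x * F c d x)%:E)) ->
  (s ^+ 2 * a)%:E <= \int[leb]_c \int[leb]_d \int[leb]_x ((\1_(`[0%R, s]%classic : set mR) c *
     (\1_(`[1%R, (1 + s)%R]%classic : set mR) d * (\1_(`[u, v]%classic : set mR) x * F c d x)))%:E).
Proof.
move=> s0 a0 F0 aF.
have mI (p q : R) : measurable_fun setT (fun x : mR => ((\1_(`[p, q]%classic : set mR) x) : R)%:E).
  by apply: mE; apply: measurable_indic; exact: measurable_itv.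
have I0 (p q : R) (x : mR) : 0 <= ((\1_(`[p, q]%classic : set mR) x) : R)%:E by rewrite lee_fin.
apply: (@le_trans _ _ (\int[leb]_c ((s * a)%:E * (\1_(`[0%R, s]%classic : set mR) c)%:E))).
  rewrite int_scale //; last by rewrite mulr_ge0 // ltW.
  by rewrite int_ind ?(ltW s0) // subr0 -EFinM lee_fin le_eqVlt; apply/orP; left; apply/eqP; ring.
apply: le_int => c; first by rewrite mule_ge0 // lee_fin mulr_ge0 // ltW.
rewrite [in leLHS]indicE; have [cs|_] := boolP (c \in _); last first.
  by rewrite mule0; do 2 (apply: integral_ge0 => ? _); rewrite lee_fin !mulr_ge0.
rewrite mule1.
apply: (@le_trans _ _ (\int[leb]_d (a%:E * (\1_(`[1%R, (1 + s)%R]%classic : set mR) d)%:E))).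
  rewrite int_scale // int_ind; last by rewrite lerDl ltW.
  by rewrite -EFinM lee_fin le_eqVlt; apply/orP; left; apply/eqP; ring.
apply: le_int => d; first by rewrite mule_ge0 // lee_fin.
rewrite [in leLHS]indicE; have [ds|_] := boolP (d \in _); last first.
  by rewrite mule0; apply: integral_ge0 => ? _; rewrite lee_fin !mulr_ge0.
rewrite mule1 (le_trans (aF c d _ _)) //.
- by move: cs; rewrite inE /= in_itv.
- by move: ds; rewrite inE /= in_itv.
- by apply: le_int => x; rewrite lee_fin ?mulr_ge0 // [in leRHS]indicE cs [in leRHS]indicE ds !mul1r.
Qed.

(** Otherwise [gint_cover] would give measure 0 to a box of positive volume. *)
Lemma vol_gt0 : (0 < @vol R)%R.
Proof.
rewrite lt_neqAle vol_ge0 andbT eq_sym; apply/eqP => V0.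
have [K K0 hK] := @gint_cover R 4.
have := hK (fun=> 1%R) (mcst _) (fun=> ler01); rewrite -(EFin_aint (autom_cst 1%R)) // -/vol V0 mule0.
move=> /(_ (fun _ _ _ _ => erefl)); apply/negP; rewrite -ltNge.
have s01 : ((0 < 1 :> R) && (1 <= 1 :> R))%R by apply/andP; split; lra.
apply: lt_le_trans (haar_box (u := 0%R) (v := 1%R) s01 _ (mcst _) _) => //; last by rewrite normr0 normr1; lra.
apply: lt_le_trans (box_lower (a := 1%R) (F := fun _ _ _ => 1%R) _ _ _ _) => //.
move=> c d _ _; under eq_integral do rewrite mulr1.
by rewrite int_ind // subr0.
Qed.

Definition mean f : R := (aint f / vol)%R.

Lemma aint_sum n (F : nat -> M -> R) : (forall i, autom (F i)) -> (forall i g, 0 <= F i g)%R ->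
  aint (fun g => \sum_(i < n) F i g)%R = (\sum_(i < n) aint (F i))%R.
Proof.
move=> aF F0; elim: n => [|n IH].
  rewrite big_ord0 (_ : (fun g => _) = fun g => 0 * F 0%N g)%R; last by apply/funext => x; rewrite big_ord0 mul0r.
  by rewrite aintZ // mul0r.
rewrite big_ord_recr /= -IH -aintD //; last 2 first.
- exact: autom_sum.
- by move=> g; apply: sumr_ge0.
by congr aint; apply/funext => x; rewrite big_ord_recr.
Qed.

Lemma aint_avg f N : autom f -> (forall g, 0 <= f g)%R -> (0 < N)%N -> aint (avg f N) = aint f.
Proof.
move=> af f0 N0.
have aF i : autom (fun g => f (mulm g (upm i%:R))) by apply: autom_trans => //; exact: detm_upm.
have F0 (i : nat) g : (0 <= f (mulm g (upm i%:R)))%R by [].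
rewrite /avg aintZ ?invr_ge0 //; last 2 first.
- exact: (autom_sum N aF).
- by move=> g; exact: sumr_ge0.
rewrite (aint_sum N aF F0).
under eq_bigr do rewrite (aint_trans (detm_upm _) af f0).
rewrite sumr_const card_ord -(mulr_natl (aint f)) mulrA mulVf ?mul1r //.
by rewrite pnatr_eq0 -lt0n.
Qed.

Let sq_diff (F : M -> R) (p : M * M) : R := (F p.2 - F p.1) ^+ 2.

Let sq0 (F : M -> R) p : (0 <= sq_diff F p)%R.
Proof. exact: sqr_ge0. Qed.

Let msq (F : M -> R) : measurable_fun setT F -> measurable_fun setT (sq_diff F).
Proof. by move=> mF; apply: mX; apply: mD; [|apply: mN]; apply: (mcomp mF); [exact: msnd|exact: mfst]. Qed.

Let redb (C : R) (g : M) : bool := reduced g && mbound C g.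

Let mredb C : measurable_fun setT (redb C).
Proof. by apply: measurable_and; [exact: measurable_reduced|exact: measurable_mbound]. Qed.

Lemma haar_mbound_fin (C : R) : haar (fun g : M => ((mbound C g)%:R : R)%:E) < +oo.
Proof.
have [K K0 hK] := @gint_cover R C.
have := hK (fun=> 1%R) (mcst _) (fun=> ler01) (fun _ _ _ _ => erefl).
rewrite (_ : (fun g => (1 * _)%:E) = fun g : M => ((mbound C g)%:R : R)%:E); last first.
  by apply/funext => g; rewrite mul1r.
move=> h; apply: le_lt_trans h _; rewrite -(EFin_aint (autom_cst 1%R)) // -EFinM; exact: ltry.
Qed.

Let b2 (b c : bool) : ((b%:R : R) * c%:R = (b && c)%:R)%R.
Proof. by case: b; case: c; rewrite ?mulr0 ?mulr1. Qed.

(* Substituting k -> g k in the inner integral and exchanging the integrals. *)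
Lemma double_integral_le (C s : R) (F : M -> R) : autom F -> (0 <= s)%R ->
  (forall k, detm k = 1%R -> nrm (fun g => F (mulm g k) - F g)%R <= s)%R ->
  haar (fun g => haar (fun k => (sq_diff F (g, k) * (redb C g)%:R * (redb C k)%:R)%:E)) <=
  (s ^+ 2)%:E * haar (fun g : M => ((mbound (2 * C * C) g)%:R : R)%:E).
Proof.
move=> aF s0 sF; have [mF _ FG] := aF.
pose A (p : M * M) : \bar R := (sq_diff F p * (redb C p.1)%:R * (redb C p.2)%:R)%:E.
pose A' (p : M * M) : \bar R := ((F (mulm p.1 p.2) - F p.1) ^+ 2 * (reduced p.1)%:R * (mbound (2 * C * C) p.2)%:R)%:E.
have mFm : measurable_fun setT (fun p : M * M => F (mulm p.1 p.2)) by apply: (mcomp mF); rewrite /mulm; mfun.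
have mb (b : M -> bool) : measurable_fun setT b -> measurable_fun setT (fun p : M * M => (b p.1)%:R : R) /\ measurable_fun setT (fun p : M * M => (b p.2)%:R : R).
  by move=> /measurable_bool mb; split; apply: (mcomp mb); [exact: mfst|exact: msnd].
have mA : measurable_fun setT A.
  by apply: mE; apply: mM; [apply: mM; [exact: msq|exact: (mb _ (mredb C)).1]|exact: (mb _ (mredb C)).2].
have mA' : measurable_fun setT A'.
  apply: mE; apply: mM; [apply: mM|exact: (mb _ (measurable_mbound _)).2]; last exact: (mb _ measurable_reduced).1.
  by apply: mX; apply: mD => //; apply: mN; apply: (mcomp mF); exact: mfst.
have A0 p : 0 <= A p by rewrite lee_fin mulr_ge0 // mulr_ge0 // sq0.
have A'0 p : 0 <= A' p by rewrite lee_fin mulr_ge0 // mulr_ge0 // sqr_ge0.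
have sec (B : M * M -> \bar R) (g : M) : measurable_fun setT B -> measurable_fun setT (fun k => B (g, k)).
  by move=> mB; apply: (mcomp mB); apply: mpair; [exact: mcst|exact: mid].
have sec2 (B : M * M -> \bar R) (k : M) : measurable_fun setT B -> measurable_fun setT (fun g => B (g, k)).
  by move=> mB; apply: (mcomp mB); apply: mpair; [exact: mid|exact: mcst].
have h0 (B : M * M -> \bar R) g : (forall p, 0 <= B p) -> 0 <= haar (fun k => B (g, k)).
  by move=> B0; apply: integral_ge0.
rewrite [leLHS](_ : _ = haar (fun g => haar (fun k => A (g, k)))) //.
apply: (@le_trans _ _ (haar (fun g => haar (fun k => A' (g, k))))).
  apply: (le_haar (measurable_haar mA A0) (measurable_haar mA' A'0) (fun g => h0 A g A0) (fun g => h0 A' g A'0)).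
  move=> g Dg; rewrite -(haar_mull Dg (sec A g mA) (fun k => A0 _)).
  have mAg := mcomp (sec A g mA) (measurable_mulml g).
  apply: (le_haar mAg (sec A' g mA') (fun k => A0 _) (fun k => A'0 _)) => k Dk.
  rewrite lee_fin /sq_diff /=; have := sqr_ge0 (F (mulm g k) - F g)%R.
  move: ((F (mulm g k) - F g) ^+ 2)%R => q q0; rewrite -!mulrA ler_wpM2l //.
  rewrite !b2 ler_nat /redb; case: (boolP (reduced g)) => //= rg.
  case: (boolP (mbound C g)) => //= bg; case: (boolP (reduced (mulm g k))) => //= _.
  case: (boolP (mbound C _)) => //= bk.
  have -> : k = mulm (invm g) (mulm g k) by rewrite mulmA mulVm // mul1m.
  by rewrite mulrA (mbound_mul (mbound_inv bg) bk).
rewrite (haar_swap mA' A'0).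
have mk := measurable_bool (@measurable_mbound R (2 * C * C)%R).
rewrite -haarZl ?sqr_ge0 //; last by exact: mE.
have m1 : measurable_fun setT (fun k => haar (fun g => A' (g, k))).
  have mA'' : measurable_fun setT (fun p : M * M => A' (p.2, p.1)).
    by apply: (mcomp mA'); apply: mpair; [exact: msnd|exact: mfst].
  exact: (measurable_haar mA'' (fun p => A'0 _)).
apply: (le_haar m1) => [||k|k Dk].
- by apply: mMe; [exact: mcst|exact: mE].
- by move=> k; apply: integral_ge0.
- by rewrite mule_ge0 // lee_fin ?sqr_ge0.
have aT : autom (fun g => F (mulm g k) - F g)%R by apply: automB => //; exact: autom_trans.
have [mT _ _] := autom_sq aT.
rewrite (_ : (fun g => A' (g, k)) = fun g => ((mbound (2 * C * C) k)%:R : R)%:E * ((F (mulm g k) - F g) ^+ 2 * (reduced g)%:R)%:E); last first.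
  by apply/funext => g; rewrite -EFinM /A' /= mulrC.
rewrite haarZl //; last 2 first.
- by apply: mE; apply: mM => //; exact: measurable_bool measurable_reduced.
- by move=> g; rewrite lee_fin mulr_ge0 // sqr_ge0.
rewrite muleC lee_wpmul2r // ?lee_fin //.
rewrite -[haar _]/(gint (fun g => (F (mulm g k) - F g) ^+ 2)%R) -EFin_aint //; last 2 first.
- exact: autom_sq.
- by move=> g; exact: sqr_ge0.
by rewrite -nrm_sq lee_fin ler_pXn2r ?nnegrE ?nrm_ge0 ?sF.
Qed.

(** If the lower row is not short, the identity [row1sq * row2sq = 1 + rowdot^2] bounds the upper
    row as well: a reduced matrix is large only high in the cusp. *)
Lemma reduced_mbound (s : R) g : (0 < s)%R -> detm g = 1%R -> reduced g ->
  ~~ mbound (s^-1 + 2) g -> box2 s g.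
Proof.
move=> s0 Dg rg nb; apply/negPn/negP => nbx; case/negP: nb.
have S0 := row2sq_gt0 Dg; have S2 := reduced_row2 Dg rg; have I := row_identity Dg.
have /andP[r1 r2] := rg.
have dS : (rowdot g ^+ 2 <= row2sq g ^+ 2 / 4)%R.
  by rewrite -real_normK ?num_real //; have := normr_ge0 (rowdot g); nra.
have Ss : (s ^+ 2 < row2sq g)%R.
  have sq (x : R) : (~~ (`|x| <= s) -> s ^+ 2 < x ^+ 2)%R.
    by rewrite -ltNge => xs; rewrite -(real_normK (num_real x)) ltr_pXn2r ?nnegrE ?(ltW s0).
  have c2 := sqr_ge0 g.2.1; have d2 := sqr_ge0 g.2.2.
  by move: nbx; rewrite /box2 negb_and /row2sq => /orP[] /sq; lra.
have s2 : (0 < s ^+ 2)%R by rewrite exprn_gt0.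
have R1 : (row1sq g <= s ^- 2 + 1)%R.
  rewrite -(ler_pM2r S0) I mulrDl mul1r.
  have : (1 <= s ^- 2 * row2sq g)%R by rewrite mulrC ler_pdivlMr // mul1r ltW.
  nra.
have R2 : (row2sq g <= s ^- 2 + 1)%R by exact: le_trans r2 R1.
have si : (0 < s^-1)%R by rewrite invr_gt0.
have bd (x : R) : (x ^+ 2 <= s ^- 2 + 1 -> `|x| <= s^-1 + 2)%R.
  move=> xs; rewrite -(@ler_pXn2r _ 2) ?nnegrE //; last by rewrite addr_ge0 // ltW.
  rewrite real_normK ?num_real //; apply: le_trans xs _; rewrite -exprVn; nra.
have sq := @sqr_ge0 R.
apply/and4P; split; apply: bd.
- by apply: le_trans R1; rewrite lerDl sq.
- by apply: le_trans R1; rewrite lerDr sq.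
- by apply: le_trans R2; rewrite lerDl sq.
- by apply: le_trans R2; rewrite lerDr sq.
Qed.

Lemma cusp_complement (s : R) : (0 < s)%R ->
  haar (fun g : M => ((reduced g && ~~ mbound (s^-1 + 2) g)%:R : R)%:E) <= (4 * s ^+ 2)%:E.
Proof.
move=> s0; apply: le_trans (cusp_volume (ltW s0)).
have m1 : measurable_fun setT (fun g : M => (reduced g && ~~ mbound (s^-1 + 2) g)).
  apply: measurable_and; [exact: measurable_reduced|].
  by apply: measurable_neg; exact: measurable_mbound.
have m2 : measurable_fun setT (fun g : M => (reduced g && box2 s g)).
  by apply: measurable_and; [exact: measurable_reduced|exact: measurable_box2].
have p1 (g : M) : 0 <= ((reduced g && ~~ mbound (s^-1 + 2) g)%:R : R)%:E by rewrite lee_fin.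
have p2 (g : M) : 0 <= ((reduced g && box2 s g)%:R : R)%:E by rewrite lee_fin.
apply: (le_haar (mE (measurable_bool m1)) (mE (measurable_bool m2)) p1 p2) => g Dg.
rewrite lee_fin ler_nat; case: (boolP (reduced g)) => //= rg; case: (boolP (mbound _ _)) => //= nb.
by rewrite (reduced_mbound s0 Dg rg nb).
Qed.

(** Integrating the square in the second variable gives the function [G], which is integrated in
    turn. Since [aint] is additive on nonnegative functions, the cross terms stand on the other side
    of the equations. *)
Lemma variance_double (F : M -> R) : autom F -> (forall g, 0 <= F g)%R ->
  (2 * vol * aint (fun g => (F g - mean F) ^+ 2)%R)%:E =
  haar (fun g => haar (fun k => (sq_diff F (g, k) * (reduced g)%:R * (reduced k)%:R)%:E)).
Proof.
move=> aF F0; have V0 := vol_gt0; have [mF _ _] := aF.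
set a := aint F; set b := aint (fun g => F g ^+ 2)%R.
have c0 (c : R) g : (0 <= (c - F g) ^+ 2)%R by exact: sqr_ge0.
have aC (c : R) : autom (fun g => (F g - c) ^+ 2)%R by apply: autom_sq; apply: automB => //; exact: autom_cst.
have aC0 (c : R) g : (0 <= (F g - c) ^+ 2)%R by exact: sqr_ge0.
have s0 g : (0 <= F g ^+ 2)%R by exact: sqr_ge0.
have key (c : R) : (0 <= c)%R -> (aint (fun g => (F g - c) ^+ 2) + 2 * c * a = b + c ^+ 2 * vol)%R.
  move=> cp; have c2 : (0 <= 2 * c)%R by rewrite mulr_ge0.
  have q1 g : (0 <= 2 * c * F g)%R by rewrite mulr_ge0.
  rewrite /a -aintZ // -aintD //; last exact: automZ.
  rewrite -aint_cst ?sqr_ge0 // /b -aintD //; last 3 first.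
  - exact: autom_sq.
  - exact: autom_cst.
  - by move=> g; exact: sqr_ge0.
  by congr aint; apply/funext => g; ring.
have mean0 : (0 <= mean F)%R by apply: divr_ge0; [exact: aint_ge0|exact: ltW].
have am : (a = mean F * vol)%R by rewrite /mean divfK // gt_eqF.
have E1 : (aint (fun g => (F g - mean F) ^+ 2) = b - a * mean F)%R.
  by have := key _ mean0; rewrite am; move: (aint _) => x h; nra.
pose G g : R := (b - 2 * a * F g + vol * F g ^+ 2)%R.
have GE g : (G g = aint (fun k => (F k - F g) ^+ 2))%R.
  by have := key _ (F0 g); rewrite /G; move: (aint _) => x h; nra.
have G0 g : (0 <= G g)%R by rewrite GE aint_ge0.
have aG : autom G.
  apply: automD; last by apply: automZ; exact: autom_sq.
  by apply: automB; [exact: autom_cst|exact: automZ].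
transitivity (gint G); last first.
  congr haar; apply/funext => g; rewrite EFinM GE EFin_aint // muleC /gint -haarZl //.
  - by congr haar; apply/funext => k; rewrite -EFinM /sq_diff /=; congr EFin; ring.
  - by have [mc _ _] := aC (F g); apply: mE; apply: mM => //; exact: measurable_bool measurable_reduced.
  - by move=> k; rewrite lee_fin mulr_ge0.
rewrite -EFin_aint //; congr EFin.
have : (aint G + 2 * a * a = b * vol + vol * b)%R.
  have a0 : (0 <= a)%R by rewrite aint_ge0.
  have b0 : (0 <= b)%R by rewrite aint_ge0.
  have q1 g : (0 <= 2 * a * F g)%R by rewrite !mulr_ge0.
  have q2 g : (0 <= vol * F g ^+ 2)%R by rewrite !mulr_ge0 // ltW.
  rewrite {2}/a -aintZ ?mulr_ge0 // -aintD //; last exact: automZ.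
  rewrite -aint_cst // {2}/b -aintZ ?(ltW V0) //; last exact: autom_sq.
  rewrite -aintD //; last 2 first.
  - exact: autom_cst.
  - by apply: automZ; exact: autom_sq.
  by congr aint; apply/funext => g; rewrite /G; ring.
by rewrite E1; move: (aint G) => x; rewrite am; nra.
Qed.

(** The variance of an average is a double integral of squared differences. On the bounded part of
    the domain two points differ by a bounded matrix, and [avg_almost_inv] applies through
    [double_integral_le]; the rest has small measure by [cusp_complement]. *)
Lemma avg_mean f : autom f -> ucont f -> (forall g, 0 <= f g)%R ->
  forall e : R, (0 < e)%R -> exists2 N0 : nat, (0 < N0)%N &
  forall N, (N0 <= N)%N -> (aint (fun g => `|avg f N g - mean f|) <= e)%R.
Proof.
move=> af uf f0 e e0; have [_ [B fB] _] := af.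
have V0 := vol_gt0.
have B0 : (0 <= B)%R := le_trans (normr_ge0 _) (fB idm).
(* At the end [|x| <= eta + eta^-1 x^2] turns the variance into an L^1 bound; [eta * vol] and
   [eta^-1 * e2] are both [e / 2]. *)
pose eta := (e / (2 * vol))%R; have eta0 : (0 < eta)%R by rewrite divr_gt0 // mulr_gt0.
pose e2 := (eta * (e / 2))%R; have e20 : (0 < e2)%R by rewrite mulr_gt0 // divr_gt0.
pose r := Num.sqrt (e2 / (4 * B ^+ 2 + 1) / 4)%R.
have D0 : (0 < 4 * B ^+ 2 + 1)%R by rewrite ltr_wpDl // mulr_ge0 // sqr_ge0.
have r0 : (0 < r)%R by rewrite sqrtr_gt0 divr_gt0 // divr_gt0.
have r2 : (4 * r ^+ 2 = e2 / (4 * B ^+ 2 + 1))%R.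
  by rewrite sqr_sqrtr; [rewrite mulrCA divff ?mulr1 // pnatr_eq0|rewrite ltW // divr_gt0 // divr_gt0].
pose C := (r^-1 + 2)%R.
have Hf := haar_mbound_fin (2 * C * C).
set H := haar (fun g : M => ((mbound (2 * C * C) g)%:R : R)%:E) in Hf.
have H0 : 0 <= H by apply: integral_ge0 => ? _; rewrite lee_fin.
have HE : (fine H)%:E = H by rewrite fineK // ge0_fin_numE.
have h0 : (0 <= fine H)%R by exact: fine_ge0.
pose s := Num.sqrt (e2 * vol / (fine H + 1))%R.
have Hp : (0 < fine H + 1)%R by rewrite ltr_wpDl.
have s0 : (0 < s)%R by rewrite sqrtr_gt0 divr_gt0 // mulr_gt0.
have s2 : (s ^+ 2 * fine H <= e2 * vol)%R.
  have ev : (0 < e2 * vol)%R by rewrite mulr_gt0.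
  by rewrite sqr_sqrtr ?(ltW (divr_gt0 ev Hp)) // mulrAC ler_pdivrMr // ler_wpM2l ?lerDl // ltW.
have [N0 N00 hN] := avg_almost_inv af uf s0.
exists N0 => // N NN.
pose F := avg f N; have aF : autom F := autom_avg af N.
have F0 g : (0 <= F g)%R by rewrite mulr_ge0 ?invr_ge0 // sumr_ge0.
have FB g : (`|F g| <= B)%R := avg_bound fB N g.
have mE' : mean f = mean F by rewrite /mean /F aint_avg // (leq_trans N00).
rewrite mE'.
have [mF _ _] := aF.
have var : (aint (fun g => (F g - mean F) ^+ 2) <= e2)%R.
  rewrite -(@ler_pM2l _ (2 * vol)) ?mulr_gt0 // -lee_fin variance_double //.
  pose W (g : M) : R := (reduced g && ~~ mbound C g)%:R.
  have mW : measurable_fun setT W.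
    apply: measurable_bool; apply: measurable_and; [exact: measurable_reduced|].
    by apply: measurable_neg; exact: measurable_mbound.
  pose rr (g : M) : R := (reduced g)%:R.
  have mr : measurable_fun setT rr by exact: measurable_bool measurable_reduced.
  have mrb := measurable_bool (mredb C).
  have w0 g : (0 <= W g)%R by [].
  have rr0 g : (0 <= rr g)%R by [].
  have pt g k : (sq_diff F (g, k) * rr g * rr k <=
     sq_diff F (g, k) * (redb C g)%:R * (redb C k)%:R + (B ^+ 2 * W g * rr k + B ^+ 2 * rr g * W k))%R.
    have q0 : (0 <= sq_diff F (g, k))%R by exact: sqr_ge0.
    have qB : (sq_diff F (g, k) <= B ^+ 2)%R.
      have := F0 g; have := F0 k; have := FB g; have := FB k; rewrite !ler_norml /sq_diff /=.
      move=> /andP[_ h1] /andP[_ h2] h3 h4; nra.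
    rewrite /W /rr /redb; case: (reduced g); case: (reduced k); case: (mbound C g); case: (mbound C k);
      rewrite /= ?mulr1 ?mulr0 ?mul0r ?addr0 ?add0r ?lexx //; have := sqr_ge0 B; lra.
  have E3 : (fun g => haar (fun k => (B ^+ 2 * W g * rr k + B ^+ 2 * rr g * W k)%:E)) =
      fun g => (B ^+ 2 * W g)%:E * haar (fun k => (rr k)%:E) + (B ^+ 2 * rr g)%:E * haar (fun k => (W k)%:E).
    apply/funext => g; rewrite -!haarZl ?mulr_ge0 ?sqr_ge0 //; try exact: mE.
    rewrite /haar -int_add.
    - by apply: eq_integral => p _; rewrite -!EFinM -EFinD.
    - by apply: mMe; [exact: mcst|exact: (mcomp (mE mr) measurable_haar_coord)].
    - by apply: mMe; [exact: mcst|exact: (mcomp (mE mW) measurable_haar_coord)].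
    - by move=> p; apply: mule_ge0; rewrite lee_fin // mulr_ge0 ?sqr_ge0.
    - by move=> p; apply: mule_ge0; rewrite lee_fin // mulr_ge0 ?sqr_ge0.
  have hr : haar (fun k => (rr k)%:E) = vol%:E.
    rewrite EFin_aint //; last exact: autom_cst.
    by congr haar; apply/funext => g; rewrite mul1r.
  have hW : haar (fun k => (W k)%:E) <= (4 * r ^+ 2)%:E := cusp_complement r0.
  have hW0 : 0 <= haar (fun k => (W k)%:E) by apply: integral_ge0 => ? _; rewrite lee_fin.
  have hWf : (fine (haar (fun k => (W k)%:E)))%:E = haar (fun k => (W k)%:E).
    by rewrite fineK // ge0_fin_numE // (le_lt_trans hW) // ltry.
  pose A1 (p : M * M) : \bar R := (sq_diff F p * (redb C p.1)%:R * (redb C p.2)%:R)%:E.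
  pose A2 (p : M * M) : \bar R := (B ^+ 2 * W p.1 * rr p.2 + B ^+ 2 * rr p.1 * W p.2)%:E.
  pose A3 (p : M * M) : \bar R := (sq_diff F p * rr p.1 * rr p.2)%:E.
  have c1 (h : M -> R) : measurable_fun setT h -> measurable_fun setT (fun p : M * M => h p.1).
    by move=> mh; apply: (mcomp mh); exact: mfst.
  have c2 (h : M -> R) : measurable_fun setT h -> measurable_fun setT (fun p : M * M => h p.2).
    by move=> mh; apply: (mcomp mh); exact: msnd.
  have mA1 : measurable_fun setT A1 := mE (mM (mM (msq mF) (c1 _ mrb)) (c2 _ mrb)).
  have mA2 : measurable_fun setT A2 := mE (mD (mM (mM (mcst (B ^+ 2)%R) (c1 _ mW)) (c2 _ mr)) (mM (mM (mcst (B ^+ 2)%R) (c1 _ mr)) (c2 _ mW))).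
  have mA3 : measurable_fun setT A3 := mE (mM (mM (msq mF) (c1 _ mr)) (c2 _ mr)).
  have p1 p : 0 <= A1 p by rewrite lee_fin mulr_ge0 // mulr_ge0 // sq0.
  have p2 p : 0 <= A2 p by rewrite lee_fin addr_ge0 // !mulr_ge0 ?sqr_ge0.
  have p3 p : 0 <= A3 p by rewrite lee_fin mulr_ge0 // mulr_ge0 // sq0.
  have sec (D : M * M -> \bar R) (g : M) : measurable_fun setT D -> measurable_fun setT (fun k => D (g, k)).
    by move=> mB; apply: (mcomp mB); apply: mpair; [exact: mcst|exact: mid].
  have hge0 (D : M * M -> \bar R) g : (forall p, 0 <= D p) -> 0 <= haar (fun k => D (g, k)).
    by move=> D0'; apply: integral_ge0.
  have hadd (f1 f2 : M -> \bar R) : measurable_fun setT f1 -> measurable_fun setT f2 -> (forall g, 0 <= f1 g) ->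
      (forall g, 0 <= f2 g) -> haar (fun g => f1 g + f2 g) = haar f1 + haar f2.
    by move=> m1 m2 q1 q2; rewrite /haar int_add //; exact: (mcomp _ measurable_haar_coord).
  rewrite [leLHS](_ : _ = haar (fun g => haar (fun k => A3 (g, k)))) //.
  apply: (@le_trans _ _ (haar (fun g => haar (fun k => A1 (g, k)) + haar (fun k => A2 (g, k))))).
    apply: (le_haar (measurable_haar mA3 p3)) => [||g|g Dg].
    - by apply: emeasurable_funD; exact: measurable_haar.
    - by move=> g; exact: hge0.
    - by rewrite adde_ge0 // hge0.
    rewrite -hadd //; try exact: sec.
    apply: (le_haar (sec _ g mA3)) => [|k|k|k Dk] //.
    - by apply: emeasurable_funD; exact: sec.
    - by rewrite adde_ge0.
    - by rewrite -EFinD lee_fin; exact: pt.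
  rewrite hadd; try (by apply: measurable_haar); try (by move=> g; exact: hge0).
  have -> : (2 * vol * e2 = e2 * vol + e2 * vol)%R by ring.
  rewrite EFinD; apply: leeD.
    apply: le_trans (@double_integral_le C s F aF (ltW s0) (fun k Dk => hN N k NN Dk)) _.
    by rewrite -/H -HE -EFinM lee_fin.
  rewrite [X in haar X](_ : _ = fun g => (B ^+ 2 * W g)%:E * haar (fun k => (rr k)%:E) + (B ^+ 2 * rr g)%:E * haar (fun k => (W k)%:E)); last exact: E3.
  rewrite hr -hWf.
  have -> : (fun g => (B ^+ 2 * W g)%:E * vol%:E + (B ^+ 2 * rr g)%:E * (fine (haar (fun k => (W k)%:E)))%:E) =
     fun g => (B ^+ 2 * vol)%:E * (W g)%:E + (B ^+ 2 * fine (haar (fun k => (W k)%:E)))%:E * (rr g)%:E.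
    by apply/funext => g; rewrite -!EFinM -!EFinD; congr EFin; ring.
  have w1 : (0 <= fine (haar (fun k => (W k)%:E)))%R by exact: fine_ge0.
  have v1 : (0 <= vol :> R)%R by exact: ltW.
  rewrite hadd //; last 4 first.
  - by apply: mMe; [exact: mcst|exact: mE].
  - by apply: mMe; [exact: mcst|exact: mE].
  - by move=> g; apply: mule_ge0; rewrite lee_fin // mulr_ge0 ?sqr_ge0.
  - by move=> g; apply: mule_ge0; rewrite lee_fin // mulr_ge0 ?sqr_ge0.
  rewrite !haarZl ?mulr_ge0 ?sqr_ge0 //; try exact: mE.
  rewrite hr -hWf -!EFinM -EFinD lee_fin.
  have : (fine (haar (fun k => (W k)%:E)) <= 4 * r ^+ 2)%R by rewrite -lee_fin hWf.
  rewrite r2 ler_pdivlMr //; move: (fine _) w1 => w w1 hw /=.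
  exact: weighted_le.
have aFm : autom (fun g => F g - mean F)%R by apply: automB => //; exact: autom_cst.
have ei : (0 <= eta^-1)%R by rewrite invr_ge0 ltW.
have q0 g : (0 <= eta^-1 * (F g - mean F) ^+ 2)%R by rewrite mulr_ge0 // sqr_ge0.
apply: (@le_trans _ _ (aint (fun g => eta + eta^-1 * (F g - mean F) ^+ 2)%R)).
  apply: le_aint.
  - exact: autom_norm.
  - by apply: automD; [exact: autom_cst|apply: automZ; exact: autom_sq].
  - by [].
  - by move=> g; rewrite addr_ge0 // ltW.
  - move=> g _; rewrite -(real_normK (num_real (F g - mean F))).
    move: `|F g - mean F|%R => x; rewrite (_ : (_ + _ = (eta ^+ 2 + x ^+ 2) / eta)%R); last by field; rewrite gt_eqF.
    by rewrite ler_pdivlMr //; nra.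
rewrite aintD; last 4 first.
- exact: autom_cst.
- by apply: automZ; exact: autom_sq.
- by move=> g; exact: ltW.
- exact: q0.
rewrite aint_cst ?(ltW eta0) // aintZ //; last 2 first.
- exact: autom_sq.
- by move=> g; exact: sqr_ge0.
have -> : (e = eta * vol + eta^-1 * e2)%R.
  by rewrite /e2 (mulKf (lt0r_neq0 eta0)) /eta; field; rewrite gt_eqF.
by rewrite lerD2l ler_wpM2l // invr_ge0 ltW.
Qed.
End ergodic_mean.

(** * Equidistribution of long horocycles by thickening *)

Section horocycles.
Context {R : realType}.
Local Notation mR := (measurableTypeR R).
Local Notation leb := (@lebesgue_measure R).
Local Notation M := ((mR * mR) * (mR * mR))%type.
Implicit Types (f h : M -> R) (k g : mat2 R).

(* Sends i to x + i / T. *)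
Definition hor (T x : R) : mat2 R := mulm (upm x) (diagm (Num.sqrt T)^-1).

Lemma detm_hor (T x : R) : 0 < T -> detm (hor T x) = 1.
Proof.
move=> T0; rewrite detm_mul detm_upm detm_diagm ?mulr1 //.
by rewrite invr_eq0 gt_eqF // sqrtr_gt0.
Qed.

Lemma measurable_hor (T : R) : measurable_fun setT (hor T : mR -> M).
Proof. rewrite /hor /mulm /upm /diagm; mfun. Qed.

Lemma bmeas_hor f T : autom f -> bmeas (fun x => f (hor T x)).
Proof.
by move=> [mf [B fB] _]; split; [exact: (mcomp mf (measurable_hor T))|exists B].
Qed.

(** With [t^2 = 1/T] and [c, d] near [0, 1], flowing a thickened point for time [j] moves [x] by
    nearly [j / T]; what remains on the right is a matrix near the identity, absorbed by [ucont]. *)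
Let thick (x c d t j : R) : t != 0 -> d != 0 -> d + c * (j * t ^+ 2) != 0 ->
  mulm (mulm (haar_coord (x, (c, d))) (diagm t)) (upm j) =
  mulm (mulm (upm (x + j * t ^+ 2 / (d * (d + c * (j * t ^+ 2))))) (diagm t))
       (((d + c * (j * t ^+ 2))^-1, 0), (c * t ^+ 2, d + c * (j * t ^+ 2))).
Proof.
move=> t0 d0 d1; rewrite /mulm /haar_coord /diagm /upm /=.
by congr ((_, _), (_, _)); field; rewrite ?t0 ?d0 ?d1.
Qed.

Lemma mean_bound f B : autom f -> (forall g, 0 <= f g <= B) -> 0 <= mean f <= B.
Proof.
move=> af fB; have V0 := @vol_gt0 R.
have f0 g : 0 <= f g by case/andP: (fB g).
have B0 : 0 <= B := le_trans (f0 idm) (proj2 (andP (fB idm))).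
rewrite /mean divr_ge0 ?aint_ge0 ?(ltW V0) //= ler_pdivrMr // -aint_cst //.
apply: le_aint => //; first exact: autom_cst.
by move=> g _; case/andP: (fB g).
Qed.

(** Each point of the arc is thickened to a box in [c] and [d]. There the integral along the arc
    hardly changes under the first [N] steps of the flow, so an excess [a] over the mean makes the
    integral of [|avg f N - mean f|] over the thickened arc at least [s^2 a], against [avg_mean]. *)
Lemma horo_upper f B b : autom f -> ucont f -> (forall g, 0 <= f g <= B) -> 0 <= b ->
  forall e : R, 0 < e -> exists2 T0 : R, 1 <= T0 &
  forall T u v, T0 <= T -> - b <= u -> u <= v -> v <= b -> itg u v (fun x => f (hor T x)) <= (v - u) * mean f + e.
Proof.
move=> af uf fB b0 e e0.
have f0 g : 0 <= f g by case/andP: (fB g).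
have B0 : 0 <= B := le_trans (f0 idm) (proj2 (andP (fB idm))).
have fBn g : `|f g| <= B by rewrite ger0_norm //; case/andP: (fB g).
have e3 : 0 < e / 3 by rewrite divr_gt0.
pose e1 := e / 3 / (2 * b + 1).
have e10 : 0 < e1 by rewrite divr_gt0 // ltr_wpDl // mulr_ge0.
have [d0 d00 hd] := uf _ e10.
pose s := Num.min (d0 / 2) 1.
have s0 : 0 < s by rewrite lt_min divr_gt0 //=.
have s1 : s <= 1 by rewrite ge_min lexx orbT.
have sd : 2 * s <= d0 by rewrite mulrC -ler_pdivlMr // ge_min lexx.
pose C := 2 + 4 * b.
have [K K0 hK] := @gint_cover R C.
(* Chosen so that [K * eta] is [s^2] times the allowed error [e / 3]. *)
pose eta := e / 3 * s ^+ 2 / K.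
have eta0 : 0 < eta by rewrite divr_gt0 // mulr_gt0 // exprn_gt0.
have [N N0 hN] := avg_mean af uf f0 eta0.
have NR : 0 < N%:R :> R by rewrite ltr0n.
exists (Num.max 1 (Num.max N%:R (2 * B * N%:R / (e / 3)))) => [|T u v]; first by rewrite le_max lexx.
rewrite !ge_max => /and3P[T1 TN TB] bu uv vb.
have uv0 : 0 <= v - u by rewrite subr_ge0.
have uvC : 2 + 2 * (`|u| + `|v|) <= C.
  have : `|u| <= b by rewrite ler_norml bu (le_trans uv vb).
  have : `|v| <= b by rewrite ler_norml vb (le_trans bu uv).
  by rewrite /C; lra.
have e1v : e1 * (v - u) <= e / 3.
  by rewrite /e1 mulrAC ler_pdivrMr ?ltr_wpDl ?mulr_ge0 // ler_wpM2l ?(ltW e3) //; lra.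
have T0 : 0 < T by exact: lt_le_trans T1.
have NT : N%:R / T <= 1 by rewrite ler_pdivrMr // mul1r.
have BT : 2 * B * (N%:R / T) <= e / 3 by rewrite mulrA ler_pdivrMr //; move: TB; rewrite ler_pdivrMr // [T * _]mulrC.
pose t := (Num.sqrt T)^-1.
have t0 : t != 0 by rewrite invr_eq0 gt_eqF // sqrtr_gt0.
have t2 : t ^+ 2 = T^-1 by rewrite exprVn sqr_sqrtr // ltW.
have Ti1 : T^-1 <= 1 by rewrite invf_le1.
have Ti0 : 0 < T^-1 by rewrite invr_gt0.
pose phi (x : mR) : R := f (hor T x); have bphi : bmeas phi := bmeas_hor T af.
set A := itg u v _.
have Dt : detm (diagm t) = 1 by exact: detm_diagm.
have aT : autom (fun g => avg f N (mulm g (diagm t)) - mean f).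
  by apply: automB; [apply: autom_trans => //; exact: autom_avg|exact: autom_cst].
pose h g : R := `|avg f N (mulm g (diagm t)) - mean f|.
have ah : autom h := autom_norm aT.
have hc (c d : R) : measurable_fun setT (fun x : mR => haar_coord (x, (c, d)) : M) by rewrite /haar_coord; mfun.
have bc (c d : R) h' : autom h' -> bmeas (fun x : mR => h' (haar_coord (x, (c, d)))).
  by move=> [mh [B' hB] _]; split; [exact: (mcomp mh (hc c d))|exists B'].
have key (c d : R) : 0 <= c <= s -> 1 <= d <= 1 + s ->
    A - 2 * (e / 3) - (v - u) * mean f <= itg u v (fun x => h (haar_coord (x, (c, d)))).
  move=> /andP[c0 cs] /andP[d1 ds].
  have aj (j : nat) : autom (fun g => f (mulm (mulm g (diagm t)) (upm j%:R))).
    have := autom_trans Dt (autom_trans (detm_upm j%:R) af); exact.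
  have each (j : nat) : (j < N)%N -> A - 2 * (e / 3) <= itg u v (fun x => f (mulm (mulm (haar_coord (x, (c, d))) (diagm t)) (upm j%:R))).
    move=> jN; set y := j%:R * t ^+ 2.
    have y0 : 0 <= y by rewrite mulr_ge0 // sqr_ge0.
    have yN : y <= N%:R / T by rewrite /y t2 ler_pM2r // ler_nat ltnW.
    have y1 : y <= 1 by exact: le_trans yN NT.
    have cy0 : 0 <= c * y by exact: mulr_ge0.
    have cy1 : c * y <= s by rewrite -[leRHS]mulr1 ler_pM.
    have d'1 : 1 <= d + c * y by rewrite -[leLHS]addr0 lerD.
    have dd : 1 <= d * (d + c * y) by rewrite -[leLHS]mulr1 ler_pM //.
    set z := y / (d * (d + c * y)).
    have z0 : 0 <= z by rewrite divr_ge0 // (le_trans ler01).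
    have zy : z <= y by rewrite /z ler_pdivrMr ?(lt_le_trans ltr01) // ler_peMr.
    have bz : bmeas (fun x : mR => phi (x + z)) by apply: bmeas_comp => //; mfun.
    apply: (@le_trans _ _ (itg u v (fun x => phi (x + z) - e1))).
      rewrite itgB //; last exact: bmeas_cst.
      rewrite itg_cst //.
      have := itg_move bphi uv z0 (fun x => fBn _); rewrite ler_norml => /andP[mv _].
      have Bz : 2 * B * z <= e / 3.
        apply: le_trans BT; rewrite ler_wpM2l ?mulr_ge0 //; exact: le_trans yN.
      by move: mv Bz e1v; rewrite -/A -[A]/(itg u v phi); clear; lra.
    apply: le_itg => [||x _]; [by apply: bmeasB => //; exact: bmeas_cst|exact: (bc c d _ (aj j))|].
    have dn0 : d != 0 by rewrite gt_eqF // (lt_le_trans ltr01).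
    have d'n0 : d + c * y != 0 by rewrite gt_eqF // (lt_le_trans ltr01).
    rewrite thick // -/y -/z.
    set k : mat2 R := (_, _).
    have Dk : detm k = 1 by rewrite /detm /k /= mul0r subr0 mulVf.
    have Dh : detm (mulm (upm (x + z)) (diagm t)) = 1 by rewrite detm_mul detm_upm Dt mulr1.
    have nk : nearm d0 k.
      have u1 : `|d + c * y - 1| <= d0 by rewrite ger0_norm ?subr_ge0 //; clear -ds cy1 sd; lra.
      have u2 : `|(d + c * y)^-1 - 1| <= d0.
        rewrite distrC ger0_norm; last by rewrite subr_ge0 invf_le1 // (lt_le_trans ltr01).
        have : (d + c * y)^-1 * (d + c * y) = 1 by rewrite mulVf.
        have : 0 < (d + c * y)^-1 by rewrite invr_gt0 (lt_le_trans ltr01).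
        move: (d + c * y) d'1 u1 => p p1; rewrite ger0_norm ?subr_ge0 // => u1; move: p^-1 => q q0 pq; clear -p1 u1 q0 pq; nra.
      apply/and4P; split; rewrite /= ?normr0 ?(ltW d00) //.
      rewrite t2 ger0_norm; last by rewrite mulr_ge0 // ltW.
      by apply: (@le_trans _ _ (s * 1)); [rewrite ler_pM // ltW|clear -sd s0; lra].
    have := hd _ _ Dh Dk nk; rewrite distrC ler_norml => /andP[_]; by rewrite /phi /hor -/t lerBlDr -lerBlDl.
  have avE x : avg f N (mulm (haar_coord (x, (c, d))) (diagm t)) =
      N%:R^-1 * \sum_(j < N) f (mulm (mulm (haar_coord (x, (c, d))) (diagm t)) (upm j%:R)) by [].
  have bF (j : nat) : bmeas (fun x : mR => f (mulm (mulm (haar_coord (x, (c, d))) (diagm t)) (upm j%:R))).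
    exact: (bc c d _ (aj j)).
  have bS := bmeas_sum N bF.
  have low : A - 2 * (e / 3) <= itg u v (fun x => avg f N (mulm (haar_coord (x, (c, d))) (diagm t))).
    rewrite [leRHS](_ : _ = itg u v (fun x => N%:R^-1 * \sum_(j < N) f (mulm (mulm (haar_coord (x, (c, d))) (diagm t)) (upm j%:R)))) //.
    rewrite itgZ // (itg_sum N _ _ bF) [leRHS]mulrC ler_pdivlMr // mulr_natr -[N in leLHS]card_ord -sumr_const.
    by apply: ler_sum => j _; exact: each.
  have bA : bmeas (fun x : mR => avg f N (mulm (haar_coord (x, (c, d))) (diagm t))).
    by apply: (bc c d (fun g => avg f N (mulm g (diagm t)))); apply: autom_trans => //; exact: autom_avg.
  have bh := bc c d _ ah.
  rewrite lerBlDr; apply: le_trans low _.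
  have -> : (v - u) * mean f = itg u v (fun=> mean f) by rewrite itg_cst // mulrC.
  rewrite -itgD //; last exact: bmeas_cst.
  apply: le_itg => // [|x _]; first by apply: bmeasD => //; exact: bmeas_cst.
  by rewrite -lerBlDr /h; exact: ler_norm.
set a := A - 2 * (e / 3) - (v - u) * mean f in key.
suff : a <= e / 3 by rewrite /a; lra.
have [a0|a0] := leP a 0; first exact: le_trans a0 (ltW e3).
have h0 g : 0 <= h g by exact: normr_ge0.
have s01 : (0 < s) && (s <= 1) by rewrite s0.
have [mh _ hG] := ah.
have := box_lower (F := fun c d x => h (haar_coord (x, (c, d)))) (u := u) (v := v) s0 (ltW a0) (fun _ _ _ => h0 _).
have lo c d : 0 <= c <= s -> 1 <= d <= 1 + s ->
   (a%:E <= \int[leb]_x ((\1_(`[u, v]%classic : set mR) x * h (haar_coord (x, (c, d))))%:E))%E.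
  by move=> cs ds; rewrite -EFin_itg ?lee_fin; [exact: key|exact: (bc c d _ ah)].
move=> /(_ lo) l1.
have := le_trans l1 (le_trans (haar_box s01 uvC mh h0) (hK h mh h0 hG)).
rewrite -EFin_aint // -EFinM lee_fin => l2.
have : s ^+ 2 * a <= s ^+ 2 * (e / 3).
  apply: le_trans l2 _; rewrite mulrC -ler_pdivlMr //.
  rewrite [aint h](_ : _ = aint (fun g => `|avg f N g - mean f|)).
    by rewrite [s ^+ 2 * _]mulrC; exact: hN.
  apply: (aint_trans (h := fun g => `|avg f N g - mean f|)) => //.
  by apply: autom_norm; apply: automB; [exact: autom_avg|exact: autom_cst].
by rewrite ler_pM2l // exprn_gt0.
Qed.

(** The lower bound is [horo_upper] for [B - f]. *)
Lemma horo_equi f B b : autom f -> ucont f -> (forall g, 0 <= f g <= B) -> 0 <= b ->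
  forall e : R, 0 < e -> exists2 T0 : R, 1 <= T0 &
  forall T u v, T0 <= T -> - b <= u -> u <= v -> v <= b -> `|itg u v (fun x => f (hor T x)) - (v - u) * mean f| <= e.
Proof.
move=> af uf fB b0 e e0.
have f0 g : 0 <= f g by case/andP: (fB g).
pose f' g : R := B - f g.
have af' : autom f' by apply: automB => //; exact: autom_cst.
have uf' : ucont f'.
  have := ucontD (@ucont_cst R B) (ucontZ (-1) uf); congr ucont.
  by apply/funext => g; rewrite mulN1r.
have fB' g : 0 <= f' g <= B by have /andP[? ?] := fB g; rewrite /f'; apply/andP; split; lra.
have B0 : 0 <= B := le_trans (f0 idm) (proj2 (andP (fB idm))).
have V0 := @vol_gt0 R.
have mE' : mean f' = B - mean f.
  have : aint f' + aint f = B * vol.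
    rewrite -aintD // => [|g]; last by case/andP: (fB' g).
    by rewrite -aint_cst //; congr aint; apply/funext => g; rewrite /f' subrK.
  by rewrite /mean => E; apply/eqP; rewrite eq_sym subr_eq -mulrDl E mulfK // gt_eqF.
have [T1 T11 h1] := horo_upper af uf fB b0 e0.
have [T2 T21 h2] := horo_upper af' uf' fB' b0 e0.
exists (Num.max T1 T2) => [|T u v]; first by rewrite le_max T11.
rewrite ge_max => /andP[TT1 TT2] bu uv vb.
have l1 := h1 _ _ _ TT1 bu uv vb; have l2 := h2 _ _ _ TT2 bu uv vb.
rewrite ler_norml lerBrDr lerBlDr [e + _]addrC l1 andbT.
move: l2; rewrite mE' itgB; [|exact: bmeas_cst|exact: bmeas_hor].
by rewrite itg_cst //; move: (itg _ _ _) => x; lra.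
Qed.

(** The function [|avg f N - mean f|] is again automorphic and uniformly continuous, of small mean
    by [avg_mean]; the threshold on [T] depends on [N]. *)
Lemma horo_avg f B b : autom f -> ucont f -> (forall g, 0 <= f g <= B) -> 0 <= b ->
  forall e : R, 0 < e -> exists2 N0 : nat, (0 < N0)%N & forall N, (N0 <= N)%N ->
  exists2 T0 : R, 1 <= T0 &
  forall T u v, T0 <= T -> - b <= u -> u <= v -> v <= b -> itg u v (fun x => `|avg f N (hor T x) - mean f|) <= e.
Proof.
move=> af uf fB b0 e e0; have V0 := @vol_gt0 R.
have f0 g : 0 <= f g by case/andP: (fB g).
have D0 : 0 < 2 * b + 1 by rewrite ltr_wpDl // mulr_ge0.
pose eta := e / 2 / (2 * b + 1) * vol.
have eta0 : 0 < eta by rewrite mulr_gt0 // divr_gt0 // divr_gt0.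
have [N0 N00 hN] := avg_mean af uf f0 eta0.
exists N0 => // N NN.
pose h g : R := `|avg f N g - mean f|.
have ah : autom h by apply: autom_norm; apply: automB; [exact: autom_avg|exact: autom_cst].
have uh : ucont h.
  apply: ucont_norm; have := ucontD (ucont_avg N uf) (@ucont_cst R (- mean f)); exact.
have /andP[m0 mB] := mean_bound af fB.
have hB g : 0 <= h g <= B.
  rewrite normr_ge0 /=.
  have fBn g' : `|f g'| <= B by rewrite ger0_norm //; case/andP: (fB g').
  have a0 : 0 <= avg f N g by rewrite mulr_ge0 ?invr_ge0 // sumr_ge0.
  have := avg_bound fBn N g; rewrite ger0_norm // => aB.
  by rewrite ler_norml; apply/andP; split; lra.
have e2 : 0 < e / 2 by rewrite divr_gt0.
have [T0 T01 hT] := horo_equi ah uh hB b0 e2.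
exists T0 => // T u v TT bu uv vb; have uv0 : 0 <= v - u by rewrite subr_ge0.
have := hT T u v TT bu uv vb; rewrite ler_norml => /andP[_].
have mh : mean h <= e / 2 / (2 * b + 1) by rewrite /mean ler_pdivrMr //; exact: hN.
have : (v - u) * mean h <= e / 2.
  apply: le_trans (ler_wpM2l uv0 mh) _.
  by rewrite mulrA ler_pdivrMr // mulrC ler_wpM2l ?(ltW e2) //; lra.
by move: (itg _ _ _) => x; lra.
Qed.
End horocycles.

(** * Functions concentrated in the cusp *)

Section cusp.
Context {R : realType}.
Local Notation mR := (measurableTypeR R).
Local Notation leb := (@lebesgue_measure R).
Local Notation M := ((mR * mR) * (mR * mR))%type.
Implicit Types (f h : M -> R) (k g : mat2 R).

(* The complement of a neighbourhood of the cusp that shrinks as C grows. *)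
Definition thick (C : R) g := exists2 k : zmat, sl2z k & mbound C (mulm (zr k) g).

(** Same quadratic form inequality as in [sreduced_unique], without strictness. *)
Lemma reduced_shortest g (k : zmat) : detm g = 1 -> sl2z k -> reduced g ->
  row2sq g <= row2sq (mulm (zr k) g).
Proof.
move=> Dg sk /andP[e1 e2].
have -> : row2sq (mulm (zr k) g) = (k.2.1 ^+ 2)%:~R * row1sq g + (2 * k.2.1 * k.2.2)%:~R * rowdot g + (k.2.2 ^+ 2)%:~R * row2sq g.
  by rewrite !rmorphM /row2sq /row1sq /rowdot /mulm /zr /=; ring.
have h0 := row2sq_gt0 Dg.
have : (k.2.1 != 0) || (k.2.2 != 0).
  by apply/negPn/negP; rewrite negb_or !negbK => /andP[/eqP c0 /eqP d0]; move: sk; rewrite /sl2z /zdet /= c0 d0 !mulr0.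
move: (k.2.1) (k.2.2) => r s rs.
have i1 : (1 <= r ^+ 2 - `|r| * `|s| + s ^+ 2 :> int) by nia.
have i1' : (1 <= (r ^+ 2)%:~R - (`|r| * `|s|)%:~R + (s ^+ 2)%:~R :> R).
  by rewrite -rmorphB -rmorphD /= -[leLHS]/(1%:~R) ler_int.
have i2 : - ((`|r| * `|s|)%:~R * row2sq g) <= (2 * r * s)%:~R * rowdot g.
  rewrite lerNl (le_trans (ler_norm _)) // normrN normrM -intr_norm !normrM.
  rewrite (_ : `|2| = 2 :> int) // !rmorphM /=.
  have : 0 <= (`|r| * `|s|)%:~R :> R by rewrite ler0z mulr_ge0.
  rewrite rmorphM /= => z0.
  rewrite [leLHS](_ : _ = (`|r|%:~R * `|s|%:~R) * (2 * `|rowdot g|)); last first.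
    by rewrite -[2%Z%:~R]/(2 : R); ring.
  exact: ler_wpM2l.
have r2 : 0 <= (r ^+ 2)%:~R :> R by rewrite ler0z sqr_ge0.
have i3 : (r ^+ 2)%:~R * row2sq g <= (r ^+ 2)%:~R * row1sq g by rewrite ler_wpM2l.
have i4 : row2sq g <= ((r ^+ 2)%:~R - (`|r| * `|s|)%:~R + (s ^+ 2)%:~R) * row2sq g.
  by rewrite -[leLHS]mul1r ler_pM2r.
move: i4; rewrite !mulrDl mulNr; lra.
Qed.

Let clip (t : R) : R := Num.min 1 (Num.max 0 t).

Let clip01 t : 0 <= clip t <= 1.
Proof. by rewrite /clip le_min ler01 le_max lexx /= ge_min lexx. Qed.

Let clip_lip (s t e : R) : 0 <= e -> s <= t + e -> clip s <= clip t + e.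
Proof.
move=> e0 st; rewrite /clip /Num.min /Num.max.
by do ! case: ifPn; rewrite -?leNgt; lra.
Qed.

Let clip0 t : t <= 0 -> clip t = 0.
Proof. by move=> t0; rewrite /clip /Num.max ltNge t0 /= min_r. Qed.

Let clip1 t : 1 <= t -> clip t = 1.
Proof. by move=> t1; rewrite /clip /Num.max (lt_le_trans ltr01 t1) min_l. Qed.

Variable Y : R.
Hypothesis Y0 : 0 < Y.

Let cut (k : zmat) g : R := clip (2 - Y * row2sq (mulm (zr k) g)).
Let nth_cut (n : nat) g : R := if pickle_inv n is Some k then (if k \in sl2z then cut k g else 0) else 0.
(** The height of [k g i] is the inverse of [row2sq (k g)], so this is a continuous cutoff of the
    largest height in the orbit. Enumerating the integer matrices makes it a countable supremum,
    hence measurable. *)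
Let bump g : R := sups (nth_cut^~ g) 0.

Let nth01 n g : 0 <= nth_cut n g <= 1.
Proof. by rewrite /nth_cut; case: pickle_inv => [k|]; [case: ifP|]; rewrite ?clip01 // lexx ler01. Qed.

Let ub g : has_ubound (range (nth_cut^~ g)).
Proof. by exists 1 => _ [n _ <-]; case/andP: (nth01 n g). Qed.

Let rangeE g : sdrop (nth_cut^~ g) 0 = range (nth_cut^~ g).
Proof. by apply/seteqP; split => _ [n _ <-]; exists n. Qed.

Let cut_le (k : zmat) g : sl2z k -> cut k g <= bump g.
Proof.
move=> sk; rewrite /bump /sups /= rangeE; apply: ub_le_sup; first exact: ub.
by exists (pickle k) => //; rewrite /nth_cut pickleK_inv mem_set.
Qed.

Let bump_le g c : 0 <= c -> (forall k : zmat, sl2z k -> cut k g <= c) -> bump g <= c.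
Proof.
move=> c0 hc; rewrite /bump /sups /= rangeE; apply: ge_sup.
  by exists (nth_cut 0 g), 0%N.
move=> _ [n _ <-]; rewrite /nth_cut; case: pickle_inv => [k|//].
by case: ifPn => // /set_mem; exact: hc.
Qed.

Let bump01 g : 0 <= bump g <= 1.
Proof.
rewrite bump_le ?andbT // => [|k _]; last by case/andP: (clip01 (2 - Y * row2sq (mulm (zr k) g))).
have s1 : sl2z ((1, 0), (0, 1)) by rewrite /sl2z /zdet.
by apply: le_trans (cut_le g s1); case/andP: (clip01 (2 - Y * row2sq (mulm (zr ((1, 0), (0, 1))) g))).
Qed.

Let measurable_bump : measurable_fun setT (bump : M -> R).
Proof.
apply: (@measurable_fun_sups _ _ _ setT (fun n g => nth_cut n g) 0%N) => [g _|n]; first exact: ub.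
rewrite /nth_cut; case: pickle_inv => [k|]; last exact: mcst.
case: (k \in sl2z); last exact: mcst.
rewrite /cut /clip.
have mr : measurable_fun setT (fun g : M => 2 - Y * row2sq (mulm (zr k) g)).
  apply: mD; [exact: mcst|apply: mN; apply: mM; [exact: mcst|]].
  exact: (mcomp measurable_row2sq (measurable_mulml (zr k))).
by apply: measurable_minr; [exact: mcst|apply: measurable_maxr => //; exact: mcst].
Qed.

Let bump_ginv : ginv (bump : M -> R).
Proof.
have le (k : zmat) g : sl2z k -> bump (mulm (zr k) g) <= bump g.
  move=> sk; apply: bump_le => [|l sl]; first by case/andP: (bump01 g).
  have <- : cut (zmul l k) g = cut l (mulm (zr k) g) by rewrite /cut zr_mul mulmA.
  by apply: cut_le; exact: sl2z_mul.
move=> k g sk Dg; apply/eqP; rewrite eq_le le //=.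
have := le (zinv k) (mulm (zr k) g) (sl2z_inv sk).
by rewrite mulmA zr_inv mulVm ?mul1m ?detm_zr.
Qed.

Let row2sq_near (d : R) g k : 0 <= d <= 1 / 16 -> nearm d k ->
  `|row2sq (mulm g k) - row2sq g| <= 8 * d * row2sq g.
Proof.
move=> /andP[d0 d1] /and4P[n1 n2 n3 n4].
case: g => -[a b] [c e]; case: k n1 n2 n3 n4 => -[p q] [r s] /=.
rewrite ![`|_| <= d]ler_norml => /andP[p1 p2] /andP[q1 q2] /andP[r1 r2] /andP[s1 s2].
rewrite /row2sq /mulm /=.
set S := c ^+ 2 + e ^+ 2.
have ce : `|c * e| * 2 <= S.
  rewrite normrM /S -(real_normK (num_real c)) -(real_normK (num_real e)).
  by have := sqr_ge0 (`|c| - `|e|); lra.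
have prod (x y z w : R) : - z <= x <= z -> - w <= y <= w -> `|x * y| <= z * w.
  by move=> hx hy; rewrite normrM; apply: ler_pM => //; rewrite ler_norml.
pose P := p - 1; pose T := s - 1.
have hP : - d <= P <= d by rewrite /P; apply/andP; split; lra.
have hT : - d <= T <= d by rewrite /T; apply/andP; split; lra.
have hq : - d <= q <= d by rewrite q1.
have hr : - d <= r <= d by rewrite r1.
rewrite (_ : _ - _ = c ^+ 2 * (2 * P + P * P + q * q) + e ^+ 2 * (2 * T + T * T + r * r) +
   2 * (c * e) * (q + r + P * r + q * T)); last by rewrite /S /P /T; ring.
have c0 := sqr_ge0 c; have e0 := sqr_ge0 e.
have dd : d * d <= d / 16 by nra.
have B1 : `|2 * P + P * P + q * q| <= 3 * d.
  have := prod _ _ _ _ hP hP; have := prod _ _ _ _ hq hq; rewrite !ler_norml.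
  by move=> /andP[i1 i2] /andP[i3 i4]; apply/andP; split; lra.
have B2 : `|2 * T + T * T + r * r| <= 3 * d.
  have := prod _ _ _ _ hT hT; have := prod _ _ _ _ hr hr; rewrite !ler_norml.
  by move=> /andP[i1 i2] /andP[i3 i4]; apply/andP; split; lra.
have B3 : `|q + r + P * r + q * T| <= 3 * d.
  have := prod _ _ _ _ hP hr; have := prod _ _ _ _ hq hT; rewrite !ler_norml.
  by move=> /andP[i1 i2] /andP[i3 i4]; apply/andP; split; lra.
apply: (@le_trans _ _ (c ^+ 2 * (3 * d) + e ^+ 2 * (3 * d) + S * (3 * d))).
  apply: le_trans (ler_normD _ _) _; apply: lerD.
    apply: le_trans (ler_normD _ _) _; apply: lerD.
      by rewrite normrM (ger0_norm c0) ler_wpM2l.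
    by rewrite normrM (ger0_norm e0) ler_wpM2l.
  rewrite normrM; apply: ler_pM => //; rewrite normrM (ger0_norm (ler0n R 2)); lra.
rewrite -mulrDl -/S.
have : 0 <= S * d by rewrite mulr_ge0 // addr_ge0.
lra.
Qed.

Let ucont_bump : ucont (bump : M -> R).
Proof.
move=> e e0; pose d := Num.min (1 / 64) (e / 64).
have d0 : 0 < d by rewrite lt_min !divr_gt0.
have d1 : d <= 1 / 64 by rewrite ge_min lexx.
have de : 64 * d <= e by rewrite mulrC -ler_pdivlMr // ge_min lexx orbT.
exists (d / 4) => [|g k Dg Dk nk]; first by rewrite divr_gt0.
have oneside (x : mat2 R) (l : mat2 R) : detm x = 1 -> nearm d l -> bump (mulm x l) <= bump x + e.
  move=> Dx nl; apply: bump_le => [|j sj].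
    by rewrite addr_ge0 ?(ltW e0) //; case/andP: (bump01 x).
  apply: (@le_trans _ _ (cut j x + e)); last by rewrite lerD2r cut_le.
  rewrite /cut mulmA.
  have dd : 0 <= d <= 1 / 16 by rewrite ltW //=; lra.
  have := row2sq_near (mulm (zr j) x) dd nl.
  have : 0 < row2sq (mulm (zr j) x) by apply: row2sq_gt0; rewrite detm_mul detm_zr // Dx mulr1.
  move: (row2sq (mulm (zr j) x)) (row2sq (mulm (mulm (zr j) x) l)) => s s' s0.
  rewrite ler_norml => /andP[l1 l2].
  (* A relative error of [row2sq] is a small absolute error of the cutoff while [Y s] is bounded;
     beyond 4 the perturbed value is still at least 2, where the cutoff vanishes. *)
  have [sb|sb] := leP (Y * s) 4.
    apply: clip_lip (ltW e0) _.
    have : Y * (s - s') <= Y * (8 * d * s) by rewrite ler_pM2l //; lra.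
    have -> : Y * (8 * d * s) = 8 * d * (Y * s) by ring.
    have : 8 * d * (Y * s) <= 8 * d * 4 by rewrite ler_wpM2l // mulr_ge0 // ltW.
    rewrite mulrBr; lra.
  have s's : s / 2 <= s' by nra.
  rewrite (clip0 (t := 2 - Y * s')).
    by rewrite addr_ge0 ?(ltW e0) //; case/andP: (clip01 (2 - Y * s)).
  have : Y * (s / 2) <= Y * s' by rewrite ler_pM2l.
  by move: sb; rewrite mulrA; lra.
have nk1 : nearm d k by apply: nearm_le nk; lra.
have nk2 : nearm d (invm k).
  by move: nk1 => /and4P[h1 h2 h3 h4]; apply/and4P; split; rewrite /= ?normrN.
have Dgk : detm (mulm g k) = 1 by rewrite detm_mul Dg Dk mulr1.
have := oneside _ _ Dgk nk2; rewrite -mulmA mulmV // mulm1 => h1.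
have h2 := oneside _ _ Dg nk1.
by rewrite ler_norml; apply/andP; split; lra.
Qed.

Let autom_bump : autom (bump : M -> R).
Proof.
split; [exact: measurable_bump| |exact: bump_ginv].
by exists 1 => g; have /andP[b0 b1] := bump01 g; rewrite ger0_norm.
Qed.

(** On reduced matrices the cutoff vanishes outside [box2 s] with [s^2 = 2 / Y], and [cusp_volume]
    gives [4 s^2]. *)
Let aint_bump : aint (bump : M -> R) <= 8 / Y.
Proof.
pose s := Num.sqrt (2 / Y).
have s0 : 0 <= s by exact: sqrtr_ge0.
have s2 : s ^+ 2 = 2 / Y by rewrite sqr_sqrtr // divr_ge0 // ltW.
have b0 g : 0 <= bump g by case/andP: (bump01 g).
rewrite -lee_fin EFin_aint //.
have -> : 8 / Y = 4 * s ^+ 2 by rewrite s2; ring.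
apply: le_trans (cusp_volume s0).
have mb : measurable_fun setT (fun g : M => reduced g && box2 s g).
  by apply: measurable_and; [exact: measurable_reduced|exact: measurable_box2].
have mr := mE (mM measurable_bump (measurable_bool (@measurable_reduced R))).
apply: (le_haar mr (mE (measurable_bool mb))) => [g|g|g Dg].
- by rewrite lee_fin mulr_ge0.
- by rewrite lee_fin.
rewrite lee_fin; case: (boolP (reduced g)) => [rg|_]; last by rewrite mulr0.
rewrite mulr1 andTb; apply: bump_le => // k sk.
have [bx|nb] := boolP (box2 s g); first by case/andP: (clip01 (2 - Y * row2sq (mulm (zr k) g))).
rewrite /cut clip0 // subr_le0 mulrC -ler_pdivrMr //.
apply: le_trans (reduced_shortest Dg sk rg); rewrite -s2 /row2sq.
have sq (x : R) : ~~ (`|x| <= s) -> s ^+ 2 <= x ^+ 2.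
  by rewrite -ltNge => xs; rewrite -(real_normK (num_real x)) ler_pXn2r ?nnegrE // ltW.
have c2 := sqr_ge0 g.2.1; have d2 := sqr_ge0 g.2.2.
by move: nb; rewrite /box2 negb_and => /orP[] /sq; lra.
Qed.

Lemma cusp_bump : exists f : M -> R, [/\ autom f, ucont f, forall g, 0 <= f g <= 1,
  mean f <= 8 / Y / vol & forall g, detm g = 1 -> ~ thick (Num.sqrt (2 * Y) + 2) g -> f g = 1].
Proof.
exists bump; split => //.
  by rewrite /mean; apply: ler_wpM2r; [rewrite invr_ge0 vol_ge0|exact: aint_bump].
move=> g Dg nt; have [k sk rk] := reduction Dg.
apply/eqP; rewrite eq_le; have /andP[_ ->] := bump01 g; rewrite /=.
apply: le_trans (cut_le g sk); rewrite /cut clip1 //.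
pose s := (Num.sqrt (2 * Y))^-1.
have s0 : 0 < s by rewrite invr_gt0 sqrtr_gt0 mulr_gt0.
have nb : ~~ mbound (s^-1 + 2) (mulm (zr k) g).
  by apply/negP => bk; apply: nt; exists k => //; move: bk; rewrite /s invrK.
have Dkg : detm (mulm (zr k) g) = 1 by rewrite detm_mul detm_zr // Dg mulr1.
have /andP[c2 d2] := reduced_mbound s0 Dkg rk nb.
have s2 : Y * s ^+ 2 = 1 / 2.
  by rewrite /s exprVn sqr_sqrtr ?mulr_ge0 ?(ltW Y0) //; field; rewrite gt_eqF.
have sq (x : R) : `|x| <= s -> x ^+ 2 <= s ^+ 2.
  by move=> xs; rewrite -(real_normK (num_real x)) ler_pXn2r ?nnegrE // ltW.
rewrite /row2sq; have := sq _ c2; have := sq _ d2.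
move: (_ ^+ 2) ((mulm (zr k) g).2.1 ^+ 2) => p q h1 h2.
have : Y * (q + p) <= Y * (s ^+ 2 + s ^+ 2) by rewrite ler_pM2l //; lra.
by rewrite !mulrDr s2; lra.
Qed.
End cusp.

Lemma cusp_function (R : realType) (e : R) : 0 < e -> exists2 C : R, 0 < C &
  exists f : ((measurableTypeR R * measurableTypeR R) * (measurableTypeR R * measurableTypeR R))%type -> R,
  [/\ autom f, ucont f, forall g, 0 <= f g <= 1, mean f <= e &
      forall g, detm g = 1 -> ~ thick C g -> f g = 1].
Proof.
move=> e0; have V0 := @vol_gt0 R.
pose Y := 8 / (e * vol); have Y0 : 0 < Y by rewrite divr_gt0 // mulr_gt0.
exists (Num.sqrt (2 * Y) + 2); first by rewrite ltr_wpDl ?sqrtr_ge0.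
have [f [af uf f01 fm ft]] := cusp_bump Y0.
exists f; split => //; apply: le_trans fm _.
by rewrite /Y (_ : 8 / _ / _ = e) //; field; rewrite !gt_eqF.
Qed.

(** * Greedy coverings, block averages and quadratic polynomials *)

Section counting.
Context {R : realType}.

(* Vitali-type covering: an interval [n, n + u) is attached to each n in Z, and disjoint ones are selected
   greedily from the left. *)
Lemma greedy (c : R) (Z : pred nat) (W : nat -> R) (U X : nat) : 0 <= c -> (forall i, 0 <= W i) ->
  (forall n, (n < X)%N -> Z n -> exists2 u, (0 < u <= U)%N &
     (\sum_(n <= i < n + u) Z i)%:R <= c * \sum_(n <= i < n + u) W i) ->
  (\sum_(0 <= i < X) Z i)%:R <= c * \sum_(0 <= i < X + U) W i.
Proof.
move=> c0 W0 H; have W0' a b : 0 <= \sum_(a <= i < b) W i by exact: sumr_ge0.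
suff S : forall m a, (X - a <= m)%N -> (a <= X)%N ->
    (\sum_(a <= i < X) Z i)%:R <= c * \sum_(a <= i < X + U) W i.
  by apply: (S X) => //; rewrite subn0.
elim=> [|m IH] a ma aX; first by rewrite big_geq ?mulr_ge0 //; lia.
have [aX'|aX'] := leqP X a; first by rewrite big_geq // mulr_ge0.
have [Za|Za] := boolP (Z a); last first.
  rewrite big_ltn // (negbTE Za) add0n; apply: le_trans (IH a.+1 _ _) _; [lia|lia|].
  by rewrite ler_wpM2l // [leRHS]big_ltn ?lerDr //; lia.
have [u /andP[u0 uU] hu] := H a aX' Za.
have [le|lt] := leqP X (a + u).
  apply: (@le_trans _ _ (\sum_(a <= i < a + u) Z i)%:R).
    by rewrite ler_nat [leqRHS](@big_cat_nat _ _ _ X) ?leq_addr //=; lia.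
  apply: le_trans hu _; rewrite ler_wpM2l // [leRHS](@big_cat_nat _ _ _ (a + u)) ?lerDl //=; lia.
rewrite (@big_cat_nat _ _ _ (a + u)) //=; [|lia|lia].
rewrite [X in _ <= _ * X](@big_cat_nat _ _ _ (a + u)) //=; [|lia|lia].
rewrite natrD mulrDr; apply: lerD => //; apply: IH; lia.
Qed.

Section block_averages.
Implicit Types (g h : nat -> R) (m X : nat).

(** The conditional expectation on the partition into blocks of length [m]. For [m] dividing [m']
    the coarser average is a projection of the finer one, and [bavg_energy] is Pythagoras'
    theorem. *)
Definition bavg m g (n : nat) : R := m%:R^-1 * \sum_(j < m) g (n %/ m * m + j)%N.

Lemma sum_blocks m X g : (0 < m)%N -> (m %| X)%N ->
  \sum_(n < X) g n = \sum_(b < X %/ m) \sum_(j < m) g (b * m + j)%N.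
Proof.
move=> m0 /dvdnP[k ->]; rewrite mulnK //; elim: k => [|k IH].
  by rewrite mul0n !big_ord0.
rewrite big_ord_recr /= -IH mulSnr big_split_ord /=; congr (_ + _).
Qed.

Lemma bavgE m g b (j : 'I_m) : bavg m g (b * m + j) = m%:R^-1 * \sum_(i < m) g (b * m + i)%N.
Proof.
have m0 : (0 < m)%N by case: j => j /=; lia.
by rewrite /bavg divnMDl // divn_small // addn0.
Qed.

Lemma bavg_shift m g (p n : nat) : (0 < m)%N -> (m %| p)%N ->
  bavg m (fun i => g (p + i)%N) n = bavg m g (p + n).
Proof.
move=> m0 /dvdnP[k ->]; rewrite /bavg divnMDl // mulnDl; congr (_ * _).
by apply: eq_bigr => j _; rewrite addnA.
Qed.

Lemma sum_bavg m X g : (0 < m)%N -> (m %| X)%N -> \sum_(n < X) bavg m g n = \sum_(n < X) g n.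
Proof.
move=> m0 mX; rewrite !(sum_blocks _ m0 mX); apply: eq_bigr => b _.
under eq_bigr do rewrite bavgE.
rewrite sumr_const card_ord -(mulr_natl (_ * _)) mulrA divff ?mul1r //.
by rewrite pnatr_eq0 -lt0n.
Qed.

Lemma sum_bavgM m X g h : (0 < m)%N -> (m %| X)%N ->
  \sum_(n < X) bavg m g n * h n = \sum_(n < X) bavg m g n * bavg m h n.
Proof.
move=> m0 mX; rewrite (sum_blocks (fun n => bavg m g n * h n) m0 mX).
rewrite (sum_blocks (fun n => bavg m g n * bavg m h n) m0 mX); apply: eq_bigr => b _.
under eq_bigr do rewrite bavgE; under [RHS]eq_bigr do rewrite !bavgE.
rewrite -mulr_sumr sumr_const card_ord -(mulr_natl (_ * (_ * _))) mulrCA.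
by congr (_ * _); rewrite mulrA divff ?mul1r // pnatr_eq0 -lt0n.
Qed.

Lemma bavg_bavg m m' g n : (0 < m)%N -> (0 < m')%N -> (m %| m')%N -> bavg m' (bavg m g) n = bavg m' g n.
Proof.
move=> m0 m'0 mm; rewrite /bavg -/(bavg m g); congr (_ * _).
have mp : (m %| n %/ m' * m')%N by exact: dvdn_mull.
have := sum_bavg (fun i => g (n %/ m' * m' + i)%N) m0 mm.
by under eq_bigr do rewrite bavg_shift //.
Qed.

Lemma bavg_energy m m' X g : (0 < m)%N -> (0 < m')%N -> (m %| m')%N -> (m' %| X)%N ->
  \sum_(n < X) (bavg m g n - bavg m' g n) ^+ 2 =
  \sum_(n < X) bavg m g n ^+ 2 - \sum_(n < X) bavg m' g n ^+ 2.
Proof.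
move=> m0 m'0 mm mX.
have E := sum_bavgM g (bavg m g) m'0 mX.
have E' : \sum_(n < X) bavg m' g n * bavg m g n = \sum_(n < X) bavg m' g n ^+ 2.
  by rewrite E; apply: eq_bigr => n _; rewrite bavg_bavg.
rewrite -sumrB (_ : \sum_(n < X) _ = \sum_(n < X) ((bavg m g n ^+ 2 + bavg m' g n ^+ 2) - 2 * (bavg m' g n * bavg m g n))); last first.
  by apply: eq_bigr => n _; ring.
have E2 : \sum_(n < X) 2 * (bavg m' g n * bavg m g n) = 2 * \sum_(n < X) bavg m' g n ^+ 2.
  by rewrite -E' mulr_sumr.
rewrite [RHS]sumrB; rewrite sumrB E2 big_split /=; ring.
Qed.

Lemma bavg_bound m g n (B : R) : (forall i, `|g i| <= B) -> `|bavg m g n| <= B.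
Proof.
move=> gB; have B0 : 0 <= B := le_trans (normr_ge0 _) (gB 0%N).
case: m => [|m]; first by rewrite /bavg big_ord0 mulr0 normr0.
rewrite /bavg normrM ger0_norm ?invr_ge0 // mulrC ler_pdivrMr // (le_trans (ler_norm_sum _ _ _)) //.
apply: le_trans (ler_sum _ (G := fun=> B) _) _ => [i _|]; first exact: gB.
by rewrite sumr_const card_ord mulr_natr.
Qed.

(* The mean squares of the block averages can drop substantially at few of the K scales only. *)
Lemma good_scale (ms : nat -> nat) (K X : nat) (g h : nat -> R) (B : R) : (0 < K)%N ->
  (forall i, (0 < ms i)%N) -> (forall i, (ms i %| ms i.+1)%N) -> (ms K %| X)%N ->
  (forall i, `|g i| <= B) -> (forall i, `|h i| <= B) ->
  exists2 i, (i < K)%N & K%:R * (\sum_(n < X) (bavg (ms i) g n - bavg (ms i.+1) g n) ^+ 2 +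
    \sum_(n < X) (bavg (ms i) h n - bavg (ms i.+1) h n) ^+ 2) <= 2 * B ^+ 2 * X%:R.
Proof.
move=> K0 m0 mm mX gB hB; apply: contrapT => no.
have B0 : 0 <= B := le_trans (normr_ge0 _) (gB 0%N).
pose V i := \sum_(n < X) bavg (ms i) g n ^+ 2 + \sum_(n < X) bavg (ms i) h n ^+ 2.
have dv j i : (ms i %| ms (i + j))%N.
  by elim: j => [|j IH]; rewrite ?addn0 // addnS; exact: dvdn_trans (mm _).
have V0 i : 0 <= V i by rewrite addr_ge0 // sumr_ge0 // => n _; exact: sqr_ge0.
have VB : V 0%N <= 2 * B ^+ 2 * X%:R.
  rewrite /V -mulrA mulr_natl mulr2n mulr_natr.
  have one (f : nat -> R) : (forall i, `|f i| <= B) -> \sum_(n < X) bavg (ms 0%N) f n ^+ 2 <= B ^+ 2 *+ X.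
    move=> fB; apply: le_trans (ler_sum _ (G := fun=> B ^+ 2) _) _ => [i _|]; last by rewrite sumr_const card_ord.
    by rewrite -(real_normK (num_real (bavg _ _ _))) ler_pXn2r ?nnegrE // bavg_bound.
  by apply: lerD; exact: one.
have step i : (i < K)%N -> 2 * B ^+ 2 * X%:R < K%:R * (V i - V i.+1).
  move=> iK; rewrite ltNge; apply/negP => le; apply: no; exists i => //.
  have mX' : (ms i.+1 %| X)%N by apply: dvdn_trans mX; rewrite -(subnKC iK); exact: dv.
  by rewrite !bavg_energy // (_ : _ + _ = V i - V i.+1) // /V; ring.
have tot k : (k <= K)%N -> k%:R * (2 * B ^+ 2 * X%:R) <= K%:R * (V 0%N - V k).
  elim: k => [_|k IH kK]; first by rewrite mul0r subrr mulr0.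
  rewrite -natr1 mulrDl mul1r (_ : V 0%N - V k.+1 = (V 0%N - V k) + (V k - V k.+1)); last by ring.
  by rewrite mulrDr; apply: lerD; [apply: IH; exact: ltnW|apply: ltW; exact: step].
have K0' : 0 < K%:R :> R by rewrite ltr0n.
have := step 0%N K0; have := tot K (leqnn K); rewrite ler_pM2l // => h1.
have : V 0%N - V 1%N <= 2 * B ^+ 2 * X%:R by have := V0 1%N; lra.
have [K1|K1] := leqP K 1.
  have -> : K = 1%N by lia.
  by rewrite mul1r => ? ?; lra.
have t1 := tot K (leqnn K); rewrite ler_pM2l // in t1.
have s1 := step K.-1 (ltac:(lia)); rewrite prednK // in s1.
have t2 := tot K.-1 (leq_pred K).
have KE : K%:R = K.-1%:R + 1 :> R by rewrite natr1 prednK.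
have : K%:R * (2 * B ^+ 2 * X%:R) < K%:R * (V 0%N - V K).
  rewrite [ltLHS](_ : _ = K.-1%:R * (2 * B ^+ 2 * X%:R) + 2 * B ^+ 2 * X%:R); last by rewrite KE; ring.
  rewrite (_ : V 0%N - V K = (V 0%N - V K.-1) + (V K.-1 - V K)); last by ring.
  by rewrite mulrDr; apply: ler_ltD.
by rewrite ltr_pM2l //; have := V0 K; lra.
Qed.
End block_averages.

(* Lagrange interpolation at 0 < a < b. *)
Lemma quad_bound (r e f A a b : R) : 0 < b -> b / 3 <= a <= b / 2 -> `|r| <= A ->
  `|r + e * a - f * a ^+ 2| <= A -> `|r + e * b - f * b ^+ 2| <= A ->
  `|f| * b ^+ 2 <= 11 * A /\ `|e| * b <= 13 * A.
Proof.
move=> b0 /andP[a1 a2] h0; set pa := r + e * a - _; set pb := r + e * b - _ => h1 h2.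
have a0 : 0 < a by apply: lt_le_trans a1; rewrite divr_gt0.
have ba : 0 < b - a by lra.
have A0 : 0 <= A by exact: le_trans (normr_ge0 _) h0.
have fE : f * b ^+ 2 = pa * (b ^+ 2 / (a * (b - a))) - pb * (b / (b - a)) - r * (b / a).
  by rewrite /pa /pb; field; rewrite !gt_eqF.
have F : `|f| * b ^+ 2 <= 11 * A.
  have c1 : 0 <= b ^+ 2 / (a * (b - a)) <= 6.
    by rewrite divr_ge0 ?sqr_ge0 ?mulr_ge0 ?(ltW a0) ?(ltW ba) //= ler_pdivrMr ?mulr_gt0 //; nra.
  have c2 : 0 <= b / (b - a) <= 2.
    by rewrite divr_ge0 ?(ltW b0) ?(ltW ba) //= ler_pdivrMr //; lra.
  have c3 : 0 <= b / a <= 3.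
    by rewrite divr_ge0 ?(ltW b0) ?(ltW a0) //= ler_pdivrMr //; lra.
  have pr (x c k : R) : `|x| <= A -> 0 <= c <= k -> `|x * c| <= k * A.
    by move=> xA /andP[c0 ck]; rewrite normrM (ger0_norm c0) mulrC; apply: ler_pM.
  rewrite -(ger0_norm (sqr_ge0 b)) -normrM fE.
  apply: le_trans (ler_normB _ _) _; have := pr _ _ _ h0 c3.
  have : `|pa * (b ^+ 2 / (a * (b - a))) - pb * (b / (b - a))| <= 8 * A.
    by apply: le_trans (ler_normB _ _) _; have := pr _ _ _ h1 c1; have := pr _ _ _ h2 c2; lra.
  lra.
split=> //; rewrite -[X in _ * X <= _](ger0_norm (ltW b0)) -normrM.
have -> : e * b = pb - r + f * b ^+ 2 by rewrite /pb; ring.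
apply: le_trans (ler_normD _ _) _.
rewrite normrM (ger0_norm (sqr_ge0 b)).
have := ler_normB pb r; lra.
Qed.

Lemma sorted_gap (s : seq nat) i j : sorted ltn s -> (i <= j < size s)%N ->
  (nth 0%N s i + (j - i) <= nth 0%N s j)%N.
Proof.
move=> ss; elim: j => [|j IH] /andP[ij js]; first by rewrite leqn0 in ij; rewrite (eqP ij) addn0.
move: ij; rewrite leq_eqVlt => /predU1P[->|ij]; first by rewrite subnn addn0.
have := IH _; rewrite -ltnS ij (ltnW js) => /(_ isT) h.
have := (sorted_ltn_nth ltn_trans 0%N ss) j j.+1; rewrite !inE (ltnW js) js => /(_ isT isT (ltnSn j)).
by move: h; lia.
Qed.

(** More than [2 d] small values, where [d = u / rho + 1], would include three at mutual distance at
    least [d]. Lagrange interpolation from these to [u] has coefficients at most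
    [(u / d)^2 <= rho^2], so the value at [u] would be at most [3 rho^2]. *)
Lemma sublevel_count (r e f t : R) (rho u : nat) : (0 < rho)%N -> 0 < t ->
  3 * rho%:R ^+ 2 < `|r + e * (u%:R * t) - f * (u%:R * t) ^+ 2| ->
  (\sum_(0 <= m < u) (`|r + e * (m%:R * t) - f * (m%:R * t) ^+ 2| <= 1)%R <= 2 * (u %/ rho).+1)%N.
Proof.
move=> rho0 t0; pose p (x : R) := r + e * (x * t) - f * (x * t) ^+ 2.
rewrite -[r + _ - _]/(p u%:R) => big.
pose A (m : nat) := `|p m%:R| <= 1.
rewrite (eq_bigr (fun m => (A m : nat))) // leqNgt; apply/negP => lt.
pose d := (u %/ rho).+1.
pose s := [seq m <- iota 0 u | A m].
have ss : sorted ltn s by apply: sorted_filter; [exact: ltn_trans|exact: iota_ltn_sorted].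
have sz : (2 * d < size s)%N.
  apply: leq_trans lt _; rewrite size_filter -sum1_count [leqRHS]big_mkcond /= /index_iota subn0.
  by apply: leq_sum => i _; case: (A i).
have mem i : (i < size s)%N -> A (nth 0%N s i) /\ (nth 0%N s i < u)%N.
  by move=> is_; have := mem_nth 0%N is_; rewrite mem_filter mem_iota add0n => /andP[? /andP[_ ?]].
have [A0 l0] := mem 0%N (ltac:(lia)); have [A1 l1] := mem d (ltac:(lia)); have [A2 l2] := mem (2 * d)%N sz.
have g1 : (nth 0%N s 0 + d <= nth 0%N s d)%N.
  by have := @sorted_gap s 0 d ss; rewrite subn0; apply; lia.
have g2 : (nth 0%N s d + d <= nth 0%N s (2 * d))%N.
  by have := @sorted_gap s d (2 * d) ss; rewrite (_ : 2 * d - d = d)%N; [apply|]; lia.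
move: A0 A1 A2 l0 l1 l2 g1 g2; rewrite /A.
move: (nth _ _ 0%N) (nth _ _ d) (nth _ _ (2 * d)%N) => a b c A0 A1 A2 l0 l1 l2 g1 g2.
have ud : u%:R <= rho%:R * d%:R :> R.
  by rewrite -natrM ler_nat mulnC; apply: ltnW; exact: ltn_ceil.
have G1 : a%:R + d%:R <= b%:R :> R by rewrite -natrD ler_nat.
have G2 : b%:R + d%:R <= c%:R :> R by rewrite -natrD ler_nat.
have L0 : a%:R < u%:R :> R by rewrite ltr_nat.
have L1 : b%:R < u%:R :> R by rewrite ltr_nat.
have L2 : c%:R < u%:R :> R by rewrite ltr_nat.
have a0 : 0 <= a%:R :> R by []. 
have d0 : 0 < d%:R :> R by rewrite ltr0n.
have rho0' : 0 < rho%:R :> R by rewrite ltr0n.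
move: (a%:R : R) (b%:R : R) (c%:R : R) (u%:R : R) (d%:R : R) (rho%:R : R) A0 A1 A2 G1 G2 L0 L1 L2 a0 d0 ud rho0' big.
clear; move=> a b c u d rho A0 A1 A2 G1 G2 L0 L1 L2 a0 d0 ud rho0' big.
have E : p u = p a * ((u - b) * (u - c) / ((b - a) * (c - a))) - p b * ((u - a) * (u - c) / ((b - a) * (c - b))) +
   p c * ((u - a) * (u - b) / ((c - a) * (c - b))).
  by rewrite /p; field; rewrite !subr_eq0 !gt_eqF //; lra.
have bd (x y z w : R) : 0 <= x <= u -> 0 <= y <= u -> d <= z -> d <= w -> 0 <= x * y / (z * w) <= rho ^+ 2.
  move=> /andP[x0 xu] /andP[y0 yu] zd wd.
  have z0 : 0 < z by exact: lt_le_trans zd.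
  have w0 : 0 < w by exact: lt_le_trans wd.
  rewrite divr_ge0 ?mulr_ge0 ?(ltW z0) ?(ltW w0) //= ler_pdivrMr ?mulr_gt0 //.
  have h1 : x <= rho * z by apply: le_trans xu (le_trans ud _); rewrite ler_pM2l.
  have h2 : y <= rho * w by apply: le_trans yu (le_trans ud _); rewrite ler_pM2l.
  by rewrite (_ : rho ^+ 2 * (z * w) = (rho * z) * (rho * w)); [exact: ler_pM|ring].
have pr (x k : R) : `|x| <= 1 -> 0 <= k <= rho ^+ 2 -> `|x * k| <= rho ^+ 2.
  by move=> x1 /andP[k0 kr]; rewrite normrM (ger0_norm k0) -[leRHS]mul1r; apply: ler_pM.
have : `|p u| <= 3 * rho ^+ 2.
  rewrite E; apply: le_trans (ler_normD _ _) _.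
  have t1 : `|p a * ((u - b) * (u - c) / ((b - a) * (c - a)))| <= rho ^+ 2.
    by apply: pr => //; apply: bd; try (apply/andP; split); lra.
  have t2 : `|p b * ((u - a) * (u - c) / ((b - a) * (c - b)))| <= rho ^+ 2.
    by apply: pr => //; apply: bd; try (apply/andP; split); lra.
  have t3 : `|p c * ((u - a) * (u - b) / ((c - a) * (c - b)))| <= rho ^+ 2.
    by apply: pr => //; apply: bd; try (apply/andP; split); lra.
  have := ler_normB (p a * ((u - b) * (u - c) / ((b - a) * (c - a)))) (p b * ((u - a) * (u - c) / ((b - a) * (c - b)))).
  lra.
by rewrite leNgt big.
Qed.

(** Restricted to such times, [key] is injective. *)
Lemma isolated_count (T : finType) (X : nat) (G : pred nat) (key : nat -> T) :
  (\sum_(n < X) (G n && `[< forall n', (n' < X)%N -> G n' -> key n' = key n -> n' = n >]) <= #|T|)%N.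
Proof.
pose A := [set n : 'I_X | G n && `[< forall n', (n' < X)%N -> G n' -> key n' = key n -> n' = n >]]%SET.
rewrite (_ : (\sum_(n < X) _)%N = #|A|); last first.
  rewrite -sum1_card [RHS]big_mkcond /=; apply: eq_bigr => n _; rewrite inE.
  by case: (G n) => //=; case: asboolP.
rewrite -(@card_in_imset _ _ (fun n : 'I_X => key n) A); first exact: max_card.
move=> n n'; rewrite !inE => /andP[Gn /asboolP hn] /andP[Gn' /asboolP hn'] E.
by apply: val_inj; apply: hn' => //=; exact: ltn_ord.
Qed.
End counting.

(** * Polynomial divergence of nearby horocycles *)

Section near_identity.
Context {R : realType}.
Implicit Types (k g D X : mat2 R) (s t : R).

Lemma nearm_inv (d : R) k : nearm d k -> nearm d (invm k).
Proof. by move=> /and4P[h1 h2 h3 h4]; apply/and4P; split; rewrite /= ?normrN. Qed.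

Lemma nearm_mul (d e : R) k l : 0 <= d <= 1 -> 0 <= e <= 1 -> nearm d k -> nearm e l ->
  nearm (2 * (d + e)) (mulm k l).
Proof.
move=> /andP[d0 d1] /andP[e0 e1]; case: k l => -[a b] [c c'] [[p q] [r s]].
move=> /and4P[/= h1 h2 h3 h4] /and4P[/= k1 k2 k3 k4].
have pr (x y : R) : `|x| <= d -> `|y| <= e -> `|x * y| <= d * e by move=> *; rewrite normrM ler_pM.
have de : d * e <= d / 2 + e / 2.
  have : d * e <= d * 1 by rewrite ler_wpM2l.
  have : d * e <= 1 * e by rewrite ler_wpM2r.
  lra.
have fin (x y z w : R) : `|x| <= d -> `|y| <= e -> `|z| <= d * e -> `|w| <= d * e ->
    `|x + y + z + w| <= 2 * (d + e).
  move=> *; apply: le_trans (ler_normD _ _) _; have := ler_normD (x + y) z; have := ler_normD x y; lra.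
apply/and4P; split; rewrite /mulm /=.
- have -> : a * p + b * r - 1 = (a - 1) + (p - 1) + (a - 1) * (p - 1) + b * r by ring.
  by apply: fin => //; apply: pr.
- have -> : a * q + b * s = b + q + (a - 1) * q + b * (s - 1) by ring.
  by apply: fin => //; apply: pr.
- have -> : c * p + c' * r = c + r + c * (p - 1) + (c' - 1) * r by ring.
  by apply: fin => //; apply: pr.
- have -> : c * q + c' * s - 1 = (c' - 1) + (s - 1) + c * q + (c' - 1) * (s - 1) by ring.
  by apply: fin => //; apply: pr.
Qed.

Lemma zr_near1 (k : zmat) (d : R) : d < 1 -> nearm d (zr k) -> zr k = idm :> mat2 R.
Proof.
move=> d1; case: k => -[a b] [c e] /and4P[/= h1 h2 h3 h4].
have key (x : int) : `|x%:~R| <= d -> x = 0.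
  move=> xd; have : (`|x|%:~R < 1%:~R :> R) by rewrite intr_norm; exact: le_lt_trans d1.
  by rewrite ltr_int; lia.
have key1 (x : int) : `|x%:~R - 1| <= d -> x = 1.
  by rewrite -[1]/(1%:~R) -rmorphB /= => /key; lia.
by rewrite /zr /idm /= (key _ h2) (key _ h3) (key1 _ h1) (key1 _ h4).
Qed.

(* Relative position of two points after flowing both by the horocycle flow for time s. *)
Definition drift D s := mulm (upm (- s)) (mulm D (upm s)).

Lemma driftE D s : drift D s = ((D.1.1 - s * D.2.1, D.1.2 + (D.1.1 - D.2.2) * s - D.2.1 * s ^+ 2),
  (D.2.1, D.2.2 + s * D.2.1)).
Proof. by rewrite /drift /mulm /upm /=; congr ((_, _), (_, _)); ring. Qed.

Lemma drift_add D s t : drift (drift D s) t = drift D (s + t).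
Proof. by rewrite !driftE /=; congr ((_, _), (_, _)); ring. Qed.

(** Two tolerances are kept apart because flowing for a time [W] feeds the entries controlled by
    [d'] into the upper right one with factors up to [W^2] ([closeup_drift]). *)
Definition closeup (c d d' : R) D :=
  [/\ `|D.1.2 - c| <= d, `|D.1.1 - 1| <= d', `|D.2.1| <= d' & `|D.2.2 - 1| <= d'].

Lemma closeup_near (c d d' e : R) D : `|c| <= 1 -> d + d' <= e -> 2 * d' <= e -> 0 <= d -> 0 <= d' ->
  closeup c d d' D -> nearm e (mulm D (upm (- c))).
Proof.
case: D => -[p r] [f q] c1 h1 h2 d0 d'0 [/= k1 k2 k3 k4].
have pr (x : R) : `|x| <= d' -> `|c * x| <= d'.
  by move=> xd; rewrite normrM -[leRHS]mul1r ler_pM.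
apply/and4P; split; rewrite /mulm /upm /=.
- by rewrite mulr0 mulr1 addr0; lra.
- rewrite (_ : _ + _ = (r - c) - c * (p - 1)); last by ring.
  by apply: le_trans (ler_normB _ _) _; have := pr _ k2; lra.
- by rewrite mulr0 mulr1 addr0; lra.
- rewrite (_ : _ - 1 = (q - 1) - c * f); last by ring.
  by apply: le_trans (ler_normB _ _) _; have := pr _ k3; lra.
Qed.

Lemma closeup_drift (c d d' W s : R) D : `|s| <= W -> 0 <= d' -> closeup c d d' D ->
  closeup c (d + (2 * W + W ^+ 2) * d') ((1 + W) * d') (drift D s).
Proof.
move=> sW d'0; case: D => -[p r] [f q] [/= k1 k2 k3 k4]; rewrite driftE.
have W0 : 0 <= W by exact: le_trans (normr_ge0 _) sW.
have sf : `|s * f| <= W * d' by rewrite normrM ler_pM.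
have s2 : `|s| ^+ 2 <= W ^+ 2 by rewrite ler_pXn2r ?nnegrE.
split => /=.
- rewrite (_ : _ - c = (r - c) + ((p - 1) * s - (q - 1) * s - f * s ^+ 2)); last by ring.
  apply: le_trans (ler_normD _ _) _; apply: lerD => //.
  have g1 : `|(p - 1) * s| <= d' * W by rewrite normrM ler_pM.
  have g2 : `|(q - 1) * s| <= d' * W by rewrite normrM ler_pM.
  have g3 : `|f * s ^+ 2| <= d' * W ^+ 2 by rewrite normrM normrX ler_pM // exprn_ge0.
  have := ler_normB ((p - 1) * s - (q - 1) * s) (f * s ^+ 2).
  have := ler_normB ((p - 1) * s) ((q - 1) * s); lra.
- rewrite (_ : _ - 1 = (p - 1) - s * f); last by ring.
  by apply: le_trans (ler_normB _ _) _; lra.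
- have : 0 <= W * d' by rewrite mulr_ge0.
  lra.
- rewrite (_ : _ - 1 = (q - 1) + s * f); last by ring.
  by apply: le_trans (ler_normD _ _) _; lra.
Qed.

(** Conjugation by [diagm (Num.sqrt S)] divides the upper right entry by [S] and multiplies the
    lower left one by [S], which brings such a position within [O(1/S)] of the identity: the two
    points stay together up to times of order [S]. *)
Definition tube (S : R) D := [/\ `|D.1.2| <= 1, `|D.1.1 - D.2.2| <= S^-1,
  `|D.2.1| <= S ^- 2 & `|D.1.1 + D.2.2 - 2| <= 1].

Definition wtube (A S : R) D := [/\ `|D.1.2| <= A, `|D.1.1 - D.2.2| <= A / S,
  `|D.2.1| <= A / S ^+ 2 & `|D.1.1 + D.2.2 - 2| <= 1].

Lemma wtube_near (A S : R) D : 0 < A -> A <= S -> detm D = 1 -> wtube A S D ->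
  nearm (3 * A / S) (mulm (invm (diagm (Num.sqrt S))) (mulm D (diagm (Num.sqrt S)))).
Proof.
move=> A0 AS; have S0 : 0 < S by exact: lt_le_trans AS.
case: D => -[p r] [f q]; rewrite /detm /= => det [/= h1 h2 h3 h4].
have b0 : Num.sqrt S != 0 by rewrite gt_eqF // sqrtr_gt0.
have b2 : Num.sqrt S ^+ 2 = S by rewrite sqr_sqrtr // ltW.
have -> : mulm (invm (diagm (Num.sqrt S))) (mulm ((p, r), (f, q)) (diagm (Num.sqrt S))) = ((p, r / S), (f * S, q)).
  have E (be : R) : be != 0 -> mulm (invm (diagm be)) (mulm ((p, r), (f, q)) (diagm be)) = ((p, r / be ^+ 2), (f * be ^+ 2, q)).
    by move=> be0; rewrite /mulm /invm /diagm /=; congr ((_, _), (_, _)); field.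
  by rewrite E // b2.
have AS0 : 0 < A / S by rewrite divr_gt0.
have AS1 : A / S <= 1 by rewrite ler_pdivrMr // mul1r.
have r' : `|r / S| <= A / S by rewrite normrM normfV (gtr0_norm S0) ler_pM2r // invr_gt0.
have f' : `|f * S| <= A / S.
  by rewrite normrM (gtr0_norm S0) -ler_pdivlMr // -mulrA -invfM -expr2.
have rf : `|r * f| <= A / S * (A / S).
  by rewrite (_ : r * f = (r / S) * (f * S)); [rewrite normrM ler_pM|field; rewrite gt_eqF].
set a := A / S in AS0 AS1 r' f' rf h2 *.
have -> : 3 * A / S = 3 * a by rewrite /a mulrA.
have pq : (p + q - 2) * (p + q + 2) = 4 * (r * f) + (p - q) ^+ 2.
  have -> : r * f = p * q - 1 by rewrite -det; ring.
  by ring.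
have e2 : (p - q) ^+ 2 <= a * a.
  by rewrite -(real_normK (num_real (p - q))) expr2 ler_pM.
have e20 := sqr_ge0 (p - q).
move: h4 rf h2; rewrite !ler_norml => /andP[l1 l2] /andP[l3 l4] /andP[l5 l6].
have s3 : 3 <= p + q + 2 by lra.
have aa : a * a <= a by rewrite -[leRHS]mulr1 ler_pM2l.
have u1 : p + q - 2 <= 2 * a by nra.
have u2 : - (2 * a) <= p + q - 2 by nra.
apply/and4P; split => /=; rewrite ?(le_trans r') ?(le_trans f') //; try (clear -AS0; lra).
- by clear -u1 u2 l1 l2 l3 l4 l5 l6; rewrite ler_norml; apply/andP; split; lra.
- by clear -u1 u2 l1 l2 l3 l4 l5 l6; rewrite ler_norml; apply/andP; split; lra.
Qed.

(* Off the cusp, at most one element of SL_2(Z) keeps two points close for a long time. *)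
Lemma wtube_unique (C A : R) : 0 < C -> 0 < A -> exists2 S0 : R, 0 < S0 & forall S X X' (k l : zmat), S0 <= S ->
  detm X = 1 -> detm X' = 1 -> sl2z k -> sl2z l -> thick C (mulm X (diagm (Num.sqrt S))) ->
  wtube A S (mulm (invm X) (mulm (zr k) X')) -> wtube A S (mulm (invm X) (mulm (zr l) X')) ->
  zr k = zr l :> mat2 R.
Proof.
(* For [S] this large the quotient of the two integer matrices, conjugated into a bounded position,
   is at distance less than 1 from the identity and hence equal to it ([zr_near1]). *)
move=> C0 A0; exists (3 * A + 3 * A * (32 * C ^+ 2)) => [|S X X' k l SS DX DX' sk sl [j sj bj] hk hl].
  by rewrite addr_gt0 // !mulr_gt0 // exprn_gt0.
have CC : 0 < 3 * A * (32 * C ^+ 2) by rewrite !mulr_gt0 // exprn_gt0.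
have AS : A <= S by lra.
have S0 : 0 < S by exact: lt_le_trans AS.
set b := diagm (Num.sqrt S) in bj *.
have Db : detm b = 1 by rewrite detm_diagm // gt_eqF // sqrtr_gt0.
have DD (i : zmat) : sl2z i -> detm (mulm (invm X) (mulm (zr i) X')) = 1.
  by move=> si; rewrite !detm_mul detm_inv DX DX' detm_zr // !mulr1.
have nk := wtube_near A0 AS (DD _ sk) hk; have nl := wtube_near A0 AS (DD _ sl) hl.
rewrite -/b in nk nl.
set Ek := mulm (invm b) _ in nk; set El := mulm (invm b) _ in nl.
set eta := 3 * A / S in nk nl.
have eta0 : 0 < eta by rewrite !divr_gt0 // mulr_gt0.
have eta1 : eta <= 1 by rewrite ler_pdivrMr // mul1r; lra.
have nN : nearm (4 * eta) (mulm Ek (invm El)).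
  have e01 : 0 <= eta <= 1 by rewrite (ltW eta0).
  have -> : 4 * eta = 2 * (eta + eta) by ring.
  exact: (nearm_mul e01 e01 nk (nearm_inv nl)).
pose K := mulm (zr j) (mulm X b).
have DK : detm K = 1 by rewrite !detm_mul detm_zr // DX Db !mulr1.
have NE : mulm Ek (invm El) = mulm (invm K) (mulm (mulm (zr j) (mulm (mulm (zr k) (invm (zr l))) (invm (zr j)))) K).
  have invM (g h : mat2 R) : invm (mulm g h) = mulm (invm h) (invm g).
    by rewrite /invm /mulm /=; congr ((_, _), (_, _)); ring.
  have invK (g : mat2 R) : invm (invm g) = g by case: g => -[? ?] [? ?]; rewrite /invm /= !opprK.
  rewrite /Ek /El /K !invM !invK -!mulmA; congr (mulm _ (mulm _ _)).
  rewrite [in RHS](mulmA (invm (zr j)) (zr j)) mulVm ?detm_zr // mul1m.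
  rewrite [in RHS](mulmA (invm (zr j)) (zr j)) mulVm ?detm_zr // mul1m.
  congr mulm; rewrite (mulmA b) mulmV // mul1m (mulmA X') mulmV // mul1m //.
pose J := zmul j (zmul (zmul k (zinv l)) (zinv j)).
have JE : zr J = mulm (zr j) (mulm (mulm (zr k) (invm (zr l))) (invm (zr j))) :> mat2 R.
  by rewrite /J !zr_mul !zr_inv.
rewrite NE -JE in nN.
have bK' : mbound C K by [].
clearbody K.
have DK' : detm (invm K) = 1 by rewrite detm_inv.
have bK : mbound C (invm K) by exact: mbound_inv.
have e40 : 0 <= 4 * eta by rewrite mulr_ge0 // ltW.
have := nearm_conj_bound DK' bK e40 nN.
have invK (g : mat2 R) : invm (invm g) = g by case: g => -[? ?] [? ?]; rewrite /invm /= !opprK.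
rewrite invK -!mulmA mulmV // mulm1 mulmA mulmV // mul1m => nJ.
have lt1 : 4 * C ^+ 2 * (4 * eta) < 1.
  by rewrite /eta [ltLHS](_ : _ = 16 * C ^+ 2 * 3 * A / S); [rewrite ltr_pdivrMr // mul1r; lra|field; rewrite gt_eqF].
have J1 := zr_near1 lt1 nJ.
have E1 : mulm (zr k) (invm (zr l)) = idm :> mat2 R.
  have := congr1 (fun g => mulm (invm (zr j)) (mulm g (zr j))) J1.
  rewrite JE mul1m mulVm ?detm_zr // -!mulmA mulVm ?detm_zr // mulm1 mulmA mulVm ?detm_zr // mul1m.
  by [].
have := congr1 (fun g => mulm g (zr l)) E1; rewrite -mulmA mulVm ?detm_zr // mulm1 mul1m.
by [].
Qed.

Lemma nat_large (l : seq R) (m : nat) : exists2 v : nat, (m <= v)%N & forall x, x \in l -> x <= v%:R.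
Proof.
elim: l => [|x l [v mv hv]]; first by exists m.
exists (maxn v (Num.bound `|x|)) => [|y]; first by rewrite leq_max mv.
rewrite inE => /predU1P[->|/hv yv]; last by apply: le_trans yv _; rewrite ler_nat leq_maxl.
apply: le_trans (ler_norm x) _; apply: le_trans (ltW (archi_boundP (normr_ge0 x))) _.
by rewrite ler_nat leq_maxr.
Qed.

(** [quad_bound] wants an intermediate point between a third and a half of the total time; rounding
    [v / 2] down stays in that range from [v = 2] on. *)
Lemma half_time (t : R) (v : nat) : 0 < t -> (2 <= v)%N ->
  v%:R * t / 3 <= (v %/ 2)%:R * t <= v%:R * t / 2.
Proof.
move=> t0 v2; have v3 : (v <= v %/ 2 * 3)%N by lia.
rewrite ![v%:R * t / _]mulrAC !ler_pM2r // ler_pdivrMr // ler_pdivlMr // -!natrM !ler_nat v3.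
exact: leq_trunc_div.
Qed.

(** The slope of a secant is [e - f (s + s')], at most [(13 + 4 * 11) / b] up to time [2 b]. *)
Lemma quad_slope (r e f b s s' : R) : 0 < b -> `|f| * b ^+ 2 <= 11 -> `|e| * b <= 13 ->
  0 <= s <= 2 * b -> 0 <= s' <= 2 * b ->
  `|(r + e * s - f * s ^+ 2) - (r + e * s' - f * s' ^+ 2)| * b <= 57 * `|s - s'|.
Proof.
move=> b0 F E /andP[s0 sm] /andP[s'0 s'm].
rewrite (_ : _ - _ = (s - s') * (e - f * (s + s'))); last by ring.
rewrite normrM -mulrA mulrC ler_wpM2r //.
have : `|e - f * (s + s')| <= `|e| + `|f| * (4 * b).
  apply: le_trans (ler_normB _ _) _; rewrite lerD2l normrM ler_wpM2l // ger0_norm ?addr_ge0 //; lra.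
move=> h; apply: le_trans (ler_wpM2r (ltW b0) h) _.
by rewrite mulrDl; lra.
Qed.

(** The crossing happens between the steps [v] and [v + 1]. By [quad_slope] the entry moves by at
    most [57 * 2 / w] on the last [w]-th part of the time, which [228 / d <= w] makes at most
    [d / 2]; the other half of the tolerance absorbs the rounding of the crossing time to a whole
    step. *)
Lemma drift_window (c d d' d0 t : R) (w v : nat) p r f q : 0 < d -> 0 < d' -> 0 < t -> (0 < w)%N ->
  228 / d <= w%:R -> d0 <= d' / 2 -> 5 <= v%:R :> R -> 114 / d <= v%:R -> 44 / (d' * t) <= v%:R ->
  t^-1 <= v%:R -> closeup 0 d0 d0 ((p, r), (f, q)) ->
  `|f| * (v%:R * t) ^+ 2 <= 11 -> `|p - q| * (v%:R * t) <= 13 ->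
  `|r + (p - q) * (v%:R * t) - f * (v%:R * t) ^+ 2| < c ->
  c <= `|r + (p - q) * (v.+1%:R * t) - f * (v.+1%:R * t) ^+ 2| ->
  exists b : bool, forall m, (v.+1 - v.+1 %/ w <= m <= v.+1)%N ->
    closeup ((-1) ^+ b * c) d d' (drift ((p, r), (f, q)) (m%:R * t)).
Proof.
move=> d_gt0 d'0 t0 w_gt0 wd dd2 v0R vd vd2 vd4 [/= h1 h2 h3 h4] F E lo hm1.
set m1 := v.+1 in hm1 *; pose e := p - q; pose rr (s : R) := r + e * s - f * s ^+ 2.
rewrite -/(rr _) in lo; rewrite -/(rr _) in hm1.
pose b := v%:R * t.
have b0 : 0 < b by rewrite mulr_gt0 //; lra.
have vE : m1%:R = v%:R + 1 :> R by rewrite natr1.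
have m1b : m1%:R * t <= 2 * b by rewrite vE /b mulrA ler_pM2r //; lra.
have b1 : 1 <= b by rewrite /b -ler_pdivrMr // mul1r.
have bd : 44 <= d' * b by move: vd2; rewrite ler_pdivrMr ?mulr_gt0 // /b; lra.
have slope (s s' : R) : 0 <= s <= m1%:R * t -> 0 <= s' <= m1%:R * t -> `|rr s - rr s'| * b <= 57 * `|s - s'|.
  move=> /andP[s0 sm] /andP[s'0 s'm]; apply: quad_slope => //.
  - by rewrite s0 (le_trans sm m1b).
  - by rewrite s'0 (le_trans s'm m1b).
have [bb sg] : exists bb : bool, rr (m1%:R * t) = (-1) ^+ bb * `|rr (m1%:R * t)|.
  by case: (ger0P (rr (m1%:R * t))) => _; [exists false; rewrite expr0 mul1r|exists true; rewrite expr1 mulN1r opprK].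
have top : `|(`|rr (m1%:R * t)| - c)| <= d / 2.
  have m1t : 0 <= m1%:R * t by rewrite mulr_ge0 // ltW.
  have q1 : 0 <= m1%:R * t <= m1%:R * t by rewrite m1t lexx.
  have q2 : 0 <= v%:R * t <= m1%:R * t by rewrite mulr_ge0 ?(ltW t0) //= ler_pM2r // vE lerDl.
  have dt : `|m1%:R * t - v%:R * t| = t by rewrite vE (_ : _ - _ = t) ?gtr0_norm //; ring.
  have sl := slope _ _ q1 q2; rewrite dt in sl.
  have := ler_dist_dist (rr (m1%:R * t)) (rr (v%:R * t)) => dist.
  have : `|rr (m1%:R * t) - rr (v%:R * t)| <= d / 2.
    rewrite -(ler_pM2r b0); apply: le_trans sl _; rewrite /b mulrA ler_pM2r //.
    by move: vd; rewrite ler_pdivrMr //; lra.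
  move=> h; have hh := le_trans dist h.
  move: hh; rewrite !ler_norml => /andP[g1 g2]; clear -g1 g2 hm1 lo d_gt0; apply/andP; split; lra.
exists bb => m /andP[m_lo m_hi]; rewrite driftE /=; set s := m%:R * t.
have s0 : 0 <= s by rewrite mulr_ge0 // ltW.
have sm : s <= m1%:R * t by rewrite ler_pM2r // ler_nat.
have fs : `|s * f| <= d' / 2.
  rewrite normrM (ger0_norm s0).
  have h : s * `|f| <= 2 * b * `|f| by rewrite ler_wpM2r // (le_trans sm).
  apply: le_trans h _; rewrite -(ler_pM2r b0); move: F; rewrite -/b => F; clear -F bd b0; nra.
have f1 : `|f| <= d'.
  have fb : `|f| * b <= `|f| * b ^+ 2 by rewrite ler_wpM2l // expr2 ler_peMr // ltW.
  rewrite -(ler_pM2r b0); move: F; rewrite -/b => F; clear -F fb bd b0; lra.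
split => //=; last 2 first.
- rewrite (_ : _ - 1 = (p - 1) - s * f); last by ring.
  by apply: le_trans (ler_normB _ _) _; clear -h2 dd2 fs; lra.
- rewrite (_ : _ - 1 = (q - 1) + s * f); last by ring.
  by apply: le_trans (ler_normD _ _) _; clear -h4 dd2 fs; lra.
- rewrite -/e -[_ - f * s ^+ 2]/(rr s).
  have -> : rr s - (-1) ^+ bb * c = (rr s - rr (m1%:R * t)) + (-1) ^+ bb * (`|rr (m1%:R * t)| - c) by rewrite mulrBr -sg; ring.
  apply: le_trans (ler_normD _ _) _; rewrite [X in _ + X]normrM normrX normrN1 expr1n mul1r.
  suff : `|rr s - rr (m1%:R * t)| <= d / 2 by clear -top; lra.
  rewrite -(ler_pM2r b0); apply: le_trans (slope _ _ _ _) _.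
  + by rewrite s0.
  + by rewrite lexx andbT mulr_ge0 // ltW.
  rewrite distrC /s -mulrBl normrM (gtr0_norm t0) -natrB // ger0_norm //.
  have w0 : 0 < w%:R :> R by rewrite ltr0n.
  have : (m1 - m)%:R * w%:R <= m1%:R :> R.
    by rewrite -natrM ler_nat; apply: leq_trans (leq_trunc_div m1 w); rewrite leq_mul2r leq_subCl m_lo orbT.
  move: ((m1 - m)%:R : R) (ler0n R (m1 - m)) => x x0 xw.
  have xd : 228 * x <= d * m1%:R.
    have : 228 <= d * w%:R by move: wd; rewrite ler_pdivrMr // mulrC.
    by move=> dw; clear -dw xw x0 d_gt0; nra.
  have := ler_wpM2r (ltW t0) xd; rewrite -!mulrA.
  by have := ler_wpM2l (ltW d_gt0) m1b; clear; lra.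
Qed.

(* If the two points are close but not in the tube, the first time at which the upper right entry of their
   relative position reaches c is followed backwards by a long stretch on which the relative position is almost
   constant. *)
Lemma drift_time (d : R) : 0 < d -> exists2 w : nat, (0 < w)%N &
  forall (d' t : R) (m0 : nat), 0 < d' -> 0 < t -> exists2 d0 : R, 0 < d0 & forall S : R, 0 < S ->
  exists mmax : nat, forall (c : R) D, 1 / 2 <= c <= 1 -> closeup 0 d0 d0 D ->
  ~ (`|D.1.1 - D.2.2| <= S^-1 /\ `|D.2.1| <= S ^- 2) ->
  exists (b : bool) (m1 : nat), (m0 <= m1 <= mmax)%N /\
    forall m, (m1 - m1 %/ w <= m <= m1)%N -> closeup ((-1) ^+ b * c) d d' (drift D (m%:R * t)).
Proof.
move=> d_gt0; pose w := (Num.bound (228 / d)).+1; exists w => // d' t m0 d'0 t0.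
have wd : 228 / d <= w%:R.
  have := archi_boundP (divr_ge0 (ler0n R 228) (ltW d_gt0)); rewrite /w -natr1; lra.
have [ms ms5 msl] := nat_large [:: 114 / d; 44 / (d' * t); t^-1] (m0 + 5).
(* The last term keeps the upper right entry at most 1/4 up to time [ms t], so that the level
   [c >= 1/2] is reached later than that. *)
pose d0 := Num.min (Num.min (1 / 4) (d' / 2)) (1 / 4 / (1 + 2 * (ms%:R * t) + (ms%:R * t) ^+ 2)).
have mt0 : 0 <= ms%:R * t by rewrite mulr_ge0 // ltW.
have den : 0 < 1 + 2 * (ms%:R * t) + (ms%:R * t) ^+ 2 by have := sqr_ge0 (ms%:R * t); lra.
exists d0 => [|S S0]; first by rewrite !lt_min !divr_gt0.
have dd1 : d0 <= 1 / 4 by rewrite !ge_min lexx.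
have dd2 : d0 <= d' / 2 by rewrite !ge_min lexx orbT.
have dd3 : d0 * (1 + 2 * (ms%:R * t) + (ms%:R * t) ^+ 2) <= 1 / 4 by rewrite -ler_pdivlMr // ge_min lexx orbT.
(* Without a crossing up to this time, [quad_bound] would give [|p - q| <= 13 / (mmax t) <= S^-1],
   and likewise a bound for [f], against [nt]. *)
pose mmax := (Num.bound (13 * S / t) + 5)%N.
have mm : 13 * S < mmax%:R * t.
  rewrite -ltr_pdivrMr // /mmax natrD ltr_wpDr //.
  by apply: archi_boundP; rewrite divr_ge0 ?mulr_ge0 // ltW.
exists mmax => c [[p r] [f q]] /andP[c1 c2] [/= h1 h2 h3 h4] nt.
pose e := p - q; pose rr (s : R) := r + e * s - f * s ^+ 2.
rewrite subr0 in h1.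
have e_le : `|e| <= 2 * d0.
  by rewrite /e (_ : p - q = (p - 1) - (q - 1)); [apply: le_trans (ler_normB _ _) _; lra|ring].
have quad v : (2 <= v)%N -> (forall m, (m <= v)%N -> `|rr (m%:R * t)| <= 1) ->
    `|f| * (v%:R * t) ^+ 2 <= 11 /\ `|e| * (v%:R * t) <= 13.
  move=> v2 hv; have vt : 0 < v%:R * t by rewrite mulr_gt0 // ltr0n; exact: leq_trans v2.
  rewrite -[11]mulr1 -[13]mulr1.
  have hb := half_time t0 v2.
  apply: (@quad_bound R r e f 1 ((v %/ 2)%:R * t) (v%:R * t)) => //.
  - by have := hv 0%N (leq0n _); rewrite /rr mul0r mulr0 expr0n /= mulr0 addr0 subr0.
  - by apply: hv; exact: leq_div.
  - exact: hv.
have [mx mxle hmx] : exists2 m, (m <= mmax)%N & c <= `|rr (m%:R * t)|.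
  apply: contrapT => no; apply: nt.
  have hv m : (m <= mmax)%N -> `|rr (m%:R * t)| <= 1.
    move=> mle; have [le|lt] := leP c `|rr (m%:R * t)|; first by case: no; exists m.
    exact: le_trans (ltW lt) c2.
  have m2 : (2 <= mmax)%N by rewrite /mmax addnC.
  have [F E] := quad mmax m2 hv.
  rewrite /= -/e; move: (mmax%:R * t) mm F E => b mm F E.
  have S0' := ltW S0; have f0 := normr_ge0 f; have en0 := normr_ge0 e.
  split; first by rewrite -[S^-1]mul1r ler_pdivlMr //; clear -mm E S0' en0; nra.
  by rewrite -[S ^- 2]mul1r ler_pdivlMr ?exprn_gt0 //; clear -mm F S0' f0; nra.
have ex : exists m, c <= `|rr (m%:R * t)| by exists mx.
have [m1 hm1 min1] := ex_minnP ex.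
have m1mx := leq_trans (min1 _ hmx) mxle.
have below m : (m < m1)%N -> `|rr (m%:R * t)| < c.
  by move=> mm1; rewrite ltNge; apply/negP => /min1; rewrite leqNgt mm1.
have big : (ms < m1)%N.
  rewrite ltnNge; apply/negP => m1ms.
  have : `|rr (m1%:R * t)| <= 1 / 4.
    apply: le_trans dd3.
    have ts : 0 <= m1%:R * t <= ms%:R * t by rewrite mulr_ge0 ?(ltW t0) //= ler_pM2r // ler_nat.
    move: (m1%:R * t) (ms%:R * t) ts => s s' /andP[s0 ss'].
    rewrite /rr; apply: le_trans (ler_normB _ _) _; apply: le_trans (lerD (ler_normD _ _) (lexx _)) _.
    rewrite (normrM e) (normrM f) (ger0_norm s0) (ger0_norm (sqr_ge0 s)).
    have : `|e| * s <= 2 * d0 * s' by rewrite ler_pM.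
    have : `|f| * s ^+ 2 <= d0 * s' ^+ 2 by rewrite ler_pM ?sqr_ge0 // ler_pXn2r ?nnegrE // (le_trans s0).
    by clear -h1; lra.
  by move: hm1; clear -c1; lra.
case: m1 hm1 min1 m1mx below big => [//|v] hm1 min1 m1mx below; rewrite ltnS => msv.
have v5 : (5 <= v)%N by apply: leq_trans msv; apply: leq_trans ms5; exact: leq_addl.
have m0v : (m0 <= v.+1)%N by apply: leqW; apply: leq_trans msv; apply: leq_trans ms5; exact: leq_addr.
have [F E] := quad v (leq_trans (isT : 2 <= 5)%N v5) (fun m mv => ltW (lt_le_trans (below m mv) c2)).
set m1 := v.+1 in hm1 min1 m1mx below m0v *.
have vE : m1%:R = v%:R + 1 :> R by rewrite natr1.
have v0R : 5 <= v%:R :> R by rewrite -[5]/(5%:R) ler_nat.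
have large (x : R) : x \in [:: 114 / d; 44 / (d' * t); t^-1] -> x <= v%:R.
  by move=> /msl h; apply: le_trans h _; rewrite ler_nat.
have vd : 114 / d <= v%:R by apply: large; rewrite inE eqxx.
have vd2 : 44 / (d' * t) <= v%:R by apply: large; rewrite !inE eqxx orbT.
have vd4 : t^-1 <= v%:R by apply: large; rewrite !inE eqxx !orbT.
have hD : closeup 0 d0 d0 ((p, r), (f, q)) by split => //=; rewrite subr0.
have w0 : (0 < w)%N by [].
have [bb hbb] := drift_window d_gt0 d'0 t0 w0 wd dd2 v0R vd vd2 vd4 hD F E (below v (ltnSn v)) hm1.
by exists bb, m1; split => //; rewrite m0v.
Qed.
End near_identity.

(** * Comparing two orbit points with the same first variable *)

Section transfer.
Context {R : realType}.
Local Notation M2 := (mat2 R).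
Implicit Types (Psi : M2 -> M2 -> R) (Z : M2) (y s t e d : R).

Definition inv2 Psi := (forall (k : zmat) g h, sl2z k -> detm g = 1 -> detm h = 1 -> Psi (mulm (zr k) g) h = Psi g h) /\
  (forall (k : zmat) g h, sl2z k -> detm g = 1 -> detm h = 1 -> Psi g (mulm (zr k) h) = Psi g h).

Definition ucontr Psi := forall e, 0 < e -> exists2 d, 0 < d & forall g h k, detm g = 1 -> detm h = 1 ->
  detm k = 1 -> nearm d k -> `|Psi g (mulm h k) - Psi g h| <= e.

Definition dil y : M2 := diagm (Num.sqrt y).

(* With Z = dil y * g, this is Psi (g, dil y * g * (dil y)^-1 * upm k). *)
Definition obs Psi y (k : R) Z := Psi (mulm (invm (dil y)) Z) (mulm Z (mulm (invm (dil y)) (upm k))).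

Definition flow t Z (n : nat) := mulm Z (upm (n%:R * t)).

Lemma sqrt_bounds y : 1 <= y <= 2 -> 1 <= Num.sqrt y <= 2.
Proof.
move=> /andP[y1 y2]; have s0 := sqrtr_ge0 y; have E : Num.sqrt y ^+ 2 = y by rewrite sqr_sqrtr //; lra.
apply/andP; split.
  by rewrite -sqrtr1 ler_wsqrtr.
nra.
Qed.

Lemma detm_dil y : 1 <= y <= 2 -> detm (dil y) = 1.
Proof. by move=> /sqrt_bounds/andP[h _]; rewrite detm_diagm // gt_eqF //; lra. Qed.

Lemma dil_upm y s : 1 <= y <= 2 -> mulm (upm (s / y)) (invm (dil y)) = mulm (invm (dil y)) (upm s).
Proof.
move=> yb; have /andP[s1 _] := sqrt_bounds yb.
have E : Num.sqrt y ^+ 2 = y by rewrite sqr_sqrtr //; case/andP: yb; lra.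
have nz : Num.sqrt y != 0 by rewrite gt_eqF //; lra.
by rewrite -{1}E /dil /mulm /invm /upm /diagm /=; congr ((_, _), (_, _)); field; rewrite ?nz.
Qed.

Lemma detm_flow t Z n : detm Z = 1 -> detm (flow t Z n) = 1.
Proof. by move=> h; rewrite /flow detm_mul detm_upm h mulr1. Qed.

Lemma drift_pos (k : zmat) Z Z' s : mulm (invm (mulm Z (upm s))) (mulm (zr k) (mulm Z' (upm s))) =
  drift (mulm (invm Z) (mulm (zr k) Z')) s.
Proof.
have -> : invm (mulm Z (upm s)) = mulm (upm (- s)) (invm Z).
  by rewrite /mulm /upm /invm /=; congr ((_, _), (_, _)); ring.
by rewrite /drift !mulmA.
Qed.

Lemma mbound_dil_upm y (k : R) : 1 <= y <= 2 -> `|k| <= 1 -> mbound 2 (mulm (invm (dil y)) (upm k)).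
Proof.
move=> yb kc; have /andP[q1 q2] := sqrt_bounds yb.
have q3 : (Num.sqrt y)^-1 <= 1 by rewrite invf_le1 //; lra.
have q4 : 0 <= (Num.sqrt y)^-1 by rewrite invr_ge0 sqrtr_ge0.
have qn : `|(Num.sqrt y)^-1| <= 1 by rewrite ger0_norm.
rewrite /dil /diagm /invm /upm /mulm /=; apply/and4P; split => /=.
- by rewrite mulr1 mulr0 addr0; lra.
- rewrite oppr0 mul0r addr0 normrM; apply: (@le_trans _ _ (1 * 1)); first exact: ler_pM.
  by lra.
- by rewrite oppr0 mul0r mulr0 addr0 normr0.
- rewrite oppr0 mul0r add0r mulr1 ger0_norm //; lra.
Qed.

Section observable.
Variable Psi : M2 -> M2 -> R.
Hypotheses (iPsi : inv2 Psi) (uPsi : ucontr Psi).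

(** The first variables agree modulo SL_2(Z). In the second, a relative position near [upm (c / y)]
    becomes one near [upm c] after conjugation by [dil y], which amounts to replacing the shift [k]
    by [k + c]. *)
Lemma obs_transfer e : 0 < e -> exists2 d, 0 < d & forall y Z Z' (k1 k2 : zmat) (c k : R), 1 <= y <= 2 ->
  detm Z = 1 -> detm Z' = 1 -> sl2z k1 -> sl2z k2 -> mulm (invm (dil y)) Z' = mulm (zr k1) (mulm (invm (dil y)) Z) ->
  `|k + c| <= 1 -> nearm d (mulm (mulm (invm Z) (mulm (zr k2) Z')) (upm (- (c / y)))) ->
  `|obs Psi y k Z' - obs Psi y (k + c) Z| <= e.
Proof.
move=> e0; have [d d0 hd] := uPsi e0.
exists (d / 16) => [|y Z Z' k1 k2 c k yb DZ DZ' s1 s2 HZ kc]; first by rewrite divr_gt0.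
set E := mulm _ (upm (- (c / y))) => nE.
have Da := detm_dil yb; have Dai : detm (invm (dil y)) = 1 by rewrite detm_inv.
have DE : detm E = 1 by rewrite !detm_mul detm_inv DZ detm_zr // DZ' detm_upm !mulr1.
pose K := mulm (invm (dil y)) (upm (k + c)).
have DK : detm K = 1 by rewrite detm_mul Dai detm_upm mulr1.
have ZE : Z' = mulm (zr (zinv k2)) (mulm Z (mulm E (upm (c / y)))).
  rewrite /E -!mulmA upm_mul addNr (_ : upm 0 = idm) // mulm1 (mulmA Z) mulmV // mul1m zr_inv mulmA mulVm ?detm_zr //.
  by rewrite mul1m.
clearbody E.
have bK : mbound 2 K by exact: mbound_dil_upm.
have KU : mulm (invm (dil y)) (upm (k + c)) = K by [].
clearbody K.
have obsE : obs Psi y k Z' = Psi (mulm (invm (dil y)) Z) (mulm (mulm Z K) (mulm (invm K) (mulm E K))).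
  rewrite /obs HZ; case: (iPsi) => i1 i2.
  have D1 : detm (mulm (invm (dil y)) Z) = 1 by rewrite detm_mul Dai DZ mulr1.
  rewrite i1 //; last by rewrite !detm_mul DZ' Dai detm_upm !mulr1.
  rewrite {1}ZE -!mulmA (mulmA (upm (c / y))) dil_upm // -mulmA upm_mul (addrC c k) KU.
  rewrite i2; last 3 first.
  - exact: sl2z_inv.
  - by rewrite detm_mul Dai DZ mulr1.
  - by rewrite !detm_mul DZ DE DK !mulr1.
  by rewrite (mulmA K) mulmV // mul1m.
rewrite obsE /obs KU; apply: hd.
- by rewrite detm_mul Dai DZ mulr1.
- by rewrite detm_mul DZ DK mulr1.
- by rewrite !detm_mul detm_inv DK DE !mulr1.
have -> : d = 4 * 2 ^+ 2 * (d / 16) by field.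
by apply: nearm_conj_bound => //; rewrite divr_ge0 // ltW.
Qed.

Lemma obs_bavg e : 0 < e -> exists2 d, 0 < d & forall y Z Z' (k1 k2 : zmat) (c k t W : R) (m n : nat), 1 <= y <= 2 ->
  detm Z = 1 -> detm Z' = 1 -> sl2z k1 -> sl2z k2 -> mulm (invm (dil y)) Z' = mulm (zr k1) (mulm (invm (dil y)) Z) ->
  `|k + c| <= 1 -> 0 < t -> (0 < m)%N -> m%:R * t <= W ->
  (forall s, `|s| <= W ->
    nearm d (mulm (drift (drift (mulm (invm Z) (mulm (zr k2) Z')) (n%:R * t)) s) (upm (- (c / y))))) ->
  `|bavg m (fun i => obs Psi y k (flow t Z' i)) n - bavg m (fun i => obs Psi y (k + c) (flow t Z i)) n| <= e.
Proof.
move=> e0; have [d d0 hd] := obs_transfer e0; exists d => // y Z Z' k1 k2 c k t W m n yb DZ DZ' s1 s2 HZ kc t0 m0 mW hn.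
have one i : (i < m)%N -> `|obs Psi y k (flow t Z' (n %/ m * m + i)) - obs Psi y (k + c) (flow t Z (n %/ m * m + i))| <= e.
  move=> im; set j := (_ + i)%N.
  apply: (hd y _ _ k1 k2) => //; rewrite ?detm_flow //.
    by rewrite /flow mulmA HZ -mulmA -mulmA.
  rewrite drift_pos -(_ : n%:R * t + (j%:R * t - n%:R * t) = j%:R * t); last by ring.
  rewrite -drift_add; apply: hn; rewrite -mulrBl normrM (gtr0_norm t0).
  apply: le_trans mW; rewrite ler_pM2r //.
  have h1 : (n < j + m)%N by rewrite /j {1}(divn_eq n m) -addnA ltn_add2l ltn_addl // ltn_mod.
  have h2 : (j < n + m)%N by rewrite /j {2}(divn_eq n m) -addnA ltn_add2l ltn_addl.
  rewrite ler_norml; apply/andP; split.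
    by rewrite lerBrDl lerBlDr -natrD ler_nat ltnW.
  by rewrite lerBlDl -natrD ler_nat ltnW.
rewrite /bavg -mulrBr -sumrB normrM ger0_norm ?invr_ge0 // mulrC ler_pdivrMr ?ltr0n //.
apply: le_trans (ler_norm_sum _ _ _) _; apply: le_trans (ler_sum _ (G := fun=> e) _) _ => [i _|].
  exact: one.
by rewrite sumr_const card_ord mulr_natr.
Qed.

Lemma closeup_le (c d e : R) D : d <= e -> closeup c d d D -> closeup c e e D.
Proof. by move=> de [h1 h2 h3 h4]; split; apply: le_trans de. Qed.

(** The sign of the drift is unknown: after a drift by [(-1)^b / y], the shift [b] at one point
    corresponds to the shift [b + (-1)^b = ~~ b] at the other, so either sign exchanges the
    observables 0 and 1. *)
Lemma pair_close e : 0 < e -> exists2 w : nat, (0 < w)%N & forall (t : R) (m : nat), 0 < t -> (0 < m)%N ->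
  exists2 d0 : R, 0 < d0 <= 1 / 4 & forall S : R, 0 < S -> exists mmax : nat, forall y Z Z' (k1 k2 : zmat) n, 1 <= y <= 2 ->
  detm Z = 1 -> detm Z' = 1 -> sl2z k1 -> sl2z k2 -> mulm (invm (dil y)) Z' = mulm (zr k1) (mulm (invm (dil y)) Z) ->
  let D := drift (mulm (invm Z) (mulm (zr k2) Z')) (n%:R * t) in
  let g (b : bool) i := obs Psi y b%:R (flow t Z i) in let g' (b : bool) i := obs Psi y b%:R (flow t Z' i) in
  closeup 0 d0 d0 D -> ~ (`|D.1.1 - D.2.2| <= S^-1 /\ `|D.2.1| <= S ^- 2) ->
  (forall b, `|bavg m (g' b) n - bavg m (g b) n| <= e) /\
  exists b m1, (m1 <= mmax)%N /\
    forall i, (m1 - m1 %/ w <= i <= m1)%N -> `|bavg m (g' b) (n + i) - bavg m (g (~~ b)) (n + i)| <= e.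
Proof.
move=> e0; have [d d0 hd] := obs_bavg e0.
have [w w0 hw] := @drift_time R (d / 2) (ltac:(by rewrite divr_gt0)).
exists w => // t m t0 m0; pose W := m%:R * t.
have W0 : 0 < W by rewrite mulr_gt0 // ltr0n.
(* Leaves room for the drift during one stretch of length [W = m t], which enlarges the tolerance by
   a factor of order [(1 + W)^2]. *)
pose d' := d / 2 / (2 * (1 + W) ^+ 2).
have den : 0 < 2 * (1 + W) ^+ 2 by rewrite mulr_gt0 // exprn_gt0 // addr_gt0.
have d'0 : 0 < d' by rewrite !divr_gt0.
have dd' : 2 * (1 + W) ^+ 2 * d' = d / 2 by rewrite /d' mulrC divfK // gt_eqF.
have [d1 d10 hd1] := hw d' t 0%N d'0 t0.
exists (Num.min (Num.min d1 d') (1 / 4)) => [|S S0]; first by rewrite !lt_min d10 d'0 ge_min lexx orbT divr_gt0.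
have [mmax hm] := hd1 S S0; exists mmax => y Z Z' k1 k2 n yb DZ DZ' s1 s2 HZ D g g' cD nD.
have cD1 : closeup 0 d1 d1 D by apply: closeup_le cD; rewrite !ge_min lexx.
have cD' : closeup 0 d' d' D by apply: closeup_le cD; rewrite !ge_min lexx orbT.
have dW : W * d' <= W ^+ 2 * d' + d' by have := sqr_ge0 (W - 1 / 2); nra.
have W2 : 0 <= W ^+ 2 * d' by rewrite mulr_ge0 ?sqr_ge0 // ltW.
have Wd : 0 <= W * d' by rewrite mulr_ge0 // ltW.
have dd2 : 2 * d' + 4 * (W * d') + 2 * (W ^+ 2 * d') = d / 2 by rewrite -dd'; ring.
split=> [b|].
  have := hd y Z Z' k1 k2 0 b%:R t W m n yb DZ DZ' s1 s2 HZ.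
  rewrite addr0; apply => //; first by case: (b); rewrite ?normr1 ?normr0.
  move=> s sW; rewrite mul0r oppr0.
  have := @closeup_near R 0 (d' + (2 * W + W ^+ 2) * d') ((1 + W) * d') d (drift D s); rewrite oppr0; apply.
  - by rewrite normr0.
  - by clear -dd2 Wd W2 d'0 d0; lra.
  - by clear -dd2 Wd W2 d'0 d0; lra.
  - by clear -dd2 Wd W2 d'0 d0; lra.
  - by clear -dd2 Wd W2 d'0 d0; lra.
  - by apply: closeup_drift => //; exact: ltW.
have y0 : 0 < y by case/andP: yb => y1 _; exact: lt_le_trans y1.
have iy : 1 / 2 <= y^-1 <= 1.
  by case/andP: yb => y1 y2; apply/andP; split; [rewrite -[y^-1]mul1r ler_pM2l // lef_pV2 ?posrE | rewrite invf_le1].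
have [b [m1 [m1m hb]]] := hm y^-1 D iy cD1 nD.
exists b, m1; split => // i ib.
have := hd y Z Z' k1 k2 ((-1) ^+ b) b%:R t W m (n + i)%N yb DZ DZ' s1 s2 HZ.
have -> : b%:R + (-1) ^+ b = (~~ b)%:R :> R by case: (b); rewrite /= ?expr0 ?expr1 ?add0r ?subrr.
apply => //; first by case: (b); rewrite /= ?normr1 ?normr0.
move=> s sW; rewrite natrD mulrDl -drift_add -/D.
apply: (@closeup_near R _ (d / 2 + (2 * W + W ^+ 2) * d') ((1 + W) * d')).
- rewrite normrM normrX normrN1 expr1n mul1r ger0_norm; case/andP: iy => i1 i2; clear -i1 i2; lra.
- by clear -dd2 Wd W2 d'0 d0; lra.
- by clear -dd2 Wd W2 d'0 d0; lra.
- by clear -dd2 Wd W2 d'0 d0; lra.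
- by clear -dd2 Wd W2 d'0 d0; lra.
- by apply: closeup_drift; [|exact: ltW|exact: hb].
Qed.
End observable.
End transfer.

(** * Rarity of pairs that stay close *)

Section tubes.
Context {R : realType}.
Local Notation M2 := (mat2 R).
Implicit Types (Z D : M2) (t S c C A : R).

(** Up to time [S] the bounds of the tube suffice; later, a bounded upper right entry limits the
    coefficients of the quadratic through [quad_bound]. *)
Lemma tube_wtube S A t D (u m : nat) : 1 <= A -> 0 < t -> 2 * t <= S -> (m < u)%N -> tube S D ->
  (forall i, (i < u)%N -> `|(drift D (i%:R * t)).1.2| <= A) -> wtube (25 * A) S (drift D (m%:R * t)).
Proof.
move=> A1 t0 tS mu; case: D => -[p r] [f q] [h1 h2 h3 h4] hi; rewrite /= in h1 h2 h3 h4.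
have S0 : 0 < S by lra.
set s := m%:R * t; have s0 : 0 <= s by rewrite mulr_ge0 // ltW.
have hm := hi m mu; rewrite -/s in hm.
have f0 := normr_ge0 f.
have fS : `|f| * S ^+ 2 <= 1 by rewrite -ler_pdivlMr ?exprn_gt0 // mul1r.
have eS : `|p - q| * S <= 1 by rewrite -ler_pdivlMr // mul1r.
have sf : `|f| * s * S <= 11 * A -> `|p - s * f - (q + s * f)| * S <= 25 * A.
  move=> h; rewrite (_ : _ - _ = (p - q) - 2 * (f * s)); last by ring.
  apply: le_trans (ler_wpM2r (ltW S0) (ler_normB _ _)) _.
  rewrite mulrDl normrM (normrM f) (ger0_norm s0) ger0_norm //; lra.
have key : `|f| * s * S <= 11 * A.
  have [sS|Ss] := leP s S.
    by apply: (@le_trans _ _ (`|f| * S ^+ 2)); [rewrite -mulrA ler_wpM2l // expr2 ler_wpM2r // ltW|lra].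
  case: u mu hi => [//|v] mu hi.
  have sv : s <= v%:R * t by rewrite ler_pM2r // ler_nat.
  have v2 : (2 <= v)%N.
    have : 2 * t < v%:R * t by lra.
    by rewrite ltr_pM2r // -[2]/(2%:R) ltr_nat => /ltnW.
  have b0 : 0 < v%:R * t by lra.
  have h0 : `|r| <= A by lra.
  have ia : ((v %/ 2) < v.+1)%N by rewrite ltnS leq_div.
  have ha := hi _ ia; have hb := hi _ (ltnSn v); rewrite !driftE /= in ha hb.
  have [F _] := quad_bound b0 (half_time t0 v2) h0 ha hb.
  move: F; set b := v%:R * t in sv b0 * => F.
  apply: (@le_trans _ _ (`|f| * b ^+ 2)) => //; rewrite -mulrA ler_wpM2l // expr2.
  by apply: ler_pM => //; lra.
rewrite driftE /=; split => /=.
- by apply: le_trans (_ : A <= _); [move: hm; rewrite driftE|lra].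
- by rewrite ler_pdivlMr //; exact: sf.
- by rewrite ler_pdivlMr ?exprn_gt0 //; lra.
- by rewrite (_ : _ - 2 = p + q - 2) //; ring.
Qed.

(** From a time in the tube the pair is followed until the upper right entry first exceeds
    [3 rho^2]. On this stretch a single integer matrix is involved ([wtube_unique]), so
    [sublevel_count] shows that the tube is visited on a fraction at most [4 / rho] of it; [greedy]
    adds up the stretches. The choice of [S] makes every stretch longer than [rho] steps. *)
Lemma tube_count C c t : 0 < C -> 0 < c -> 0 < t -> exists2 rho : nat, (0 < rho)%N & exists2 S : R, 1 <= S &
  forall Z Z' (P X : nat), detm Z = 1 -> detm Z' = 1 ->
  (forall (n : nat) (k : zmat), (n < X)%N -> sl2z k -> tube S (drift (mulm (invm Z) (mulm (zr k) Z')) (n%:R * t)) ->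
    exists2 u, (0 < u <= P)%N & 3 * rho%:R ^+ 2 < `|(drift (mulm (invm Z) (mulm (zr k) Z')) ((n + u)%:R * t)).1.2|) ->
  (\sum_(0 <= n < X) `[< thick C (mulm (flow t Z n) (diagm (Num.sqrt S))) /\
     exists2 k : zmat, sl2z k & tube S (drift (mulm (invm Z) (mulm (zr k) Z')) (n%:R * t)) >])%:R <= c * (X + P)%:R.
Proof.
move=> C0 c0 t0.
have [rho rho2 rhol] := @nat_large R [:: 4 / c] 2.
have rho0 : (0 < rho)%N by exact: leq_trans rho2.
have rc : 4 <= c * rho%:R by rewrite mulrC -ler_pdivrMr // rhol // inE eqxx.
have rho2R : 2 <= rho%:R :> R by rewrite -[2]/(2%:R) ler_nat.
pose A := 3 * (rho%:R : R) ^+ 2.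
have A1 : 3 < A by rewrite /A; nra.
have A25 : 0 < 25 * A by lra.
have [S0 S00 uniq] := wtube_unique C0 A25.
pose S := 1 + S0 + 2 * t + rho%:R * t.
have rt0 : 0 <= rho%:R * t by rewrite mulr_ge0 // ltW.
exists rho => //; exists S => [|Z Z' P X DZ DZ' H2]; first by rewrite /S; lra.
have Spos : 0 < S by rewrite /S; lra.
have SS0 : S0 <= S by rewrite /S; lra.
have tS : 2 * t <= S by rewrite /S; lra.
have rS : rho%:R * t <= S by rewrite /S; lra.
clearbody S.
pose DD (k : zmat) := mulm (invm Z) (mulm (zr k) Z').
pose B n := `[< thick C (mulm (flow t Z n) (diagm (Num.sqrt S))) /\ exists2 k : zmat, sl2z k & tube S (drift (DD k) (n%:R * t)) >].
suff -> : c * (X + P)%:R = c * \sum_(0 <= i < X + P) 1.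
  apply: (@greedy R c B (fun=> 1) P X) => [|//|n nX /asboolP[_ [k sk tk]]]; first exact: ltW.
  have ex : exists u, A < `|(drift (DD k) ((n + u)%:R * t)).1.2| by have [u _ hu] := H2 n k nX sk tk; exists u.
  have [u hu umin] := ex_minnP ex.
  have [u' /andP[u'0 u'P] hu'] := H2 n k nX sk tk.
  pose D := drift (DD k) (n%:R * t).
  have DE i : drift (DD k) ((n + i)%:R * t) = drift D (i%:R * t) by rewrite drift_add -mulrDl -natrD.
  have below i : (i < u)%N -> `|(drift D (i%:R * t)).1.2| <= A.
    by move=> iu; rewrite leNgt -DE; apply/negP => /umin; rewrite leqNgt iu.
  rewrite DE in hu.
  have tD : tube S D by exact: tk.
  clearbody D.
  have ur : (rho < u)%N.
    rewrite ltnNge; apply/negP => ur; move: hu; apply/negP; rewrite -leNgt.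
    apply: le_trans (ltW A1).
    case: D tD {DE below} => -[p r] [f q] [h1 h2 h3 _]; rewrite driftE; rewrite /= in h1 h2 h3 *.
    have uS : u%:R * t <= S by apply: le_trans rS; rewrite ler_pM2r // ler_nat.
    have ut0 : 0 <= u%:R * t by rewrite mulr_ge0 // ltW.
    move: (u%:R * t) uS ut0 => s sS s0.
    have eS : `|(p - q) * s| <= 1.
      rewrite normrM (ger0_norm s0); apply: le_trans (ler_pM _ _ h2 sS) _ => //.
      by rewrite mulVf // gt_eqF.
    have fS : `|f * s ^+ 2| <= 1.
      rewrite normrM (ger0_norm (sqr_ge0 s)); apply: (@le_trans _ _ (S ^- 2 * S ^+ 2)).
        by apply: ler_pM; rewrite ?sqr_ge0 // ler_pXn2r ?nnegrE // ltW.
      by rewrite mulVf // expf_neq0 // gt_eqF.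
    apply: le_trans (ler_normB _ _) _; have := ler_normD r ((p - q) * s); lra.
  exists u; first by rewrite (leq_ltn_trans _ ur) //= (leq_trans (umin u' hu')).
  rewrite big_const_nat iter_addr_0 addKn.
  have cnt : (\sum_(n <= i < n + u) B i <= 2 * (u %/ rho).+1)%N.
    case: D tD DE below hu => -[p r] [f q] tD DE below hu.
    rewrite driftE /= in hu.
    apply: leq_trans (sublevel_count rho0 t0 hu).
    have -> : (\sum_(n <= i < n + u) B i = \sum_(0 <= m < u) B (m + n))%N.
      by rewrite -{1}(add0n n) big_addn addKn.
    rewrite [leqLHS]big_nat_cond [leqRHS]big_nat_cond; apply: leq_sum => m; rewrite andbT => /andP[_ mu].
    case: (boolP (B (m + n)%N)) => // /asboolP[th [k' sk' tk']].
    rewrite [X in (_ <= X)%N](_ : _ = 1%N) //; apply/eqP; rewrite eqb1.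
    have A1' : 1 <= A by lra.
    have w1 := tube_wtube A1' t0 tS mu tD below.
    have w2 : wtube (25 * A) S (drift (DD k') ((m + n)%:R * t)).
      have A251 : 1 <= 25 * A by lra.
      have iS : 0 < S^-1 by rewrite invr_gt0.
      have iS2 : 0 < S ^- 2 by rewrite invr_gt0 exprn_gt0.
      case: tk' => k1 k2 k3 k4; split => //; first lra.
        by apply: le_trans k2 _; rewrite ler_peMl ?(ltW iS).
      by apply: le_trans k3 _; rewrite ler_peMl ?(ltW iS2).
    rewrite -DE addnC -drift_pos in w1.
    rewrite -drift_pos in w2.
    have E := uniq S _ _ k k' SS0 (detm_flow t (m + n) DZ) (detm_flow t (m + n) DZ') sk sk' th w1 w2.
    have : tube S (drift ((p, r), (f, q)) (m%:R * t)) by rewrite -DE addnC /DD E.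
    by rewrite driftE => -[].
  apply: le_trans (_ : (2 * (u %/ rho).+1)%:R <= _); first by rewrite ler_nat.
  have E1 : (u %/ rho).+1%:R = (u %/ rho)%:R + 1 :> R by rewrite natr1.
  rewrite natrM E1; have : (u %/ rho)%:R * rho%:R <= u%:R :> R by rewrite -natrM ler_nat leq_trunc_div.
  have : rho%:R <= u%:R :> R by rewrite ler_nat ltnW.
  move: ((u %/ rho)%:R : R) (u%:R : R) (ler0n R (u %/ rho)) => x v x0 v1 v2.
  have : 4 * x <= c * v by nra.
  have : 4 <= c * v by nra.
  by clear; lra.
by rewrite big_const_nat iter_addr_0 subn0.
Qed.
End tubes.

(** * Frequencies of exceptional times *)

Section frequency.
Context {R : realType}.

Definition freq (X : nat) (b : pred nat) : R := (\sum_(0 <= n < X) b n)%:R.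

Lemma freqE X (b : pred nat) : freq X b = \sum_(n < X) (b n)%:R.
Proof. by rewrite /freq big_mkord natr_sum. Qed.

Lemma sum_freq (f : nat -> R) (a : R) (bs : seq (pred nat)) X : (forall n, `|f n| <= 2) -> 0 <= a ->
  (forall n, (n < X)%N -> ~~ has (fun b : pred nat => b n) bs -> `|f n| <= a) ->
  `|\sum_(n < X) f n| <= a * X%:R + 2 * \sum_(b <- bs) freq X b.
Proof.
move=> f2 a0 fa; apply: le_trans (ler_norm_sum _ _ _) _.
have pt (n : 'I_X) : `|f n| <= a + 2 * \sum_(b <- bs) (b n)%:R.
  have s0 : 0 <= \sum_(b <- bs) (b n)%:R :> R by exact: sumr_ge0.
  have [|no] := boolP (has (fun b : pred nat => b n) bs); last first.
    by apply: le_trans (fa n (ltn_ord n) no) _; lra.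
  elim: bs {fa s0} => //= b bs IH; rewrite big_cons.
  have s0 : 0 <= \sum_(b <- bs) (b n)%:R :> R by exact: sumr_ge0.
  case: (b n) => /= [_|/IH]; first by apply: le_trans (f2 n) _; rewrite mulr1n; lra.
  by move=> h; apply: le_trans h _; rewrite add0r.
apply: le_trans (ler_sum _ (fun n _ => pt n)) _.
have -> : \sum_(b <- bs) freq X b = \sum_(n < X) \sum_(b <- bs) (b n)%:R.
  elim: (bs) => [|b s IH]; first by rewrite big_nil big1 // => n _; rewrite big_nil.
  by rewrite big_cons IH freqE -big_split /=; apply: eq_bigr => n _; rewrite big_cons.
by rewrite big_split /= sumr_const card_ord mulr_natr -mulr_sumr.
Qed.

(** The Hardy-Littlewood maximal inequality for forward averages, with [greedy] as the covering
    argument. *)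
Lemma freq_maximal (w U X : nat) (B : pred nat) :
  freq X (fun n => `[< exists2 u, (0 < u <= U)%N & (u < 4 * w * \sum_(n <= i < n + u) ((i < X) && B i))%N >]) <=
  4 * w%:R * freq X B.
Proof.
pose W i : R := ((i < X)%N && B i)%:R.
have W0 i : 0 <= W i by exact: ler0n.
have c0 : 0 <= 4 * w%:R :> R by rewrite mulr_ge0.
pose Z : pred nat := fun n =>
  `[< exists2 u, (0 < u <= U)%N & (u < 4 * w * \sum_(n <= i < n + u) ((i < X) && B i))%N >].
change (freq X Z <= 4 * w%:R * freq X B).
have := @greedy R (4 * w%:R) Z W U X c0 W0.
have -> : \sum_(0 <= i < X + U) W i = freq X B.
  rewrite (@big_cat_nat _ _ _ X) ?leq_addr //= [X in _ + X]big_nat_cond [X in _ + X]big1 ?addr0; last first.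
    by move=> i /andP[/andP[Xi _] _]; rewrite /W ltnNge Xi.
  rewrite freqE big_mkord; apply: eq_bigr => i _.
  by rewrite /W ltn_ord.
apply=> n nX /asboolP[u uU hu]; exists u => //.
have zu : (\sum_(n <= i < n + u) Z i <= u)%N.
  apply: leq_trans (leq_sum _ (E2 := fun=> 1%N) (fun i _ => leq_b1 _)) _.
  by rewrite big_const_nat iter_addn_0 mul1n addKn.
apply: le_trans (_ : u%:R <= _); first by rewrite ler_nat.
by rewrite -natr_sum -natrM -natrM ler_nat ltnW.
Qed.

Lemma freq_markov (f : nat -> R) (e : R) X : 0 < e ->
  freq X (fun n => e < `|f n|) <= (\sum_(n < X) f n ^+ 2) / e ^+ 2.
Proof.
move=> e0; rewrite freqE ler_pdivlMr ?exprn_gt0 // mulr_suml; apply: ler_sum => n _.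
case: ltP => [h|_]; last by rewrite mul0r sqr_ge0.
by rewrite mul1r -(real_normK (num_real (f n))) ler_pXn2r ?nnegrE // ltW.
Qed.

Lemma freq_or (b c : pred nat) X : freq X (fun n => b n || c n) <= freq X b + freq X c.
Proof.
by rewrite -natrD ler_nat -big_split; apply: leq_sum => n _; case: (b n) (c n) => -[].
Qed.

Lemma freq_boundary (m k X : nat) : (0 < m)%N -> (m %| X)%N ->
  freq X (fun n => m <= n %% m + k)%N * m%:R <= k%:R * X%:R.
Proof.
move=> m0 mX; rewrite freqE (sum_blocks (fun n => (m <= n %% m + k)%N%:R) m0 mX).
have one b : \sum_(j < m) (m <= (b * m + j) %% m + k)%N%:R <= k%:R :> R.
  under eq_bigr => j _ do rewrite modnMDl modn_small //.
  rewrite -natr_sum ler_nat -(big_mkord xpredT (fun j => nat_of_bool (m <= j + k)%N)).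
  rewrite (@big_cat_nat _ _ _ (m - k)) ?leq_subr //=.
  rewrite big_nat_cond big1 ?add0n; last first.
    by move=> i /andP[/andP[_ ik] _]; apply/eqP; rewrite eqb0 -ltnNge; move: ik; lia.
  apply: leq_trans (leq_sum _ (E2 := fun=> 1%N) (fun i _ => leq_b1 _)) _.
  by rewrite big_const_nat iter_addn_0 mul1n leq_subCl.
apply: le_trans (_ : \sum_(b < X %/ m) k%:R * m%:R <= _).
  by rewrite mulr_suml ler_sum // => b _; rewrite ler_wpM2r.
by rewrite sumr_const card_ord -[_ *+ (X %/ m)]mulr_natr -mulrA -natrM mulnC divnK.
Qed.

(** Bad times have density at most [1 / (4 w)] in both stretches, too few to cover the last [w]-th
    part, where a common good offset remains. *)
Lemma window_pick (B : pred nat) (n n' m w : nat) : (0 < w)%N ->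
  (4 * w * \sum_(n <= i < n + m.+1) B i <= m.+1)%N -> (4 * w * \sum_(n' <= i < n' + m.+1) B i <= m.+1)%N ->
  exists i, [/\ (m - m %/ w <= i <= m)%N, ~~ B (n + i)%N & ~~ B (n' + i)%N].
Proof.
move=> w0 h h'; apply: contrapT => no.
have sh p : (\sum_(p <= i < p + m.+1) B i = \sum_(0 <= i < m.+1) B (p + i))%N.
  by rewrite -{1}(add0n p) big_addn addKn; apply: eq_bigr => i _; rewrite addnC.
rewrite !sh in h h'.
have le : (m - m %/ w <= m.+1)%N by apply: leqW; exact: leq_subr.
have : (m %/ w < (\sum_(0 <= i < m.+1) B (n + i)) + (\sum_(0 <= i < m.+1) B (n' + i)))%N.
  rewrite -big_split /= [ltnRHS](@big_cat_nat _ _ _ (m - m %/ w)) //=.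
  apply: leq_trans (leq_addl _ _).
  apply: (@leq_trans (\sum_(m - m %/ w <= i < m.+1) 1)%N).
    by rewrite big_const_nat iter_addn_0 mul1n subSn ?leq_subr // subKn // leq_div.
  rewrite big_nat_cond [leqRHS]big_nat_cond; apply: leq_sum => i; rewrite andbT ltnS => ib.
  case: (boolP (B (n + i)%N)) => // b1; case: (boolP (B (n' + i)%N)) => // b2.
  by case: no; exists i.
have := ltn_ceil m w0; rewrite mulSn.
move: (\sum_(_ <= _ < _) _)%N (\sum_(_ <= _ < _) _)%N (m %/ w)%N h h' => a b q h h' q1 q2.
have : (4 * w * q.+1 <= 2 * m.+1)%N.
  apply: (@leq_trans (4 * w * (b + a))); first by rewrite leq_mul2l q2 orbT.
  by rewrite mulnDr mul2n -addnn leq_add.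
rewrite mulnS -mulnA; lia.
Qed.
End frequency.

(** * Shearing at one scale and the tower of scales *)

Section level.
Context {R : realType}.
Local Notation M2 := (mat2 R).
Implicit Types (Psi : M2 -> M2 -> R) (Z : M2) (y t e : R).

Lemma flow_add t Z a b : flow t (flow t Z a) b = flow t Z (a + b).
Proof. by rewrite /flow -mulmA upm_mul natrD mulrDl. Qed.

Lemma flow_period y t Z P (k1 : zmat) h : sl2z k1 ->
  mulm (invm (dil y)) (flow t Z P) = mulm (zr k1) (mulm (invm (dil y)) Z) ->
  exists2 k : zmat, sl2z k & mulm (invm (dil y)) (flow t Z (h * P)) = mulm (zr k) (mulm (invm (dil y)) Z).
Proof.
move=> s1 E; elim: h => [|h [k sk Ek]].
  exists ((1, 0), (0, 1)) => //; rewrite (_ : zr _ = idm) // mul0n /flow mul0r (_ : upm 0 = idm) // mulm1 mul1m //.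
exists (zmul k1 k); first exact: sl2z_mul.
by rewrite mulSn -flow_add {1}/flow mulmA E -!mulmA -/(flow t Z (h * P)) Ek zr_mul -mulmA.
Qed.

(** The letters are averages at a time and at its partner: [x], [z] at the short scale, [x'], [z']
    at the long scale, and [v], [w] at the short scale after the drift, where the two observables
    are exchanged. *)
Lemma chain12 (x x' z z' v w : bool -> R) (b : bool) e :
  (forall b, `|x b - x' b| <= e) -> (forall b, `|z b - z' b| <= e) -> (forall b, `|v b - x' b| <= e) ->
  (forall b, `|w b - z' b| <= e) -> (forall b, `|z b - x b| <= e) -> `|w b - v (~~ b)| <= e ->
  `|x' true - x' false| <= 12 * e /\ `|z' true - z' false| <= 12 * e.
Proof.
have n2 (p q : R) : `|p - q| <= e -> p <= q + e /\ q <= p + e by rewrite ler_norml => /andP[? ?]; split; lra.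
move=> h1 h2 h3 h4 h5 /n2[h6 h7].
have [a1 a2] := n2 _ _ (h1 true); have [a3 a4] := n2 _ _ (h1 false).
have [b1 b2] := n2 _ _ (h2 true); have [b3 b4] := n2 _ _ (h2 false).
have [c1 c2] := n2 _ _ (h3 true); have [c3 c4] := n2 _ _ (h3 false).
have [d1 d2] := n2 _ _ (h4 true); have [d3 d4] := n2 _ _ (h4 false).
have [e1 e2] := n2 _ _ (h5 true); have [e3 e4] := n2 _ _ (h5 false).
clear h1 h2 h3 h4 h5 n2.
by case: b h6 h7 => /= h6 h7; split; rewrite ler_norml; apply/andP; split; lra.
Qed.


(** As the start is not near the end of a long block, [n] and [n + i] share the average at scale
    [m']. The offset [i] comes from [window_pick], so that the two scales agree after the drift as
    well. *)
Lemma pair_chain (m m' p n w mmax X : nat) (g g' : bool -> nat -> R) (e : R) : 0 <= e -> (0 < m)%N -> (0 < m')%N -> (0 < w)%N ->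
  (m %| p)%N -> (m' %| p)%N -> (m' %| X)%N -> (forall b i, g' b i = g b (p + i)%N) -> (p + n < X)%N ->
  (n %% m' + mmax < m')%N ->
  let B i := [exists b, e < `|bavg m (g b) i - bavg m' (g b) i|] in
  let maxbad n := exists2 u, (0 < u <= mmax.+1)%N & (u < 4 * w * \sum_(n <= i < n + u) ((i < X) && B i))%N in
  ~ maxbad n -> ~ maxbad (p + n)%N ->
  (forall b, `|bavg m (g' b) n - bavg m (g b) n| <= e) ->
  (exists b m1, (m1 <= mmax)%N /\
    forall i, (m1 - m1 %/ w <= i <= m1)%N -> `|bavg m (g' b) (n + i) - bavg m (g (~~ b)) (n + i)| <= e) ->
  `|bavg m' (g true) n - bavg m' (g false) n| <= 12 * e /\
  `|bavg m' (g true) (p + n) - bavg m' (g false) (p + n)| <= 12 * e.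
Proof.
move=> e0 m0 m'0 w0 mp m'p m'X gE pnX nm B maxbad b1 b2 h0 [b [m1 [m1m hw]]].
have blk i : (i <= mmax)%N -> ((n + i) %/ m' = n %/ m')%N.
  move=> im; rewrite {1}(divn_eq n m') -addnA divnMDl // [X in (_ + X)%N]divn_small ?addn0 //.
  by apply: leq_ltn_trans nm; rewrite leq_add2l.
have ltX q i : (q < X)%N -> ((q + i) %/ m' = q %/ m')%N -> (q + i < X)%N.
  move=> qX E; case/dvdnP: m'X => k Xk; rewrite Xk -ltn_divLR // E ltn_divLR // -Xk //.
have blkp i : (i <= mmax)%N -> ((p + n + i) %/ m' = (p + n) %/ m')%N.
  by move=> im; case/dvdnP: m'p => k ->; rewrite -addnA !divnMDl // blk.
have nX : (n < X)%N by apply: leq_ltn_trans pnX; exact: leq_addl.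
have cnt q u : ~ maxbad q -> (0 < u <= mmax.+1)%N -> (4 * w * \sum_(q <= i < q + u) ((i < X) && B i) <= u)%N.
  by move=> h hu; rewrite leqNgt; apply/negP => lt; apply: h; exists u.
have good q i : (q + i < X)%N -> ~~ ((q + i < X)%N && B (q + i)%N) ->
    forall b, `|bavg m (g b) (q + i) - bavg m' (g b) (q + i)| <= e.
  by move=> qX; rewrite qX /= => /existsPn nB c; have := nB c; rewrite -leNgt.
have at0 q : ~ maxbad q -> (q < X)%N -> forall b, `|bavg m (g b) q - bavg m' (g b) q| <= e.
  move=> mb qX; have := cnt q 1%N mb isT; rewrite addn1 big_nat1 => h.
  have := good q 0%N; rewrite addn0 => /(_ qX); apply.
  apply/negP => hB; move: h; rewrite hB muln1; lia.
have [i [ib n1 n2]] := @window_pick (fun i => (i < X)%N && B i) n (p + n) m1 w w0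
   (cnt n m1.+1 b1 m1m) (cnt (p + n)%N m1.+1 b2 m1m).
have im : (i <= mmax)%N by apply: leq_trans m1m; case/andP: ib.
have c1 := good n i (ltX _ _ nX (blk i im)) n1.
have c2 := good (p + n)%N i (ltX _ _ pnX (blkp i im)) n2.
have sh b' q : bavg m (g' b') q = bavg m (g b') (p + q).
  by rewrite -(bavg_shift (g b') _ m0 mp); congr (_ * _); apply: eq_bigr => j _; rewrite gE.
have b'n b' : bavg m' (g b') (n + i) = bavg m' (g b') n by rewrite /bavg blk.
have b'p b' : bavg m' (g b') (p + n + i) = bavg m' (g b') (p + n) by rewrite /bavg blkp.
have a1 := at0 n b1 nX; have a2 := at0 (p + n)%N b2 pnX.
have hwi := hw i ib; rewrite sh addnA in hwi.
have h00 b' : `|bavg m (g b') (p + n) - bavg m (g b') n| <= e by rewrite -sh; exact: h0.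
apply: (@chain12 (fun b => bavg m (g b) n) (fun b => bavg m' (g b) n) (fun b => bavg m (g b) (p + n))
  (fun b => bavg m' (g b) (p + n)) (fun b => bavg m (g b) (n + i)) (fun b => bavg m (g b) (p + n + i)) b e) => //= b'.
  by rewrite -b'n.
by rewrite -b'p.
Qed.
(** The entries are rounded to multiples of [1 / N]; the number of cells depends on [C] and [d]
    only, as the pigeonhole argument requires. *)
Lemma quantize (C d : R) : 0 < C -> 0 < d -> exists q : nat, exists cell : M2 -> ('I_q.+1 * 'I_q.+1) * ('I_q.+1 * 'I_q.+1),
  forall K K', detm K = 1 -> mbound C K -> mbound C K' -> cell K = cell K' -> closeup 0 d d (mulm (invm K) K').
Proof.
move=> C0 d0; have [N N1 hN] := nat_large [:: 2 * C / d] 1.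
have N0 : 0 < N%:R :> R by rewrite ltr0n.
have Nd : 2 * C * N%:R^-1 <= d by rewrite ler_pdivrMr // -ler_pdivrMl // mulrC; apply: hN; rewrite inE.
pose tr (x : R) := Num.truncn ((x + C) * N%:R).
pose q := Num.truncn (2 * C * N%:R); exists q.
pose cl x : 'I_q.+1 := inord (tr x).
exists (fun K => ((cl K.1.1, cl K.1.2), (cl K.2.1, cl K.2.2))) => -[[a b] [c' c]] [[a' b'] [c1' c1]] /= D.
move=> /and4P[/= a1 a2 a3 a4] /and4P[/= b1 b2 b3 b4] [/= e1 e2 e3 e4].
have tq x : `|x| <= C -> (tr x < q.+1)%N.
  rewrite ler_norml => /andP[x1 x2]; rewrite ltnS; apply: le_truncn.
  by rewrite ler_pM2r //; lra.
have key x x' : `|x| <= C -> `|x'| <= C -> cl x = cl x' -> `|x' - x| <= N%:R^-1.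
  move=> hx hx' /(congr1 val); rewrite /= !inordK ?tq // => E.
  move: hx hx'; rewrite !ler_norml => /andP[x1 x2] /andP[x1' x2'].
  have p0 : 0 <= (x + C) * N%:R by rewrite mulr_ge0 //; lra.
  have p0' : 0 <= (x' + C) * N%:R by rewrite mulr_ge0 //; lra.
  have /andP[t1 t2] := truncn_itv p0; have /andP[t1' t2'] := truncn_itv p0'.
  rewrite -/(tr x) -/(tr x') E -natr1 in t1 t2 t1' t2'.
  have : `|(x' - x) * N%:R| <= 1 by rewrite ler_norml; apply/andP; split; lra.
  by rewrite normrM (ger0_norm (ltW N0)) -ler_pdivlMr // mul1r ler_norml.
have k1 := key _ _ a1 b1 e1; have k2 := key _ _ a2 b2 e2; have k3 := key _ _ a3 b3 e3; have k4 := key _ _ a4 b4 e4.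
rewrite /detm /= in D.
have fin (x y u v : R) : `|x| <= C -> `|y| <= C -> `|u| <= N%:R^-1 -> `|v| <= N%:R^-1 -> `|x * u - y * v| <= d.
  move=> hx hy hu hv; apply: le_trans Nd; apply: le_trans (ler_normB _ _) _; rewrite !normrM.
  have := ler_pM (normr_ge0 _) (normr_ge0 _) hx hu; have := ler_pM (normr_ge0 _) (normr_ge0 _) hy hv; lra.
split; rewrite /mulm /invm /=.
- by rewrite (_ : _ - 0 = c * (b' - b) - b * (c1 - c)); [exact: fin|ring].
- by rewrite -D (_ : _ - _ = c * (a' - a) - b * (c1' - c')); [exact: fin|ring].
- by rewrite (_ : _ + _ = a * (c1' - c') - c' * (a' - a)); [exact: fin|ring].
- by rewrite -D (_ : _ - _ = a * (c1 - c) - c' * (b' - b)); [exact: fin|ring].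
Qed.

(** Times are grouped by residue mod [P] and by runs of [l] periods; the runs bound the number [h]
    of periods between two members. *)
Lemma same_group (P L l X n n' : nat) : (0 < P)%N -> (0 < l)%N -> (l %| L)%N -> X = (L * P)%N -> (n < n')%N -> (n' < X)%N ->
  inord (n %% P) = inord (n' %% P) :> 'I_P.-1.+1 ->
  inord (n %/ P %/ l) = inord (n' %/ P %/ l) :> 'I_(L %/ l).-1.+1 ->
  exists2 h, (0 < h <= l)%N & n' = (h * P + n)%N.
Proof.
move=> P0 l0 lL XE nn' n'X /(congr1 val) E1 /(congr1 val) E2.
have nX : (n < X)%N := ltn_trans nn' n'X.
rewrite /= !inordK ?prednK ?ltn_mod // in E1.
have L0 : (0 < L)%N by move: nX; rewrite XE; case: (L).
have Ll0 : (0 < L %/ l)%N by rewrite divn_gt0 // dvdn_leq.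
have lt (i : nat) : (i < X)%N -> (i %/ P %/ l < L %/ l)%N.
  by move=> iX; rewrite ltn_divLR // divnK // ltn_divLR // -XE.
rewrite /= !inordK ?prednK ?lt // in E2.
have le : (n %/ P <= n' %/ P)%N by apply: leq_div2r; exact: ltnW.
have nE : n' = ((n' %/ P - n %/ P) * P + n)%N.
  by rewrite {1}(divn_eq n' P) {2}(divn_eq n P) addnA -mulnDl subnK // E1.
exists (n' %/ P - n %/ P)%N => //; apply/andP; split.
  by rewrite lt0n; apply/eqP => h0; move: nE; rewrite h0 mul0n add0n => E; move: nn'; rewrite E ltnn.
rewrite (divn_eq (n' %/ P) l) leq_subLR -E2 [in leqRHS](divn_eq (n %/ P) l) -addnA leq_add2l.
by apply: leq_trans (leq_addl _ _); apply: ltnW; exact: ltn_pmod.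
Qed.

Lemma tube_closeup (d S : R) (D : M2) : d <= 1 / 4 -> closeup 0 d d D ->
  `|D.1.1 - D.2.2| <= S^-1 -> `|D.2.1| <= S ^- 2 -> tube S D.
Proof.
case: D => -[p r] [f q] d4 [/= c1 c2 c3 c4] t1 t2; split => //=.
  by move: c1; rewrite subr0; lra.
rewrite (_ : p + q - 2 = (p - 1) + (q - 1)); last by ring.
by apply: le_trans (ler_normD _ _) _; lra.
Qed.

(* Pairs of times in the same residue class mod P whose points are close in SL_2(Z)\SL_2(R) should not remain close
   up to time P. *)
Definition escapes (t S : R) (rho l P X : nat) Z := forall n h (k : zmat), (n < X)%N -> (0 < h <= l)%N -> sl2z k ->
  let D (j : nat) := drift (mulm (invm Z) (mulm (zr k) (flow t Z (h * P)))) (j%:R * t) in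
  tube S (D n) -> exists2 u, (0 < u <= P)%N & 3 * rho%:R ^+ 2 < `|(D (n + u)%N).1.2|.

Definition level_ok Psi e e3 (C t : R) (m mu l rho : nat) (S : R) := forall y Z P L (k1 : zmat), 1 <= y <= 2 -> detm Z = 1 -> sl2z k1 ->
  mulm (invm (dil y)) (flow t Z P) = mulm (zr k1) (mulm (invm (dil y)) Z) -> (m * mu %| P)%N -> (l %| L)%N ->
  (0 < P)%N -> (0 < L)%N -> let X := (L * P)%N in let g (b : bool) i := obs Psi y b%:R (flow t Z i) in
  freq X (fun n => `[< ~ thick C (flow t Z n) >]) <= e * X%:R ->
  freq X (fun n => `[< ~ thick C (mulm (flow t Z n) (diagm (Num.sqrt S))) >]) <= e * X%:R ->
  escapes t S rho l P X Z ->
  (forall b, \sum_(n < X) (bavg m (g b) n - bavg (m * mu) (g b) n) ^+ 2 <= e3 * X%:R) ->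
  `|\sum_(n < X) (g true n - g false n)| <= 24 * e * X%:R.

(** Outside six families of times, each of frequency at most [e], a time has a partner with the same
    first variable and a nearby second one, and [pair_chain] bounds the difference of the two long
    averages by [12 e]. The bound [e3] is independent of [m], so that it can be met by an energy
    argument over all scales. *)
Lemma level Psi : inv2 Psi -> ucontr Psi -> (forall g h, `|Psi g h| <= 1) -> forall e, 0 < e -> exists2 e3 : R, 0 < e3 &
  forall (C t : R) (m : nat), 0 < C -> 0 < t -> (0 < m)%N -> exists mu l rho : nat, exists S : R,
  [/\ (0 < mu)%N, (0 < l)%N, (0 < rho)%N, 1 <= S & level_ok Psi e e3 C t m mu l rho S].
Proof.
move=> iP uP P1 e e0; have [w w0 hw] := pair_close iP uP e0.
have w0R : 0 < w%:R :> R by rewrite ltr0n.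
(* [freq_markov] for both observables, followed by [freq_maximal], bounds the times spoilt by the
   change of scale by a fraction [4 w * 2 e3 / e^2 = e]. *)
exists (e ^+ 3 / (8 * w%:R)) => [|C t m C0 t0 m0]; first by rewrite divr_gt0 ?exprn_gt0 ?mulr_gt0.
have [d0 /andP[d00 d01] hd0] := hw t m t0 m0.
have [q [cell hcell]] := quantize C0 d00.
(* A run of [l] periods has at most one isolated time per residue and cell, by this choice a
   fraction at most [e] of all its times. *)
have [l l1 hl] := nat_large [:: (q.+1 * q.+1 * (q.+1 * q.+1))%:R / e] 1.
have l0R : 0 < l%:R :> R by rewrite ltr0n.
have le_ : (q.+1 * q.+1 * (q.+1 * q.+1))%:R <= e * l%:R.
  by rewrite -ler_pdivrMl // mulrC; apply: hl; rewrite inE.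
(* Summed over the [l] values of [h], and with [X + P <= 2 X], the tubes take up at most a fraction
   [e]. *)
have c0 : 0 < e / (2 * l%:R) by rewrite divr_gt0 // mulr_gt0.
have [rho rho0 [S S1 hS]] := tube_count C0 c0 t0.
have S0 : 0 < S by exact: lt_le_trans S1.
have [mmax hmm] := hd0 S S0.
(* The longest drift must be short compared with the long scale [m mu], so that few times start a
   drift that leaves its block. *)
have [mu mu1 hmu] := nat_large [:: mmax%:R / e] 1.
have mue : mmax%:R <= e * mu%:R by rewrite -ler_pdivrMl // mulrC; apply: hmu; rewrite inE.
exists mu, l, rho, S; split => // y Z P L k1 yb DZ s1 per mP lL P0 L0 X g cus1 cus2 H2 en.
pose m' := (m * mu)%N.
have m'0 : (0 < m')%N by rewrite muln_gt0 m0.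
have mm' : (m %| m')%N by exact: dvdn_mulr.
have PX : (P %| X)%N by exact: dvdn_mull.
have m'X : (m' %| X)%N by exact: dvdn_trans PX.
have XR0 : 0 <= X%:R :> R by [].
pose B i := [exists b, e < `|bavg m (g b) i - bavg m' (g b) i|].
pose maxbad n := `[< exists2 u, (0 < u <= mmax.+1)%N & (u < 4 * w * \sum_(n <= i < n + u) ((i < X) && B i))%N >].
pose bdry n := (m' <= n %% m' + mmax)%N.
pose cusp1 n := `[< ~ thick C (flow t Z n) >].
pose cusp2 n := `[< ~ thick C (mulm (flow t Z n) (diagm (Num.sqrt S))) >].
pose tub h n := `[< thick C (mulm (flow t Z n) (diagm (Num.sqrt S))) /\
  exists2 k : zmat, sl2z k & tube S (drift (mulm (invm Z) (mulm (zr k) (flow t Z (h * P)))) (n%:R * t)) >].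
pose bs0 : seq (pred nat) := [:: maxbad : pred nat; bdry : pred nat; cusp1 : pred nat; cusp2 : pred nat] ++ [seq (tub h : pred nat) | h <- iota 1 l].
pose G n := (n < X)%N && ~~ has (fun b : pred nat => b n) bs0.
have GP n : G n -> [/\ (n < X)%N, ~ (exists2 u, (0 < u <= mmax.+1)%N & (u < 4 * w * \sum_(n <= i < n + u) ((i < X) && B i))%N),
    (n %% m' + mmax < m')%N, thick C (flow t Z n) & thick C (mulm (flow t Z n) (diagm (Num.sqrt S))) /\
    forall h, (0 < h <= l)%N -> ~~ tub h n].
  have E : has (fun b : pred nat => b n) bs0 = [|| maxbad n, bdry n, cusp1 n, cusp2 n | has (fun h => tub h n) (iota 1 l)].
    by rewrite /bs0 has_cat has_map -[X in X || _]/([|| maxbad n, bdry n, cusp1 n, cusp2 n | false]) orbF -!orbA.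
  move=> /andP[nX]; rewrite E 4!negb_or => /and5P[h1 h2 h3 h4 /hasPn h5].
  split=> //; first by move: h1 => /asboolPn.
  - by move: h2; rewrite /bdry -ltnNge.
  - by move: h3 => /asboolPn; exact: contrapT.
  - split; first by move: h4 => /asboolPn; exact: contrapT.
    by move=> h /andP[hp hle]; apply: h5; rewrite mem_iota hp add1n ltnS.
have [kap hkap] : exists kap : nat -> zmat, forall n, sl2z (kap n) /\ (G n -> mbound C (mulm (zr (kap n)) (flow t Z n))).
  have ex n : exists k : zmat, sl2z k /\ (G n -> mbound C (mulm (zr k) (flow t Z n))).
    have [[k sk bk]|no] := pselect (thick C (flow t Z n)); first by exists k.
    exists ((1, 0), (0, 1)); split => // /GP[_ _ _ th _]; case: (no th).
  by have [kap hk] := choice ex; exists kap.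
pose key n := ((inord (n %% P) : 'I_P.-1.+1), (inord (n %/ P %/ l) : 'I_(L %/ l).-1.+1), cell (mulm (zr (kap n)) (flow t Z n))).
pose iso n := G n && `[< forall n', (n' < X)%N -> G n' -> key n' = key n -> n' = n >].
pose bs := (iso : pred nat) :: bs0.
have Ll0 : (0 < L %/ l)%N by rewrite divn_gt0 // dvdn_leq.
have fiso : freq X iso <= e * X%:R.
  have fle : freq X iso <= (P * (L %/ l))%:R * (q.+1 * q.+1 * (q.+1 * q.+1))%:R :> R.
    have cE : #|{: 'I_P.-1.+1 * 'I_(L %/ l).-1.+1 * (('I_q.+1 * 'I_q.+1) * ('I_q.+1 * 'I_q.+1))}| =
      (P * (L %/ l) * (q.+1 * q.+1 * (q.+1 * q.+1)))%N by rewrite !card_prod !card_ord !prednK.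
    by rewrite /freq -natrM ler_nat -cE big_mkord; exact: isolated_count.
  apply: le_trans fle _; rewrite -(ler_pM2r l0R) mulrAC -natrM -mulnA divnK // mulnC -/X.
  by rewrite [leRHS]mulrAC mulrC ler_wpM2r.
have fmax : freq X maxbad <= e * X%:R.
  apply: le_trans (freq_maximal w mmax.+1 X B) _.
  have fB : freq X B <= 2 * (e ^+ 3 / (8 * w%:R) * X%:R / e ^+ 2).
    have one b : freq X (fun n => e < `|bavg m (g b) n - bavg m' (g b) n|) <= e ^+ 3 / (8 * w%:R) * X%:R / e ^+ 2.
      by apply: le_trans (freq_markov _ X e0) _; rewrite ler_pM2r ?invr_gt0 ?exprn_gt0.
    have -> : B = (fun n => (e < `|bavg m (g true) n - bavg m' (g true) n|) || (e < `|bavg m (g false) n - bavg m' (g false) n|)).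
      apply/funext => n; apply/existsP/orP => [[[] h]|[h|h]]; [by left|by right|by exists true|by exists false].
    by apply: le_trans (freq_or _ _ _) _; rewrite mulrDl !mul1r; apply: lerD.
  apply: le_trans (ler_wpM2l _ fB) _; first by rewrite mulr_ge0.
  rewrite le_eqVlt; apply/orP; left; apply/eqP; field.
  by rewrite (gt_eqF e0) (gt_eqF w0R).
have fbdry : freq X bdry <= e * X%:R.
  have mR : 0 < m'%:R :> R by rewrite ltr0n.
  have m1 : 1 <= m%:R :> R by rewrite ler1n.
  rewrite -(ler_pM2r mR); apply: le_trans (freq_boundary mmax m'0 m'X) _.
  rewrite [leRHS]mulrAC ler_wpM2r //; apply: le_trans mue _; rewrite ler_pM2l // natrM ler_peMl //.
have ftub : \sum_(h <- iota 1 l) freq X (tub h) <= e * X%:R.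
  have one h : h \in iota 1 l -> freq X (tub h) <= e * X%:R / l%:R.
    rewrite mem_iota add1n ltnS => hl'.
    apply: le_trans (hS Z (flow t Z (h * P)) P X DZ (detm_flow _ _ DZ) _) _.
      by move=> n k nX sk; exact: (H2 n h k nX hl' sk).
    have PX' : P%:R <= X%:R :> R by rewrite ler_nat /X leq_pmull.
    have -> : e * X%:R / l%:R = e / (2 * l%:R) * (X%:R + X%:R) by field; rewrite gt_eqF.
    by rewrite ler_pM2l // natrD lerD2l.
  rewrite big_seq; apply: le_trans (ler_sum _ one) _.
  rewrite -big_seq big_const_seq count_predT size_iota iter_addr_0 -[_ *+ l]mulr_natr divfK // gt_eqF //.
have pairc a b : (a < b)%N -> G a -> G b -> key a = key b ->
    `|bavg m' (g true) a - bavg m' (g false) a| <= 12 * e /\ `|bavg m' (g true) b - bavg m' (g false) b| <= 12 * e.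
  move=> ab Ga Gb [k1E k2E cE].
  have [aX mba bda tha [thSa nta]] := GP a Ga; have [bX mbb bdb thb _] := GP b Gb.
  have [h hl' bE] := same_group P0 l1 lL (erefl X) ab bX k1E k2E.
  have [kh skh perh] := flow_period h s1 per.
  pose k2 := zmul (zinv (kap a)) (kap b).
  have [ska mba'] := hkap a; have [skb mbb'] := hkap b.
  have sk2 : sl2z k2 by apply: sl2z_mul => //; exact: sl2z_inv.
  have cl : closeup 0 d0 d0 (drift (mulm (invm Z) (mulm (zr k2) (flow t Z (h * P)))) (a%:R * t)).
    rewrite -drift_pos -/(flow t (flow t Z (h * P)) a) flow_add -bE -/(flow t Z a).
    have -> : mulm (invm (flow t Z a)) (mulm (zr k2) (flow t Z b)) =
        mulm (invm (mulm (zr (kap a)) (flow t Z a))) (mulm (zr (kap b)) (flow t Z b)).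
      rewrite /k2 zr_mul zr_inv; have invM (p r : M2) : invm (mulm p r) = mulm (invm r) (invm p).
        by rewrite /invm /mulm /=; congr ((_, _), (_, _)); ring.
      by rewrite invM -!mulmA.
    apply: hcell => //; [|exact: mba'|exact: mbb'].
    by rewrite detm_mul detm_zr // detm_flow // mulr1.
  have nt : ~ (`|(drift (mulm (invm Z) (mulm (zr k2) (flow t Z (h * P)))) (a%:R * t)).1.1 -
      (drift (mulm (invm Z) (mulm (zr k2) (flow t Z (h * P)))) (a%:R * t)).2.2| <= S^-1 /\
      `|(drift (mulm (invm Z) (mulm (zr k2) (flow t Z (h * P)))) (a%:R * t)).2.1| <= S ^- 2).
    move=> [t1 t2]; have := nta h hl' => /asboolPn; apply; split => //; exists k2 => //.
    exact: (tube_closeup d01 cl t1 t2).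
  have [r1 r2] := hmm y Z (flow t Z (h * P)) kh k2 a yb DZ (detm_flow _ _ DZ) skh sk2 perh cl nt.
  rewrite bE; apply: (@pair_chain m m' (h * P) a w mmax X g (fun b i => obs Psi y b%:R (flow t (flow t Z (h * P)) i)) e) => //.
  - exact: ltW.
  - by rewrite dvdn_mull // (dvdn_trans mm').
  - by rewrite dvdn_mull.
  - by move=> b' i; rewrite /g flow_add.
  - by rewrite -bE.
  - by rewrite -bE.
have main n : (n < X)%N -> ~~ has (fun b : pred nat => b n) bs -> `|bavg m' (g true) n - bavg m' (g false) n| <= 12 * e.
  move=> nX; rewrite /bs -[has _ _]/(iso n || has (fun b : pred nat => b n) bs0) negb_or => /andP[niso nbs].
  have Gn : G n by rewrite /G nX.
  move: niso; rewrite /iso Gn /= => /asboolPn /existsNP[n' /not_implyP[n'X /not_implyP[Gn' /not_implyP[kE ne]]]].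
  have [lt|gt|//] := ltngtP n n'; last by move=> E; case: ne.
    by have [] := pairc n n' lt Gn Gn' (esym kE).
  by have [] := pairc n' n gt Gn' Gn kE.
rewrite sumrB -(sum_bavg (g true) m'0 m'X) -(sum_bavg (g false) m'0 m'X) -sumrB.
have f2 n : `|bavg m' (g true) n - bavg m' (g false) n| <= 2.
  have gb b : `|bavg m' (g b) n| <= 1 by apply: bavg_bound => i; exact: P1.
  by apply: le_trans (ler_normB _ _) _; rewrite [2](_ : _ = 1 + 1) //; apply: lerD.
have e12 : 0 <= 12 * e by rewrite mulr_ge0 // ltW.
apply: le_trans (@sum_freq R (fun n => bavg m' (g true) n - bavg m' (g false) n) (12 * e) bs X f2 e12 main) _.
rewrite !big_cons big_map.
(* The good times contribute [12 e], and the six families, on which the difference is at most 2,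
   another [12 e]. *)
have -> : 24 * e * X%:R = 12 * e * X%:R + 2 * (6 * (e * X%:R)) by ring.
rewrite lerD2l ler_pM2l //; move: cus1 cus2; rewrite -/cusp1 -/cusp2; move: (freq X cusp1) (freq X cusp2) fiso fmax fbdry ftub.
move: (freq _ _) (freq _ _) (freq _ _) (\sum_(_ <- _) _) (e * X%:R); clear; move=> *; lra.
Qed.

(** The scale provided by [good_scale] depends on the orbit, so the parameters of [level] are fixed
    beforehand for all [K] scales: each long scale is the next short one, and the number [L] of
    periods is a multiple of every run length. *)
Lemma core Psi : inv2 Psi -> ucontr Psi -> (forall g h, `|Psi g h| <= 1) -> forall (e C t : R), 0 < e -> 0 < C -> 0 < t ->
  exists K M L l rho : nat, exists S0 : R, exists S : nat -> R,
  [/\ [/\ (0 < M)%N, (0 < L)%N & 0 < S0], forall i, 1 <= S i & forall y Z P (k1 : zmat), 1 <= y <= 2 -> detm Z = 1 -> sl2z k1 ->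
  mulm (invm (dil y)) (flow t Z P) = mulm (zr k1) (mulm (invm (dil y)) Z) -> (M %| P)%N -> (0 < P)%N ->
  let X := (L * P)%N in let g (b : bool) i := obs Psi y b%:R (flow t Z i) in
  freq X (fun n => `[< ~ thick C (flow t Z n) >]) <= e * X%:R ->
  (forall i, (i < K)%N -> freq X (fun n => `[< ~ thick C (mulm (flow t Z n) (diagm (Num.sqrt (S i)))) >]) <= e * X%:R) ->
  escapes t S0 rho l P X Z ->
  `|\sum_(n < X) (g true n - g false n)| <= 24 * e * X%:R].
Proof.
move=> iP uP P1 e C t e0 C0 t0; have [e3 e30 he3] := level iP uP P1 e0.
have /choice[v hv] m : exists v : (nat * nat) * (nat * R), (0 < m)%N ->
    [/\ (0 < v.1.1)%N, (0 < v.1.2)%N, (0 < v.2.1)%N, 1 <= v.2.2 & level_ok Psi e e3 C t m v.1.1 v.1.2 v.2.1 v.2.2].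
  have [m0|m0] := posnP m; first by exists ((0%N, 0%N), (0%N, 0 : R)); rewrite m0.
  by have [mu [l [rho [S h]]]] := he3 C t m C0 t0 m0; exists ((mu, l), (rho, S)).
(* [good_scale] bounds the change of both observables together by [2 X / K]. *)
have [K K1 hK] := nat_large [:: 2 / e3] 1.
pose fix ms i := if i is j.+1 then (ms j * (v (ms j)).1.1)%N else 1%N.
have ms0 i : (0 < ms i)%N.
  by elim: i => //= i IH; rewrite muln_gt0 IH; case: (hv _ IH).
pose S i := (v (ms i)).2.2.
pose L := (\prod_(i < K) (v (ms i)).1.2)%N.
pose l := (\max_(i < K) (v (ms i)).1.2)%N.
pose rho := (\max_(i < K) (v (ms i)).2.1)%N.
have S1 i : 1 <= S i by case: (hv _ (ms0 i)).
have S0 i : 0 < S i by exact: lt_le_trans (S1 i).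
have [Sm Sm0 hSm] : exists2 Sm : R, 0 < Sm & forall i, (i < K)%N -> Sm <= S i.
  elim: (K) => [|k [s s0 hs]]; first by exists 1.
  exists (Num.min s (S k)); first by rewrite lt_min s0 S0.
  move=> i; rewrite ltnS leq_eqVlt => /predU1P[->|/hs h]; first by rewrite ge_min lexx orbT.
  by rewrite ge_min h.
exists K, (ms K), L, l, rho, Sm, S; split => //.
  by split => //; apply/prodn_gt0 => i; case: (hv _ (ms0 i)).
move=> y Z P k1 yb DZ s1 per MP P0 X g cus1 cus2 esc.
have L0 : (0 < L)%N by apply/prodn_gt0 => i; case: (hv _ (ms0 i)).
have dv i : (ms i %| ms i.+1)%N by exact: dvdn_mulr.
have dvK j i : (ms i %| ms (i + j))%N.
  by elim: j => [|j IH]; rewrite ?addn0 // addnS; exact: dvdn_trans (dv _).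
have MX : (ms K %| X)%N by apply: dvdn_mull.
have g1 b i : `|g b i| <= 1 by exact: P1.
have [i iK en] := good_scale K1 ms0 dv MX (g1 true) (g1 false).
have [mu0 l0 rho0 _ ok] := hv _ (ms0 i).
have Si0 := S0 i.
apply: (ok y Z P L k1) => //.
- by apply: dvdn_trans MP; rewrite -(subnKC iK); exact: dvK.
- by rewrite /L (bigD1 (Ordinal iK)) //= dvdn_mulr.
- exact: (cus2 i iK).
- move=> n h k nX /andP[h0 hl] sk D tD.
  have [||u uP' hu] := esc n h k nX _ sk.
  + by rewrite h0 (leq_trans hl) // /l (leq_bigmax (Ordinal iK)).
  + have iS : (S i)^-1 <= Sm^-1 by rewrite lef_pV2 ?posrE // hSm.
    case: tD => t1 t2 t3 t4; split => //; first exact: le_trans iS.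
    apply: le_trans t3 _; rewrite lef_pV2 ?posrE ?exprn_gt0 //.
    by rewrite ler_pXn2r ?nnegrE ?(ltW Sm0) ?(ltW Si0) //; exact: hSm.
  exists u => //; apply: le_lt_trans hu; rewrite ler_pM2l // ler_pXn2r ?nnegrE // ler_nat.
  by rewrite (leq_bigmax (Ordinal iK)).
have KR : 0 < K%:R :> R by rewrite ltr0n.
have K3 : 2 <= e3 * K%:R by rewrite -ler_pdivrMl // mulrC; apply: hK; rewrite inE.
have XR0 : 0 <= X%:R :> R by [].
have sq b' : 0 <= \sum_(n < X) (bavg (ms i) (g b') n - bavg (ms i.+1) (g b') n) ^+ 2.
  by apply: sumr_ge0 => n _; exact: sqr_ge0.
move=> b; rewrite -(ler_pM2l KR).
apply: (@le_trans _ _ (2 * X%:R)); last by rewrite mulrCA mulrA ler_wpM2r.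
move: en; rewrite expr1n mulr1 mulrDr => en; apply: le_trans en.
by case: b; [rewrite lerDl|rewrite lerDr]; rewrite mulr_ge0 // ?ler0n; exact: sq.
Qed.
End level.

(** * Blocks of the horocycle over Farey arcs *)

Section geometry.
Context {R : realType}.
Local Notation M2 := (mat2 R).
Implicit Types (T x w y t : R) (k : zmat).

Lemma horE T x : hor T x = (((Num.sqrt T)^-1, x * Num.sqrt T), (0, Num.sqrt T)) :> M2.
Proof. by rewrite /hor /mulm /upm /diagm /= invrK; congr ((_, _), (_, _)); ring. Qed.

Lemma hor_upm T x s : 0 < T -> mulm (hor T x) (upm s) = hor T (x + s / T).
Proof.
move=> T0; have r0 : Num.sqrt T != 0 by rewrite gt_eqF // sqrtr_gt0.
have E : Num.sqrt T ^+ 2 = T by rewrite sqr_sqrtr // ltW.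
have TE : s / T = s / Num.sqrt T ^+ 2 by rewrite E.
by rewrite !horE TE /mulm /upm /=; congr ((_, _), (_, _)); field.
Qed.

Lemma upm_hor T x s : mulm (upm s) (hor T x) = hor T (s + x).
Proof. by rewrite /hor mulmA upm_mul. Qed.

Lemma dil_hor T x y : 0 < T -> 1 <= y <= 2 -> mulm (dil y) (hor T x) = hor (T / y) (y * x).
Proof.
move=> T0 yb; have /andP[s1 _] := sqrt_bounds yb.
have y0 : 0 < y by case/andP: yb; lra.
have r0 : Num.sqrt T != 0 by rewrite gt_eqF // sqrtr_gt0.
have q0 : Num.sqrt y != 0 by rewrite gt_eqF //; lra.
have E : Num.sqrt y ^+ 2 = y by rewrite sqr_sqrtr // ltW.
rewrite !horE sqrtrM ?ltW // sqrtrV ?ltW // -{3}E /dil /diagm /mulm /=; congr ((_, _), (_, _)); field.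
all: by rewrite ?r0 ?q0.
Qed.

Lemma hor_diag T x (S : R) : 0 < T -> 0 < S -> mulm (hor T x) (diagm (Num.sqrt S)) = hor (T / S) x.
Proof.
move=> T0 S0.
have r0 : Num.sqrt T != 0 by rewrite gt_eqF // sqrtr_gt0.
have q0 : Num.sqrt S != 0 by rewrite gt_eqF // sqrtr_gt0.
rewrite !horE sqrtrM ?ltW // sqrtrV ?ltW // /diagm /mulm /=; congr ((_, _), (_, _)); field.
all: by rewrite ?r0 ?q0.
Qed.

(** The denominator of the Moebius action on the real line; the derivative of [act k] is
    [jac^-2]. *)
Definition jac k w : R := k.2.1%:~R * w + k.2.2%:~R.
Definition act k w : R := (k.1.1%:~R * w + k.1.2%:~R) / jac k w.

Definition tilt (a c : R) : M2 := ((a^-1, 0), (c, a)).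

(** When [T = jac^2 T'] the diagonal of the tilt is trivial, and its lower left entry is small for
    large [T]: near [act k w], the image of a horocycle at height [1/T'] is almost one at height
    [1/T]. *)
Lemma zr_hor k T T' w : sl2z k -> 0 < T -> 0 < T' -> 0 < jac k w -> mulm (zr k) (hor T' w) =
  mulm (hor T (act k w)) (tilt (jac k w * Num.sqrt T' / Num.sqrt T) (k.2.1%:~R / (Num.sqrt T * Num.sqrt T'))).
Proof.
case: k => -[a b] [c d]; rewrite /sl2z /= /zdet /= => sk T0 T'0; rewrite /act /jac /= => J0.
have r0 : Num.sqrt T != 0 by rewrite gt_eqF // sqrtr_gt0.
have q0 : Num.sqrt T' != 0 by rewrite gt_eqF // sqrtr_gt0.
have skR : a%:~R * d%:~R - b%:~R * c%:~R = 1 :> R by rewrite -!rmorphM /= -rmorphB /= sk.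
have J0' : c%:~R * w + d%:~R != 0 by rewrite gt_eqF.
rewrite !horE /mulm /zr /tilt /=; move: (a%:~R : R) (b%:~R : R) (c%:~R : R) (d%:~R : R) skR J0' {sk J0} => {}a {}b {}c {}d skR J0'.
congr ((_, _), (_, _)).
- transitivity (((a * d - b * c) + c * (a * w + b)) / ((c * w + d) * Num.sqrt T')); last first.
    by rewrite skR; field; rewrite r0 q0 J0'.
  by field; rewrite q0 J0'.
- by field; rewrite r0 J0'.
- by field; rewrite r0 q0.
- by field; rewrite r0.
Qed.

Lemma flow_hor y k t (P : nat) w n : 0 < t -> (0 < P)%N ->
  flow t (mulm (dil y) (mulm (zr k) (hor (P%:R * t) w))) n = mulm (dil y) (mulm (zr k) (hor (P%:R * t) (w + n%:R / P%:R))).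
Proof.
move=> t0 P0; rewrite /flow -(mulmA (dil y)) -(mulmA (zr k)) hor_upm ?mulr_gt0 ?ltr0n //.
do 2 congr mulm; congr hor; congr (_ + _); field.
by rewrite (gt_eqF t0) pnatr_eq0 -lt0n P0.
Qed.

(** The determinant controls the trace through [(p + q - 2) (p + q + 2) = 4 r f + (p - q)^2], which
    gives the diagonal entries separately. *)
Lemma noescape_near (b A p r f q : R) : 1 <= b -> 1 <= A -> p * q - r * f = 1 -> `|r| <= 1 -> `|p + q - 2| <= 1 ->
  `|f| * b ^+ 2 <= 11 * A -> `|p - q| * b <= 13 * A -> nearm (300 * A ^+ 2 / b) ((p, r / b), (f * b, q)).
Proof.
move=> b1 A1 det r1 tr F E; have b0 : 0 < b by lra.
have A0 : 0 < A by lra.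
have AA : A <= A ^+ 2 by rewrite expr2 ler_peMl // ltW.
have pq : (p + q - 2) * (p + q + 2) = 4 * (r * f) + (p - q) ^+ 2.
  have -> : r * f = p * q - 1 by rewrite -det; ring.
  by ring.
have fb : `|f| * b <= 11 * A by apply: le_trans F; rewrite ler_wpM2l // expr2 ler_peMr // ltW.
have rf : `|r * f| * b <= 11 * A.
  by rewrite normrM -mulrA; apply: le_trans fb; rewrite ler_piMl // mulr_ge0 // ltW.
have e2 : (p - q) ^+ 2 * b <= 169 * A ^+ 2.
  have h : (`|p - q| * b) ^+ 2 <= (13 * A) ^+ 2 by rewrite ler_pXn2r ?nnegrE ?mulr_ge0 // ltW.
  rewrite exprMn real_normK ?num_real // in h.
  rewrite (_ : 169 * A ^+ 2 = (13 * A) ^+ 2); last by ring.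
  by apply: le_trans h; rewrite ler_wpM2l ?sqr_ge0 // expr2 ler_peMr // ltW.
have s3 : 3 <= p + q + 2 by move: tr; rewrite ler_norml => /andP[]; lra.
have T3 : `|p + q - 2| * b * 3 <= 44 * A + 169 * A ^+ 2.
  have : `|p + q - 2| * (p + q + 2) * b <= 44 * A + 169 * A ^+ 2.
    have s0 : 0 <= p + q + 2 by lra.
    rewrite -{1}(ger0_norm s0) -normrM pq.
    apply: le_trans (_ : (`|4 * (r * f)| + `|(p - q) ^+ 2|) * b <= _).
      by rewrite ler_pM2r // ler_normD.
    have n4 : `|4 * (r * f)| = 4 * `|r * f| by rewrite (normrM 4) ger0_norm.
    by rewrite n4 (ger0_norm (sqr_ge0 (p - q))) mulrDl; lra.
  by apply: le_trans; rewrite mulrAC ler_wpM2r ?(ltW b0) // ler_wpM2l.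
have h (u : R) : `|u| * b <= 300 * A ^+ 2 -> `|u| <= 300 * A ^+ 2 / b by rewrite ler_pdivlMr.
apply/and4P; split => /=; apply: h.
- rewrite (_ : p - 1 = (p + q - 2) / 2 + (p - q) / 2); last by field.
  apply: le_trans (ler_wpM2r (ltW b0) (ler_normD _ _)) _.
  by rewrite mulrDl !normrM (ger0_norm (_ : 0 <= 2^-1 :> R)) ?invr_ge0 //; lra.
- by rewrite normrM normfV (gtr0_norm b0) divfK ?gt_eqF //; lra.
- by rewrite normrM (gtr0_norm b0) -mulrA -expr2; lra.
- rewrite (_ : q - 1 = (p + q - 2) / 2 - (p - q) / 2); last by field.
  apply: le_trans (ler_wpM2r (ltW b0) (ler_normB _ _)) _.
  by rewrite mulrDl !normrM (ger0_norm (_ : 0 <= 2^-1 :> R)) ?invr_ge0 //; lra.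
Qed.

Lemma invm_mul (g h : M2) : invm (mulm g h) = mulm (invm h) (invm g).
Proof. by rewrite /invm /mulm /=; congr ((_, _), (_, _)); ring. Qed.

Lemma mulKm (g h : M2) : detm g = 1 -> mulm (invm g) (mulm g h) = h.
Proof. by move=> Dg; rewrite mulmA mulVm // mul1m. Qed.

Lemma mulmK (g h : M2) : detm g = 1 -> mulm g (mulm (invm g) h) = h.
Proof. by move=> Dg; rewrite mulmA mulmV // mul1m. Qed.

(** For [N] the identity the right side is a conjugate of [upm (- h)], with lower left entry
    [h c^2 / y] where [c] is that of [k]. *)
Lemma entry21 (N : M2) k j (h : nat) y (e : R) : 1 <= y <= 2 -> sl2z k -> nearm e N -> 0 <= e ->
  zr j = mulm (dil y) (mulm N (mulm (mulm (zr k) (mulm (upm (- h%:R)) (invm (zr k)))) (invm (dil y)))) ->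
  `|j.2.1%:~R * y - h%:R * k.2.1%:~R ^+ 2| <= e * (1 + h%:R * `|k.1.1%:~R * k.2.1%:~R| + h%:R * k.2.1%:~R ^+ 2).
Proof.
move=> yb sk nN e0 E; have /andP[s1 _] := sqrt_bounds yb.
have y0 : 0 < y by case/andP: yb; lra.
have q0 : Num.sqrt y != 0 by rewrite gt_eqF //; lra.
have sE : Num.sqrt y ^+ 2 = y by rewrite sqr_sqrtr // ltW.
have dk := @detm_zr R _ sk.
have := congr1 (fun g : M2 => g.2.1) E.
move: N nN k dk {sk E} => [[n1 n2] [n3 n4]] /and4P[/= h1 h2 h3 h4] [[a b] [c d]].
rewrite /detm /zr /dil /diagm /mulm /upm /invm /=.
move: (a%:~R : R) (b%:~R : R) (c%:~R : R) (d%:~R : R) (h%:R : R) (ler0n R h) => {}a {}b {}c {}d {}h h0 dk ->.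
set X := (X in X * y - _).
have -> : X * y - h * c ^+ 2 = n3 * (1 + h * (a * c)) + (n4 - 1) * (h * c ^+ 2).
  have -> : X * y = X * Num.sqrt y ^+ 2 by rewrite sE.
  transitivity (n3 * ((a * d - b * c) + h * (a * c)) + (n4 - 1) * (h * c ^+ 2)); last by rewrite dk.
  by rewrite /X; field; exact: q0.
apply: le_trans (ler_normD _ _) _.
have g1 : `|n3 * (1 + h * (a * c))| <= e * (1 + h * `|a * c|).
  rewrite normrM; apply: ler_pM => //; apply: le_trans (ler_normD _ _) _.
  by rewrite normr1 (normrM h) (ger0_norm h0).
have g2 : `|(n4 - 1) * (h * c ^+ 2)| <= e * (h * c ^+ 2).
  by rewrite normrM (ger0_norm (mulr_ge0 h0 (sqr_ge0 c))) ler_wpM2r // mulr_ge0 // sqr_ge0.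
lra.
Qed.

Lemma escape_product k j (D : M2) (b w y : R) (h : nat) : 0 < b -> sl2z k -> sl2z j -> 1 <= y <= 2 ->
  D = mulm (invm (mulm (dil y) (mulm (zr k) (hor b w)))) (mulm (zr j) (mulm (dil y) (mulm (zr k) (hor b (w + h%:R))))) ->
  let K := mulm (zr k) (upm w) in let V := mulm (diagm (Num.sqrt b)^-1) (mulm D (invm (diagm (Num.sqrt b)^-1))) in
  zr j = mulm (dil y) (mulm (mulm K (mulm V (invm K)))
     (mulm (mulm (zr k) (mulm (upm (- h%:R)) (invm (zr k)))) (invm (dil y)))).
Proof.
move=> b0 sk sj yb -> K V.
have Dy := detm_dil yb; have dk := @detm_zr R _ sk.
have Da : detm (diagm (Num.sqrt b)^-1) = 1 by rewrite detm_diagm // invr_eq0 gt_eqF // sqrtr_gt0.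
have hE : hor b (w + h%:R) = mulm (upm h%:R) (hor b w) by rewrite upm_hor addrC.
rewrite /V /K hE /hor; move: (diagm _) Da => a Da.
move: (dil y) Dy => dy Dy.
have iu s : invm (upm s) = upm (- s) :> M2 by rewrite /invm /upm /= oppr0.
rewrite !invm_mul !iu -!mulmA.
rewrite (mulmK _ Da) -[upm (- w)]iu (mulmK _ (detm_upm _)) (mulmK _ dk) (mulmK _ Dy).
rewrite (mulmK _ Da) (mulmK _ (detm_upm _)) (mulKm _ dk) -(iu h%:R) (mulmK _ (detm_upm _)) (mulmK _ dk).
by rewrite mulmV // mulm1.
Qed.

(** If a pair in the tube did not separate within a period, its rescaled relative position would be
    within [O(1/b)] of the identity, [b = P t]. An integer matrix would then have lower left entry
    [j] with [|j y - h c^2| = O(1/b)] and [1 <= h <= l]; as [h c^2 >= 1], this [j] is nonzero, and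
    the hypothesis on [y] excludes it. *)
Lemma block_escapes k w0 (L l rho : nat) (S0 : R) : sl2z k -> k.2.1 != 0 -> exists T1 K B : R,
  forall t P y, 0 < t -> (1 < P)%N -> T1 <= P%:R * t -> 1 <= y <= 2 ->
  (forall j m : int, j != 0 -> `|j%:~R| <= K -> B < P%:R * t * `|j%:~R * y - m%:~R|) ->
  escapes t S0 rho l P (L * P) (mulm (dil y) (mulm (zr k) (hor (P%:R * t) w0))).
Proof.
move=> sk c0.
have [B1 B11 bk] := mbound_ex (zr k : M2).
pose A : R := 3 * rho%:R ^+ 2 + 1.
pose S := 2 * B1 * (1 + `|w0| + L%:R).
pose al : R := k.1.1%:~R; pose c : R := k.2.1%:~R.
pose Q := 300 * A ^+ 2.
have Q0 : 0 <= Q by apply: mulr_ge0; [exact: ler0n|exact: sqr_ge0].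
have QE : Q = 300 * A ^+ 2 by [].
clearbody Q.
pose cst := 4 * S ^+ 2 * Q.
pose F := 1 + l%:R * `|al * c| + l%:R * c ^+ 2.
have A1 : 1 <= A by rewrite /A lerDr mulr_ge0 // exprn_ge0.
have cst0 : 0 <= cst by apply: mulr_ge0 => //; apply: mulr_ge0 => //; exact: sqr_ge0.
have F0 : 0 <= F.
  have la : 0 <= l%:R * `|al * c| by exact: (mulr_ge0 (ler0n _ _) (normr_ge0 _)).
  have lc : 0 <= l%:R * c ^+ 2 by exact: (mulr_ge0 (ler0n _ _) (sqr_ge0 _)).
  by rewrite /F; lra.
have B0 : 0 <= cst * F by exact: mulr_ge0.
have c1 : 1 <= c ^+ 2.
  by rewrite /c -rmorphXn /= -[1]/(1%:~R) ler_int -gtz0_ge1 exprn_even_gt0.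
exists (cst * F + 1), (l%:R * c ^+ 2 + 1), (cst * F) => t P y t0 P1 TP yb NR n h j nX /andP[h0 hl] sj D tD.
apply: contrapT => noesc.
have P0 : (0 < P)%N by exact: ltnW.
have PR : 0 < P%:R :> R by rewrite ltr0n.
set b := P%:R * t in TP NR *.
have b1 : 1 <= b by lra.
have b0 : 0 < b by lra.
pose w := w0 + n%:R / P%:R.
have wS : mbound (1 + `|w0| + L%:R) (upm w).
  have n0 : 0 <= `|w0| + L%:R by rewrite addr_ge0.
  have wle : `|w| <= `|w0| + L%:R.
    apply: le_trans (ler_normD _ _) _; rewrite lerD2l ger0_norm ?divr_ge0 // ler_pdivrMr //.
    by rewrite -natrM ler_nat ltnW.
  by apply/and4P; split; rewrite /upm /= ?normr1 ?normr0; clear -n0 wle; lra.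
have DE : D n = mulm (invm (mulm (dil y) (mulm (zr k) (hor b w)))) (mulm (zr j) (mulm (dil y) (mulm (zr k) (hor b (w + h%:R))))).
  rewrite /D -drift_pos -/(flow t _ n) -/(flow t (flow t _ (h * P)) n) flow_add !flow_hor // -/b -/w.
  congr (mulm _ (mulm _ (mulm _ (mulm _ _)))); congr hor.
  by rewrite /w natrD natrM; field; rewrite gt_eqF.
have jE := escape_product b0 sk sj yb DE.
have DD : detm (D n) = 1.
  have dY z : detm (mulm (dil y) (mulm (zr k) (hor b z))) = 1.
    by rewrite (detm_mul (dil y)) (detm_mul (zr k)) (detm_dil yb) detm_zr // detm_hor // !mulr1.
  by rewrite DE (detm_mul (invm _)) detm_inv dY (detm_mul (zr j)) dY detm_zr // !mulr1.
case: tD => t1 _ _ t4.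
have below u : (u <= P)%N -> `|(drift (D n) (u%:R * t)).1.2| <= A.
  move=> uP; rewrite /D drift_add -mulrDl -natrD -/(D (n + u)%N).
  have [u0|u0] := posnP u; first by rewrite u0 addn0; apply: le_trans t1 A1.
  rewrite leNgt; apply/negP => lt; apply: noesc; exists u; first by rewrite u0.
  by apply: le_lt_trans lt; rewrite /A lerDl.
have V1 : nearm (Q / b) (mulm (diagm (Num.sqrt b)^-1) (mulm (D n) (invm (diagm (Num.sqrt b)^-1)))).
  have bE : Num.sqrt b ^+ 2 = b by rewrite sqr_sqrtr // ltW.
  have r0 : Num.sqrt b != 0 by rewrite gt_eqF // sqrtr_gt0.
  have bt := half_time t0 P1.
  have h1 := below _ (leq_div P 2); have h2 := below _ (leqnn P).
  move: DD t1 t4 h1 h2; move: (D n) => [[p r] [f q]]; rewrite !driftE /detm /= -/b => DD t1 t4 h1 h2.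
  have h3 : `|r| <= A by exact: le_trans A1.
  rewrite -/b in bt; have [g1 g2] := quad_bound b0 bt h3 h1 h2.
  have -> : mulm (diagm (Num.sqrt b)^-1) (mulm ((p, r), (f, q)) (invm (diagm (Num.sqrt b)^-1))) = ((p, r / b), (f * b, q)).
    have e1 : r / b = r / Num.sqrt b ^+ 2 by rewrite bE.
    have e2 : f * b = f * Num.sqrt b ^+ 2 by rewrite bE.
    rewrite e1 e2; move: (Num.sqrt b) r0 => s s0.
    by rewrite /mulm /diagm /invm /=; congr ((_, _), (_, _)); field.
  by rewrite QE; exact: noescape_near.
have Qb : 0 <= Q / b by rewrite divr_ge0 // ltW.
have dK : detm (invm (mulm (zr k) (upm w))) = 1 by rewrite detm_inv detm_mul detm_zr // detm_upm mulr1.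
have bK : mbound S (invm (mulm (zr k) (upm w))) by apply: mbound_inv; exact: mbound_mul.
have nN := nearm_conj_bound dK bK Qb V1.
have invK (g : M2) : invm (invm g) = g by case: g => -[? ?] [? ?]; rewrite /invm /= !opprK.
rewrite invK in nN.
have e0 : 0 <= 4 * S ^+ 2 * (Q / b) by apply: mulr_ge0 => //; apply: mulr_ge0 => //; exact: sqr_ge0.
have key := entry21 yb sk nN e0 jE.
have key2 : b * `|j.2.1%:~R * y - h%:R * c ^+ 2| <= cst * F.
  have -> : cst * F = b * (4 * S ^+ 2 * (Q / b) * F) by rewrite /cst; field; rewrite gt_eqF.
  rewrite ler_pM2l //; apply: le_trans key _; rewrite ler_wpM2l // /F -/al -/c.
  have hl' : h%:R <= l%:R :> R by rewrite ler_nat.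
  by rewrite -!addrA lerD2l; apply: lerD; rewrite ler_wpM2r ?sqr_ge0.
have small : `|j.2.1%:~R * y - h%:R * c ^+ 2| <= 1.
  rewrite -(ler_pM2l b0) mulr1; apply: le_trans key2 _; lra.
have h1c : 1 <= h%:R * c ^+ 2.
  have : 1 <= h%:R :> R by rewrite ler1n.
  by move=> h1; apply: (le_trans h1); rewrite ler_peMr.
have hlc : h%:R * c ^+ 2 <= l%:R * c ^+ 2 by rewrite ler_wpM2r ?sqr_ge0 // ler_nat.
have [j0|j0] := eqVneq j.2.1 0.
  move: key2; rewrite j0 mul0r sub0r normrN ger0_norm; last by rewrite (le_trans ler01).
  by rewrite leNgt => /negP; apply; apply: (@lt_le_trans _ _ b); [clear -TP; lra|rewrite ler_peMr // ltW].
have jl : `|j.2.1%:~R| <= l%:R * c ^+ 2 + 1.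
  have y1 : 1 <= `|y| by by case/andP: yb => y1 _; rewrite ger0_norm // (le_trans ler01).
  apply: (@le_trans _ _ `|j.2.1%:~R * y|); first by rewrite normrM ler_peMr.
  rewrite -[_ * y](subrK (h%:R * c ^+ 2)); apply: le_trans (ler_normD _ _) _.
  have hc0 : 0 <= h%:R * c ^+ 2 by clear -h1c; lra.
  by rewrite (ger0_norm hc0); clear -small hlc; lra.
have := NR _ (h%:Z * k.2.1 ^+ 2) j0 jl.
by rewrite rmorphM rmorphXn /= ltNge key2.
Qed.
End geometry.

(** * Riemann sums along a nearly even grid *)

Section riemann.
Context {R : realType}.
Local Notation mR := (measurableTypeR R).
Local Notation leb := (@lebesgue_measure R).
Implicit Types (u v : R) (f F : mR -> R).

Lemma itg_scale u v (a : R) f : 0 < a -> bmeas f -> u <= v -> itg u v (fun x => f (a * x)) = a^-1 * itg (a * u) (a * v) f.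
Proof.
move=> a0; have a1 : a != 0 by rewrite gt_eqF.
have ms : measurable_fun setT (fun x : mR => a * x : mR) by mfun.
have pos g : bmeas g -> (forall x, 0 <= g x) -> itg u v (fun x => g (a * x)) = a^-1 * itg (a * u) (a * v) g.
  move=> bg g0; apply: EFin_inj.
  rewrite EFin_itg; last exact: bmeas_comp.
  have -> : a^-1 = `|a|^-1 by rewrite gtr0_norm.
  rewrite EFinM EFin_itg // -(@integral_affine _ a 0) //.
  - apply: eq_integral => x _; rewrite addr0; congr (_%:E); rewrite !indicE; congr (_%:R * _).
    by congr nat_of_bool; apply/idP/idP; rewrite !inE /= !in_itv /= !ler_pM2l.
  - by apply: mE; apply: mM; [apply: measurable_indic; exact: measurable_itv|case: bg].
  - by move=> x; rewrite lee_fin mulr_ge0.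
move=> bf uv; have [mf [B fB]] := bf.
have B0 : 0 <= B := le_trans (normr_ge0 _) (fB 0).
have bfB := bmeasD bf (bmeas_cst B).
have p0 x : 0 <= f x + B by have := fB x; rewrite ler_norml => /andP[? ?]; lra.
have := pos _ bfB p0.
rewrite itgD //; last exact: bmeas_cst.
  rewrite itgD //; last exact: bmeas_cst.
  rewrite !itg_cst //; last by rewrite ler_pM2l.
  have E (J : R) : a^-1 * (J + B * (a * v - a * u)) = a^-1 * J + B * (v - u) by field.
  by rewrite E => /addIr.
exact: (bmeas_comp bf ms).
Qed.

Lemma itg_steps F (xs o : nat -> R) (X : nat) (dl eps e B : R) : bmeas F -> 0 <= e -> 0 <= B ->
  (forall n, (n < X)%N -> 0 <= xs n.+1 - xs n) ->
  (forall n, (n < X)%N -> (1 - eps) * dl <= xs n.+1 - xs n <= dl) ->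
  (forall n, (n < X)%N -> `|o n| <= B) ->
  (forall n x, (n < X)%N -> xs n <= x <= xs n.+1 -> `|F x - o n| <= e) ->
  `|itg (xs 0%N) (xs X) F - dl * \sum_(n < X) o n| <= (e + eps * B) * (dl * X%:R) /\
  (1 - eps) * (dl * X%:R) <= xs X - xs 0%N <= dl * X%:R.
Proof.
move=> bF e0 B0; elim: X => [|X IH] h0 h1 hB hF.
  have i0 : itg (xs 0%N) (xs 0%N) F = 0.
    have [_ [C FC]] := bF.
    have := itg_bound (lexx (xs 0%N)) bF (fun x _ => FC x); rewrite subrr mulr0 normr_le0 => /eqP //.
  by rewrite big_ord0 i0 !mulr0 subrr normr0 subrr lexx.
have [I1 /andP[I2 I3]] := IH (fun n nX => h0 n (ltnW nX)) (fun n nX => h1 n (ltnW nX)) (fun n nX => hB n (ltnW nX))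
  (fun n x nX => hF n x (ltnW nX)).
have /andP[s1 s2] := h1 X (ltnSn X); have s0 := h0 X (ltnSn X).
have le1 : xs X <= xs X.+1 by lra.
have mono : forall n, (n <= X)%N -> xs 0%N <= xs n.
  elim=> // n IHn nX; have := h0 n (ltnW nX); have := IHn (ltnW nX); lra.
have le0 := mono X (leqnn X).
have st : `|itg (xs X) (xs X.+1) F - dl * o X| <= (e + eps * B) * dl.
  rewrite (_ : _ - _ = (itg (xs X) (xs X.+1) F - o X * (xs X.+1 - xs X)) + o X * ((xs X.+1 - xs X) - dl)); last by ring.
  rewrite -(itg_cst (o X) le1) -itgB //; last exact: bmeas_cst.
  apply: le_trans (ler_normD _ _) _; rewrite mulrDl; apply: lerD.
    apply: le_trans (itg_bound (c := e) le1 _ _) _.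
    - by apply: bmeasB => //; exact: bmeas_cst.
    - by move=> x xb; exact: hF.
    - by rewrite ler_wpM2l.
  rewrite normrM; have : `|xs X.+1 - xs X - dl| <= eps * dl by rewrite ler_norml; apply/andP; split; lra.
  move=> h; have ob := hB X (ltnSn X).
  by apply: le_trans (ler_pM (normr_ge0 _) (normr_ge0 _) ob h) _; rewrite (_ : B * _ = eps * B * dl) //; ring.
split; last first.
  by rewrite -natr1; apply/andP; split; lra.
rewrite (itg_cat bF le0 le1) big_ord_recr /= -natr1.
rewrite (_ : _ - _ = (itg (xs 0%N) (xs X) F - dl * \sum_(i < X) o i) + (itg (xs X) (xs X.+1) F - dl * o X)); last by ring.
by apply: le_trans (ler_normD _ _) _; lra.
Qed.
End riemann.

(** * Sampling a horocycle along one orbit over a block *)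

Section grid.
Context {R : realType}.
Local Notation M2 := (mat2 R).
Implicit Types (T x w y t d : R) (k : zmat).

Lemma act_diff k w w' : sl2z k -> jac k w != 0 :> R -> jac k w' != 0 -> act k w' - act k w = (w' - w) / (jac k w * jac k w').
Proof.
case: k => -[a b] [c e]; rewrite /sl2z /= /zdet /= => sk; rewrite /act /jac /=.
have skR : a%:~R * e%:~R - b%:~R * c%:~R = 1 :> R by rewrite -!rmorphM /= -rmorphB /= sk.
move: (a%:~R : R) (b%:~R : R) (c%:~R : R) (e%:~R : R) skR => {sk}{}a {}b {}c {}e skR j1 j2.
transitivity ((a * e - b * c) * (w' - w) / ((c * w + e) * (c * w' + e))); last by rewrite skR mul1r.
by field; rewrite j1 j2.
Qed.

Lemma upm_tilt_near (m v s S d : R) : 0 <= d <= 1 -> 1 <= m <= 1 + d / 4 -> 0 <= s <= d / 4 -> 1 <= S -> `|v| * S <= d / 4 ->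
  nearm d (mulm (upm (- s)) (tilt m v)) /\
  nearm d (mulm (invm (diagm (Num.sqrt S))) (mulm (mulm (upm (- s)) (tilt m v)) (diagm (Num.sqrt S)))).
Proof.
move=> /andP[d0 d1] /andP[m1 m2] /andP[s0 s1] S1 vS.
have S0 : 0 < S by lra.
have r0 : Num.sqrt S != 0 by rewrite gt_eqF // sqrtr_gt0.
have SE : Num.sqrt S ^+ 2 = S by rewrite sqr_sqrtr // ltW.
have m0 : 0 < m by lra.
have vv : `|v| <= d / 4 by apply: le_trans vS; rewrite ler_peMr.
have dd : d * d <= d by rewrite -[leRHS]mulr1 ler_wpM2l.
have sv : `|s * v| <= d / 4.
  rewrite normrM (ger0_norm s0); have : s * `|v| <= d / 4 * (d / 4) by apply: ler_pM.
  lra.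
have im : `|m^-1 - 1| <= d / 4.
  rewrite ler_norml; apply/andP; split.
    by rewrite lerBrDl -[m^-1]mul1r ler_pdivlMr //; nra.
  have : m^-1 <= 1 by rewrite invf_le1.
  lra.
have sm : 0 <= s * m <= d.
  rewrite mulr_ge0 ?(ltW m0) //=; have : s * m <= d / 4 * (1 + d / 4) by apply: ler_pM => //; exact: ltW.
  lra.
have h11 : `|m^-1 - s * v - 1| <= d.
  rewrite (_ : _ - 1 = (m^-1 - 1) - s * v); last by ring.
  by apply: le_trans (ler_normB _ _) _; lra.
have h22 : `|m - 1| <= d by rewrite ler_norml; apply/andP; split; lra.
have smS : `|s * m / S| <= d.
  case/andP: sm => sm0 smd; rewrite ger0_norm ?divr_ge0 ?(ltW S0) // ler_pdivrMr //.
  by apply: le_trans smd _; rewrite ler_peMr.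
have E1 : mulm (upm (- s)) (tilt m v) = ((m^-1 - s * v, - (s * m)), (v, m)).
  by rewrite /mulm /upm /tilt /=; congr ((_, _), (_, _)); ring.
rewrite E1; split.
  apply/and4P; split => //=; last by lra.
  by rewrite normrN ger0_norm; case/andP: sm.
have -> : mulm (invm (diagm (Num.sqrt S))) (mulm ((m^-1 - s * v, - (s * m)), (v, m)) (diagm (Num.sqrt S))) =
    ((m^-1 - s * v, - (s * m / Num.sqrt S ^+ 2)), (v * Num.sqrt S ^+ 2, m)).
  move: (Num.sqrt S) r0 (m^-1) => r r0 mi.
  by rewrite /mulm /diagm /invm /=; congr ((_, _), (_, _)); field.
rewrite SE; apply/and4P; split => //=; first by rewrite normrN.
by rewrite normrM (gtr0_norm S0); lra.
Qed.

(** Consecutive grid points are at most [t / T] apart, so any [x] in between is reached by flowing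
    for a time at most [t]; as [Dm^2 P t] is close to [T] and [jac] to [Dm], the tilt is small as
    well. The conjugate by [diagm (Num.sqrt S)] is what the cusp condition at scale [S] sees. *)
Lemma grid_near k (w0 : R) (L P : nat) t T (Dm ep d S : R) : sl2z k -> (0 < P)%N -> 0 < t -> 0 < T -> 0 < Dm ->
  (forall w, w0 <= w <= w0 + L%:R -> Dm <= jac k w <= (1 + ep) * Dm) -> 0 <= ep ->
  T <= Dm ^+ 2 * (P%:R * t) <= (1 + ep) ^+ 2 * T -> t <= d / 4 -> (1 + ep) ^+ 2 <= 1 + d / 4 -> d <= 1 -> 1 <= S ->
  `|k.2.1%:~R| * Dm * S <= d / 4 * T ->
  forall n x, (n < L * P)%N -> act k (w0 + n%:R / P%:R) <= x <= act k (w0 + n.+1%:R / P%:R) ->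
  exists kap : M2, [/\ detm kap = 1, mulm (zr k) (hor (P%:R * t) (w0 + n%:R / P%:R)) = mulm (hor T x) kap, nearm d kap &
    nearm d (mulm (invm (diagm (Num.sqrt S))) (mulm kap (diagm (Num.sqrt S))))].
Proof.
move=> sk P0 t0 T0 Dm0 hD ep0 /andP[TP1 TP2] td epd d1 S1 hv n x nX /andP[x1 x2].
have PR : 0 < P%:R :> R by rewrite ltr0n.
have range i : (i <= L * P)%N -> w0 <= w0 + i%:R / P%:R <= w0 + L%:R.
  move=> iX; rewrite lerDl divr_ge0 //= lerD2l ler_pdivrMr // -natrM ler_nat //.
have /andP[D1 D2] := hD _ (range n (ltnW nX)); have /andP[D1' D2'] := hD _ (range n.+1 nX).
set w := w0 + n%:R / P%:R in x1 D1 D2 *; set w' := w0 + n.+1%:R / P%:R in x2 D1' D2'.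
have J0 : 0 < jac k w by lra.
have J0' : 0 < jac k w' by lra.
have b0 : 0 < P%:R * t by rewrite mulr_gt0.
have wd : w' - w = P%:R^-1 by rewrite /w /w' -natr1; field; rewrite gt_eqF.
have dx : act k w' - act k w <= (P%:R * Dm ^+ 2)^-1.
  rewrite act_diff ?gt_eqF // wd [(P%:R * _)^-1]invfM ler_pM2l ?invr_gt0 // lef_pV2 ?posrE ?mulr_gt0 ?exprn_gt0 // expr2.
  by rewrite ler_pM // ltW.
pose s := T * (x - act k w).
have s0 : 0 <= s by rewrite mulr_ge0 ?(ltW T0) // subr_ge0.
have st : s <= t.
  have : s <= T * (P%:R * Dm ^+ 2)^-1 by rewrite /s ler_pM2l //; lra.
  move=> h; apply: le_trans h _; rewrite ler_pdivrMr ?mulr_gt0 ?exprn_gt0 //; lra.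
have xE : hor T x = mulm (hor T (act k w)) (upm s).
  by rewrite hor_upm // /s; congr hor; field; rewrite gt_eqF.
exists (mulm (upm (- s)) (tilt (jac k w * Num.sqrt (P%:R * t) / Num.sqrt T) (k.2.1%:~R / (Num.sqrt T * Num.sqrt (P%:R * t))))).
set a := Num.sqrt T; set b := Num.sqrt (P%:R * t).
have a0 : 0 < a by rewrite sqrtr_gt0.
have b0' : 0 < b by rewrite sqrtr_gt0.
have aE : a ^+ 2 = T by rewrite sqr_sqrtr // ltW.
have bE : b ^+ 2 = P%:R * t by rewrite sqr_sqrtr // ltW.
have ab : a <= Dm * b.
  by rewrite -(ler_pXn2r (n := 2)) ?nnegrE ?mulr_ge0 ?(ltW a0) ?(ltW b0') ?(ltW Dm0) // exprMn aE bE.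
have ba : Dm * b <= (1 + ep) * a.
  rewrite -(ler_pXn2r (n := 2)) ?nnegrE ?mulr_ge0 ?addr_ge0 ?(ltW a0) ?(ltW b0') ?(ltW Dm0) // !exprMn aE bE.
  exact: TP2.
set mu := jac k w * b / a.
have mu0 : 0 < mu by rewrite divr_gt0 ?mulr_gt0.
have mub : 1 <= mu <= 1 + d / 4.
  apply/andP; split.
    rewrite ler_pdivlMr // mul1r; apply: le_trans ab _; by rewrite ler_pM2r.
  rewrite ler_pdivrMr //; apply: (@le_trans _ _ ((1 + ep) * Dm * b)); first by rewrite ler_pM2r.
  rewrite -mulrA; apply: (@le_trans _ _ ((1 + ep) * ((1 + ep) * a))); first by rewrite ler_wpM2l // addr_ge0.
  by rewrite mulrA -expr2 ler_pM2r.
have vS : `|k.2.1%:~R / (a * b)| * S <= d / 4.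
  rewrite normrM normfV (gtr0_norm (mulr_gt0 a0 b0')) mulrAC ler_pdivrMr ?mulr_gt0 // -(ler_pM2r Dm0).
  have aab : T <= (a * b) * Dm by rewrite -aE expr2 -(mulrA a b) ler_pM2l // mulrC.
  have d40 : 0 <= d / 4 by lra.
  have -> : `|k.2.1%:~R| * S * Dm = `|k.2.1%:~R| * Dm * S by rewrite mulrAC.
  apply: le_trans hv _; have -> : d / 4 * (a * b) * Dm = d / 4 * ((a * b) * Dm) by rewrite -(mulrA (d / 4)).
  by rewrite ler_wpM2l.
have sd : 0 <= s <= d / 4 by rewrite s0 (le_trans st).
have d0 : 0 <= d <= 1 by lra.
have [n1 n2] := upm_tilt_near d0 mub sd S1 vS.
split => //.
  by rewrite (detm_mul (upm _)) detm_upm mul1r /detm /tilt /= mul0r subr0 mulVf // gt_eqF.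
by rewrite (zr_hor sk T0 b0 J0) -/a -/b -/mu xE -mulmA (mulmA (upm s)) upm_mul subrr (_ : upm 0 = idm) // mul1m.
Qed.

Definition ucont2 (Psi : M2 -> M2 -> R) := forall e, 0 < e -> exists2 d, 0 < d & forall g h k l : M2, detm g = 1 -> detm h = 1 ->
  detm k = 1 -> detm l = 1 -> nearm d k -> nearm d l -> `|Psi (mulm g k) (mulm h l) - Psi g h| <= e.

Lemma nearm_id (d : R) : 0 <= d -> nearm d (idm : M2).
Proof. by move=> d0; apply/and4P; split; rewrite /idm /= ?subrr normr0. Qed.

Lemma detm_idm : detm (idm : M2) = 1.
Proof. by rewrite /detm /idm /= mulr1 mulr0 subr0. Qed.

Lemma ucont2_r Psi : ucont2 Psi -> ucontr Psi.
Proof.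
move=> u e e0; have [d d0 hd] := u e e0; exists d => // g h k Dg Dh Dk nk.
by have := hd g h idm k Dg Dh detm_idm Dk (nearm_id (ltW d0)) nk; rewrite mulm1.
Qed.

Lemma dil_hor_conj T x y : 0 < T -> 1 <= y <= 2 -> mulm (dil y) (mulm (hor T x) (invm (dil y))) = hor T (y * x).
Proof.
move=> T0 yb; have y0 : 0 < y by case/andP: yb; lra.
have r0 : Num.sqrt T != 0 by rewrite gt_eqF // sqrtr_gt0.
have q0 : Num.sqrt y != 0 by rewrite gt_eqF // sqrtr_gt0.
have -> : y * x = Num.sqrt y ^+ 2 * x by rewrite sqr_sqrtr // ltW.
rewrite !horE /dil /diagm /mulm /invm /=; move: (Num.sqrt T) (Num.sqrt y) r0 q0 => r q r0 q0.
by congr ((_, _), (_, _)); field; rewrite ?r0 ?q0.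
Qed.

Definition obs_at (Psi : M2 -> M2 -> R) T y (b : R) x := Psi (hor T x) (mulm (hor T (y * x)) (upm b)).

Lemma obs_near Psi (e : R) : ucont2 Psi -> 0 < e -> exists2 d, 0 < d & forall T y x (b : R) kap, 0 < T -> 1 <= y <= 2 ->
  `|b| <= 1 -> detm kap = 1 -> nearm d kap ->
  `|obs_at Psi T y b x - obs Psi y b (mulm (dil y) (mulm (hor T x) kap))| <= e.
Proof.
move=> u e0; have [d d0 hd] := u e e0; exists (d / 16) => [|T y x b kap T0 yb b1 Dk nk]; first by rewrite divr_gt0.
have Dy := detm_dil yb; have Dh := @detm_hor R T x T0.
pose K := mulm (invm (dil y)) (upm b).
have DK : detm K = 1 by rewrite /K detm_mul detm_inv Dy detm_upm mulr1.
have bK : mbound 2 K by exact: mbound_dil_upm.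
have E1 : mulm (hor T (y * x)) (upm b) = mulm (dil y) (mulm (hor T x) K) by rewrite -(dil_hor_conj x T0 yb) /K -!mulmA.
have dd : 0 <= d / 16 by rewrite divr_ge0 // ltW.
have nK := nearm_conj_bound DK bK dd nk.
have E4 : 4 * 2 ^+ 2 * (d / 16) = d by field.
rewrite E4 in nK.
rewrite /obs_at E1 /obs (mulKm _ Dy) distrC.
have -> : mulm (mulm (dil y) (mulm (hor T x) kap)) (mulm (invm (dil y)) (upm b)) =
    mulm (mulm (dil y) (mulm (hor T x) K)) (mulm (invm K) (mulm kap K)).
  by rewrite -/K -(mulmA (dil y)) -(mulmA (hor T x)) -(mulmA (dil y)) -(mulmA (hor T x)) (mulmK _ DK).
apply: hd => //.
- by rewrite (detm_mul (dil y)) (detm_mul (hor T x)) Dy Dh DK !mulr1.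
- by rewrite (detm_mul (invm K)) (detm_mul kap) detm_inv DK Dk !mulr1.
- by apply: nearm_le nk; rewrite ler_pdivrMr //; lra.
Qed.

(** The number of grid points in the cusp is at most the sum of [f] along a horocycle of height
    [y S / T]. The integral of [f] contributes [2 e1], for its mean and the equidistribution error,
    and the passage from the sum to the integral another [2 e1]. *)
Lemma grid_cusp (f : M2 -> R) (C e1 d2 : R) : autom f -> 0 < e1 ->
  (forall g kap, detm g = 1 -> detm kap = 1 -> nearm d2 kap -> `|f (mulm g kap) - f g| <= e1) ->
  (forall g, 0 <= f g <= 1) -> mean f <= e1 -> (forall g, detm g = 1 -> ~ thick C g -> f g = 1) ->
  forall T y S (Z : nat -> M2) (xs : nat -> R) (X : nat) (dl : R), 0 < T -> 1 <= y <= 2 -> 1 <= S -> 0 < dl ->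
  (forall n, (n < X)%N -> 0 <= xs n.+1 - xs n) ->
  (forall n, (n < X)%N -> (1 - e1) * dl <= xs n.+1 - xs n <= dl) ->
  (forall n x, (n < X)%N -> xs n <= x <= xs n.+1 -> exists kap, [/\ detm kap = 1, Z n = mulm (dil y) (mulm (hor T x) kap) &
     nearm d2 (mulm (invm (diagm (Num.sqrt S))) (mulm kap (diagm (Num.sqrt S))))]) ->
  `|itg (y * xs 0%N) (y * xs X) (fun x => f (hor (T / y / S) x)) - (y * xs X - y * xs 0%N) * mean f| <= e1 * (dl * X%:R) ->
  freq X (fun n => `[< ~ thick C (mulm (Z n) (diagm (Num.sqrt S))) >]) <= 4 * e1 * X%:R.
Proof.
move=> af e10 fd f01 fm fth T y S Z xs X dl T0 yb S1 dl0 h0 h1 hZ hI.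
have S0 : 0 < S by lra.
have y0 : 0 < y by case/andP: yb; lra.
have Ty0 : 0 < T / y by rewrite divr_gt0.
have DS : detm (diagm (Num.sqrt S)) = 1 by rewrite detm_diagm // gt_eqF // sqrtr_gt0.
pose bS := diagm (Num.sqrt S).
pose o n := f (mulm (Z n) bS).
pose F x := f (hor (T / y / S) (y * x)).
have bF : bmeas F.
  by apply: (bmeas_comp (f := fun x => f (hor (T / y / S) x)) (bmeas_hor _ af)); mfun.
have m0 := mean_bound af f01.
have obd : forall n, (n < X)%N -> `|o n| <= 1.
  by move=> n _; rewrite /o; have /andP[p0 ple] := f01 (mulm (Z n) bS); rewrite ger0_norm.
have Fo n x : (n < X)%N -> xs n <= x <= xs n.+1 -> `|F x - o n| <= e1.
  move=> nX xb; have [kap [Dk ZE nk]] := hZ n x nX xb.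
  have -> : o n = f (mulm (hor (T / y / S) (y * x)) (mulm (invm bS) (mulm kap bS))).
    rewrite /o ZE -(hor_diag _ Ty0 S0) -(dil_hor x T0 yb) -/bS; congr f.
    by rewrite -(mulmA (dil y)) -(mulmA (hor T x)) -(mulmA (mulm (dil y) _)) (mulmK _ DS) -(mulmA (dil y)).
  rewrite distrC; apply: fd => //; first by rewrite detm_hor // divr_gt0.
  by rewrite (detm_mul (invm bS)) (detm_mul kap) detm_inv DS Dk !mulr1.
have [I1 /andP[I2 I3]] := itg_steps bF (ltW e10) ler01 h0 h1 obd Fo.
have x0X : xs 0%N <= xs X.
  have : 0 <= (1 - e1) * (dl * X%:R) \/ True by right.
  have mono : forall n, (n <= X)%N -> xs 0%N <= xs n.
    elim=> // n IHn nX; have := h0 n nX; have := IHn (ltnW nX); lra.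
  by move=> _; exact: mono.
have IE : itg (xs 0%N) (xs X) F = y^-1 * itg (y * xs 0%N) (y * xs X) (fun x => f (hor (T / y / S) x)).
  exact: (itg_scale y0 (bmeas_hor _ af) x0X).
have IF : itg (xs 0%N) (xs X) F <= 2 * e1 * (dl * X%:R).
  have y1 : y^-1 <= 1 by rewrite invf_le1 //; case/andP: yb.
  have dX0 : 0 <= dl * X%:R by rewrite mulr_ge0 // ltW.
  have hI2 : itg (y * xs 0%N) (y * xs X) (fun x => f (hor (T / y / S) x)) <= y * ((xs X - xs 0%N) * mean f) + e1 * (dl * X%:R).
    move: hI; rewrite ler_norml; move: (itg _ _ _) => I0 /andP[_ h]; clear -h; lra.
  rewrite IE; apply: le_trans (ler_wpM2l (_ : 0 <= y^-1) hI2) _; first by rewrite invr_ge0 ltW.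
  have yV : y^-1 * (y * ((xs X - xs 0%N) * mean f)) = (xs X - xs 0%N) * mean f by rewrite mulKf // gt_eqF.
  rewrite mulrDr yV.
  have g1 : (xs X - xs 0%N) * mean f <= (dl * X%:R) * e1.
    by case/andP: m0 => m0 _; apply: ler_pM => //; rewrite subr_ge0.
  have g2 : y^-1 * (e1 * (dl * X%:R)) <= e1 * (dl * X%:R).
    by rewrite ler_piMl // mulr_ge0 // ltW.
  lra.
have so : freq X (fun n => `[< ~ thick C (mulm (Z n) bS) >]) <= \sum_(n < X) o n.
  rewrite freqE; apply: ler_sum => n _; rewrite /o.
  have /andP[p0 _] := f01 (mulm (Z n) bS).
  case: asboolP => // nth; rewrite fth //.
  have xb : xs n <= xs n <= xs n.+1 by rewrite lexx -subr_ge0 h0.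
  have [kap [Dk ZE _]] := hZ n (xs n) (ltn_ord n) xb.
  by rewrite ZE (detm_mul _ bS) DS (detm_mul (dil y)) (detm_mul (hor T _)) detm_dil // detm_hor // Dk !mulr1.
apply: le_trans so _; rewrite -(ler_pM2l dl0).
have -> : dl * (4 * e1 * X%:R) = 2 * e1 * (dl * X%:R) + (e1 + e1 * 1) * (dl * X%:R) by ring.
move: I1; rewrite ler_norml => /andP[I1 _]; lra.
Qed.
End grid.

(** * Shift invariance on one block *)

Section blocks.
Context {R : realType}.
Local Notation M2 := (mat2 R).
Implicit Types (Psi : M2 -> M2 -> R) (T x w y t d : R) (k : zmat).

(** The only arithmetic information on [y] in the argument, used through [block_escapes]. *)
Definition nonres (K B T y : R) := forall j m : int, j != 0 -> `|j%:~R| <= K -> B < T * `|j%:~R * y - m%:~R|.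

Lemma choose_period (T t Dm ep : R) (M : nat) : 0 < T -> 0 < t -> 0 < Dm -> (0 < M)%N -> 0 < ep -> 2 * (Dm ^+ 2 * t) <= T ->
  Dm ^+ 2 * t * M%:R <= ep * T ->
  exists P : nat, [/\ (M %| P)%N, (1 < P)%N & T <= Dm ^+ 2 * (P%:R * t) <= (1 + ep) ^+ 2 * T].
Proof.
move=> T0 t0 Dm0 M0 ep0 h2 hM; have MR : 0 < M%:R :> R by rewrite ltr0n.
have D0 : 0 < Dm ^+ 2 * t by rewrite mulr_gt0 // exprn_gt0.
pose z := T / (Dm ^+ 2 * t * M%:R).
have z0 : 0 <= z by rewrite divr_ge0 ?(ltW T0) // mulr_ge0 ?(ltW D0).
have zE : z * (Dm ^+ 2 * t * M%:R) = T by rewrite divfK // gt_eqF // mulr_gt0.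
have /andP[z1 z2] := truncn_itv z0.
exists (M * (Num.truncn z).+1)%N.
have TP : T <= Dm ^+ 2 * ((M * (Num.truncn z).+1)%:R * t).
  rewrite natrM; have -> : Dm ^+ 2 * (M%:R * (Num.truncn z).+1%:R * t) = (Num.truncn z).+1%:R * (Dm ^+ 2 * t * M%:R) by ring.
  by rewrite -[leLHS]zE ler_pM2r ?mulr_gt0 // ltW.
split; first exact: dvdn_mulr.
  rewrite -(ltr_nat R) -(ltr_pM2l D0) mulr1.
  have : Dm ^+ 2 * ((M * (Num.truncn z).+1)%:R * t) = Dm ^+ 2 * t * (M * (Num.truncn z).+1)%:R by ring.
  lra.
rewrite TP /= natrM -natr1.
have -> : Dm ^+ 2 * (M%:R * ((Num.truncn z)%:R + 1) * t) = (Num.truncn z)%:R * (Dm ^+ 2 * t * M%:R) + Dm ^+ 2 * t * M%:R by ring.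
have : (Num.truncn z)%:R * (Dm ^+ 2 * t * M%:R) <= T by rewrite -[leRHS]zE ler_pM2r // mulr_gt0.
have : 0 <= ep ^+ 2 * T by rewrite mulr_ge0 ?sqr_ge0 // ltW.
have -> : (1 + ep) ^+ 2 * T = T + 2 * (ep * T) + ep ^+ 2 * T by ring.
have : 0 <= ep * T by rewrite mulr_ge0 // ltW.
lra.
Qed.

Lemma step_size k (w w' P Dm ep e1 : R) : sl2z k -> 0 < P -> 0 < Dm -> w' - w = P^-1 -> Dm <= jac k w <= (1 + ep) * Dm ->
  Dm <= jac k w' <= (1 + ep) * Dm -> 0 <= ep <= e1 / 2 -> 0 <= e1 <= 1 ->
  0 <= act k w' - act k w /\ (1 - e1) * (P * Dm ^+ 2)^-1 <= act k w' - act k w <= (P * Dm ^+ 2)^-1.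
Proof.
move=> sk P0 D0 wd /andP[a1 a2] /andP[b1 b2] /andP[p0 p1] /andP[e0 e1'].
have J0 : 0 < jac k w by lra.
have J0' : 0 < jac k w' by lra.
rewrite act_diff ?gt_eqF // wd; split; first by rewrite divr_ge0 ?invr_ge0 ?mulr_ge0 // ltW.
have JJ : Dm ^+ 2 <= jac k w * jac k w' by rewrite expr2 ler_pM // ltW.
have JJ' : jac k w * jac k w' <= (1 + ep) ^+ 2 * Dm ^+ 2 by rewrite -exprMn expr2 ler_pM // ltW.
have D2 : 0 < Dm ^+ 2 by rewrite exprn_gt0.
have JJ0 : 0 < jac k w * jac k w' by rewrite mulr_gt0.
rewrite [(P * _)^-1]invfM; move: (jac k w * jac k w') JJ JJ' JJ0 => u u1 u2 u0.
rewrite mulrCA !ler_pM2l ?invr_gt0 //; apply/andP; split; last by rewrite lef_pV2.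
rewrite -[leRHS]mul1r ler_pdivlMr // mulrAC ler_pdivrMr // mul1r.
apply: le_trans (ler_wpM2l _ u2) _; first by lra.
rewrite mulrA ler_piMl ?(ltW D2) //.
have : (1 + ep) ^+ 2 <= (1 + e1 / 2) ^+ 2 by rewrite ler_pXn2r ?nnegrE //; lra.
nra.
Qed.

Lemma jac_range k (w0 w Wd ep Dm L : R) : 0 <= Wd * `|k.2.1%:~R| -> L <= ep * Wd -> 0 <= ep ->
  Wd * `|k.2.1%:~R| <= Dm -> Dm = Num.min (jac k w0) (jac k (w0 + L)) -> w0 <= w <= w0 + L -> Dm <= jac k w <= (1 + ep) * Dm.
Proof.
rewrite /jac; set c : R := k.2.1%:~R; move: (k.2.2%:~R : R) => d0 W0 LW ep0 WD DE /andP[w1 w2].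
have L0 : 0 <= L by lra.
have cL : `|c| * L <= ep * Dm.
  apply: (@le_trans _ _ (ep * (Wd * `|c|))); last by rewrite ler_wpM2l.
  by rewrite mulrA [leRHS]mulrC ler_wpM2l.
have [c0|c0] := leP 0 c.
  have E : c * w0 <= c * (w0 + L) by rewrite ler_wpM2l //; lra.
  have E1 : c * w0 <= c * w by rewrite ler_wpM2l.
  have E2 : c * w <= c * (w0 + L) by rewrite ler_wpM2l.
  move: DE; rewrite min_l; last by lra.
  move: cL; rewrite (ger0_norm c0) => cL DE; rewrite DE in cL *; apply/andP; split; lra.
have E : c * (w0 + L) <= c * w0 by rewrite ler_wnM2l ?(ltW c0) //; lra.
have E1 : c * w <= c * w0 by rewrite ler_wnM2l ?(ltW c0).
have E2 : c * (w0 + L) <= c * w by rewrite ler_wnM2l ?(ltW c0).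
move: DE; rewrite min_r; last by lra.
move: cL; rewrite (ltr0_norm c0) => cL DE; rewrite DE in cL *; apply/andP; split; lra.
Qed.

Lemma le_parts (a1 a2 a3 a4 a5 T : R) : 0 <= a1 -> 0 <= a2 -> 0 <= a3 -> 0 <= a4 -> 0 <= a5 ->
  1 + a1 + a2 + a3 + a4 + a5 <= T -> [/\ 1 <= T, a1 <= T, a2 <= T, a3 <= T & a4 <= T /\ a5 <= T].
Proof. by move=> *; split; first [split|idtac]; lra. Qed.

Lemma dist2 (a1 a2 a3 a4 e : R) : `|a1 - a3| <= e -> `|a2 - a4| <= e -> `|(a1 - a2) - (a3 - a4)| <= 2 * e.
Proof.
move=> h1 h2; rewrite (_ : _ - _ = (a1 - a3) - (a2 - a4)); last by ring.
by apply: le_trans (ler_normB _ _) _; lra.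
Qed.

Lemma norm_sub2 (a b : R) : `|a| <= 1 -> `|b| <= 1 -> `|a - b| <= 2.
Proof. by move=> h1 h2; apply: le_trans (ler_normB _ _) _; lra. Qed.

Lemma block_bound (I J e' dX len e : R) : `|I - J| <= (2 * e' + e' * 2) * dX -> `|J| <= 96 * e' * dX -> 0 <= e' <= 1 / 20 ->
  (1 - e') * dX <= len -> 200 * e' <= e -> 0 <= dX -> 0 <= len -> `|I| <= e * len.
Proof.
move=> I1 sd /andP[e0 e1] I2 ee dX0 len0.
have IJ : `|I| <= 100 * e' * dX.
  rewrite -[I](subrK J); apply: le_trans (ler_normD _ _) _; lra.
have ed : e' * dX <= dX / 2 by rewrite mulrC ler_wpM2l //; lra.
have dXx : dX <= 2 * len by lra.
apply: le_trans IJ _; apply: (@le_trans _ _ (100 * e' * (2 * len))); first by rewrite ler_wpM2l // mulr_ge0.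
rewrite mulrA ler_wpM2r //; lra.
Qed.

(** For a fixed block and large [T] the period [P] is chosen with [Dm^2 P t] close to [T]; the
    points of the block then follow the orbit of [Z0] on a grid of step nearly [dl]. [core] bounds
    the sum over the grid and [itg_steps] passes to the integral. *)
Lemma block Psi : inv2 Psi -> ucont2 Psi -> (forall g h, `|Psi g h| <= 1) -> (forall T y b, bmeas (obs_at Psi T y b)) ->
  forall e : R, 0 < e <= 1 -> exists L W : nat, [/\ (0 < L)%N, (0 < W)%N & forall k (w0 : R), sl2z k -> k.2.1 != 0 ->
  W%:R * `|k.2.1%:~R| <= jac k w0 -> W%:R * `|k.2.1%:~R| <= jac k (w0 + L%:R) ->
  exists T0 K B : R, forall T y, T0 <= T -> 1 <= y <= 2 -> nonres K B T y ->
  `|itg (act k w0) (act k (w0 + L%:R)) (fun x => obs_at Psi T y 1 x - obs_at Psi T y 0 x)| <=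
  e * (act k (w0 + L%:R) - act k w0)].
Proof.
move=> iP uP P1 mP e /andP[e0 e1]; have uPr := ucont2_r uP.
(* [core] contributes [24 * 4 e' = 96 e'] and the Riemann sum [4 e'], relative to a length at most
   twice that of the block; hence the requirement [200 e' <= e]. *)
pose e' := e / 20 / 20; have e'0 : 0 < e' by rewrite !divr_gt0.
have e'1 : e' <= 1 / 20 by rewrite ler_pdivrMr //; rewrite /e'; lra.
have ee : 200 * e' <= e by rewrite /e'; lra.
have e'01 : 0 <= e' <= 1 by rewrite (ltW e'0) /=; lra.
have e'20 : 0 <= e' <= 1 / 20 by rewrite (ltW e'0).
clearbody e'.
have [d1 d10 hobs] := obs_near uP e'0.
have [C C0 [f [af uf f01 fm fth]]] := @cusp_function R e' e'0.
have [d2 d20 hf] := uf e' e'0.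
pose d := Num.min 1 (Num.min d1 d2).
have d0 : 0 < d by rewrite !lt_min ltr01 d10 d20.
have dle1 : d <= 1 by rewrite ge_min lexx.
have dd1 : d <= d1 by rewrite !ge_min lexx !orbT.
have dd2 : d <= d2 by rewrite !ge_min lexx !orbT.
pose t := d / 4; have t0 : 0 < t by rewrite divr_gt0.
have e40 : 0 < 4 * e' by rewrite mulr_gt0.
have [K [M [L [l [rho [S0 [S [[M0 L0 S00] S1 hcore]]]]]]]] := core iP uPr P1 e40 C0 t0.
have LR : 0 < L%:R :> R by rewrite ltr0n.
pose ep := Num.min (e' / 2) (d / 12).
have ep0 : 0 < ep by rewrite lt_min !divr_gt0.
have ep1 : ep <= e' / 2 by rewrite ge_min lexx.
have ep2 : ep <= d / 12 by rewrite ge_min lexx orbT.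
have epd : (1 + ep) ^+ 2 <= 1 + d / 4 by nra.
(* Along [L] units on which [jac] is at least [W |c|], it varies by a factor at most [1 + ep]. *)
have [W W1 hW] := nat_large [:: L%:R / ep] 1.
have WL : L%:R <= ep * W%:R by rewrite -ler_pdivrMl // mulrC; apply: hW; rewrite inE.
exists L, W; split => // k w0 sk c0 J1 J2.
set c : R := k.2.1%:~R in J1 J2.
have c1 : 1 <= `|c| by rewrite /c -intr_norm -[1]/(1%:~R) ler_int -gtz0_ge1 normr_gt0.
pose Dm := Num.min (jac k w0) (jac k (w0 + L%:R)).
have WD : W%:R * `|c| <= Dm by rewrite le_min J1.
have W1R : 1 <= W%:R :> R by rewrite ler1n.
have Dm0 : 0 < Dm by apply: lt_le_trans WD; exact: (mulr_gt0 (lt_le_trans ltr01 W1R) (lt_le_trans ltr01 c1)).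
have hD w : w0 <= w <= w0 + L%:R -> Dm <= jac k w <= (1 + ep) * Dm.
  apply: (@jac_range k w0 w W%:R ep Dm L%:R) => //; last exact: ltW.
have [T1 [K1 [B1 hesc]]] := block_escapes w0 L l rho S0 sk c0.
have [Sx Sx1 hSx] : exists2 Sx : R, 1 <= Sx & forall i, (i < K)%N -> S i <= Sx.
  elim: (K) => [|j [s s1 hs]]; first by exists 1.
  exists (Num.max s (S j)); first by rewrite le_max s1.
  move=> i; rewrite ltnS leq_eqVlt => /predU1P[->|/hs h]; first by rewrite le_max lexx orbT.
  by rewrite le_max h.
pose x0 := act k w0; pose x1 := act k (w0 + L%:R).
pose bb := 2 * (`|x0| + `|x1|).
have bb0 : 0 <= bb by rewrite mulr_ge0 // addr_ge0.
pose dX := L%:R / Dm ^+ 2.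
have dX0 : 0 < dX by rewrite divr_gt0 // exprn_gt0.
have e'dX : 0 < e' * dX by rewrite mulr_gt0.
have [Tf Tf1 hfe] := horo_equi af uf f01 bb0 e'dX.
exists (1 + `|T1| * Dm ^+ 2 + 2 * (Dm ^+ 2 * t) + Dm ^+ 2 * t * M%:R / ep + 4 * (`|c| * Dm * Sx) / d + 2 * Sx * Tf), K1, (B1 * Dm ^+ 2).
move=> T y TT yb NR.
have D2 : 0 < Dm ^+ 2 by rewrite exprn_gt0.
have Sx0 : 0 < Sx by exact: lt_le_trans Sx1.
have q1 : 0 <= `|T1| * Dm ^+ 2 by rewrite mulr_ge0 // ltW.
have q2 : 0 < 2 * (Dm ^+ 2 * t) by rewrite !mulr_gt0.
have q3 : 0 <= Dm ^+ 2 * t * M%:R / ep by rewrite divr_ge0 ?(ltW ep0) // mulr_ge0 // mulr_ge0 // ltW.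
have q4 : 0 <= 4 * (`|c| * Dm * Sx) / d.
  by rewrite divr_ge0 ?(ltW d0) // mulr_ge0 // mulr_ge0 ?(ltW Sx0) // mulr_ge0 ?(ltW Dm0).
have q5 : 0 <= 2 * Sx * Tf by rewrite mulr_ge0 ?mulr_ge0 ?(ltW Sx0) // (le_trans ler01).
have [T1le hT1 hT2 q3' [q4' hT5]] := le_parts q1 (ltW q2) q3 q4 q5 TT.
have Tp : 0 < T by exact: lt_le_trans T1le.
have hT3 : Dm ^+ 2 * t * M%:R <= ep * T by rewrite -ler_pdivrMl // mulrC.
have hT4 : `|c| * Dm * Sx <= d / 4 * T.
  by move: q4'; rewrite ler_pdivrMr // => h; clear -h; lra.
clear q3' q4'.
clear TT q1 q2 q3 q4 q5.
have [P [MP P1' /andP[TP1 TP2]]] := choose_period Tp t0 Dm0 M0 ep0 hT2 hT3.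
have P0 : (0 < P)%N by exact: ltnW.
have PR : 0 < P%:R :> R by rewrite ltr0n.
have PtT1 : T1 <= P%:R * t.
  rewrite -(ler_pM2l D2); apply: le_trans TP1; apply: le_trans hT1; rewrite mulrC ler_pM2r //; exact: ler_norm.
have NR' : forall j m : int, j != 0 -> `|j%:~R| <= K1 -> B1 < P%:R * t * `|j%:~R * y - m%:~R|.
  move=> j m j0 jK; rewrite -(ltr_pM2r D2); apply: lt_le_trans (NR j m j0 jK) _.
  by rewrite [leRHS]mulrC mulrA ler_wpM2r.
have esc := hesc t P y t0 P1' PtT1 yb NR'.
pose Z0 := mulm (dil y) (mulm (zr k) (hor (P%:R * t) w0)); rewrite -/Z0 in esc.
have b0 : 0 < P%:R * t by rewrite mulr_gt0.
pose dl := (P%:R * Dm ^+ 2)^-1.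
have dl0 : 0 < dl by rewrite invr_gt0 mulr_gt0.
have dlX : dl * (L * P)%:R = dX by rewrite /dl /dX natrM; field; rewrite !gt_eqF.
pose xs (n : nat) := act k (w0 + n%:R / P%:R).
have range i : (i <= L * P)%N -> w0 <= w0 + i%:R / P%:R <= w0 + L%:R.
  by move=> iX; rewrite lerDl divr_ge0 //= lerD2l ler_pdivrMr // -natrM ler_nat.
have inc : forall n, (n < L * P)%N -> 0 <= xs n.+1 - xs n /\ (1 - e') * dl <= xs n.+1 - xs n <= dl.
  move=> n nX; apply: (@step_size k _ _ P%:R Dm ep e' sk PR Dm0).
  - by rewrite -natr1; field; rewrite gt_eqF.
  - by apply: hD; apply: range; exact: ltnW.
  - by apply: hD; exact: range.
  - by rewrite (ltW ep0).
  - exact: e'01.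
have inc0 : forall n, (n < L * P)%N -> 0 <= xs n.+1 - xs n by move=> n /inc[].
have inc1 : forall n, (n < L * P)%N -> (1 - e') * dl <= xs n.+1 - xs n <= dl by move=> n /inc[].
have xs0 : xs 0%N = x0 by rewrite /xs mul0r addr0.
have xsX : xs (L * P)%N = x1 by rewrite /xs natrM mulfK // gt_eqF.
have x01 : x0 <= x1.
  have j1 : 0 < jac k w0 by apply: lt_le_trans Dm0 _; rewrite ge_min lexx.
  have j2 : 0 < jac k (w0 + L%:R) by apply: lt_le_trans Dm0 _; rewrite ge_min lexx orbT.
  by rewrite -subr_ge0 act_diff ?gt_eqF // addrAC subrr add0r divr_ge0 // mulr_ge0 // ltW.
have flE n : flow t Z0 n = mulm (dil y) (mulm (zr k) (hor (P%:R * t) (w0 + n%:R / P%:R))) by exact: flow_hor.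
have grid S' : 1 <= S' -> S' <= Sx -> forall n x, (n < L * P)%N -> xs n <= x <= xs n.+1 ->
    exists kap : M2, [/\ detm kap = 1, flow t Z0 n = mulm (dil y) (mulm (hor T x) kap), nearm d kap &
    nearm d (mulm (invm (diagm (Num.sqrt S'))) (mulm kap (diagm (Num.sqrt S'))))].
  move=> S'1 S'x n x nX xb.
  have hv : `|k.2.1%:~R| * Dm * S' <= d / 4 * T.
    by apply: le_trans hT4; rewrite ler_wpM2l // mulr_ge0 // ltW.
  have TP12 : T <= Dm ^+ 2 * (P%:R * t) <= (1 + ep) ^+ 2 * T by rewrite TP1.
  have [kap [k1 k2 k3 k4]] := grid_near sk P0 t0 Tp Dm0 hD (ltW ep0) TP12 (lexx _) epd dle1 S'1 hv nX xb.
  by exists kap; split => //; rewrite flE k2.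
have y12 : 0 < y /\ `|y| <= 2.
  case/andP: (yb) => y1 y2; have yp : 0 < y by exact: lt_le_trans y1.
  by split => //; rewrite ger0_norm // ltW.
have cusp S' : 1 <= S' -> S' <= Sx ->
    freq (L * P) (fun n => `[< ~ thick C (mulm (flow t Z0 n) (diagm (Num.sqrt S'))) >]) <= 4 * e' * (L * P)%:R.
  move=> S'1 S'x.
  have fd g kap : detm g = 1 -> detm kap = 1 -> nearm d2 kap -> `|f (mulm g kap) - f g| <= e' by exact: hf.
  apply: (grid_cusp af e'0 fd f01 fm fth Tp yb S'1 dl0 inc0 inc1).
    move=> n x nX xb; have [kap [k1 k2 k3 k4]] := grid S' S'1 S'x n x nX xb.
    by exists kap; split => //; exact: nearm_le k4.
  rewrite xs0 xsX dlX; have [y0 y2] := y12.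
  have yx z : `|z| <= `|x0| + `|x1| -> - bb <= y * z <= bb.
    by move=> hz; rewrite -ler_norml normrM; apply: ler_pM.
  have /andP[u1 _] := yx x0 (ltac:(by rewrite lerDl)).
  have /andP[_ v1] := yx x1 (ltac:(by rewrite lerDr)).
  apply: hfe => //; last by rewrite ler_pM2l.
  have S'0 : 0 < S' by exact: lt_le_trans S'1.
  rewrite ler_pdivlMr // ler_pdivlMr //; apply: le_trans hT5.
  have : S' * y <= Sx * 2 by apply: ler_pM => //; [exact: ltW|exact: ltW|case/andP: yb].
  by move=> h; rewrite -mulrA mulrC (mulrC 2) ler_wpM2r // (le_trans ler01).
have DZ0 : detm Z0 = 1 by rewrite (detm_mul (dil y)) (detm_mul (zr k)) detm_dil // detm_zr // detm_hor // !mulr1.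
(* A full period is [w -> w + 1], which the integer matrix [k u1 k^-1] realises in the first
   variable. *)
pose u1 : zmat := ((1, 1), (0, 1)).
pose k1 := zmul k (zmul u1 (zinv k)).
have sk1 : sl2z k1 by apply: sl2z_mul => //; apply: sl2z_mul => //; exact: sl2z_inv.
have per : mulm (invm (dil y)) (flow t Z0 P) = mulm (zr k1) (mulm (invm (dil y)) Z0).
  rewrite flE /Z0 !(mulKm _ (detm_dil yb)) divff ?gt_eqF // addrC -(upm_hor _ w0 1) /k1 !zr_mul zr_inv.
  have -> : zr u1 = upm 1 :> M2 by [].
  by rewrite -(mulmA (zr k)) -(mulmA (upm 1)) (mulKm _ (detm_zr sk)).
have cus1 : freq (L * P) (fun n => `[< ~ thick C (flow t Z0 n) >]) <= 4 * e' * (L * P)%:R.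
  have := cusp 1 (lexx _) Sx1; rewrite sqrtr1 (_ : diagm 1 = idm); last by rewrite /diagm invr1.
  by under [X in freq _ X]funext do rewrite mulm1.
have cus2 i : (i < K)%N -> freq (L * P) (fun n => `[< ~ thick C (mulm (flow t Z0 n) (diagm (Num.sqrt (S i)))) >]) <= 4 * e' * (L * P)%:R.
  by move=> iK; apply: cusp; [exact: S1|exact: hSx].
have sums := hcore y Z0 P k1 yb DZ0 sk1 per MP P0 cus1 cus2 esc.
pose g (b : bool) i := obs Psi y b%:R (flow t Z0 i).
have go n : (n < L * P)%N -> `|g true n - g false n| <= 2.
  by move=> _; apply: norm_sub2; exact: P1.
have near2 n x : (n < L * P)%N -> xs n <= x <= xs n.+1 ->
    `|(obs_at Psi T y 1 x - obs_at Psi T y 0 x) - (g true n - g false n)| <= 2 * e'.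
  move=> nX xb; have [kap [r1 r2 r3 _]] := grid 1 (lexx _) Sx1 n x nX xb.
  have n1 := nearm_le dd1 r3.
  have h1 := hobs T y x 1 kap Tp yb (ltac:(by rewrite normr1)) r1 n1.
  have h0 := hobs T y x 0 kap Tp yb (ltac:(by rewrite normr0)) r1 n1.
  by rewrite /g r2; exact: (dist2 h1 h0).
have bF : bmeas (fun x => obs_at Psi T y 1 x - obs_at Psi T y 0 x) by apply: bmeasB.
have e2 : 0 <= 2 * e' by exact: (mulr_ge0 (ler0n R 2) (ltW e'0)).
have [I1 /andP[I2 I3]] := itg_steps bF e2 (ler0n R 2) inc0 inc1 go near2.
rewrite xs0 xsX dlX in I1 I2 I3.
have sd : `|dl * \sum_(n < L * P) (g true n - g false n)| <= 96 * e' * dX.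
  rewrite normrM (gtr0_norm dl0) -dlX; apply: le_trans (ler_wpM2l (ltW dl0) sums) _.
  by rewrite le_eqVlt; apply/orP; left; apply/eqP; ring.
apply: (block_bound I1 sd e'20 I2 ee (ltW dX0)).
by rewrite subr_ge0.
Qed.
End blocks.

(** * Exhausting an interval by Farey arcs *)

Section exhaustion.
Context {R : realType}.
Local Notation mR := (measurableTypeR R).

Definition evn (P : nat -> Prop) := exists n0, forall n, (n0 <= n)%N -> P n.

Lemma evn_and (P Q : nat -> Prop) : evn P -> evn Q -> evn (fun n => P n /\ Q n).
Proof.
move=> [n hn] [m hm]; exists (maxn n m) => i; rewrite geq_max => /andP[h1 h2].
by split; [exact: hn|exact: hm].
Qed.

Lemma evn_imp (P Q : nat -> Prop) : (forall n, P n -> Q n) -> evn P -> evn Q.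
Proof. by move=> PQ [n hn]; exists n => m nm; apply: PQ; exact: hn. Qed.

Context (F : nat -> mR -> R).
Hypotheses (bF : forall n, bmeas (F n)) (F2 : forall n x, `|F n x| <= 2).
Implicit Types (u v w b c e : R) (k : zmat).

Definition piece b u v := u <= v /\ evn (fun n => `|itg u v (F n)| <= b * (v - u)).

Lemma piece_cat b u v w : piece b u v -> piece b v w -> piece b u w.
Proof.
move=> [uv h1] [vw h2]; split; first exact: le_trans vw.
apply: evn_imp (evn_and h1 h2) => n [i1 i2]; rewrite (itg_cat (bF n) uv vw).
by apply: le_trans (ler_normD _ _) _; lra.
Qed.

Lemma piece_refl b u : piece b u u.
Proof.
split => //; exists 0%N => n _; rewrite subrr mulr0.
by have := itg_bound (lexx u) (bF n) (fun x _ => F2 n x); rewrite subrr mulr0.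
Qed.

Lemma piece_le b c u v : b <= c -> piece b u v -> piece c u v.
Proof.
by move=> bc [uv h]; split => //; apply: evn_imp h => n h; apply: le_trans h _; rewrite ler_wpM2r // subr_ge0.
Qed.

Lemma piece2 u v : u <= v -> piece 2 u v.
Proof. by move=> uv; split => //; exists 0%N => n _; exact: itg_bound. Qed.

Lemma piece_mix b e kap u v w z : e <= b -> piece b u v -> piece e v w -> piece b w z ->
  kap * (z - u) <= w - v -> piece (b - kap * (b - e)) u z.
Proof.
move=> eb [uv h1] [vw h2] [wz h3] hk; have vz := le_trans vw wz; split; first exact: le_trans vz.
apply: evn_imp (evn_and h1 (evn_and h2 h3)) => n [i1 [i2 i3]].
rewrite (itg_cat (bF n) uv vz) (itg_cat (bF n) vw wz).
apply: le_trans (ler_normD _ _) _; apply: le_trans (lerD (lexx _) (ler_normD _ _)) _.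
have : (b - e) * (kap * (z - u)) <= (b - e) * (w - v) by rewrite ler_wpM2l // subr_ge0.
lra.
Qed.

Definition farey k := [/\ sl2z k, 0 < k.2.1 & 0 < k.2.2].
Definition lft k : R := k.1.2%:~R / k.2.2%:~R.
Definition rgt k : R := k.1.1%:~R / k.2.1%:~R.

Lemma farey_len k : farey k -> rgt k - lft k = (k.2.1%:~R * k.2.2%:~R)^-1.
Proof.
move: k => [[a b'] [c d]] [sk c0 d0]; rewrite /rgt /lft /=.
have skR : a%:~R * d%:~R - b'%:~R * c%:~R = 1 :> R by move: sk; rewrite /sl2z /= /zdet /= => sk; rewrite -!rmorphM /= -rmorphB /= sk.
have c1 : c%:~R != 0 :> R by rewrite intr_eq0 gt_eqF.
have d1 : d%:~R != 0 :> R by rewrite intr_eq0 gt_eqF.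
have -> : (c%:~R * d%:~R)^-1 = (a%:~R * d%:~R - b'%:~R * c%:~R) / (c%:~R * d%:~R) :> R by rewrite skR mul1r.
by field; rewrite c1 d1.
Qed.

Lemma farey_le k : farey k -> lft k <= rgt k.
Proof.
move=> fk; rewrite -subr_ge0 farey_len //; case: fk => _ c0 d0.
by rewrite invr_ge0 mulr_ge0 // ler0z ltW.
Qed.

Lemma farey_mul k l : sl2z l -> farey k -> (0 <= l.1.1)%R -> 0 <= l.1.2 -> 0 <= l.2.1 -> 0 <= l.2.2 -> farey (zmul k l).
Proof.
move=> sl [sk c0 d0] h1 h2 h3 h4.
have det : l.1.1 * l.2.2 - l.1.2 * l.2.1 = 1 by move: sl; rewrite /sl2z /zdet.
split; first exact: sl2z_mul.
- rewrite /zmul /=; have [l0|l0] := eqVneq l.1.1 0.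
    have : l.2.1 != 0 by apply/eqP => l1; move: det; rewrite l0 l1; lia.
    by move=> l1; rewrite l0 mulr0 add0r mulr_gt0 // lt_neqAle eq_sym l1.
  by rewrite ltr_wpDr ?mulr_ge0 ?(ltW d0) // mulr_gt0 // lt_neqAle eq_sym l0.
- rewrite /zmul /=; have [l0|l0] := eqVneq l.2.2 0.
    have : l.1.2 != 0 by apply/eqP => l1; move: det; rewrite l0 l1; lia.
    by move=> l1; rewrite l0 mulr0 addr0 mulr_gt0 // lt_neqAle eq_sym l1.
  by rewrite ltr_wpDl ?mulr_ge0 ?(ltW c0) // mulr_gt0 // lt_neqAle eq_sym l0.
Qed.

Lemma lft_mul k l : lft (zmul k l) = (k.1.1%:~R * l.1.2%:~R + k.1.2%:~R * l.2.2%:~R) / (k.2.1%:~R * l.1.2%:~R + k.2.2%:~R * l.2.2%:~R).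
Proof. by rewrite /lft /zmul /= !rmorphD !rmorphM. Qed.

Lemma rgt_mul k l : rgt (zmul k l) = (k.1.1%:~R * l.1.1%:~R + k.1.2%:~R * l.2.1%:~R) / (k.2.1%:~R * l.1.1%:~R + k.2.2%:~R * l.2.1%:~R).
Proof. by rewrite /rgt /zmul /= !rmorphD !rmorphM. Qed.

Definition farey_bound b := forall k, farey k -> piece b (lft k) (rgt k).

(** As [c <= d], the points beyond [w = W] fill at least [1 / (W + 1)] of the arc, and sufficiently
    many blocks fill half of that. *)
Lemma blocks_len (c d W L J : R) : 0 < c -> c <= d -> 1 <= c -> 1 <= L -> 0 <= W -> c * W + d <= J ->
  (2 * (W + 1))^-1 * (c * d)^-1 <= J * L / ((c * W + d) * (c * (W + J * L) + d)).
Proof.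
move=> c0 cd c1 L1 W0 J1.
have cW : 0 <= c * W by rewrite mulr_ge0 // ltW.
have cdW : c * W <= d * W by rewrite ler_wpM2r.
have A0 : 0 < c * W + d by lra.
have J0 : 0 < J by lra.
have JL : J <= c * (J * L).
  have : J <= J * L by rewrite ler_peMr // ltW.
  have : J * L <= c * (J * L) by rewrite ler_peMl // mulr_ge0 ?(ltW J0) //; lra.
  lra.
have AW : c * W + d <= d * (W + 1) by lra.
have JL0 : 0 < J * L by rewrite mulr_gt0 //; lra.
have cJL : 0 < c * (J * L) by rewrite mulr_gt0.
have B0 : 0 < c * (W + J * L) + d by lra.
have B1 : c * (W + J * L) + d <= 2 * (c * (J * L)) by lra.
have d0 : 0 < d by lra.
have W1 : 0 < W + 1 by lra.
rewrite -invfM -[leLHS]mul1r ler_pdivrMr ?mulr_gt0 // mulrAC ler_pdivlMr ?mulr_gt0 // mul1r.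
have -> : J * L * (2 * (W + 1) * (c * d)) = (d * (W + 1)) * (2 * (c * (J * L))) by ring.
by apply: ler_pM => //; exact: ltW.
Qed.

Section step.
Context (e : R) (L W : nat).
Hypotheses (e1 : 0 < e <= 1) (L0 : (0 < L)%N) (W0 : (0 < W)%N).
Hypothesis blk : forall k (w0 : R), sl2z k -> k.2.1 != 0 -> W%:R * `|k.2.1%:~R| <= jac k w0 ->
  W%:R * `|k.2.1%:~R| <= jac k (w0 + L%:R) ->
  evn (fun n => `|itg (act k w0) (act k (w0 + L%:R)) (F n)| <= e * (act k (w0 + L%:R) - act k w0)).

Lemma block_piece k (w0 : R) : sl2z k -> k.2.1 != 0 -> W%:R * `|k.2.1%:~R| <= jac k w0 ->
  W%:R * `|k.2.1%:~R| <= jac k (w0 + L%:R) -> piece e (act k w0) (act k (w0 + L%:R)).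
Proof.
move=> sk c0 h1 h2; split; last exact: blk.
have c1 : 0 < W%:R * `|k.2.1%:~R| :> R by rewrite mulr_gt0 ?ltr0n // normr_gt0 intr_eq0.
have j1 := lt_le_trans c1 h1; have j2 := lt_le_trans c1 h2.
by rewrite -subr_ge0 act_diff ?gt_eqF // addrAC subrr add0r divr_ge0 // mulr_ge0 // ltW.
Qed.

(* The blocks fill a definite proportion of each Farey interval and what remains is a finite union of Farey
   intervals. *)
Lemma farey_step b : e <= b -> farey_bound b -> farey_bound (b - (2 * (W%:R + 1))^-1 * (b - e)).
Proof.
move=> eb hb k fk; have [sk c0 d0] := fk.
move: k fk sk c0 d0 => [[a b'] [c d]] fk sk /= c0 d0.
have skR : a%:~R * d%:~R - b'%:~R * c%:~R = 1 :> R by move: sk; rewrite /sl2z /= /zdet /= => sk; rewrite -!rmorphM /= -rmorphB /= sk.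
have cR : 1 <= c%:~R :> R by rewrite -[1]/(1%:~R) ler_int -gtz0_ge1.
have dR : 1 <= d%:~R :> R by rewrite -[1]/(1%:~R) ler_int -gtz0_ge1.
have LR : 1 <= L%:R :> R by rewrite ler1n.
have WR : 0 <= W%:R :> R by [].
have natz (j : nat) : j%:Z%:~R = j%:R :> R by [].
pose k := ((a, b'), (c, d)) : zmat.
(* The blocks are made to accumulate at the end with the smaller denominator, so that the part cut
   off near the other end is a proportion bounded away from 1. The second case is the mirror image,
   with [k'] and negative [w]. *)
have [cd|dc] := leP c d.
- pose p (j : nat) := act k (j%:R : R).
  have p0 : p 0%N = lft k by rewrite /p /act /jac /lft /= !mulr0 !add0r.
  have pj j : piece b (p j) (p j.+1).
    have fk' : farey (zmul k ((j.+1%:Z, j%:Z), (1, 1))) by apply: farey_mul => //; rewrite /sl2z /= /zdet /=; lia.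
    have := hb _ fk'; set k1 := zmul _ _.
    have -> : lft k1 = p j by rewrite lft_mul /p /act /jac /= ?natz; congr (_ / _); ring.
    by have -> : rgt k1 = p j.+1 by rewrite rgt_mul /p /act /jac /= ?natz; congr (_ / _); ring.
  have head j : piece b (p 0%N) (p j) by elim: j => [|j IH]; [exact: piece_refl|exact: (piece_cat IH (pj j))].
  have tail j : piece b (p j) (rgt k).
    have fk' : farey (zmul k ((1, j%:Z), (0, 1))) by apply: farey_mul => //; rewrite /sl2z /= /zdet /=; lia.
    have := hb _ fk'; set k1 := zmul _ _.
    have -> : lft k1 = p j by rewrite lft_mul /p /act /jac /= ?natz; congr (_ / _); ring.
    by have -> : rgt k1 = rgt k by rewrite rgt_mul /rgt /= ?natz; congr (_ / _); ring.
  have cW (j : nat) : 0 <= c%:~R * j%:R :> R by rewrite mulr_ge0 // ler0z ltW.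
  have pjac j : (W <= j)%N -> W%:R * `|c%:~R| <= jac k (j%:R : R).
    move=> Wj; rewrite /jac /= ger0_norm ?ler0z ?(ltW c0) // mulrC.
    have : c%:~R * W%:R <= c%:~R * j%:R :> R by rewrite ler_wpM2l ?ler_nat // ler0z ltW.
    lra.
  have jpos (j : nat) : jac k (j%:R : R) != 0 by rewrite gt_eqF // /jac /=; have := cW j; lra.
  have mid j : piece e (p W) (p (W + j * L)%N).
    elim: j => [|j IH]; first by rewrite mul0n addn0; exact: piece_refl.
    apply: (piece_cat IH); have E : (W + j.+1 * L)%:R = (W + j * L)%:R + L%:R :> R by rewrite mulSnr addnA natrD.
    rewrite /p E; apply: block_piece => //.
    + by rewrite /= gt_eqF.
    + by apply: pjac; exact: leq_addr.
    + by rewrite -E; apply: pjac; exact: leq_addr.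
  have [J _ hJ] := @nat_large R [:: c%:~R * W%:R + d%:~R] 0.
  rewrite -/k -p0; apply: (piece_mix eb (head W) (mid J) (tail _)).
  rewrite p0 farey_len // /p act_diff // natrD natrM [in leRHS]addrAC subrr add0r /jac /=.
  apply: blocks_len => //; first by rewrite ltr0z.
    by rewrite ler_int.
  by apply: hJ; rewrite inE.
- pose k' := ((- b', a), (- d, c)) : zmat.
  have sk' : sl2z k' by move: sk; rewrite /sl2z /= /zdet /=; lia.
  pose p (j : nat) := act k' (- j%:R : R).
  have p0 : p 0%N = rgt k by rewrite /p /act /jac /rgt /= oppr0 !mulr0 !add0r.
  have pj j : piece b (p j.+1) (p j).
    have fk' : farey (zmul k ((1, 1), (j%:Z, j.+1%:Z))) by apply: farey_mul => //; rewrite /sl2z /= /zdet /=; lia.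
    have := hb _ fk'; set k1 := zmul _ _.
    have -> : lft k1 = p j.+1 by rewrite lft_mul /p /act /jac /= ?natz !rmorphN /=; congr (_ / _); ring.
    by have -> : rgt k1 = p j by rewrite rgt_mul /p /act /jac /= ?natz !rmorphN /=; congr (_ / _); ring.
  have tail j : piece b (p j) (p 0%N) by elim: j => [|j IH]; [exact: piece_refl|exact: (piece_cat (pj j) IH)].
  have head j : piece b (lft k) (p j).
    have fk' : farey (zmul k ((1, 0), (j%:Z, 1))) by apply: farey_mul => //; rewrite /sl2z /= /zdet /=; lia.
    have := hb _ fk'; set k1 := zmul _ _.
    have -> : lft k1 = lft k by rewrite lft_mul /lft /= ?natz; congr (_ / _); ring.
    by have -> : rgt k1 = p j by rewrite rgt_mul /p /act /jac /= ?natz !rmorphN /=; congr (_ / _); ring.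
  have dW (j : nat) : 0 <= d%:~R * j%:R :> R by rewrite mulr_ge0 // ler0z ltW.
  have pjac j : (W <= j)%N -> W%:R * `|(- d)%:~R| <= jac k' (- j%:R : R).
    move=> Wj; rewrite /jac /= rmorphN /= normrN ger0_norm ?ler0z ?(ltW d0) // mulrNN mulrC.
    have : d%:~R * W%:R <= d%:~R * j%:R :> R by rewrite ler_wpM2l ?ler_nat // ler0z ltW.
    lra.
  have jpos (j : nat) : jac k' (- j%:R : R) != 0.
    by rewrite gt_eqF // /jac /= rmorphN /= mulrNN; have := dW j; lra.
  have mid j : piece e (p (W + j * L)%N) (p W).
    elim: j => [|j IH]; first by rewrite mul0n addn0; exact: piece_refl.
    apply: (piece_cat _ IH); have E : - (W + j * L)%:R = - (W + j.+1 * L)%:R + L%:R :> R by rewrite mulSn !natrD; ring.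
    rewrite /p E; apply: block_piece => //.
    + by rewrite /= oppr_eq0 gt_eqF.
    + by apply: pjac; exact: leq_addr.
    + by rewrite -E; apply: pjac; exact: leq_addr.
  have [J _ hJ] := @nat_large R [:: d%:~R * W%:R + c%:~R] 0.
  rewrite -/k -p0; apply: (piece_mix eb (head _) (mid J) (tail _)).
  rewrite p0 farey_len // /p act_diff //.
  rewrite (_ : - W%:R - - _ = J%:R * L%:R); last by rewrite natrD natrM; ring.
  rewrite /jac /= rmorphN /= !mulrNN natrD natrM (mulrC (c%:~R)) (mulrC (_ + c%:~R)).
  apply: blocks_len => //; first by rewrite ltr0z.
    by rewrite ler_int ltW.
  by apply: hJ; rewrite inE.
Qed.
End step.

Hypothesis blk : forall e, 0 < e <= 1 -> exists L W : nat, [/\ (0 < L)%N, (0 < W)%N & forall k (w0 : R), sl2z k -> k.2.1 != 0 ->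
  W%:R * `|k.2.1%:~R| <= jac k w0 -> W%:R * `|k.2.1%:~R| <= jac k (w0 + L%:R) ->
  evn (fun n => `|itg (act k w0) (act k (w0 + L%:R)) (F n)| <= e * (act k (w0 + L%:R) - act k w0))].

(** From the trivial bound 2, each step lowers the constant by at least [kap e] as long as it
    exceeds [2 e]. *)
Lemma farey_small e : 0 < e <= 1 -> farey_bound (2 * e).
Proof.
move=> e01; have [L [W [L0 W0 hb]]] := blk e01; case/andP: (e01) => e0 e1.
pose kap := (2 * (W%:R + 1))^-1 : R.
have kap0 : 0 < kap by rewrite invr_gt0 mulr_gt0 // addr_gt0 // ltr0n.
have kap1 : kap <= 1.
  have W1 : 1 <= W%:R :> R by rewrite ler1n.
  by rewrite invf_le1; lra.
have it n : farey_bound (Num.max (2 * e) (2 - n%:R * (kap * e))).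
  elim: n => [|n IH] k fk.
    apply: (piece_le _ (piece2 (farey_le fk))); rewrite mul0r subr0 le_max lexx orbT //.
  have be : e <= Num.max (2 * e) (2 - n%:R * (kap * e)) by rewrite le_max; apply/orP; left; lra.
  have st := farey_step e01 L0 W0 hb be IH fk.
  apply: (piece_le _ st); rewrite -/kap.
  have h1 : 2 * e <= Num.max (2 * e) (2 - n%:R * (kap * e)) by rewrite le_max lexx.
  have h2 : Num.max (2 * e) (2 - n%:R * (kap * e)) <= Num.max (2 * e) (2 - n.+1%:R * (kap * e)) + kap * e.
    have ke : 0 <= kap * e by rewrite mulr_ge0 // ltW.
    have nE : n.+1%:R = n%:R + 1 :> R by rewrite natr1.
    rewrite nE ge_max; apply/andP; split.
      have : 2 * e <= Num.max (2 * e) (2 - (n%:R + 1) * (kap * e)) by rewrite le_max lexx.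
      lra.
    have : 2 - (n%:R + 1) * (kap * e) <= Num.max (2 * e) (2 - (n%:R + 1) * (kap * e)) by rewrite le_max lexx orbT.
    lra.
  move: (Num.max (2 * e) (2 - n%:R * (kap * e))) h1 h2 => x h1 h2.
  have : kap * e <= kap * (x - e) by rewrite ler_pM2l //; lra.
  lra.
have [n _ hn] := @nat_large R [:: 2 / (kap * e)] 0.
have : 2 / (kap * e) <= n%:R by apply: hn; rewrite inE.
rewrite ler_pdivrMr ?mulr_gt0 // => n2 k fk.
by have := it n k fk; rewrite max_l //; lra.
Qed.

(** The arc is cut at the mediant. A full left half is handled by [farey_small], and the half
    containing [x] has a product of denominators larger by at least 1; after [N] cuts the trivial
    bound on an arc, whose length is the inverse of that product, finishes. *)
Lemma farey_initial (N : nat) k x e : farey k -> lft k <= x <= rgt k -> 0 < e ->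
  evn (fun n => `|itg (lft k) x (F n)| <= e + 2 / (k.2.1%:~R * k.2.2%:~R + N%:R)).
Proof.
elim: N k x e => [|N IH] k x e fk /andP[x1 x2] e0.
  exists 0%N => n _; apply: le_trans (itg_bound x1 (bF n) (fun x _ => F2 n x)) _.
  rewrite addr0; have := farey_len fk; lra.
have [sk c0 d0] := fk.
pose k1 := zmul k ((1, 0), (1, 1)); pose k2 := zmul k ((1, 1), (0, 1)).
have fk1 : farey k1 by apply: farey_mul.
have fk2 : farey k2 by apply: farey_mul.
have l1 : lft k1 = lft k by rewrite lft_mul /lft /=; congr (_ / _); ring.
have r2 : rgt k2 = rgt k by rewrite rgt_mul /rgt /=; congr (_ / _); ring.
have m12 : rgt k1 = lft k2 by rewrite rgt_mul lft_mul.
have cR : 1 <= k.2.1%:~R :> R by rewrite -[1]/(1%:~R) ler_int -gtz0_ge1.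
have dR : 1 <= k.2.2%:~R :> R by rewrite -[1]/(1%:~R) ler_int -gtz0_ge1.
have k1E : k1.2.1%:~R * k1.2.2%:~R = k.2.1%:~R * k.2.2%:~R + k.2.2%:~R ^+ 2 :> R.
  by rewrite /k1 /zmul /= !rmorphD !rmorphM /=; ring.
have k2E : k2.2.1%:~R * k2.2.2%:~R = k.2.1%:~R * k.2.2%:~R + k.2.1%:~R ^+ 2 :> R.
  by rewrite /k2 /zmul /= !rmorphD !rmorphM /=; ring.
set c : R := k.2.1%:~R in cR k1E k2E *; set d : R := k.2.2%:~R in dR k1E k2E *.
have cd0 : 0 < c * d by rewrite mulr_gt0 //; lra.
have big (z : R) : 1 <= z -> 2 / (c * d + z ^+ 2 + N%:R) <= 2 / (c * d + N.+1%:R).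
  move=> z1; have z2 : 1 <= z ^+ 2 by rewrite expr_ge1 //; lra.
  have N0 : 0 <= N%:R :> R by [].
  rewrite ler_pM2l // lef_pV2 ?posrE -?natr1; lra.
have [xm|mx] := leP x (rgt k1).
  have := IH k1 x e fk1; rewrite l1 x1 xm => /(_ isT e0); rewrite k1E; apply: evn_imp => n h.
  by apply: le_trans h _; rewrite lerD2l big.
have e20 : 0 < e / 2 by rewrite divr_gt0.
have := IH k2 x (e / 2) fk2; rewrite r2 x2 -m12 (ltW mx) k2E => /(_ isT e20) h2.
pose e' := Num.min 1 (e / 4).
have e'b : 0 < e' <= 1 by rewrite lt_min ltr01 divr_gt0 //= ge_min lexx.
have [h0 h1] := farey_small e'b fk1.
have len : rgt k1 - lft k1 <= 1.
  rewrite farey_len // k1E invf_le1; have : 1 <= d ^+ 2 by rewrite expr_ge1 //; lra.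
    by lra.
  by lra.
have e'4 : e' <= e / 4 by rewrite ge_min lexx orbT.
apply: evn_imp (evn_and h1 h2) => n [i1 i2].
rewrite -l1 (itg_cat (bF n) h0 (ltW mx)).
have i3 : `|itg (lft k1) (rgt k1) (F n)| <= e / 2.
  apply: le_trans i1 _; have : 2 * e' * (rgt k1 - lft k1) <= 2 * e' * 1.
    by rewrite ler_wpM2l //; case/andP: e'b => /ltW; lra.
  lra.
have bc := big c cR; apply: le_trans (ler_normD _ _) _; lra.
Qed.

Lemma farey_zero k x e : farey k -> lft k <= x <= rgt k -> 0 < e -> evn (fun n => `|itg (lft k) x (F n)| <= e).
Proof.
move=> fk xb e0; have e20 : 0 < e / 2 by rewrite divr_gt0.
have [N N1 hN] := nat_large [:: 4 / e] 1.
apply: evn_imp (farey_initial N fk xb e20) => n h; apply: le_trans h _.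
have [_ c0 d0] := fk.
have cd0 : 0 <= k.2.1%:~R * k.2.2%:~R :> R by rewrite mulr_ge0 // ler0z ltW.
have NR : 0 < N%:R :> R by rewrite ltr0n.
have : 4 <= e * N%:R by rewrite -ler_pdivrMl // mulrC; apply: hN; rewrite inE.
move=> eN; suff : 2 / (k.2.1%:~R * k.2.2%:~R + N%:R) <= e / 2 by lra.
rewrite ler_pdivrMr; last by rewrite ltr_wpDl.
have : 0 <= e * (k.2.1%:~R * k.2.2%:~R) by rewrite mulr_ge0 // ltW.
lra.
Qed.

Lemma itg_vanish u v e : u <= v -> 0 < e -> evn (fun n => `|itg u v (F n)| <= e).
Proof.
pose kz (a : int) : zmat := ((a + 1, a), (1, 1)).
have fkz a : farey (kz a) by split => //; rewrite /sl2z /= /zdet /=; ring.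
have lz a : lft (kz a) = a%:~R by rewrite /lft /= divr1.
have rz a : rgt (kz a) = (a + 1)%:~R by rewrite /rgt /= divr1.
have unit (a : int) x d : a%:~R <= x <= (a + 1)%:~R -> 0 < d -> evn (fun n => `|itg a%:~R x (F n)| <= d).
  by move=> xb d0; have := @farey_zero (kz a) x d (fkz a); rewrite lz rz; apply.
have ints (a : int) (m : nat) d : 0 < d -> evn (fun n => `|itg a%:~R (a + m%:Z)%:~R (F n)| <= d).
  elim: m d => [|m IH] d d0.
    rewrite addr0; exists 0%N => n _.
    by apply: le_trans (itg_bound (lexx _) (bF n) (fun x _ => F2 n x)) _; rewrite subrr mulr0 ltW.
  have d20 : 0 < d / 2 by rewrite divr_gt0.
  have h2 : evn (fun n => `|itg (a + m%:Z)%:~R (a + m.+1%:Z)%:~R (F n)| <= d / 2).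
    by apply: unit => //; rewrite -[m.+1]addn1 PoszD addrA lexx andbT ler_int lerDl.
  apply: evn_imp (evn_and (IH _ d20) h2) => n [i1 i2].
  rewrite (@itg_cat _ a%:~R (a + m%:Z)%:~R) //; last 2 first.
  - by rewrite ler_int; lia.
  - by rewrite ler_int; lia.
  by apply: le_trans (ler_normD _ _) _; lra.
have from (a : int) x d : a%:~R <= x -> 0 < d -> evn (fun n => `|itg a%:~R x (F n)| <= d).
  move=> ax d0; have d20 : 0 < d / 2 by rewrite divr_gt0.
  have /andP[f1 f2] := floor_itv x.
  have af : a <= Num.floor x by rewrite floor_ge_int.
  have [m mE] : exists m : nat, Num.floor x = a + m%:Z by exists `|Num.floor x - a|%N; lia.
  have h1 := ints a m _ d20; rewrite -mE in h1.
  have h2 : evn (fun n => `|itg (Num.floor x)%:~R x (F n)| <= d / 2) by apply: unit => //; rewrite f1 ltW.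
  apply: evn_imp (evn_and h1 h2) => n [i1 i2].
  rewrite (@itg_cat _ a%:~R (Num.floor x)%:~R) ?ler_int //.
  by apply: le_trans (ler_normD _ _) _; lra.
move=> uv e0; have e20 : 0 < e / 2 by rewrite divr_gt0.
have /andP[f1 f2] := floor_itv u.
apply: evn_imp (evn_and (from _ _ _ f1 e20) (from _ _ _ (le_trans f1 uv) e20)) => n [i1 i2].
have := itg_cat (bF n) f1 uv; move: (itg _ v _) i2 => I2 i2 E.
have -> : itg u v (F n) = I2 - itg (Num.floor u)%:~R u (F n) by rewrite E; ring.
by apply: le_trans (ler_normB _ _) _; lra.
Qed.
End exhaustion.

Lemma dist_unit (R : realDomainType) (s t : R) : 0 <= s <= 1 -> 0 <= t <= 1 -> `|s - t| <= 1.
Proof. by move=> /andP[? ?] /andP[? ?]; rewrite ler_norml; apply/andP; split; lra. Qed.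

(** * Equidistribution of pairs of horocycles *)

Section equidistribution.
Context {R : realType}.
Local Notation mR := (measurableTypeR R).
Local Notation M := ((mR * mR) * (mR * mR))%type.
Implicit Types (u v e d : R) (g h : M).

Lemma mean_diff (f h : M -> R) e : autom f -> autom h -> (forall g, 0 <= f g) -> (forall g, 0 <= h g) -> 0 <= e ->
  (forall g, detm g = 1 -> f g <= h g + e) -> mean f <= mean h + e.
Proof.
move=> af ah f0 h0 e0 fh; have V0 := @vol_gt0 R.
have -> : mean h + e = (aint h + e * vol) / vol by rewrite /mean mulrDl mulfK // gt_eqF.
rewrite /mean ler_pM2r ?invr_gt0 // -aint_cst // -aintD //; last exact: autom_cst.
apply: le_aint => //; first by apply: automD => //; exact: autom_cst.
by move=> g; rewrite addr_ge0.
Qed.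

Context (Psi : M -> M -> R).
Hypotheses (iP : inv2 Psi) (uP : ucont2 Psi) (P01 : forall g h, 0 <= Psi g h <= 1)
  (mP : measurable_fun setT (fun p : M * M => Psi p.1 p.2)).

Let P1 g h : `|Psi g h| <= 1.
Proof. by have /andP[? ?] := P01 g h; rewrite ger0_norm. Qed.

Lemma autom_slice g : detm g = 1 -> autom (Psi g).
Proof.
move=> Dg; split; [|by exists 1|by move=> k h sk Dh; case: iP => _ i2; exact: i2].
by apply: (mcomp mP (f := fun h => (g, h))); apply: mpair; [exact: mcst|exact: mid].
Qed.

Lemma ucont_slice g : detm g = 1 -> ucont (Psi g).
Proof.
move=> Dg e e0; have [d d0 hd] := ucont2_r uP e0; exists d => // h k Dh Dk nk.
by apply: hd.
Qed.

Let P0 g h : 0 <= Psi g h. Proof. by case/andP: (P01 g h). Qed.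

Lemma mean_slice_near e : 0 < e -> exists2 d, 0 < d & forall g k, detm g = 1 -> detm k = 1 -> nearm d k ->
  (forall h, detm h = 1 -> `|Psi (mulm g k) h - Psi g h| <= e) /\ `|mean (Psi (mulm g k)) - mean (Psi g)| <= e.
Proof.
move=> e0; have [d d0 hd] := uP e0; exists d => // g k Dg Dk nk.
have pt h : detm h = 1 -> `|Psi (mulm g k) h - Psi g h| <= e.
  by move=> Dh; have := hd g h k idm Dg Dh Dk detm_idm nk (nearm_id (ltW d0)); rewrite mulm1.
have Dgk : detm (mulm g k) = 1 by rewrite detm_mul Dg Dk mulr1.
have ag := autom_slice Dg; have agk := autom_slice Dgk.
split => //; rewrite ler_norml; apply/andP; split.
  rewrite lerBrDl lerBlDr; apply: mean_diff => //; first exact: ltW.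
  by move=> h Dh; have := pt h Dh; rewrite ler_norml => /andP[? _]; lra.
rewrite lerBlDl; apply: mean_diff => //; first exact: ltW.
by move=> h Dh; have := pt h Dh; rewrite ler_norml => /andP[_ ?]; lra.
Qed.

(** Stated for every matrix [g], since the boundedness in [autom] ranges over all matrices. *)
Lemma mean01 g : 0 <= mean (Psi g) <= 1.
Proof.
have V0 := @vol_gt0 R.
have mg : measurable_fun setT (Psi g : M -> R).
  by apply: (mcomp mP (f := fun h => (g, h))); apply: mpair; [exact: mcst|exact: mid].
have le1 : (gint (Psi g) <= gint (fun=> 1%R))%E.
  by apply: le_gint => //; move=> h _; case/andP: (P01 g h).
have fin1 : gint (fun=> 1 : R) \is a fin_num by apply: gint_fin => //; exact: autom_cst.
have fing : gint (Psi g) \is a fin_num.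
  by rewrite ge0_fin_numE ?gint_ge0 // (le_lt_trans le1) // -ge0_fin_numE // gint_ge0.
rewrite /mean divr_ge0 ?aint_ge0 ?(ltW V0) //= ler_pdivrMr // mul1r.
exact: fine_le.
Qed.

Lemma autom_mean : autom (fun g => mean (Psi g)).
Proof.
split.
- rewrite /mean /aint; apply: mM; last exact: mcst.
  have mh : measurable_fun setT (fun g => gint (Psi g)).
    apply: (@measurable_haar _ (fun p : M * M => (Psi p.1 p.2 * (reduced p.2)%:R)%:E)).
      apply: mE; apply: mM => //; apply: (mcomp (measurable_bool measurable_reduced)); exact: msnd.
    by move=> p; rewrite lee_fin mulr_ge0.
  exact: (mcomp (@fine_measurable R setT measurableT) mh).
- by exists 1 => g; have /andP[m0 m1] := mean01 g; rewrite ger0_norm.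
move=> k g sk Dg.
have Dkg : detm (mulm (zr k) g) = 1 by rewrite detm_mul detm_zr // Dg mulr1.
have le g1 g2 : detm g1 = 1 -> detm g2 = 1 -> (forall h, detm h = 1 -> Psi g1 h = Psi g2 h) -> mean (Psi g1) <= mean (Psi g2).
  move=> D1 D2 E; rewrite -[leRHS]addr0; apply: mean_diff => //; try exact: autom_slice.
  by move=> h Dh; rewrite E // addr0.
have i1 : forall h, detm h = 1 -> Psi (mulm (zr k) g) h = Psi g h by move=> h Dh; case: iP => i1 _; exact: i1.
by apply/le_anti; rewrite !le // => h Dh; rewrite i1.
Qed.

Lemma ucont_mean : ucont (fun g => mean (Psi g)).
Proof.
by move=> e e0; have [d d0 hd] := mean_slice_near e0; exists d => // g k Dg Dk nk; have [] := hd g k Dg Dk nk.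
Qed.

(** Invariance moves [g] to a bounded matrix; these fall into finitely many cells, and slices over
    one cell are uniformly close. *)
Lemma slice_net C e : 0 < C -> 0 < e -> exists2 zs : seq M, forall z, z \in zs -> detm z = 1 & forall g, detm g = 1 -> thick C g ->
  exists2 z, z \in zs & (forall h, detm h = 1 -> `|Psi g h - Psi z h| <= e) /\ `|mean (Psi g) - mean (Psi z)| <= e.
Proof.
move=> C0 e0; have [d d0 hd] := mean_slice_near e0.
have [q [cell hcell]] := quantize C0 d0.
have /choice[zf hz] (c : ('I_q.+1 * 'I_q.+1) * ('I_q.+1 * 'I_q.+1)) : exists z : M, detm z = 1 /\
    ((exists K : M, [/\ detm K = 1, mbound C K & cell K = c]) -> mbound C z /\ cell z = c).
  have [[K [h1 h2 h3]]|no] := pselect (exists K : M, [/\ detm K = 1, mbound C K & cell K = c]); first by exists K.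
  by exists idm; split => //; exact: detm_idm.
exists [seq zf c | c <- enum {: ('I_q.+1 * 'I_q.+1) * ('I_q.+1 * 'I_q.+1)}].
  by move=> z /mapP[c _ ->]; case: (hz c).
move=> g Dg [k sk bk]; pose K := mulm (zr k) g.
have DK : detm K = 1 by rewrite detm_mul detm_zr // Dg mulr1.
pose z := zf (cell K).
have [Dz /(_ (ex_intro _ K (And3 DK bk erefl)))[bz cz]] := hz (cell K).
exists z; first by apply/mapP; exists (cell K) => //; rewrite mem_enum.
have nl : nearm d (mulm (invm z) K).
  have [c1 c2 c3 c4] := hcell z K Dz bz bk cz.
  by apply/and4P; split => //; rewrite -[_.1.2]subr0.
have Dl : detm (mulm (invm z) K) = 1 by rewrite detm_mul detm_inv Dz DK mulr1.
have := hd z (mulm (invm z) K) Dz Dl nl; rewrite (mulmK _ Dz) => -[h1 h2].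
have KE h : detm h = 1 -> Psi K h = Psi g h by move=> Dh; case: iP => i1 _; exact: i1.
split; first by move=> h Dh; rewrite -KE //; exact: h1.
have [_ _ inv] := autom_mean.
by rewrite -(inv k g sk Dg).
Qed.

Lemma avg_list b (zs : seq M) e : 0 <= b -> 0 < e -> (forall z, z \in zs -> detm z = 1) ->
  exists2 N0 : nat, (0 < N0)%N & forall N, (N0 <= N)%N -> exists2 T0 : R, 1 <= T0 &
  forall z, z \in zs -> forall T u v, T0 <= T -> - b <= u -> u <= v -> v <= b ->
    itg u v (fun x => `|avg (Psi z) N (hor T x) - mean (Psi z)|) <= e.
Proof.
move=> b0 e0; elim: zs => [_|z zs IH hz]; first by exists 1%N => // N _; exists 1.
have Dz : detm z = 1 by apply: hz; rewrite inE eqxx.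
have hz' : forall z', z' \in zs -> detm z' = 1 by move=> z' zz; apply: hz; rewrite inE zz orbT.
have [N1 N10 h1] := IH hz'.
have [N2 N20 h2] := horo_avg (autom_slice Dz) (ucont_slice Dz) (P01 z) b0 e0.
exists (maxn N1 N2) => [|N]; first by rewrite leq_max N10.
rewrite geq_max => /andP[/h1[T1 T11 g1] /h2[T2 T21 g2]].
exists (Num.max T1 T2) => [|z']; first by rewrite le_max T11.
rewrite inE => /predU1P[->|zz] T u v; rewrite ge_max => /andP[t1 t2] *; [exact: g2|exact: g1].
Qed.

Lemma bmeas_obs T y b : bmeas (obs_at Psi T y b).
Proof.
split; last by exists 1 => x; exact: P1.
have mh : measurable_fun setT (fun x : mR => (hor T x, mulm (hor T (y * x)) (upm b)) : M * M).
  apply: mpair; first exact: measurable_hor.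
  rewrite /mulm /hor /upm /diagm /mulm /=; mfun.
exact: (mcomp mP mh).
Qed.

Lemma avg_diff (f h : M -> R) N g e : 0 <= e -> detm g = 1 -> (forall g', detm g' = 1 -> `|f g' - h g'| <= e) ->
  `|avg f N g - avg h N g| <= e.
Proof.
move=> e0 Dg fh; rewrite /avg -mulrBr -sumrB normrM ger0_norm ?invr_ge0 //.
have [->|N0] := posnP N; first by rewrite big_ord0 normr0 mulr0.
rewrite mulrC ler_pdivrMr ?ltr0n //; apply: le_trans (ler_norm_sum _ _ _) _.
apply: le_trans (ler_sum _ (G := fun=> e) _) _ => [i _|]; last by rewrite sumr_const card_ord mulr_natr.
by apply: fh; rewrite detm_mul Dg detm_upm mulr1.
Qed.

Lemma itg_sum_seq (I : eqType) (r : seq I) u v (F : I -> mR -> R) : (forall i, bmeas (F i)) ->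
  bmeas (fun x => \sum_(i <- r) F i x) /\ itg u v (fun x => \sum_(i <- r) F i x) = \sum_(i <- r) itg u v (F i).
Proof.
move=> bF; elim: r => [|i r [IH1 IH2]].
  have -> : (fun x => \sum_(i <- [::]) F i x) = (fun=> 0) :> (mR -> R) by apply/funext => x; rewrite big_nil.
  rewrite big_nil; split; first exact: bmeas_cst.
  have := itgZ u v 0 (bmeas_cst 0 : bmeas (fun=> 0 : R)).
  by rewrite !mul0r => ->.
have -> : (fun x => \sum_(j <- i :: r) F j x) = (fun x => F i x + \sum_(j <- r) F j x) :> (mR -> R).
  by apply/funext => x; rewrite big_cons.
by rewrite big_cons; split; [exact: bmeasD|rewrite itgD // IH2].
Qed.

(* One averages the second variable along the horocycle; for a fixed first variable this is close to its mean in L^1. *)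
Lemma avg_close u v e : u <= v -> 0 < e -> exists2 N : nat, (0 < N)%N & exists T0 : R, forall T y, T0 <= T -> 1 <= y <= 2 ->
  `|itg u v (fun x => avg (Psi (hor T x)) N (hor T (y * x))) - (v - u) * mean (fun g => mean (Psi g))| <= e.
Proof.
move=> uv e0; pose l := v - u; have l0 : 0 <= l by rewrite subr_ge0.
pose e1 := e / (8 * (l + 1)).
have l1 : 0 < l + 1 by lra.
have e10 : 0 < e1 by rewrite divr_gt0 // mulr_gt0.
have eE : 8 * (e1 * l) + 8 * e1 = e by rewrite /e1; field; rewrite gt_eqF.
clearbody e1.
have [C C0 [f [af uf f01 fm fth]]] := @cusp_function R e1 e10.
have [zs Dzs hzs] := slice_net C0 e10.
pose b := 2 * (`|u| + `|v|).
have b0 : 0 <= b by rewrite mulr_ge0 // addr_ge0.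
pose e2 := e1 / ((size zs).+1%:R).
have e20 : 0 < e2 by rewrite divr_gt0 // ltr0n.
have [N N0 hN] := avg_list b0 e20 Dzs.
have [T1 T11 h1] := hN N (leqnn N).
have [T2 T21 h2] := horo_equi af uf f01 b0 e10.
have am := autom_mean; have um := ucont_mean.
have [T3 T31 h3] := horo_equi am um mean01 b0 e10.
exists N => //; exists (Num.max T1 (Num.max T2 T3)) => T y; rewrite !ge_max => /and3P[t1 t2 t3] yb.
have y0 : 0 < y by case/andP: yb; lra.
have y2 : `|y| <= 2 by case/andP: yb => _ h; rewrite ger0_norm // ltW.
have y1 : y^-1 <= 1 by rewrite invf_le1 //; case/andP: yb.
have T0 : 0 < T by lra.
have inb w : `|w| <= `|u| + `|v| -> - b <= w <= b.
  by move=> h; rewrite -ler_norml; apply: le_trans h _; rewrite /b ler_peMl ?addr_ge0 //; lra.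
have inyb w : `|w| <= `|u| + `|v| -> - b <= y * w <= b.
  by move=> h; rewrite -ler_norml normrM; apply: ler_pM.
have nu : `|u| <= `|u| + `|v| by rewrite lerDl.
have nv : `|v| <= `|u| + `|v| by rewrite lerDr.
have /andP[u1 _] := inb u nu; have /andP[_ v1] := inb v nv.
have /andP[yu1 _] := inyb u nu; have /andP[_ yv1] := inyb v nv.
pose A x := avg (Psi (hor T x)) N (hor T (y * x)).
pose m x := mean (Psi (hor T x)).
have bA : bmeas A.
  by apply: bmeasZ; apply: (@bmeas_sum _ N (fun i => obs_at Psi T y i%:R)) => i; exact: bmeas_obs.
have bm : bmeas m := bmeas_hor T am.
have bf : bmeas (fun x => f (hor T x)) := bmeas_hor T af.
have bz z c : bmeas (fun x => `|avg (Psi z) N (hor T x) - c|).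
  apply: bmeas_norm; apply: bmeasB; last exact: bmeas_cst.
  apply: bmeasZ; apply: (@bmeas_sum _ N (fun i x => Psi z (mulm (hor T x) (upm i%:R)))) => i.
  split; last by exists 1 => x; exact: P1.
  apply: (mcomp mP (f := fun x => (z, mulm (hor T x) (upm i%:R)))); apply: mpair; first exact: mcst.
  by apply: (mcomp (measurable_mulmr _)); exact: measurable_hor.
pose Fz z x := `|avg (Psi z) N (hor T (y * x)) - mean (Psi z)|.
have my : measurable_fun setT (fun x : mR => y * x : mR) by mfun.
have bFz z : bmeas (Fz z) by exact: (bmeas_comp (bz z (mean (Psi z))) my).
have [bS SE] := itg_sum_seq zs u v bFz.
have Fle z : z \in zs -> itg u v (Fz z) <= e2.
  move=> zz; rewrite (itg_scale y0 (bz z (mean (Psi z))) uv) mulrC.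
  have yuv : y * u <= y * v by rewrite ler_pM2l.
  have g1 := h1 z zz T _ _ t1 yu1 yuv yv1.
  rewrite ler_pdivrMr //; apply: le_trans g1 _; rewrite ler_peMr ?(ltW e20) //; case/andP: yb => //.
have Sle : \sum_(z <- zs) itg u v (Fz z) <= e1.
  rewrite big_seq; apply: le_trans (ler_sum _ Fle) _.
  rewrite -big_seq big_const_seq count_predT iter_addr_0 -[_ *+ size zs]mulr_natr /e2 mulrAC ler_pdivrMr ?ltr0n //.
  by rewrite ler_pM2l // ler_nat.
have fle : itg u v (fun x => f (hor T x)) <= e1 * l + e1.
  have := h2 T u v t2 u1 uv v1; rewrite ler_norml => /andP[_]; rewrite -/l lerBlDl => h; apply: le_trans h _.
  by rewrite lerD2r mulrC ler_wpM2r.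
have mle := h3 T u v t3 u1 uv v1; rewrite -/l in mle.
have pt x : u <= x <= v -> `|A x - m x| <= f (hor T x) + \sum_(z <- zs) Fz z x + 2 * e1.
  move=> _; have Dh := @detm_hor R T x T0; have Dh' := @detm_hor R T (y * x) T0.
  have S0 : 0 <= \sum_(z <- zs) Fz z x by apply: sumr_ge0 => z _; exact: normr_ge0.
  have /andP[f0 _] := f01 (hor T x).
  (* In the thick part the slice is replaced by one of the net, whose error is a term of the sum; in
     the cusp the value [f = 1] pays for the trivial bound 1. *)
  have [th|nth] := pselect (thick C (hor T x)).
    have [z zz [k1 k2]] := hzs _ Dh th.
    have a1 : `|A x - avg (Psi z) N (hor T (y * x))| <= e1 by apply: avg_diff => //; exact: ltW.
    have a2 : Fz z x <= \sum_(z <- zs) Fz z x.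
      rewrite (big_rem z zz) /= lerDl; apply: sumr_ge0 => z' _; exact: normr_ge0.
    rewrite (_ : A x - m x = (A x - avg (Psi z) N (hor T (y * x))) + (avg (Psi z) N (hor T (y * x)) - mean (Psi z)) - (m x - mean (Psi z))); last by ring.
    apply: le_trans (ler_normB _ _) _; apply: le_trans (lerD (ler_normD _ _) (lexx _)) _.
    by move: a2 k2; rewrite /Fz -/(m x) => a2 k2; clear -a1 a2 k2 f0; lra.
  rewrite (fth _ Dh nth).
  have A01 : 0 <= A x <= 1.
    have NR : 0 < N%:R :> R by rewrite ltr0n.
    rewrite /A /avg mulr_ge0 ?invr_ge0 ?sumr_ge0 //= mulrC ler_pdivrMr // mul1r.
    apply: le_trans (ler_sum _ (G := fun=> 1) _) _ => [i _|]; last by rewrite sumr_const card_ord.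
    by case/andP: (P01 (hor T x) (mulm (hor T (y * x)) (upm i%:R))).
  have m01 := mean01 (hor T x); rewrite -/(m x) in m01.
  have n1 : `|A x - m x| <= 1 by exact: dist_unit.
  by clear -n1 S0 e10; lra.
have AB : `|itg u v A - itg u v m| <= 3 * (e1 * l) + 2 * e1.
  rewrite -itgB //; apply: le_trans (itg_norm _ _ _) _; first exact: bmeasB.
  have bfS := bmeasD bf bS; have b2 := bmeas_cst (2 * e1).
  apply: le_trans (le_itg _ (bmeasD bfS b2) pt) _; first by apply: bmeas_norm; exact: bmeasB.
  rewrite (itgD _ _ bfS b2) (itgD _ _ bf bS) SE itg_cst // -/l.
  clear -fle Sle; lra.
rewrite -/A -/l; move: AB mle; rewrite -/m; move: (itg u v A) (itg u v m) (l * _) => I J K AB mle.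
rewrite (_ : I - K = (I - J) + (J - K)); last by ring.
apply: le_trans (ler_normD _ _) _; have : 0 <= e1 * l by rewrite mulr_ge0 // ltW.
clear -AB mle eE e10; lra.
Qed.
End equidistribution.

(** * The limit along the given sequence *)

Section limit.
Context {R : realType}.
Local Notation mR := (measurableTypeR R).
Local Notation M := ((mR * mR) * (mR * mR))%type.
Implicit Types (u v e d : R) (g h : M).

Lemma inv2_shift (Psi : M -> M -> R) (b : R) : inv2 Psi -> inv2 (fun g h => Psi g (mulm h (upm b))).
Proof.
move=> [i1 i2]; split => k g h sk Dg Dh; first by apply: i1 => //; rewrite detm_mul Dh detm_upm mulr1.
have -> : mulm (mulm (zr k) h) (upm b) = mulm (zr k) (mulm h (upm b)) by rewrite mulmA.
by apply: i2 => //; rewrite detm_mul Dh detm_upm mulr1.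
Qed.

Lemma ucont2_shift (Psi : M -> M -> R) (b : R) : ucont2 Psi -> ucont2 (fun g h => Psi g (mulm h (upm b))).
Proof.
move=> uP e e0; have [d d0 hd] := uP e e0.
have Db : detm (upm b : M) = 1 := detm_upm b.
have [C C0 hC] := nearm_conj Db.
exists (Num.min d (d / C)) => [|g h k l Dg Dh Dk Dl nk nl]; first by rewrite lt_min d0 divr_gt0.
have -> : mulm (mulm h l) (upm b) = mulm (mulm h (upm b)) (mulm (invm (upm b)) (mulm l (upm b))).
  by rewrite -[RHS]mulmA (mulmA (upm b) (invm (upm b)) (mulm l (upm b))) mulmV // mul1m [RHS]mulmA.
apply: hd => //.
- by rewrite detm_mul Dh Db mulr1.
- by rewrite !detm_mul detm_inv Db Dl !mulr1.
- by apply: nearm_le nk; rewrite ge_min lexx.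
have m0 : 0 <= Num.min d (d / C) by rewrite le_min !(ltW, divr_gt0).
apply: nearm_le (hC _ _ m0 nl); rewrite mulrC -ler_pdivlMr // ge_min lexx orbT //.
Qed.

Context (Psi : M -> M -> R) (T y : nat -> R).
Hypotheses (iP : inv2 Psi) (uP : ucont2 Psi) (P01 : forall g h, 0 <= Psi g h <= 1)
  (mP : measurable_fun setT (fun p : M * M => Psi p.1 p.2))
  (y12 : forall n, 1 <= y n <= 2) (Tinf : forall B, evn (fun n => B <= T n))
  (nr : forall K B, evn (fun n => nonres K B (T n) (y n))).

(** The shift by [b] is absorbed into the function, which leaves the shift from 0 to 1 treated by
    [block]. *)
Lemma obs_step b u v e : u <= v -> 0 < e ->
  evn (fun n => `|itg u v (obs_at Psi (T n) (y n) (b + 1)) - itg u v (obs_at Psi (T n) (y n) b)| <= e).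
Proof.
move=> uv e0; pose Q g h := Psi g (mulm h (upm b)).
have QE (t t' : R) b' : obs_at Q t t' b' = obs_at Psi t t' (b + b').
  by apply/funext => x; rewrite /obs_at /Q -mulmA upm_mul addrC.
have mb t t' b' : bmeas (obs_at Psi t t' b') by exact: bmeas_obs.
have mQ t t' b' : bmeas (obs_at Q t t' b') by rewrite QE.
have Q1 g h : `|Q g h| <= 1 by rewrite /Q; have /andP[? ?] := P01 g (mulm h (upm b)); rewrite ger0_norm.
pose F n x := obs_at Q (T n) (y n) 1 x - obs_at Q (T n) (y n) 0 x.
have bF n : bmeas (F n) by apply: bmeasB.
have F2 n x : `|F n x| <= 2.
  by apply: le_trans (ler_normB _ _) _; rewrite (_ : 2 = 1 + 1) //; apply: lerD; exact: Q1.
apply: evn_imp (itg_vanish bF F2 _ uv e0) => [n|e' e'01]; first by rewrite /F itgB // !QE addr0.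
have [L [W [L0 W0 h]]] := block (inv2_shift b iP) (ucont2_shift b uP) Q1 mQ e'01.
exists L, W; split => // k w0 sk ck h1 h2; have [T0 [K [B hh]]] := h k w0 sk ck h1 h2.
by apply: evn_imp (evn_and (Tinf T0) (nr K B)) => n [t1 t2]; exact: hh.
Qed.

Lemma obs_shift k u v e : u <= v -> 0 < e ->
  evn (fun n => `|itg u v (obs_at Psi (T n) (y n) k%:R) - itg u v (obs_at Psi (T n) (y n) 0)| <= e).
Proof.
move=> uv; elim: k e => [|k IH] e e0; first by exists 0%N => n _; rewrite subrr normr0 ltW.
have e20 : 0 < e / 2 by rewrite divr_gt0.
apply: evn_imp (evn_and (IH _ e20) (obs_step k%:R uv e20)) => n.
have -> : k.+1%:R = k%:R + 1 :> R by rewrite natr1.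
move: (itg _ _ _) (itg _ _ _) (itg _ _ _) => I J K [h1 h2].
rewrite (_ : I - J = (K - J) + (I - K)); last by ring.
by apply: le_trans (ler_normD _ _) _; lra.
Qed.

Lemma obs_equi u v e : u <= v -> 0 < e ->
  evn (fun n => `|itg u v (obs_at Psi (T n) (y n) 0) - (v - u) * mean (fun g => mean (Psi g))| <= e).
Proof.
move=> uv e0; have e20 : 0 < e / 2 by rewrite divr_gt0.
have [N N0 [T0 h]] := avg_close iP uP P01 mP uv e20.
have NR : 0 < N%:R :> R by rewrite ltr0n.
have ev m : evn (fun n => forall k, (k < m)%N -> `|itg u v (obs_at Psi (T n) (y n) k%:R) - itg u v (obs_at Psi (T n) (y n) 0)| <= e / 2).
  elim: m => [|m IH]; first by exists 0%N.
  apply: evn_imp (evn_and IH (obs_shift m uv e20)) => n [h1 h2] k.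
  by rewrite ltnS leq_eqVlt => /predU1P[->|]; [exact: h2|exact: h1].
apply: evn_imp (evn_and (Tinf T0) (ev N)) => n [t0 hk].
have := h _ _ t0 (y12 n).
have -> : (fun x => avg (Psi (hor (T n) x)) N (hor (T n) (y n * x))) = (fun x => N%:R^-1 * \sum_(i < N) obs_at Psi (T n) (y n) i%:R x) by [].
have mb t t' b' : bmeas (obs_at Psi t t' b') by exact: bmeas_obs.
rewrite itgZ; last exact: (@bmeas_sum _ N (fun i => obs_at Psi (T n) (y n) i%:R)).
rewrite (@itg_sum _ N u v (fun i => obs_at Psi (T n) (y n) i%:R)) //.
set m := (v - u) * _; set I0 := itg _ _ (obs_at _ _ _ 0); move=> h1.
have h2 : `|N%:R^-1 * \sum_(i < N) itg u v (obs_at Psi (T n) (y n) i%:R) - I0| <= e / 2.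
  have -> : I0 = N%:R^-1 * \sum_(i < N) I0 by rewrite sumr_const card_ord -[X in _ = _ * X]mulr_natl mulrA mulVf ?mul1r // gt_eqF.
  rewrite -mulrBr -sumrB normrM ger0_norm ?invr_ge0 ?(ltW NR) // mulrC ler_pdivrMr //.
  apply: le_trans (ler_norm_sum _ _ _) _.
  by apply: le_trans (ler_sum _ (G := fun=> e / 2) _) _ => [i _|]; [exact: hk|rewrite sumr_const card_ord mulr_natr].
move: h1 h2; move: (N%:R^-1 * _) => A h1 h2.
rewrite (_ : I0 - m = (A - m) - (A - I0)); last by ring.
by apply: le_trans (ler_normB _ _) _; lra.
Qed.

End limit.

(** * Nonresonance from the rational approximation *)

Section nonresonance.
Context {R : realType}.
Context (C : R) (T y : nat -> R) (a q : nat -> nat).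
Hypotheses (T1 : forall n, 1 < T n) (q0 : forall n, (0 < q n)%N) (aq : forall n, coprime (a n) (q n))
  (qQ : forall n, (q n)%:R <= T n `^ (99 / 100))
  (ya : forall n, `|y n - (a n)%:R / (q n)%:R| <= C * (1 / ((q n)%:R * T n `^ (99 / 100))))
  (Tinf : forall B, evn (fun n => B <= T n)) (qinf : forall B : R, evn (fun n => B <= (q n)%:R)).

(* For [0 < |j| < q] the fraction [j a / q] is not an integer, hence at distance at least [1/q] from the integers. *)
Lemma nonres_approx K B : evn (fun n => nonres K B (T n) (y n)).
Proof.
pose K' := Num.max K 0.
have C0 : 0 <= C.
  have := le_trans (normr_ge0 _) (ya 0%N); rewrite pmulr_lge0 // divr_gt0 // mulr_gt0 ?ltr0n // powR_gt0 //.
  exact: lt_trans (T1 0%N).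
have K0 : 0 <= K' by rewrite le_max lexx orbT.
pose D := 2 * (`|B| + 1); have D0 : 0 < D by rewrite mulr_gt0 // ltr_wpDl.
have TQ n : 0 < T n `^ (99 / 100) by rewrite powR_gt0 // (lt_trans _ (T1 n)).
(* [T] exceeds [Q] by a factor tending to infinity, so a constant lower bound for [Q |j y - m|] is
   enough. *)
have TT n : T n = T n `^ (99 / 100) * T n `^ (1 / 100).
  rewrite -powRD; last by apply/implyP => _; rewrite gt_eqF // (lt_trans _ (T1 n)).
  by rewrite (_ : 99 / 100 + 1 / 100 = 1 :> R) ?powRr1 // ?(ltW (lt_trans _ (T1 n))) //; field.
have e1 : evn (fun n => D <= T n `^ (1 / 100)).
  apply: evn_imp (Tinf (D `^ 100)) => n h.
  have -> : D = (D `^ 100) `^ (1 / 100) by rewrite -powRrM (_ : 100 * (1 / 100) = 1) ?powRr1 ?(ltW D0) //; field.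
  by apply: ge0_ler_powR => //; rewrite ?nnegrE ?powR_ge0 // (le_trans _ h) ?powR_ge0.
have e2 : evn (fun n => 2 * K' * C <= T n `^ (99 / 100)).
  apply: evn_imp (qinf (2 * K' * C)) => n h; exact: le_trans (qQ n).
apply: evn_imp (evn_and (qinf (K' + 1)) (evn_and e1 e2)) => n [q1 [t1 t2]] j m j0 jK.
have qR : 0 < (q n)%:R :> R by rewrite ltr0n.
have jK' : `|j%:~R| <= K' by rewrite le_max jK.
have num : j * Posz (a n) - m * Posz (q n) != 0.
  apply/eqP => /eqP; rewrite subr_eq0 => /eqP jm.
  have : (q n %| `|j|%N)%N.
    have : (Posz (q n) %| j * Posz (a n))%Z by rewrite jm dvdz_mull.
    by rewrite dvdzE abszM /= Gauss_dvdl // coprime_sym.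
  move=> /dvdn_leq; rewrite absz_gt0 => /(_ j0); rewrite -(ler_nat R) => qj.
  have : `|j%:~R| = `|j|%N%:R :> R by rewrite -intr_norm -abszE.
  lra.
have num1 : 1 <= `|j%:~R * (a n)%:R - m%:~R * (q n)%:R| :> R.
  have -> : j%:~R * (a n)%:R - m%:~R * (q n)%:R = (j * Posz (a n) - m * Posz (q n))%:~R :> R.
    by rewrite rmorphB /= !rmorphM.
  by rewrite -intr_norm -[1]/(1%:~R) ler_int -gtz0_ge1 normr_gt0.
pose S := T n `^ (99 / 100); pose del := y n - (a n)%:R / (q n)%:R.
have S0 : 0 < S := TQ n.
have sm : `|j%:~R * ((q n)%:R * del)| <= 1 / 2.
  rewrite !normrM (ger0_norm (ltW qR)).
  have d1 : (q n)%:R * `|del| <= C / S.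
    rewrite mulrC -ler_pdivlMr //; apply: le_trans (ya n) _; rewrite -/S le_eqVlt; apply/orP; left; apply/eqP.
    by field; rewrite !gt_eqF.
  apply: le_trans (ler_pM (normr_ge0 _) _ jK' d1) _; first by rewrite mulr_ge0 // ltW.
  by rewrite mulrA ler_pdivrMr //; move: t2; rewrite -/S; lra.
have E : (q n)%:R * (j%:~R * y n - m%:~R) = (j%:~R * (a n)%:R - m%:~R * (q n)%:R) + j%:~R * ((q n)%:R * del) :> R.
  by rewrite /del; field; rewrite gt_eqF.
have lo : 1 / 2 <= (q n)%:R * `|j%:~R * y n - m%:~R|.
  rewrite -[(q n)%:R in leRHS](ger0_norm (ltW qR)) -(normrM (q n)%:R) E.
  by have := lerB_normD (j%:~R * (a n)%:R - m%:~R * (q n)%:R) (j%:~R * ((q n)%:R * del)); lra.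
have lo' : 1 / 2 <= S * `|j%:~R * y n - m%:~R|.
  by apply: le_trans lo _; rewrite ler_wpM2r // qQ.
rewrite TT -/S mulrAC; apply: (@lt_le_trans _ _ (1 / 2 * D)).
  by have := ler_norm B; rewrite /D; lra.
by apply: ler_pM => //; rewrite ltW.
Qed.
End nonresonance.

(** * The modular measure in Haar coordinates *)

Section radial.
Context {R : realType}.
Local Notation mR := (measurableTypeR R).
Local Notation leb := (@lebesgue_measure R).
Local Open Scope ereal_scope.

Lemma integral_mrestr d (T : measurableType d) (m : {measure set T -> \bar R}) (D : set T) (mD : measurable D)
    (f : T -> \bar R) : measurable_fun setT f -> (forall x, 0 <= f x) ->
  \int[mrestr m mD]_x f x = \int[m]_(x in D) f x.
Proof.
move=> mf f0.
have mC : measurable (~` D) by exact: measurableC.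
rewrite -[X in \int[_]_(x in X) _](setUv D) ge0_integral_setU //; last 2 first.
- by rewrite setUv.
- by apply/disj_setPCl.
rewrite [X in _ + X]null_set_integral ?adde0 //; last 2 first.
- exact: measurable_funS mf.
- by rewrite [LHS](_ : _ = m (~` D `&` D)) // setICl measure0.
by apply: eq_measure_integral => A mA AD; exact: (congr1 m (setIidl AD)).
Qed.

Let leb2 : {sigma_finite_measure set (mR * mR)%type -> \bar R} := prod_measure leb leb.

Let tonelli1 (f : mR * mR -> \bar R) : measurable_fun setT f -> (forall p, 0 <= f p) ->
  \int[leb2]_p f p = \int[leb]_x \int[leb]_y f (x, y).
Proof. by move=> mf f0; rewrite /leb2 /= /prod_measure fubini_tonelli1. Qed.

Let disc (r : R) : set (mR * mR) := [set p | p.1 ^+ 2 + p.2 ^+ 2 < r]%R.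

Let mdisc_fun : measurable_fun setT (fun p : mR * mR => p.1 ^+ 2 + p.2 ^+ 2)%R.
Proof. mfun. Qed.

Let mlt d (T : measurableType d) (f g : T -> R) : measurable_fun setT f -> measurable_fun setT g ->
  measurable [set x | f x < g x]%R.
Proof.
move=> mf mg; have := measurable_fun_ltr mf mg; move/(_ measurableT [set true] I).
by rewrite setTI.
Qed.

Let mdisc r : measurable (disc r).
Proof. by apply: mlt => //; exact: mcst. Qed.

Let meas_ind d (T : measurableType d) (m : {measure set T -> \bar R}) (A : set T) : measurable A ->
  m A = \int[m]_x (\1_A x)%:E.
Proof. by move=> mA; rewrite integral_indic // setIT. Qed.

Let disc_scale (t : R) : (0 < t)%R -> leb2 (disc (t ^+ 2)) = (t ^+ 2)%:E * leb2 (disc 1).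
Proof.
move=> t0; rewrite !meas_ind //.
have mind r : measurable_fun setT (fun p => (\1_(disc r) p)%:E : \bar R) by apply: mE; exact: measurable_indic.
have ind0 r p : 0 <= (\1_(disc r) p)%:E :> \bar R by rewrite lee_fin.
rewrite !tonelli1 //.
have m2 r c : measurable_fun setT (fun d : mR => (\1_(disc r) (c, d))%:E : \bar R).
  by apply: (mcomp (mind r)); mfun.
have mF r : measurable_fun setT (fun c : mR => \int[leb]_d (\1_(disc r) (c, d))%:E : \bar R).
  exact: (measurable_fun_fubini_tonelli_F (m2 := leb) _ (mind r) (ind0 r)).
have F0 r (c : mR) : 0 <= \int[leb]_d (\1_(disc r) (c, d))%:E by exact: integral_ge0.
have t1 : t != 0%R by rewrite gt_eqF.
have aff (f : R -> \bar R) : measurable_fun setT f -> (forall x, 0 <= f x) -> \int[leb]_x f x = t%:E * \int[leb]_x f (t * x)%R.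
  move=> mf f0; have := integral_affine 0 t1 mf f0; rewrite gtr0_norm // => E.
  have -> : \int[leb]_x f (t * x)%R = \int[leb]_x f (t * x + 0)%R by apply: eq_integral => x _; rewrite addr0.
  by rewrite E muleA -EFinM divff // mul1e.
rewrite (aff _ (mF _) (F0 _)) expr2 [X in _ = X * _]EFinM -muleA; congr (_ * _).
rewrite -(ge0_integral_scale (mF 1%R) (F0 1%R) (ltW t0)).
apply: eq_integral => c _; rewrite (aff _ (m2 _ _)) //; congr (_ * _); apply: eq_integral => d _; congr (_%:E).
rewrite !indicE; congr (_%:R); congr nat_of_bool; apply/idP/idP; rewrite !inE /disc /= => h.
  by rewrite -(@ltr_pM2l _ (t ^+ 2)) ?exprn_gt0 // mulr1; move: h; rewrite -expr2; lra.
by move: h; rewrite -(@ltr_pM2l _ (t ^+ 2)) ?exprn_gt0 // mulr1 -expr2; lra.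
Qed.

Let disc1_fin : leb2 (disc 1) < +oo.
Proof.
apply: (@le_lt_trans _ _ (leb2 (`[(-1)%R, 1%R]%classic `*` `[(-1)%R, 1%R]%classic))).
  apply: le_measure; rewrite ?inE; [exact: mdisc|apply: measurableX; exact: measurable_itv|].
  by move=> [a b]; rewrite /disc /= !in_itv /= => h; split; apply/andP; split; nra.
rewrite /leb2 /= /prod_measure product_measure1E; [|exact: measurable_itv|exact: measurable_itv].
rewrite [X in X * _](lebesgue_measure_itv `[(-1)%R, 1%R]) /=.
rewrite [X in _ * X](lebesgue_measure_itv `[(-1)%R, 1%R]) /=.
by case: ifP => _; [exact: (ltry ((1 - -1) * (1 - -1))%R)|rewrite mul0e].
Qed.

Let A : R := fine (leb2 (disc 1)).

Let disc_area (r : R) : (0 < r)%R -> leb2 (disc r) = (A * r)%:E.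
Proof.
move=> r0; rewrite -[in LHS](sqr_sqrtr (ltW r0)) disc_scale ?sqrtr_gt0 // sqr_sqrtr ?ltW //.
by rewrite /A mulrC [RHS]EFinM fineK // ge0_fin_numE.
Qed.

Let A0 : (0 <= A)%R. Proof. by rewrite fine_ge0. Qed.

Let null0 : leb2 [set (0, 0)%R] = 0.
Proof.
have -> : [set (0, 0)%R] = [set 0%R] `*` [set 0%R] :> set (mR * mR).
  by apply/seteqP; split => [_ ->//|[x y] [/= -> ->]].
rewrite /leb2 /= /prod_measure product_measure1E; [|exact: measurable_set1|exact: measurable_set1].
by rewrite [X in X * _]lebesgue_measure_set1 mul0e.
Qed.

Let rho (p : mR * mR) : mR := ((p.1 ^+ 2 + p.2 ^+ 2)^-1)%R.
Let mrho : measurable_fun setT rho. Proof. rewrite /rho; mfun. Qed.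

Let rho_ray (a : R) : (0 < a)%R -> leb2 [set p | a < rho p]%R = (A / a)%:E.
Proof.
move=> a0; have mr : measurable [set p | a < rho p]%R by apply: mlt => //; exact: mcst.
have m0 : measurable [set (0, 0)%R : mR * mR].
  rewrite (_ : [set _] = [set 0%R] `*` [set 0%R]); first by apply: measurableX; exact: measurable_set1.
  by apply/seteqP; split => [_ ->//|[x y] [/= -> ->]].
have <- : leb2 (disc a^-1) = (A / a)%:E by apply: disc_area; rewrite invr_gt0.
have -> : disc a^-1 = [set p | a < rho p]%R `|` [set (0, 0)%R].
  apply/seteqP; split => -[x y]; rewrite /disc /rho /=.
    move=> h; have [s0|s0] := eqVneq (x ^+ 2 + y ^+ 2)%R 0%R.
      right; move/eqP: s0; rewrite paddr_eq0 ?sqr_ge0 // !sqrf_eq0 => /andP[/eqP -> /eqP ->] //.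
    left.
    by rewrite -[a]invrK ltf_pV2 ?posrE ?invr_gt0 // lt_neqAle eq_sym s0 addr_ge0 ?sqr_ge0.
  case=> [h|[-> ->]]; last by rewrite expr0n /= addr0 invr_gt0.
  have s0 : (0 < x ^+ 2 + y ^+ 2)%R by rewrite -invr_gt0 (lt_trans a0).
  by rewrite -[(_ + _)%R]invrK ltf_pV2 ?posrE // invr_gt0.
by rewrite measureU0.
Qed.

(** The region under the graph of [A / y^2]: its area, projected to the first axis, is [A dy / y^2].
    Comparing it with [rho] on rays takes the place of polar coordinates. *)
Let D2 : set (mR * mR) := [set p | [/\ 1 / 2 < p.1, 0 < p.2 & p.2 * p.1 ^+ 2 < A]]%R.

Let mD2 : measurable D2.
Proof.
have -> : D2 = [set p | 1 / 2 < p.1]%R `&` ([set p | 0 < p.2]%R `&` [set p | p.2 * p.1 ^+ 2 < A]%R).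
  by apply/seteqP; split => p [] //= h1 []; split.
by apply: measurableI; [|apply: measurableI]; apply: mlt; mfun.
Qed.

Let slice2 (y : R) : (1 / 2 < y)%R -> leb [set s | D2 (y, s)] = (A * y ^- 2)%:E.
Proof.
move=> y2; have y0 : (0 < y ^+ 2)%R by rewrite exprn_gt0 //; lra.
have -> : [set s | D2 (y, s)] = `]0%R, (A * y ^- 2)%R[%classic.
  apply/seteqP; split => s /=; rewrite in_itv /= ltr_pdivlMr //; first by case=> _ /= -> ->.
  by case/andP.
rewrite lebesgue_measure_itv /= lte_fin.
have : (0 <= A * y ^- 2)%R by rewrite mulr_ge0 // invr_ge0 ltW.
rewrite le_eqVlt => /predU1P[<-|->]; first by rewrite ltxx.
by rewrite sube0.
Qed.

Let D2_integral (K : R -> \bar R) : measurable_fun setT K -> (forall y, 0 <= K y) -> (forall y, (y <= 1 / 2)%R -> K y = 0) ->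
  \int[leb2]_(p in D2) K p.1 = \int[leb]_y (K y * (A * y ^- 2)%:E).
Proof.
move=> mK K0 Kz; pose f (p : mR * mR) := K p.1 * (\1_D2 p)%:E.
have -> : \int[leb2]_(p in D2) K p.1 = \int[leb2]_p f p.
  rewrite integral_mkcond; apply: eq_integral => p _; rewrite /f patchE indicE.
  by case: (p \in D2); rewrite ?mule1 ?mule0.
have mi : measurable_fun setT (fun p : mR * mR => (\1_D2 p)%:E : \bar R) by apply: mE; exact: measurable_indic.
rewrite tonelli1; last 2 first.
- by apply: mMe => //; apply: (mcomp mK); mfun.
- by move=> p; rewrite /f mule_ge0 // lee_fin.
apply: eq_integral => y _; rewrite /f /=.
have my : measurable_fun setT (fun s : mR => (\1_D2 (y, s))%:E : \bar R) by apply: (mcomp mi); mfun.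
have -> : \int[leb]_s (K y * (\1_D2 (y, s))%:E) = K y * \int[leb]_s (\1_D2 (y, s))%:E.
  by rewrite (ge0_integralZl leb measurableT my) // => s _; rewrite lee_fin.
have [y2|y2] := leP y (1 / 2)%R; first by rewrite (Kz _ y2) !mul0e.
congr (_ * _); rewrite -slice2 // meas_ind; last first.
  have mp : measurable_fun setT (fun s : mR => (y, s) : mR * mR) by mfun.
  by rewrite -[X in measurable X]setTI; exact: (mp measurableT _ mD2).
by apply: eq_integral => s _; congr (_%:E); rewrite !indicE; congr (_%:R); congr nat_of_bool.
Qed.

Lemma integral_inv_sq (a : R) : (0 < a)%R -> \int[leb]_(y in `]a, +oo[) (y ^- 2)%:E = (a^-1)%:E.
Proof.
move=> a0; have y0 y : (a <= y)%R -> y != 0%R by move=> ay; rewrite gt_eqF // (lt_le_trans a0).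
have dF (y : R) : (a <= y)%R -> is_derive y 1%R (fun y : R => - y^-1)%R (y ^- 2)%R.
  move=> ay; have yn0 := y0 y ay.
  have dI : is_derive y 1%R (fun y : R => y^-1)%R (- y ^- 2 *: (1%R : R))%R by exact: (@is_deriveV _ id).
  by have := is_deriveN dI; rewrite /= scaleNr opprK scaler1.
have cV : {within `[a, +oo[, continuous (fun y : R => y ^- 2)%R}.
  apply: continuous_in_subspaceT => y; rewrite inE /= in_itv /= andbT => ay.
  by apply: cvgV; [rewrite expf_neq0 // y0|exact: exprn_continuous].
have mV : measurable_fun (`]a, +oo[%classic : set mR) (fun y : R => (y ^- 2)%:E).
  apply/measurable_EFinP; apply: measurable_funTS; apply: mV; mfun.
rewrite integral_itv_obnd_cbnd //.
rewrite (@ge0_continuous_FTC2y _ _ (fun y => - y^-1)%R _ 0%R) //.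
- by rewrite sub0e EFinN oppeK.
- by move=> y _; rewrite invr_ge0 sqr_ge0.
- by rewrite -[X in _ --> X]oppr0; apply: cvgN; apply/(gtr0_cvgV0 (f := id)) => //; exact: nbhs_pinfty_gt.
- by move=> y ay; apply: (@ex_derive _ _ _ _ _ _ _ (dF y (ltW ay))).
- by apply: cvg_at_right_filter; apply: cvgN; apply: cvgV => //; exact: y0.
- move=> y; rewrite in_itv /= andbT => ay.
  by rewrite derive1E; exact: (@derive_val _ _ _ _ _ _ _ (dF y (ltW ay))).
Qed.

Let D1 : set (mR * mR) := [set p | 1 / 2 < rho p]%R.
Let mD1 : measurable D1. Proof. by apply: mlt => //; exact: mcst. Qed.

(** Restricting to values above 1/2 makes both image measures finite on every ray, and the rays
    generate the Borel sets. *)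
Let nu1 := pushforward_measure (mrestr leb2 mD1) mrho.
Let nu2 := pushforward_measure (mrestr leb2 mD2) (measurable_fst : measurable_fun setT (@fst mR mR)).

Let nu1_ray (a : R) : nu1 `]a, +oo[%classic = (A / Num.max a (1 / 2))%:E.
Proof.
have <- : leb2 [set p | Num.max a (1 / 2) < rho p]%R = (A / Num.max a (1 / 2))%:E by apply: rho_ray; rewrite lt_max divr_gt0 ?orbT.
rewrite /nu1 /= /pushforward /= /mrestr; congr (leb2 _); apply/seteqP; split => p; rewrite /D1 /= in_itv /= andbT gt_max.
  by case=> -> ->.
by case/andP.
Qed.

Let nu2_ray (a : R) : nu2 `]a, +oo[%classic = (A / Num.max a (1 / 2))%:E.
Proof.
pose a' := Num.max a (1 / 2)%R; have a'0 : (0 < a')%R by rewrite lt_max divr_gt0 ?orbT.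
pose K (y : R) : \bar R := (\1_(`]a', +oo[%classic : set mR) y)%:E.
have mr : measurable (`]a', +oo[%classic : set mR) by exact: measurable_itv.
have mK : measurable_fun setT K by apply: mE; exact: measurable_indic.
transitivity (\int[leb2]_(p in D2) K p.1).
  have mB : measurable (fst @^-1` `]a', +oo[%classic : set (mR * mR)).
    by rewrite -[X in measurable X]setTI; exact: measurable_fst.
  transitivity (leb2 (fst @^-1` `]a', +oo[%classic `&` D2)); last first.
    by rewrite -(integral_indic leb2 mD2 mB); apply: eq_integral => p _; rewrite /K !indicE.
  rewrite /nu2 /= /pushforward /= /mrestr; congr (leb2 _).
  apply/seteqP; split => p /=; rewrite !in_itv /= !andbT gt_max; first by case=> h1 h2; split => //; case: h2 => h2 _ _; rewrite h1.
  by case=> /andP[h1 _] h2.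
rewrite D2_integral //; last 2 first.
- by move=> y; rewrite lee_fin.
- move=> y y2; rewrite /K indicE memNset // /= in_itv /= andbT gt_max [X in _ && X]ltNge y2 andbF //.
rewrite -/a' [in RHS]EFinM -integral_inv_sq // -ge0_integralZl_EFin //; last 2 first.
- by move=> y _; rewrite lee_fin invr_ge0 sqr_ge0.
- by apply/measurable_EFinP; apply: measurable_funTS; apply: mV; mfun.
rewrite [RHS]integral_mkcond; apply: eq_integral => y _; rewrite patchE /K indicE.
by case: (y \in _); rewrite ?mul1e ?mul0e // -EFinM.
Qed.

Let nu_eq (B : set mR) : measurable B -> nu1 B = nu2 B.
Proof.
apply: (@measure_unique _ R mR (@RGenOInfty.G R) (fun k : nat => `](- k%:R)%R, +oo[%classic)).
- exact: RGenOInfty.measurableE.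
- move=> _ _ [a ->] [b ->]; exists (Num.max a b); apply/seteqP; split => x /=; rewrite !in_itv /= !andbT gt_max.
    by case=> -> ->.
  by case/andP.
- by move=> i; exists (- i%:R)%R.
- apply/seteqP; split => // x _; exists (Num.truncn `|x|).+1 => //=; rewrite in_itv /= andbT.
  have := truncnS_gt `|x|%R; rewrite ltrNl; apply: le_lt_trans.
  by rewrite -normrN ler_norm.
- by move=> _ [a ->]; rewrite nu1_ray nu2_ray.
- by move=> k; rewrite nu1_ray ltry.
Qed.

(* Under the radial map [(c, d) |-> (c^2 + d^2)^-1], Lebesgue measure becomes a multiple of [dy / y^2]. *)
Lemma radial : exists2 A : R, (0 <= A)%R & forall K : R -> \bar R, measurable_fun setT K -> (forall y, 0 <= K y) ->
  (forall y, (y <= 1 / 2)%R -> K y = 0) ->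
  \int[leb]_c \int[leb]_d K ((c ^+ 2 + d ^+ 2)^-1)%R = A%:E * \int[leb]_y (K y * (y ^- 2)%:E).
Proof.
exists A => // K mK K0 Kz.
transitivity (\int[nu1]_y K y).
  rewrite ge0_integral_pushforward //= preimage_setT integral_mrestr //; last by apply: (mcomp mK); exact: mrho.
  rewrite -(@tonelli1 (fun p => K (rho p))) //; last by apply: (mcomp mK); exact: mrho.
  rewrite [RHS]integral_mkcond; apply: eq_integral => p _; rewrite patchE; case: ifPn => //.
  by rewrite notin_setE /D1 /= => /negP; rewrite -leNgt => /Kz.
transitivity (\int[nu2]_y K y); first by apply: eq_measure_integral => B mB _; exact: nu_eq.
rewrite ge0_integral_pushforward //= preimage_setT integral_mrestr //; last by apply: (mcomp mK); mfun.
rewrite D2_integral // -ge0_integral_scale //; last 2 first.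
- by apply: mMe => //; apply: mE; apply: mV; mfun.
- by move=> y; rewrite mule_ge0 // lee_fin invr_ge0 sqr_ge0.
by apply: eq_integral => y _; rewrite EFinM muleCA.
Qed.

End radial.

Local Open Scope complex_scope.
Local Open Scope quotient_scope.

Lemma integral_image (R : realType) d1 d2 (T1 : measurableType d1) (T2 : measurableType d2) (m : {measure set T1 -> \bar R})
    (D : set T1) (mD : measurable D) (f : T1 -> T2) (mf : measurable_fun setT f) (K : T2 -> \bar R) :
  measurable_fun setT K -> (forall x, 0 <= K x)%E ->
  (\int[pushforward_measure (mrestr m mD) mf]_y K y = \int[m]_(x in D) K (f x))%E.
Proof.
move=> mK K0; rewrite ge0_integral_pushforward //= preimage_setT integral_mrestr //.
exact: (mcomp mK mf).
Qed.

(** * Haar mean of functions lifted from the modular curve *)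

Section modular_mean.
Context {R : realType}.
Local Notation mR := (measurableTypeR R).
Local Notation M := ((mR * mR) * (mR * mR))%type.
Local Notation leb := (@lebesgue_measure R).
Local Notation X := (modular_curve R).
Local Notation H := (upper_half_plane R).
Local Open Scope ereal_scope.

Definition mkcurve (p : mR * mR) : X := to_curve (p.1 +i* p.2)%C.
Definition orbit_pt (g : mat2 R) : R[i] := ((rowdot g / row2sq g) +i* (row2sq g)^-1)%R%C.
Definition curve_pt (g : mat2 R) : X := to_curve (orbit_pt g).

Let halfplane : set (mR * mR) := [set p | 0 < p.2]%R.

Let measurable_halfplane : measurable halfplane.
Proof.
have -> : halfplane = setT `*` `]0%R, +oo[%classic.
  by apply/seteqP; split => -[x y]; rewrite /halfplane /= in_itv /= andbT //; case.
by apply: measurableX => //; exact: measurable_itv.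
Qed.

Lemma measurable_mkcurve : measurable_fun setT mkcurve.
Proof.
apply: (@measurability _ _ _ _ _ _ (@open X)) => // _ [U oU <-]; rewrite setTI.
have [V oV VU] : exists2 V : set R[i], open V & val @^-1` V = \pi_X @^-1` U :> set H.
  by move: oU; rewrite /open /=.
(* On and below the real axis [to_curve] takes its default value, so that this part of the plane is
   in the preimage entirely or not at all. *)
pose N : set (mR * mR) := if `[< U (\pi_X (uhp_i : H)) >] then ~` halfplane else set0.
have -> : mkcurve @^-1` U = (halfplane `&` (fun p : mR * mR => (p.1 +i* p.2)%C : R[i]) @^-1` V) `|` N.
  apply/seteqP; split => -[x y] /=; rewrite /mkcurve /to_curve /= /N.
    have [y0|y0] := ltP 0%R y => UX.
      left; split => //; have : (\pi_X @^-1` U) (insubd uhp_i (x +i* y)%C : H) by [].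
      by rewrite -VU /= val_insubd_uhp.
    right; have E : insubd uhp_i (x +i* y)%C = uhp_i :> H.
      by rewrite /insubd insubN //; apply/negP; rewrite inE /= ltNge y0.
    by rewrite E in UX; rewrite asboolT // /halfplane /= ltNge y0.
  case=> [[y0 h]|].
    have : (val @^-1` V) (insubd uhp_i (x +i* y)%C : H) by rewrite /= val_insubd_uhp.
    by rewrite VU.
  case: asboolP => // UX; rewrite /halfplane /= => /negP; rewrite -leNgt => y0.
  by rewrite /insubd insubN //; apply/negP; rewrite inE /= ltNge y0.
apply: measurableU.
  apply: measurableI => //; apply: open_plane_measurable.
  by apply: open_comp => // p _; exact: continuous_mkcomplex.
by rewrite /N; case: ifP => // _; exact: measurableC.
Qed.

Let zc (g : M) : mR * mR := ((rowdot g / row2sq g)%R, ((row2sq g)^-1)%R).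

Let mzc : measurable_fun setT zc.
Proof.
apply: mpair; last by apply: mV; exact: measurable_row2sq.
by apply: mM; [exact: measurable_rowdot|apply: mV; exact: measurable_row2sq].
Qed.

Lemma measurable_curve_pt : measurable_fun setT (curve_pt : M -> X).
Proof. exact: (mcomp measurable_mkcurve mzc). Qed.

Let leb2 : {sigma_finite_measure set (mR * mR)%type -> \bar R} := prod_measure leb leb.

(** [zc g] are the coordinates of [g i]: the imaginary part is [(c^2 + d^2)^-1], to which [radial]
    applies, and the real part is a translate of the Haar coordinate [x]. The fundamental domain
    lies above the height 1/2. *)
Let planar : exists2 A : R, (0 <= A)%R & forall G : mR * mR -> \bar R, measurable_fun setT G -> (forall p, 0 <= G p) ->
  (forall p, (p.2 <= 1 / 2)%R -> G p = 0) -> haar (fun g => G (zc g)) = A%:E * \int[leb2]_p (G p * (p.2 ^- 2)%:E).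
Proof.
have [A A0 hA] := @radial R; exists A => // G mG G0 Gz.
have mGz : measurable_fun setT (fun g : M => G (zc g)) by exact: (mcomp mG mzc).
rewrite haar_cdx //; pose K (y : mR) : \bar R := \int[leb]_x G (x, y).
have mK : measurable_fun setT K by exact: (measurable_fun_fubini_tonelli_G (m1 := leb)).
have K0 y : 0 <= K y by exact: integral_ge0.
have Gx y : measurable_fun setT (fun x : mR => G (x, y)) by apply: (mcomp mG); mfun.
transitivity (\int[leb]_c \int[leb]_d K ((c ^+ 2 + d ^+ 2)^-1)%R).
  apply: eq_integral => c _; apply: eq_integral => d _.
  have [s0|s0] := eqVneq (c ^+ 2 + d ^+ 2)%R 0%R.
    have h2 : (0 <= 1 / 2 :> R)%R by [].
    rewrite s0 invr0 /K !integral0_eq // => x _; first by apply: Gz.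
    by apply: Gz; rewrite /zc /row2sq /haar_coord /= s0 invr0.
  rewrite /K -(integral_translate (d^-1 * c / (c ^+ 2 + d ^+ 2)) (Gx _)) //.
  apply: eq_integral => x _; congr G; rewrite /zc /rowdot /row2sq /haar_coord /=; congr (_, _).
  by move: (d^-1)%R => i; field.
rewrite hA //; last by move=> y y2; rewrite /K integral0_eq // => x _; exact: Gz.
congr (_ * _); rewrite /leb2 /= /prod_measure fubini_tonelli2 //; last 2 first.
- by apply: mMe => //; apply: mE; apply: mV; mfun.
- by move=> p; rewrite mule_ge0 // lee_fin invr_ge0 sqr_ge0.
by apply: eq_integral => y _; rewrite /fubini_G /= ge0_integralZr // lee_fin invr_ge0 sqr_ge0.
Qed.

Let fund : set (mR * mR) := [set p | [/\ `|p.1| <= 1 / 2, 1 <= p.1 ^+ 2 + p.2 ^+ 2 & 0 < p.2]]%R.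

Let mle d (T : measurableType d) (f g : T -> R) : measurable_fun setT f -> measurable_fun setT g ->
  measurable [set x | f x <= g x]%R.
Proof.
move=> mf mg; have := measurable_fun_ler mf mg; move/(_ measurableT [set true] I).
by rewrite setTI.
Qed.

Let mfund : measurable fund.
Proof.
have -> : fund = [set p | `|p.1| <= 1 / 2]%R `&` ([set p | 1 <= p.1 ^+ 2 + p.2 ^+ 2]%R `&` halfplane).
  by apply/seteqP; split => p [] //= h1 []; split.
apply: measurableI; [|apply: measurableI => //]; apply: mle; mfun.
Qed.

Let mfundA (A : set X) : measurable A -> measurable (fund `&` mkcurve @^-1` A).
Proof.
by move=> mA; apply: measurableI => //; rewrite -[X in measurable X]setTI; exact: measurable_mkcurve.
Qed.

Let coord_fund (A : set X) :
  uhp_coord @` (fundamental_domain `&` \pi_X @^-1` A) = fund `&` mkcurve @^-1` A.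
Proof.
have nE (x y : R) : (1 <= `|(x +i* y)%C|)%R = (1 <= x ^+ 2 + y ^+ 2)%R.
  by rewrite normc_def lecR /= -[X in (X <= _)%R]sqrtr1 ler_sqrt // addr_ge0 ?sqr_ge0.
apply/seteqP; split => [_ [z [[zx z1] zA] <-]|[x y] [[/= x2 xy y0] pA]].
  have zE : insubd uhp_i (complex.Re (val z) +i* complex.Im (val z))%C = z.
    by rewrite -[RHS](valKd uhp_i); congr insubd; case: (val z).
  split; last by rewrite /mkcurve /= /to_curve zE.
  split => //=; last exact: Im_uhp_gt0.
  move: z1; rewrite [val z](_ : _ = complex.Re (val z) +i* complex.Im (val z))%C ?nE //; by case: (val z).
have vE : val (insubd uhp_i (x +i* y)%C : H) = (x +i* y)%C by rewrite val_insubd_uhp.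
exists (insubd uhp_i (x +i* y)%C); last by rewrite /uhp_coord vE.
by split => //; rewrite /fundamental_domain /= vE /= nE.
Qed.

Let red_fund g : detm g = 1%R -> reduced g = (zc g \in fund).
Proof.
move=> D; have r0 := row2sq_gt0 D; have rn0 : row2sq g != 0%R by rewrite gt_eqF.
have E : ((rowdot g / row2sq g) ^+ 2 + (row2sq g)^-1 ^+ 2 = row1sq g / row2sq g)%R.
  have := row_identity D; move: (row1sq g) (row2sq g) (rowdot g) rn0 => r s t s0 h.
  have t2 : (t ^+ 2 = r * s - 1)%R by rewrite h; ring.
  by rewrite exprMn t2; field.
rewrite /reduced; apply/andP/idP; rewrite inE /fund /zc /=.
  case=> h1 h2; rewrite E normrM normfV (gtr0_norm r0) ler_pdivrMr // ler_pdivlMr // invr_gt0.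
  by split => //; lra.
case; rewrite E normrM normfV (gtr0_norm r0) ler_pdivrMr // ler_pdivlMr // => h1 h2 _.
by split; lra.
Qed.

Let gint_ind : exists2 k : R, (0 <= k)%R & forall A : set X, measurable A ->
  gint (fun g => \1_A (curve_pt g)) = k%:E * modular_measure A.
Proof.
have [A A0 hA] := planar; exists (A * (pi / 3))%R; first by rewrite mulr_ge0 // divr_ge0 // pi_ge0.
move=> B mB; pose G p : \bar R := (\1_(fund `&` mkcurve @^-1` B) p)%:E.
have mI := mfundA mB.
have mG : measurable_fun setT G by apply: mE; exact: measurable_indic.
have -> : gint (fun g => \1_B (curve_pt g)) = haar (fun g => G (zc g)).
  apply: eq_haar.
  - apply: mE; apply: mM; last exact: measurable_bool measurable_reduced.
    exact: (measurableT_comp (measurable_indic mB) measurable_curve_pt).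
  - exact: (mcomp mG mzc).
  - by move=> h; rewrite lee_fin mulr_ge0.
  - by move=> h; rewrite lee_fin.
  move=> g D; rewrite red_fund // /G !indicE in_setI -natrM mulnb andbC; by congr ((_ && _)%:R)%:E.
rewrite hA //; last 2 first.
- by move=> p; rewrite lee_fin.
- move=> [x y] /= y2; rewrite /G indicE memNset // => -[[/= h1 h2 h3] _].
  move: h1; rewrite ler_norml => /andP[h0 h1]; nra.
rewrite /modular_measure /hyperbolic_area coord_fund muleA -EFinM.
have -> : (A * (pi / 3) * (3 / pi) = A)%R by have := pi_gt0 R; move: (pi : R) => p p0; field; apply: lt0r_neq0; exact: p0.
congr (_ * _); rewrite [RHS]integral_mkcond; apply: eq_integral => p _; rewrite patchE /G indicE.
by case: (p \in _); rewrite ?mul1e ?mul0e.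
Qed.

Let leb3 : {sigma_finite_measure set (mR * (mR * mR))%type -> \bar R} := prod_measure leb (prod_measure leb leb).

Let gint_curve_pt : exists2 k : R, (0 <= k)%R & forall phi : X -> R, measurable_fun setT phi -> (forall x, 0 <= phi x)%R ->
  gint (fun g => phi (curve_pt g)) = k%:E * \int[modular_measure]_x (phi x)%:E.
Proof.
have [k k0 hk] := gint_ind; exists k => // phi mphi phi0.
pose D : set (mR * (mR * mR)) := [set p | reduced (haar_coord p)].
have mD : measurable D.
  have := mcomp (@measurable_reduced R) (@measurable_haar_coord R); move/(_ measurableT [set true] I).
  by rewrite setTI.
have ml : measurable_fun setT (fun p : mR * (mR * mR) => curve_pt (haar_coord p)).
  exact: (mcomp measurable_curve_pt (@measurable_haar_coord R)).
pose nu := pushforward_measure (mrestr leb3 mD) ml.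
have E (f : X -> R) : measurable_fun setT f -> (forall x, 0 <= f x)%R -> gint (fun g => f (curve_pt g)) = \int[nu]_x (f x)%:E.
  move=> mf f0; have me := mE mf.
  rewrite integral_image //.
  rewrite [RHS]integral_mkcond /gint /haar; apply: eq_integral => p _; rewrite patchE /=.
  by case: ifPn; [rewrite inE /D /= => ->; rewrite mulr1|rewrite notin_setE /D /= => /negP/negPf ->; rewrite mulr0].
rewrite E //; clearbody nu; pose mu := mscale (NngNum k0) (@modular_measure R).
have -> : \int[nu]_x (phi x)%:E = \int[mu]_x (phi x)%:E.
  apply: eq_measure_integral => A mA _.
  have iA : measurable_fun setT (\1_A : X -> R) by exact: measurable_indic.
  rewrite [RHS](_ : _ = k%:E * modular_measure A) // -hk // (E _ iA) //.
  by rewrite integral_indic // setIT.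
rewrite ge0_integral_mscale //; first exact: mE.
by move=> x _; rewrite lee_fin.
Qed.

(** The unknown constant between Haar measure and [modular_measure] equals [vol], by evaluation at
    the constant 1, and cancels in the mean. *)
Lemma mean_curve_pt (phi : X -> R) : measurable_fun setT phi -> (forall x, 0 <= phi x)%R ->
  mean (fun g => phi (curve_pt g)) = (\int[modular_measure]_x phi x)%R.
Proof.
have [k k0 hk] := gint_curve_pt; move=> mphi phi0.
have V : (@vol R = k)%R.
  rewrite /vol /aint (hk (fun=> 1%R)) // ?integral_cst //.
  by rewrite [X in fine (_ * (_ * X))](_ : _ = 1) ?mule1 //; exact: (@probability_setT _ _ _ (@modular_measure R)).
have k1 := @vol_gt0 R; rewrite V in k1.
rewrite /mean /aint V hk // /Rintegral.
have [fin|] := boolP (\int[modular_measure]_x (phi x)%:E \is a fin_num).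
  by rewrite fineM //= mulrC mulKf // gt_eqF.
rewrite ge0_fin_numE ?integral_ge0 // => [|x _]; last by rewrite lee_fin.
rewrite -leNgt leye_eq => /eqP ->; rewrite gt0_muley ?lte_fin // mul0r //.
Qed.
End modular_mean.

(** * Topology of the modular curve *)

Section curve_topology.
Context {R : realType}.
Local Notation mR := (measurableTypeR R).
Local Notation M := ((mR * mR) * (mR * mR))%type.
Local Notation X := (modular_curve R).
Local Notation H := (upper_half_plane R).

Definition zmx (k : zmat) : 'M[int]_2 := \matrix_(i, j)
  if i == 0 then (if j == 0 then k.1.1 else k.1.2) else (if j == 0 then k.2.1 else k.2.2).
Definition mxz (g : 'M[int]_2) : zmat := ((g 0 0, g 0 1), (g 1 0, g 1 1)).

Lemma det_zmx (k : zmat) : sl2z k -> \det (zmx k) = 1.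
Proof. by rewrite det22 !mxE /=. Qed.

Lemma sl2z_mxz (g : 'M[int]_2) : \det g = 1 -> sl2z (mxz g).
Proof. by rewrite det22. Qed.

Lemma row2_neq0 (g : mat2 R) : detm g = 1 -> ((g.2.1)%:C * 'i + (g.2.2)%:C : R[i]) != 0.
Proof.
move=> D; apply/eqP => -[/=]; rewrite !mul0r !mulr0 !mulr1 subr0 !add0r !addr0 => h1 h2.
by move: D; rewrite /detm h1 h2 !mulr0 subr0 => /eqP; rewrite eq_sym oner_eq0.
Qed.

Lemma orbit_ptE (g : mat2 R) : detm g = 1 ->
  orbit_pt g = ((g.1.1)%:C * 'i + (g.1.2)%:C) / ((g.2.1)%:C * 'i + (g.2.2)%:C).
Proof.
move=> D; have r0 := row2sq_gt0 D; have rn : row2sq g != 0 by rewrite gt_eqF.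
apply: (mulIf (row2_neq0 D)); rewrite divfK ?row2_neq0 //.
move: D rn; rewrite /orbit_pt /rowdot /row2sq /detm; case: g r0 => -[a b] [c d] /= r0 D rn.
apply/eqP; rewrite eq_complex /=; apply/andP; split; apply/eqP; rewrite ?mul0r ?mulr0 ?mulr1 ?subr0 ?add0r ?addr0 ?sub0r.
  have -> : (a * c + b * d) / (c ^+ 2 + d ^+ 2) * d - (c ^+ 2 + d ^+ 2)^-1 * c = (b * (c ^+ 2 + d ^+ 2) + c * ((a * d - b * c) - 1)) / (c ^+ 2 + d ^+ 2) by field.
  by rewrite D subrr mulr0 addr0 mulfK.
have -> : (a * c + b * d) / (c ^+ 2 + d ^+ 2) * c + (c ^+ 2 + d ^+ 2)^-1 * d = (a * (c ^+ 2 + d ^+ 2) + d * (1 - (a * d - b * c))) / (c ^+ 2 + d ^+ 2) by field.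
by rewrite D subrr mulr0 addr0 mulfK.
Qed.

Lemma Im_orbit_pt (g : mat2 R) : detm g = 1 -> 0 < complex.Im (orbit_pt g).
Proof. by move=> D; rewrite /= invr_gt0 row2sq_gt0. Qed.

Lemma mobius_orbit (m : 'M[int]_2) (g : mat2 R) : \det m = 1 -> detm g = 1 ->
  mobius m (orbit_pt g) = orbit_pt (mulm (zr (mxz m)) g).
Proof.
move=> Dm D; have sm := sl2z_mxz Dm.
have D' : detm (mulm (zr (mxz m)) g) = 1 by rewrite detm_mul detm_zr // D mulr1.
rewrite !orbit_ptE //; have n1 := row2_neq0 D; have n2 := row2_neq0 D'.
move: n1 n2; rewrite /mobius /mulm /zr /mxz /=.
rewrite !rmorphD /= !rmorphM /= !rmorph_int.
move: (m 0 0) (m 0 1) (m 1 0) (m 1 1) => a b c d.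
move: (a%:~R : R[i]) (b%:~R : R[i]) (c%:~R : R[i]) (d%:~R : R[i]) => {}a {}b {}c {}d.
case: g {D D'} => -[p q] [r s] /=.
move: (p%:C) (q%:C) (r%:C) (s%:C) => {}p {}q {}r {}s n1 n2.
have n3 : c * ((p * 'i + q) / (r * 'i + s)) + d = ((c * p + d * r) * 'i + (c * q + d * s)) / (r * 'i + s) by field.
by rewrite n3; field; apply/andP.
Qed.

Lemma mxzK (k : zmat) : mxz (zmx k) = k.
Proof. by case: k => -[a b] [c d]; rewrite /mxz !mxE. Qed.

Lemma pi_eq (z w : H) : \pi_X z = \pi_X w :> X -> exists2 m : 'M[int]_2, \det m = 1 & val w = mobius m (val z).
Proof. by move/eqmodP => /asboolP[m [Dm mE]]; exists m. Qed.

Lemma eq_pi (z w : H) (m : 'M[int]_2) : \det m = 1 -> val w = mobius m (val z) -> \pi_X z = \pi_X w :> X.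
Proof. by move=> Dm mE; apply/eqmodP; apply/asboolP; exists m. Qed.

Lemma val_curve_pt (g : mat2 R) : detm g = 1 -> val (insubd uhp_i (orbit_pt g) : H) = orbit_pt g.
Proof. by move=> D; apply: val_insubd_uhp; exact: Im_orbit_pt. Qed.

Lemma curve_pt_inv (k : zmat) (g : mat2 R) : sl2z k -> detm g = 1 -> curve_pt (mulm (zr k) g) = curve_pt g.
Proof.
move=> sk D; have D' : detm (mulm (zr k) g) = 1 by rewrite detm_mul detm_zr // D mulr1.
apply/esym; apply: (@eq_pi _ _ (zmx k)); first exact: det_zmx.
by rewrite !val_curve_pt // mobius_orbit ?det_zmx // mxzK.
Qed.

(* [k k^T = 1 + E] with [E] small, and [row1 = x row2 + y perp] where [x + i y] is the orbit point and [perp] is [row2] rotated. *)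
Lemma orbit_pt_move (g k : mat2 R) d : detm g = 1 -> 0 <= d <= 1 / 100 -> nearm d k ->
  `|complex.Re (orbit_pt (mulm g k)) - complex.Re (orbit_pt g)| <= 20 * d * complex.Im (orbit_pt g) /\
  `|complex.Im (orbit_pt (mulm g k)) - complex.Im (orbit_pt g)| <= 20 * d * complex.Im (orbit_pt g).
Proof.
move=> D /andP[d0 d1]; case: k => -[k1 k2] [k3 k4] /and4P[/= n1 n2 n3 n4].
have r0 := row2sq_gt0 D; move: D r0; case: g => -[a b] [c s]; rewrite /detm /row2sq /rowdot /=.
move=> D r0; set r2 := c ^+ 2 + s ^+ 2 in r0 *.
pose e11 := k1 ^+ 2 + k2 ^+ 2 - 1; pose e12 := k1 * k3 + k2 * k4; pose e22 := k3 ^+ 2 + k4 ^+ 2 - 1.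
have E11 : `|e11| <= 3 * d by rewrite /e11; move: n1 n2; rewrite !ler_norml => /andP[? ?] /andP[? ?]; apply/andP; split; nra.
have E22 : `|e22| <= 3 * d by rewrite /e22; move: n3 n4; rewrite !ler_norml => /andP[? ?] /andP[? ?]; apply/andP; split; nra.
have E12 : `|e12| <= 3 * d.
  have k1b : `|k1| <= 1 + d by move: n1; rewrite !ler_norml => /andP[? ?]; apply/andP; split; lra.
  have k4b : `|k4| <= 1 + d by move: n4; rewrite !ler_norml => /andP[? ?]; apply/andP; split; lra.
  apply: le_trans (ler_normD _ _) _; rewrite !normrM.
  have := ler_pM (normr_ge0 _) (normr_ge0 _) k1b n3; have := ler_pM (normr_ge0 _) (normr_ge0 _) n2 k4b.
  by move: (`|k1| * _) (`|k2| * _) => u v h1 h2; nra.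
have cs : 2 * `|c * s| <= r2.
  rewrite -[X in X * _](@ger0_norm _ 2) // -normrM ler_norml /r2.
  by have := sqr_ge0 (c - s); have := sqr_ge0 (c + s) => h1 h2; apply/andP; split; nra.
have d3 : 0 <= 3 * d by rewrite mulr_ge0.
have qf (x y z u v w : R) : `|u| <= 3 * d -> `|v| <= 3 * d -> `|w| <= 3 * d -> `|x| + `|y| + `|z| <= 2 * r2 ->
    `|x * u + y * v + z * w| <= 6 * d * r2.
  move=> hu hv hw h; apply: le_trans (ler_normD _ _) _; apply: le_trans (lerD (ler_normD _ _) (lexx _)) _.
  rewrite !normrM; apply: (@le_trans _ _ (`|x| * (3 * d) + `|y| * (3 * d) + `|z| * (3 * d))).
    by rewrite !lerD // ler_wpM2l.
  by rewrite -!mulrDl; have := ler_wpM2r d3 h; lra.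
pose e2 := c ^+ 2 * e11 + (2 * (c * s)) * e12 + s ^+ 2 * e22.
pose e3 := (c * s) * e11 + (s ^+ 2 - c ^+ 2) * e12 + (- (c * s)) * e22.
have H2 : `|e2| <= 6 * d * r2.
  apply: qf => //; rewrite (normrM 2) (ger0_norm (sqr_ge0 c)) (ger0_norm (sqr_ge0 s)) (ger0_norm (ler0n R 2)).
  by move: cs; rewrite /r2; lra.
have H3 : `|e3| <= 6 * d * r2.
  apply: qf => //; rewrite normrN; have : `|s ^+ 2 - c ^+ 2| <= r2.
    by rewrite /r2 ler_norml; have := sqr_ge0 s; have := sqr_ge0 c => h1 h2; apply/andP; split; lra.
  by move: cs; lra.
have r2'E : (c * k1 + s * k3) ^+ 2 + (c * k2 + s * k4) ^+ 2 = r2 + e2 by rewrite /r2 /e2 /e11 /e12 /e22; ring.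
have rr : r2 * (94 / 100) <= r2 + e2.
  move: H2; rewrite ler_norml => /andP[h _].
  have : 6 * d * r2 <= 6 / 100 * r2 by rewrite ler_pM2r //; lra.
  by lra.
have r'0 : 0 < r2 + e2 by apply: lt_le_trans rr; rewrite mulr_gt0.
have quo (e : R) : `|e| <= 6 * d * r2 -> `|e / (r2 + e2)| <= 20 * d.
  move=> he; rewrite normrM normfV (gtr0_norm r'0) ler_pdivrMr //; apply: le_trans he _.
  have := ler_wpM2l d0 rr; nra.
have dotE : (a * k1 + b * k3) * (c * k1 + s * k3) + (a * k2 + b * k4) * (c * k2 + s * k4) =
    (a * c + b * s) / r2 * (r2 + e2) + r2^-1 * e3.
  have r2n : c ^+ 2 + s ^+ 2 != 0 by rewrite gt_eqF.
  have aE : a = ((a * c + b * s) * c + s) / r2.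
    have -> : (a * c + b * s) * c + s = (a * c + b * s) * c + s * (a * s - b * c) by rewrite D mulr1.
    by rewrite /r2; field.
  have bE : b = ((a * c + b * s) * s - c) / r2.
    have -> : ((a * c + b * s) * s - c) = ((a * c + b * s) * s - c * (a * s - b * c)) by rewrite D mulr1.
    by rewrite /r2; field.
  move: aE bE; move: (a * c + b * s) => t -> ->.
  by rewrite /e2 /e3 /e11 /e12 /e22 /r2; field.
rewrite !r2'E dotE; split.
  have -> : ((a * c + b * s) / r2 * (r2 + e2) + r2^-1 * e3) / (r2 + e2) - (a * c + b * s) / r2 = e3 / (r2 + e2) * r2^-1.
    by field; rewrite !gt_eqF.
  by rewrite normrM [X in _ * X]gtr0_norm ?invr_gt0 // ler_wpM2r ?invr_ge0 ?(ltW r0) // quo.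
have -> : (r2 + e2)^-1 - r2^-1 = - e2 / (r2 + e2) * r2^-1 by field; rewrite !gt_eqF.
by rewrite normrM [X in _ * X]gtr0_norm ?invr_gt0 // ler_wpM2r ?invr_ge0 ?(ltW r0) //; apply: quo; rewrite normrN.
Qed.

Lemma homography_cvg (a b c d z : R[i]) : c * z + d != 0 ->
  ((a * w + b) / (c * w + d) @[w --> z] --> (a * z + b) / (c * z + d)).
Proof.
move=> n0; have lin (p q : R[i]) : (p * w + q) @[w --> z] --> p * z + q.
  apply: (@cvgD (R[i] : numFieldType) R[i] R[i] (nbhs z) _ (fun w => p * w) (fun w => q)); last exact: cvg_cst.
  by apply: (@cvgM (R[i] : numFieldType) R[i] (nbhs z) _ (fun w => p) (fun w => w)); [exact: cvg_cst|exact: cvg_id].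
apply: (@cvgM (R[i] : numFieldType) R[i] (nbhs z) _ (fun w => a * w + b) (fun w => (c * w + d)^-1)); first exact: lin.
by apply: (@cvgV (R[i] : numFieldType) R[i] (nbhs z) _ (fun w => (c * w + d))); last exact: lin.
Qed.

Lemma mobius_continuous (m : 'M[int]_2) (z : H) : \det m = 1 -> {for val z, continuous (mobius m : R[i] -> R[i])}.
Proof.
move=> Dm; have n0 := mobius_denom_neq0 z (det1_row1 Dm).
exact: homography_cvg.
Qed.

Lemma uhp_pt (z : H) : exists2 g : mat2 R, detm g = 1 & val z = orbit_pt g.
Proof.
have y0 := Im_uhp_gt0 z; pose x := complex.Re (val z); pose y := complex.Im (val z).
have s0 : 0 < Num.sqrt y by rewrite sqrtr_gt0.
exists ((Num.sqrt y, x / Num.sqrt y), (0, (Num.sqrt y)^-1)).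
  by rewrite /detm /= mulr0 subr0 divff // gt_eqF.
rewrite [LHS](_ : _ = (x +i* y)); last by rewrite /x /y; case: (val z).
have yE : Num.sqrt y ^+ 2 = y by rewrite sqr_sqrtr // ltW.
rewrite /orbit_pt /rowdot /row2sq /= mulr0 add0r expr0n /= add0r exprVn yE invrK.
congr (_ +i* _); clearbody y; move: s0 yE; move: (Num.sqrt y) => s s0 <-.
by field; rewrite gt_eqF.
Qed.

(** The saturation of an open set is a union of its preimages under the group. The interior of [S]
    is taken because [mobius m] is continuous only off its pole; at points of the upper half plane
    nothing is lost. *)
Lemma open_pi (O : set R[i]) : open O -> open (\pi_X @` (val @^-1` O : set H) : set X).
Proof.
move=> oO; pose S : set R[i] := [set w | exists2 m : 'M[int]_2, \det m = 1 & O (mobius m w)].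
rewrite /open /=; exists (S^°); first exact: open_interior.
apply/seteqP; split => z /=.
  move=> /interior_subset[m Dm Om].
  have [g D zE] := uhp_pt z.
  have sm := sl2z_mxz Dm.
  have D' : detm (mulm (zr (mxz m)) g) = 1 by rewrite detm_mul detm_zr // D mulr1.
  have vE := val_curve_pt D'; exists (insubd uhp_i (orbit_pt (mulm (zr (mxz m)) g))).
    by rewrite /= vE -mobius_orbit // -zE.
  apply/esym; apply: (eq_pi Dm); by rewrite vE zE mobius_orbit.
move=> [w Ow /esym/pi_eq[m Dm wE]]; rewrite /interior /=.
have := @mobius_continuous m z Dm; rewrite /prop_for /continuous_at -wE => /(_ O).
have nO : nbhs (val w) O by apply: open_nbhs_nbhs.
move=> /(_ nO) h; have : nbhs (val z) (mobius m @^-1` O) by exact: h.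
by apply: filterS => u Ou; exists m.
Qed.

Lemma Re_le_norm (z : R[i]) (r : R) : `|z| < r%:C -> `|complex.Re z| < r /\ `|complex.Im z| < r.
Proof.
case: z => x y; rewrite normc_def ltcR /= => h.
have sq (u v : R) : `|u| <= Num.sqrt (u ^+ 2 + v ^+ 2).
  by rewrite -sqrtr_sqr ler_sqrt ?addr_ge0 ?sqr_ge0 // lerDl sqr_ge0.
by split; apply: le_lt_trans h; [exact: sq|rewrite addrC; exact: sq].
Qed.

Lemma open_box (x y r : R) : 0 < r -> open [set z : R[i] | `|complex.Re z - x| < r /\ `|complex.Im z - y| < r].
Proof.
move=> r0; rewrite openE => z /= [h1 h2].
pose d := Num.min (r - `|complex.Re z - x|) (r - `|complex.Im z - y|).
have d0 : 0 < d by rewrite lt_min !subr_gt0 h1.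
apply/nbhs_ballP; exists d%:C => /=; first by rewrite ltcR.
move=> w; rewrite -ball_normE /= => /Re_le_norm; rewrite !raddfB /= => -[].
rewrite !lt_min => /andP[a1 _] /andP[_ a2]; split.
  rewrite (_ : complex.Re w - x = (complex.Re z - x) - (complex.Re z - complex.Re w)); last by ring.
  by apply: le_lt_trans (ler_normB _ _) _; lra.
rewrite (_ : complex.Im w - y = (complex.Im z - y) - (complex.Im z - complex.Im w)); last by ring.
by apply: le_lt_trans (ler_normB _ _) _; lra.
Qed.

Lemma open_curve (U : set X) : open U -> exists2 O : set (R * R), open O &
  forall p, 0 < p.2 -> (O p <-> U (mkcurve p)).
Proof.
move=> oU; have [V oV VU] : exists2 V : set R[i], open V & val @^-1` V = \pi_X @^-1` U :> set H.
  by move: oU; rewrite /open /=.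
exists ((fun p : R * R => (p.1 +i* p.2 : R[i])) @^-1` V); first by apply: open_comp => // p _; exact: continuous_mkcomplex.
move=> [x y] /= y0; have vE : val (insubd uhp_i (x +i* y) : H) = x +i* y by rewrite val_insubd_uhp.
have := congr1 (fun S : set H => S (insubd uhp_i (x +i* y))) VU.
by rewrite /= vE /mkcurve /to_curve /= => ->.
Qed.

Lemma curve_pt_ex (x : X) : exists2 g : mat2 R, detm g = 1 & x = curve_pt g.
Proof.
have [g D gE] := uhp_pt (repr x); exists g => //.
by rewrite -[LHS]reprK; congr (\pi_X _); apply: val_inj; rewrite val_curve_pt.
Qed.

(** Every representative can be moved into a small box around a fixed point, and the displacement in
    [orbit_pt_move] is relative to the height, which is bounded on the box. *)
Lemma curve_pt_move (U : set X) (x : X) : open U -> U x -> exists2 N : set X, open_nbhs x N &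
  exists2 d, 0 < d & forall g k, detm g = 1 -> detm k = 1 -> N (curve_pt g) -> nearm d k -> U (curve_pt (mulm g k)).
Proof.
move=> oU Ux; have [Q oQ QU] := open_curve oU.
have [g0 D0 xE] := curve_pt_ex x; pose p : R * R := (complex.Re (orbit_pt g0), complex.Im (orbit_pt g0)).
have p0 : 0 < p.2 := Im_orbit_pt D0.
have ptE g : detm g = 1 -> curve_pt g = mkcurve (complex.Re (orbit_pt g), complex.Im (orbit_pt g)) by [].
have Qp : Q p by apply/QU => //; rewrite /p -ptE // -xE.
have /= [r r0 rQ] : exists2 r : R, 0 < r & forall q : R * R, `|q.1 - p.1| < r -> `|q.2 - p.2| < r -> Q q.
  have /= [[P P'] [/= /nbhs_ballP[e /= e0 eP] /nbhs_ballP[f /= f0 fP]] PPA] := open_nbhs_nbhs (conj oQ Qp).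
  exists (Num.min e f) => [|[u v] /=]; first by rewrite lt_min e0.
  rewrite !lt_min => /andP[h1 _] /andP[_ h2]; apply: PPA; split => /=.
    by apply: eP; rewrite -ball_normE /= distrC.
  by apply: fP; rewrite -ball_normE /= distrC.
have r20 : 0 < r / 2 by rewrite divr_gt0.
pose B : set R[i] := [set z | `|complex.Re z - p.1| < r / 2 /\ `|complex.Im z - p.2| < r / 2].
have oB : open B := @open_box p.1 p.2 (r / 2) r20.
exists (\pi_X @` (val @^-1` B : set H)).
  split; first exact: open_pi.
  exists (insubd uhp_i (orbit_pt g0)); last by rewrite xE.
  by rewrite /= val_curve_pt // /B /= !subrr normr0.
pose d := Num.min (1 / 100) (r / 2 / (20 * (p.2 + r / 2))).
have q0 : 0 < 20 * (p.2 + r / 2) by rewrite mulr_gt0 // addr_gt0.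
have d0 : 0 < d by rewrite lt_min !divr_gt0.
have dd : 0 <= d <= 1 / 100 by rewrite (ltW d0) ge_min lexx.
have dr : d * (20 * (p.2 + r / 2)) <= r / 2 by rewrite -ler_pdivlMr // ge_min lexx orbT.
exists d => // g k D Dk [z Bz /esym/pi_eq[m Dm zE]] nk.
rewrite val_curve_pt // mobius_orbit // in zE; have sm := sl2z_mxz Dm.
pose g' := mulm (zr (mxz m)) g.
have D' : detm g' = 1 by rewrite detm_mul detm_zr // D mulr1.
have D'k : detm (mulm g' k) = 1 by rewrite detm_mul D' Dk mulr1.
have Dgk : detm (mulm g k) = 1 by rewrite detm_mul D Dk mulr1.
have -> : curve_pt (mulm g k) = curve_pt (mulm g' k).
  by rewrite -(curve_pt_inv sm Dgk); congr curve_pt; exact: mulmA.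
have [m1 m2] := orbit_pt_move D' dd nk.
rewrite /B /= zE -/g' in Bz; case: Bz => b1 b2.
have vb : 20 * d * complex.Im (orbit_pt g') <= r / 2.
  apply: le_trans dr; rewrite [leRHS]mulrCA mulrA ler_wpM2l //; first by rewrite mulr_ge0 // ltW.
  by move: b2; rewrite /p ltr_norml => /andP[_ /= ?]; lra.
have y0 := Im_orbit_pt D'k; rewrite ptE //; apply/QU => //.
have close (u u' w t : R) : `|u - w| < r / 2 -> `|u' - u| <= t -> t <= r / 2 -> `|u' - w| < r.
  move=> h1 h2 h3; rewrite (_ : u' - w = (u' - u) + (u - w)); last by ring.
  by apply: le_lt_trans (ler_normD _ _) _; lra.
by apply: rQ; [exact: close b1 m1 vb|exact: close b2 m2 vb].
Qed.
End curve_topology.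

(** * Functions on the product of two modular curves *)

Section observable.
Context {R : realType}.
Local Notation mR := (measurableTypeR R).
Local Notation M := ((mR * mR) * (mR * mR))%type.
Local Notation X := (modular_curve R).
Implicit Types (psi : X * X -> R).

Definition on_curve psi (g h : mat2 R) : R := psi (curve_pt g, curve_pt h).

Lemma inv2_on_curve psi : inv2 (on_curve psi).
Proof. by split => k g h sk Dg Dh; rewrite /on_curve curve_pt_inv. Qed.

Lemma mulmKi (g k : mat2 R) : detm k = 1 -> mulm (mulm g k) (invm k) = g.
Proof. by move=> Dk; rewrite -[LHS]mulmA mulmV // mulm1. Qed.

(** Compactness makes the local bounds uniform over [K]. If only the translated point lies in [K],
    the inverse translations exchange the roles; if neither point does, both values are [c]. *)
Lemma ucont2_on_curve psi (K : set (X * X)) (c : R) : continuous psi -> compact K ->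
  (forall p, ~ K p -> psi p = c) -> ucont2 (on_curve psi).
Proof.
move=> cpsi /compact_near_coveringP cK psic e e0.
pose P (n : nat) (t : X * X) := forall g h k l, detm g = 1 -> detm h = 1 -> detm k = 1 -> detm l = 1 ->
  (curve_pt g, curve_pt h) = t -> nearm n.+1%:R^-1 k -> nearm n.+1%:R^-1 l ->
  `|on_curve psi (mulm g k) (mulm h l) - on_curve psi g h| <= e.
have loc t : K t -> \forall t' \near t & n \near \oo, P n t'.
  case: t => x z _; have e20 : 0 < e / 2 by rewrite divr_gt0.
  have /= := cpsi (x, z) _ (nbhsx_ballx _ _ e20).
  move=> [[U V] /= [nU nV] UV].
  have [N1 [oN1 N1x] [d1 d10 h1]] := curve_pt_move (open_interior U) nU.
  have [N2 [oN2 N2z] [d2 d20 h2]] := curve_pt_move (open_interior V) nV.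
  have d0 : 0 < Num.min d1 d2 by rewrite lt_min d10.
  have [n0 _ hn0] := @nat_large R [:: (Num.min d1 d2)^-1] 1.
  exists ([set t | (N1 `&` U) t.1 /\ (N2 `&` V) t.2], [set n | (n0 <= n)%N]) => /=.
    split; last by exists n0.
    exists (N1 `&` U, N2 `&` V) => //=; split; apply: filterI => //; exact: open_nbhs_nbhs.
  move=> [[x' z'] n] [/= [[N1x' Ux'] [N2z' Vz']] nn] g h k l Dg Dh Dk Dl [gE hE] nk nl.
  have dn : n.+1%:R^-1 <= Num.min d1 d2.
    rewrite -[leRHS]invrK lef_pV2 ?posrE ?invr_gt0 ?ltr0n //.
    by apply: le_trans (hn0 _ _) _; rewrite ?inE // ler_nat (leq_trans nn).
  have kU : U (curve_pt (mulm g k)).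
    by apply: interior_subset; apply: h1 => //; [rewrite gE|apply: nearm_le nk; apply: le_trans dn _; rewrite ge_min lexx].
  have lV : V (curve_pt (mulm h l)).
    by apply: interior_subset; apply: h2 => //; [rewrite hE|apply: nearm_le nl; apply: le_trans dn _; rewrite ge_min lexx orbT].
  have b1 := UV (_, _) (conj kU lV); have b2 := UV (x', z') (conj Ux' Vz').
  move: b1 b2; rewrite /on_curve -gE -hE -!ball_normE /=; move: (psi _) (psi _) (psi _) => p q r b1 b2.
  rewrite (_ : q - p = (r - p) - (r - q)); last by ring.
  by apply: le_trans (ler_normB _ _) _; lra.
have [n0 _ hn] := cK _ _ P _ loc.
have near0 : forall g h k l, detm g = 1 -> detm h = 1 -> detm k = 1 -> detm l = 1 -> K (curve_pt g, curve_pt h) ->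
    nearm n0.+1%:R^-1 k -> nearm n0.+1%:R^-1 l -> `|on_curve psi (mulm g k) (mulm h l) - on_curve psi g h| <= e.
  by move=> g h k l Dg Dh Dk Dl Kgh nk nl; exact: (hn n0 (leqnn n0) _ Kgh g h k l).
exists n0.+1%:R^-1 => [|g h k l Dg Dh Dk Dl nk nl]; first by rewrite invr_gt0 ltr0n.
have [Kgh|nK] := pselect (K (curve_pt g, curve_pt h)); first exact: near0.
have [Kgh|nK'] := pselect (K (curve_pt (mulm g k), curve_pt (mulm h l))).
  have := near0 (mulm g k) (mulm h l) (invm k) (invm l).
  rewrite !detm_mul !detm_inv Dg Dh Dk Dl !mulr1 !mulmKi // distrC; apply => //; exact: nearm_inv.
by rewrite /on_curve !psic // subrr normr0 ltW.
Qed.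

(* Every open subset of X * X is a countable union of open boxes, indexed by pairs of rational rectangles. *)
Lemma open_curve2_measurable (W : set (X * X)) : open W -> measurable W.
Proof.
move=> oW.
pose B (u : rat * rat * (rat * rat)) : set (R * R) := `]ratr u.1.1, ratr u.1.2[ `*` `]ratr u.2.1, ratr u.2.2[.
pose good (w : (rat * rat * (rat * rat)) * (rat * rat * (rat * rat))) (UV : set X * set X) :=
  [/\ open UV.1, open UV.2, UV.1 `*` UV.2 `<=` W &
  (forall p, B w.1 p -> 0 < p.2 -> UV.1 (mkcurve p)) /\ (forall p, B w.2 p -> 0 < p.2 -> UV.2 (mkcurve p))].
have /choice[F hF] w : exists UV : set X * set X, [/\ open UV.1, open UV.2, UV.1 `*` UV.2 `<=` W &
    (exists UV', good w UV') -> good w UV].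
  have [[UV gUV]|no] := pselect (exists UV', good w UV'); first by exists UV; case: (gUV).
  by exists (set0, set0); split => //; [exact: open0|exact: open0|move=> ? []].
have -> : W = \bigcup_w ((F w).1 `*` (F w).2).
  apply/seteqP; split => [[x z] Wxz|t [w _]]; last by have [_ _ sub _] := hF w; exact: sub.
  have /= [[P Q] [/= nP nQ] PQW] := open_nbhs_nbhs (conj oW Wxz).
  have box (U : set X) (x' : X) : nbhs x' U -> exists u, exists2 p, x' = mkcurve p & 
      [/\ 0 < p.2, B u p & forall q, B u q -> 0 < q.2 -> U^° (mkcurve q)].
    move=> nU; have [g D xE] := curve_pt_ex x'; have [V oV VU] := open_curve (open_interior U).
    pose p : R * R := (complex.Re (orbit_pt g), complex.Im (orbit_pt g)).
    have p0 : 0 < p.2 := Im_orbit_pt D.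
    have Vp : V p by apply/VU => //; rewrite (_ : mkcurve p = x').
    have lb (t d : R) : 0 < d -> exists u : rat * rat, (t \in `]ratr u.1, ratr u.2[) /\
        [set` `](ratr u.1 : R), ratr u.2[ ] `<=` ball t d.
      move=> d0.
      have /rat_in_itvoo[r] : t - d < t by rewrite ltrBlDr ltrDl.
      have /rat_in_itvoo[s] : t < t + d by rewrite ltrDl.
      rewrite !in_itv /= => /andP[xs sd] /andP[dr rx].
      exists (r, s); split; first by rewrite in_itv /= rx xs.
      by move=> w /=; rewrite in_itv /= => /andP[rz zs]; rewrite /ball /= ltr_distlC (lt_trans dr rz) (lt_trans zs sd).
    have /= [[P' Q'] [/= /nbhs_ballP[e /= e0 eP] /nbhs_ballP[f /= f0 fQ]] PQV] := open_nbhs_nbhs (conj oV Vp).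
    have [u1 [u1p u1e]] := lb p.1 e e0; have [u2 [u2p u2f]] := lb p.2 f f0.
    exists (u1, u2), p => //; split => // q [/= /u1e/eP Pq /u2f/fQ Qq] q0; apply/VU => //.
    by apply: PQV.
  have [u1 [p pE [p0 Bp Uq]]] := box P x nP; have [u2 [q qE [q0 Bq Vq]]] := box Q z nQ.
  exists (u1, u2) => //; have [_ _ _ /(_ _)] := hF (u1, u2).
  case=> [|_ _ _ [g1 g2]]; last by split; [rewrite pE; exact: g1|rewrite qE; exact: g2].
  exists (P^°, Q^°); split => //=; try exact: open_interior.
  by move=> [a b] [/= /interior_subset Pa /interior_subset Qb]; apply: PQW.
apply: countable_bigcupT_measurable => [|w]; first exact: countableP.
have [q1 q2 _ _] := hF w; apply: measurableX; exact: sub_sigma_algebra.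
Qed.

Lemma measurable_curve2 psi : continuous psi -> measurable_fun setT psi.
Proof.
move=> cpsi; apply: (measurability _ (RGenOpens.measurableE R)) => // _ [_ [a [b ->] <-]].
rewrite setTI; apply: open_curve2_measurable; apply: open_comp => //; exact: interval_open.
Qed.

End observable.

(** * Equidistribution for real test functions *)

Section curve_equidistribution.
Context {R : realType}.
Local Notation mR := (measurableTypeR R).
Local Notation M := ((mR * mR) * (mR * mR))%type.
Local Notation X := (modular_curve R).
Local Notation mu := (@modular_measure R).
Local Notation mu2 := (@modular_measure R \x @modular_measure R)%E.

Lemma mu2_setT : mu2 setT = 1%E.
Proof.
rewrite -setXTT product_measure1E; [|exact: measurableT|exact: measurableT].
by rewrite [X in (X * _)%E](@probability_setT _ _ _ mu) mul1e; exact: (@probability_setT _ _ _ mu).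
Qed.

Lemma mu2_integrable (f : X * X -> R) B : measurable_fun setT f -> (forall p, `|f p| <= B) -> mu2.-integrable setT (EFin \o f).
Proof.
move=> mf fB; have fin : (mu2 setT < +oo)%E by rewrite mu2_setT ltry.
apply: measurable_bounded_integrable => //.
exists B; split; first exact: num_real.
by move=> x Bx y _; apply: le_trans (fB y) (ltW Bx).
Qed.

Lemma hor_coords (T x : R) : 0 < T -> curve_pt (hor T x) = to_curve (x%:C + 'i%C / T%:C).
Proof.
move=> T0; congr to_curve; have s0 : 0 < Num.sqrt T by rewrite sqrtr_gt0.
have sE : Num.sqrt T ^+ 2 = T by rewrite sqr_sqrtr // ltW.
have -> : 'i%C / T%:C = (T^-1)%:C * 'i%C by rewrite mulrC; congr (_ * _); exact: (esym (fmorphV (real_complex R) T)).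
rewrite /orbit_pt /rowdot /row2sq /hor /mulm /upm /diagm /=.
apply/eqP; rewrite eq_complex /=; apply/andP; split; apply/eqP.
  by move: s0 sE; move: (Num.sqrt T) => s s0 <-; field; rewrite gt_eqF.
by move: s0 sE; move: (Num.sqrt T) => s s0 <-; field; rewrite gt_eqF.
Qed.

Lemma supported_bounded (K : set (X * X)) (psi : X * X -> R) : compact K -> continuous psi -> (forall p, ~ K p -> psi p = 0) ->
  exists2 B, 0 < B & forall p, `|psi p| <= B.
Proof.
move=> cK cpsi psi0; have : compact (psi @` K) by apply: continuous_compact => //; exact: continuous_subspaceT.
move=> /compact_bounded[B [_ hB]]; exists (`|B| + 1) => [|p]; first by rewrite ltr_wpDl.
have [Kp|nK] := pselect (K p); last by rewrite psi0 // normr0 addr_ge0.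
by apply: (hB (`|B| + 1)); [rewrite ltr_pwDr ?ler_norm|exists p].
Qed.

Section unit_range.
Context (psi : X * X -> R).
Hypotheses (cpsi : continuous psi) (p01 : forall p, 0 <= psi p <= 1).

Let mpsi : measurable_fun setT psi := measurable_curve2 cpsi.
Let p0 p : 0 <= psi p. Proof. by case/andP: (p01 p). Qed.

Lemma mean_on_curve : mean (fun g : M => mean (on_curve psi g : M -> R)) = (\int[mu2]_p psi p)%R.
Proof.
pose Phi (x : X) : R := (\int[mu]_z psi (x, z))%R.
have mx x : measurable_fun setT (fun z : X => psi (x, z)).
  by apply: (mcomp mpsi (f := fun z => (x, z))); apply: mpair; [exact: mcst|exact: mid].
have mE2 : measurable_fun setT (fun p : X * X => (psi p)%:E) by exact: mE.
have E0 p : (0 <= (psi p)%:E)%E by rewrite lee_fin.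
have fin x : (\int[mu]_z (psi (x, z))%:E \is a fin_num)%E.
  rewrite ge0_fin_numE; last by apply: integral_ge0 => z _.
  apply: (@le_lt_trans _ _ (\int[mu]_(z in setT) (1%:E : \bar R))%E).
    apply: ge0_le_integral => //; first by apply: mE; exact: mx.
    by move=> z _; rewrite lee_fin; case/andP: (p01 (x, z)).
  rewrite integral_cst // [X in (_ * X)%E](@probability_setT _ _ _ mu) mule1 ltry //.
have PhiE x : (Phi x)%:E = (\int[mu]_z (psi (x, z))%:E)%E by rewrite /Phi /Rintegral fineK.
have mPhi : measurable_fun setT Phi.
  have := measurable_fun_fubini_tonelli_F (m2 := mu) _ mE2 E0; rewrite /fubini_F => mF.
  exact: (mcomp (@fine_measurable R setT measurableT) mF).
have -> : (fun g : M => mean (on_curve psi g : M -> R)) = (fun g => Phi (curve_pt g)).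
  by apply/funext => g; rewrite /Phi -(mean_curve_pt (mx (curve_pt g))).
rewrite mean_curve_pt //; last by move=> x; apply: Rintegral_ge0.
rewrite /Rintegral fubini_tonelli1 //; congr fine; apply: eq_integral => x _; exact: PhiE.
Qed.

Lemma measurable_on_curve : measurable_fun setT (fun p : M * M => on_curve psi p.1 p.2).
Proof.
apply: (mcomp mpsi (f := fun p : M * M => (curve_pt p.1, curve_pt p.2))).
by apply: mpair; apply: (mcomp (@measurable_curve_pt R)); [exact: measurable_fst|exact: measurable_snd].
Qed.

End unit_range.

Context (K : set (X * X)) (T y : nat -> R).
Hypotheses (cK : compact K) (y12 : forall n, 1 <= y n <= 2) (T0 : forall n, 0 < T n)
  (Tinf : forall B, evn (fun n => B <= T n)) (nr : forall K B, evn (fun n => nonres K B (T n) (y n))).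

Definition sample (psi : X * X -> R) n (x : mR) : R :=
  psi (to_curve (x%:C + 'i%C / (T n)%:C), to_curve ((x * y n)%:C + 'i%C / (T n)%:C)).

Lemma sampleE psi n x : sample psi n x = obs_at (on_curve psi) (T n) (y n) 0 x.
Proof. by rewrite /sample -!hor_coords // mulrC /obs_at /on_curve (_ : upm 0 = idm) // mulm1. Qed.

Lemma bmeas_sample (psi : X * X -> R) B n : continuous psi -> (forall p, `|psi p| <= B) -> bmeas (sample psi n).
Proof.
move=> cpsi pB; split; last by exists B => x; exact: pB.
have -> : sample psi n = fun x => psi (curve_pt (hor (T n) x), curve_pt (hor (T n) (x * y n))).
  by apply/funext => x; rewrite !hor_coords.
apply: (mcomp (measurable_curve2 cpsi) (f := fun x : mR => (curve_pt (hor (T n) x), curve_pt (hor (T n) (x * y n))))).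
apply: mpair; apply: (mcomp (@measurable_curve_pt R)); first exact: measurable_hor.
by apply: (mcomp (measurable_hor _)); mfun.
Qed.

Lemma curve_equi01 (psi : X * X -> R) c u v e : continuous psi -> (forall p, 0 <= psi p <= 1) -> (forall p, ~ K p -> psi p = c) ->
  u <= v -> 0 < e -> evn (fun n => `|itg u v (sample psi n) - (v - u) * (\int[mu2]_p psi p)%R| <= e).
Proof.
move=> cpsi p01 psic uv e0; rewrite -(mean_on_curve cpsi p01).
have := obs_equi (inv2_on_curve psi) (ucont2_on_curve cpsi cK psic) (fun g h => p01 _) (measurable_on_curve cpsi) y12 Tinf nr uv e0.
have E n : sample psi n = obs_at (on_curve psi) (T n) (y n) 0 by apply/funext => x; exact: sampleE.
by apply: evn_imp => n; rewrite E.
Qed.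

Lemma curve_equi (psi : X * X -> R) u v e : continuous psi -> (forall p, ~ K p -> psi p = 0) ->
  u <= v -> 0 < e -> evn (fun n => `|itg u v (sample psi n) - (v - u) * (\int[mu2]_p psi p)%R| <= e).
Proof.
move=> cpsi psi0 uv e0.
have [B B0 pB] := supported_bounded cK cpsi psi0.
pose c2 := (2 * B)^-1; have c20 : 0 < c2 by rewrite invr_gt0 mulr_gt0.
(* Rescaled into the unit interval the function equals 1/2 off [K], which is why [curve_equi01]
   allows a constant value there. *)
pose psi1 p := c2 * psi p + 1 / 2.
have cE : c2 * B = 1 / 2 by rewrite /c2; field; rewrite gt_eqF.
have c1 : continuous psi1 by move=> p; apply: cvgD; [apply: cvgM; [exact: cvg_cst|exact: cpsi]|exact: cvg_cst].
have p01 p : 0 <= psi1 p <= 1.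
  have := pB p; rewrite ler_norml => /andP[h1 h2].
  have := ler_wpM2l (ltW c20) h1; have := ler_wpM2l (ltW c20) h2; rewrite mulrN cE /psi1 => *; apply/andP; split; lra.
have pc p : ~ K p -> psi1 p = 1 / 2 by move=> nK; rewrite /psi1 psi0 // mulr0 add0r.
apply: evn_imp (curve_equi01 c1 p01 pc uv (mulr_gt0 c20 e0)) => n.
have bs := bmeas_sample n cpsi pB.
have -> : itg u v (sample psi1 n) = c2 * itg u v (sample psi n) + 1 / 2 * (v - u).
  rewrite -itgZ // -itg_cst // -itgD //; first exact: bmeasZ.
  exact: bmeas_cst.
have ip := mu2_integrable (measurable_curve2 cpsi) pB.
have -> : (\int[mu2]_p psi1 p = c2 * \int[mu2]_p psi p + 1 / 2)%R.
  rewrite RintegralD //; last 2 first.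
  - by apply: (@mu2_integrable _ (c2 * B)); [apply: mM; [exact: mcst|exact: measurable_curve2]|move=> p; rewrite normrM (gtr0_norm c20) ler_pM2l].
  - by apply: (@mu2_integrable _ (1 / 2)); [exact: mcst|move=> p; rewrite ger0_norm].
  by rewrite RintegralZl // Rintegral_cst // [X in fine X](_ : _ = 1%E) ?mulr1 //; exact: mu2_setT.
have -> : forall I J, c2 * I + 1 / 2 * (v - u) - (v - u) * (c2 * J + 1 / 2) = c2 * (I - (v - u) * J) by move=> I J; ring.
by rewrite normrM (gtr0_norm c20) ler_pM2l.
Qed.

End curve_equidistribution.

(** * Reduction to closed intervals and to real and imaginary parts *)

Section bounded_interval.
Context {R : realType} (I : set R).
Hypotheses (iI : is_interval I) (bI : bounded_set I) (I0 : (0 < lebesgue_measure I)%E).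
Local Notation mR := (measurableTypeR R).

(** A bounded interval differs from its closure by at most two points, which carry no Lebesgue
    measure. *)
Lemma interval_ends : exists u v : R, [/\ u < v, lebesgue_measure I = (v - u)%:E &
  forall f : mR -> R, bmeas f -> (\int[lebesgue_measure]_(x in I) f x)%R = itg u v f].
Proof.
have [M [_ hM]] := bI; have bound x : I x -> `|x| <= `|M| + 1.
  by apply: hM; rewrite ltr_pwDr // ler_norm.
have lb : has_lbound I by exists (- (`|M| + 1)) => x /bound; rewrite ler_norml => /andP[].
have ub : has_ubound I by exists (`|M| + 1) => x /bound; rewrite ler_norml => /andP[].
have [b1 [u [b2 [v IE]]]] : exists b1 u b2 v, I = [set` Interval (BSide b1 u) (BSide b2 v)] :> set R.
  exists `[< I (inf I) >], (inf I), (~~ `[< I (sup I) >]), (sup I).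
  by rewrite {1}(proj1 (is_intervalP I) iI) /Rhull (asboolT lb) (asboolT ub).
have uv : u < v.
  rewrite ltNge; apply/negP => vu; move: I0.
  by rewrite IE lebesgue_measure_itv /= lte_fin [X in if X then _ else _]ltNge vu ltxx.
exists u, v; split => //; first by rewrite IE lebesgue_measure_itv /= lte_fin uv EFinB.
move=> f [mf _]; have mE2 : measurable_fun setT (EFin \o f) by exact: mE.
rewrite IE /itg /Rintegral; congr fine; case: b1 b2 {IE} => -[].
- by rewrite integral_itv_bndo_bndc //; exact: measurable_funTS.
- by [].
- rewrite integral_itv_bndo_bndc ?integral_itv_obnd_cbnd //; exact: measurable_funTS.
- by rewrite integral_itv_obnd_cbnd //; exact: measurable_funTS.
Qed.
End bounded_interval.

Section components.
Context {R : realType}.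
Local Notation X := (modular_curve R).

Lemma continuous_Re : continuous (fun z : R[i] => complex.Re z).
Proof.
move=> z A /nbhs_ballP[e /= e0 eA].
have B0 : [set w : R[i] | `|complex.Re w - complex.Re z| < e /\ `|complex.Im w - complex.Im z| < e] z.
  by rewrite /= !subrr normr0.
have nB := open_nbhs_nbhs (conj (open_box e0) B0).
by apply: (@filterS _ (nbhs z) _ _ _ _ nB) => w /= [h1 h2]; apply: eA; rewrite -ball_normE /= distrC.
Qed.

Lemma continuous_Im : continuous (fun z : R[i] => complex.Im z).
Proof.
move=> z A /nbhs_ballP[e /= e0 eA].
have B0 : [set w : R[i] | `|complex.Re w - complex.Re z| < e /\ `|complex.Im w - complex.Im z| < e] z.
  by rewrite /= !subrr normr0.
have nB := open_nbhs_nbhs (conj (open_box e0) B0).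
by apply: (@filterS _ (nbhs z) _ _ _ _ nB) => w /= [h1 h2]; apply: eA; rewrite -ball_normE /= distrC.
Qed.

Lemma evn_cvg (f : nat -> R) l : (forall e, 0 < e -> evn (fun n => `|f n - l| <= e)) -> f n @[n --> \oo] --> l.
Proof.
move=> h; apply/cvgrPdist_le => e /h[n0 hn]; exists n0 => // n nn /=; rewrite distrC; exact: hn.
Qed.

Lemma cvg_evn (f : nat -> R) B : f n @[n --> \oo] --> +oo -> evn (fun n => B <= f n).
Proof. by move/cvgryPge => /(_ B)[n0 _ hn]; exists n0. Qed.
End components.

Theorem theorem1p3 (R : realType) (I : set R) (C : R)
    (T y : nat -> R) (a q : nat -> nat)
    (I_interval : is_interval I) (I_bounded : bounded_set I)
    (I_pos : (0 < lebesgue_measure I)%E)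
    (T_gt1 : forall n, 1 < T n)
    (y_itv : forall n, y n \in `[1, 2])
    (a_gt0 : forall n, (0 < a n)%N) (q_gt0 : forall n, (0 < q n)%N)
    (aq_coprime : forall n, coprime (a n) (q n))
    (q_leQ : forall n, (q n)%:R <= T n `^ (99 / 100))
    (y_approx : forall n, `|y n - (a n)%:R / (q n)%:R| <=
       C * (1 / ((q n)%:R * T n `^ (99 / 100))))
    (T_infty : T n @[n --> \oo] --> +oo)
    (q_infty : ((q n)%:R : R) @[n --> \oo] --> +oo) :
  (forall n,
     [set (to_curve ((x%:C + 'i%C) / (T n)%:C),
           to_curve (((x * y n)%:C + 'i%C) / (T n)%:C))
        | x in [set T n * x | x in I]] =
     [set (to_curve (x%:C + 'i%C / (T n)%:C),
           to_curve ((x * y n)%:C + 'i%C / (T n)%:C)) | x in I]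
       :> set (modular_curve R * modular_curve R)) /\
  (forall phi : modular_curve R * modular_curve R -> R[i],
     continuous phi -> compactly_supported phi ->
     (1 / fine (lebesgue_measure I))%:C *
       cintegral (@lebesgue_measure R) I (fun x =>
         phi (to_curve (x%:C + 'i%C / (T n)%:C),
              to_curve ((x * y n)%:C + 'i%C / (T n)%:C)))
     @[n --> \oo] -->
     cintegral (@modular_measure R \x @modular_measure R)%E setT phi).
Proof.
have T0 n : 0 < T n by apply: lt_trans (T_gt1 n).
split => [n|phi cphi kphi].
  have TC : (T n)%:C != 0 :> R[i] by rewrite (fmorph_eq0 (real_complex R)) gt_eqF.
  have E (t : R) : ((T n * t)%:C + 'i%C) / (T n)%:C = t%:C + 'i%C / (T n)%:C.
    by rewrite (rmorphM (real_complex R)) mulrDl mulrAC mulfV // mul1r.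
  apply/seteqP; split => [_ [_ [x Ix <-] <-]|_ [x Ix <-]].
    by exists x => //; rewrite -mulrA !E.
  by exists (T n * x); [exists x|rewrite -mulrA !E].
have y12 n : 1 <= y n <= 2 by have := y_itv n; rewrite in_itv.
have Tinf B : evn (fun n => B <= T n) := cvg_evn B T_infty.
have qinf (B : R) : evn (fun n => B <= (q n)%:R) := cvg_evn B q_infty.
have nr := nonres_approx T_gt1 q_gt0 aq_coprime q_leQ y_approx Tinf qinf.
have [u [v [uv Iuv Iint]]] := interval_ends I_interval I_bounded I_pos.
(* Applied to the real and the imaginary part; [pr 0 = 0] keeps the support inside that of [phi]. *)
have part (pr : R[i] -> R) : continuous pr -> pr 0 = 0 ->
    (v - u)^-1 * (\int[lebesgue_measure]_(x in I) pr (phi (to_curve (x%:C + 'i%C / (T n)%:C), to_curve ((x * y n)%:C + 'i%C / (T n)%:C))))%R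
    @[n --> \oo] --> (\int[(@modular_measure R \x @modular_measure R)%E]_p pr (phi p))%R.
  move=> cpr pr0; pose psi p := pr (phi p).
  have cpsi : continuous psi by move=> p; apply: continuous_comp; [exact: cphi|exact: cpr].
  have psi0 p : ~ closure [set x | phi x != 0] p -> psi p = 0.
    move=> np; rewrite /psi; have [->//|phi0] := eqVneq (phi p) 0.
    by exfalso; apply: np; apply: subset_closure.
  have vu : 0 < v - u by rewrite subr_gt0.
  have [B B0 pB] := supported_bounded kphi cpsi psi0.
  apply: evn_cvg => e e0.
  have := curve_equi kphi y12 T0 Tinf nr cpsi psi0 (ltW uv) (mulr_gt0 vu e0).
  apply: evn_imp => n h; rewrite -/(sample T y psi n _) (Iint _ (bmeas_sample y T0 n cpsi pB)).
  move: h; move: (itg _ _ _) => i h; rewrite (_ : _ - _ = (v - u)^-1 * (i - (v - u) * (\int[(@modular_measure R \x @modular_measure R)%E]_p psi p)%R)).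
    by rewrite normrM ger0_norm ?invr_ge0 ?(ltW vu) // ler_pdivrMl.
  by rewrite mulrBr mulrA mulVf ?mul1r // gt_eqF.
rewrite Iuv /=; have cR := part _ (@continuous_Re R) erefl; have cI := part _ (@continuous_Im R) erefl.
apply: cvg_trans (cvg_comp _ _ (cvg_pair cR cI) (@continuous_mkcomplex R (_, _))).
apply: near_eq_cvg; apply: nearW => n /=; rewrite /cintegral.
by apply/eqP; rewrite eq_complex /= div1r !mul0r subr0 addr0 !eqxx.
Qed.
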